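(* Let $(\bar u,\bar y,\bar\varphi)\in U_{\rm ad}\times[H^1(\Omega)\cap C^{0,\mu}(\bar\Omega)]^2$ satisfy the first order optimality conditions $$A\bar y+a(x,\bar y)+\bar u\bar y=0\ \text{ in }\Omega,\quad\partial_{n_A}\bar y=g\ \text{ on }\Gamma,$$ $$A^*\bar\varphi+\frac{\partial a}{\partial y}(x,\bar y)\bar\varphi+\bar u\bar\varphi=\frac{\partial L}{\partial y}(x,\bar y)\ \text{ in }\Omega,\quad\partial_{n_{A^*}}\bar\varphi=0\ \text{ on }\Gamma,$$ $$\bar u(x)=\operatorname{Proj}_{[\alpha,\beta]}\Big(\frac1\nu\bar y(x)\bar\varphi(x)\Big)\ \text{ for a.a. }x\in\Omega,$$ the strict complementarity condition $|\Sigma_{\bar u}|=0$, and the second order sufficient optimality condition $J''(\bar u)v^2>0$ for every $v\in C_{\bar u}\setminus\{0\}$. Then there exists $\delta>0$ such that for all $u_0\in B_\delta(\bar u)$ the sequence $\{u_j\}$ generated by the semismooth Newton algorithm for (P) (described in the context) is contained in the ball $B_\delta(\bar u)$ and converges superlinearly to $\bar u$ in $L^2(\Omega)$, i.e. $u_j\to\bar u$ and $\|u_{j+1}-\bar u\|_{L^2(\Omega)}=o(\|u_j-\bar u\|_{L^2(\Omega)})$ as $j\to\infty$.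
   Context: $\Omega\subset\mathbb{R}^d$, $d\in\{2,3\}$, is a bounded open connected set with Lipschitz boundary $\Gamma$. Operator: $Ay=-\sum_{i,j=1}^d\partial_{x_j}[a_{ij}(x)\partial_{x_i}y]$ with $a_{ij}\in L^\infty(\Omega)$ and, for some $M_A,\Lambda_A>0$, $M_A|\xi|^2\ge\sum_{i,j}a_{ij}(x)\xi_i\xi_j\ge\Lambda_A|\xi|^2$ for a.a. $x\in\Omega$ and all $\xi\in\mathbb{R}^d$; $\partial_{n_A}y=\sum_{i,j}a_{ij}\partial_{x_i}y\,n_j$ with $n$ the outward unit normal. $A^*$ and $\partial_{n_{A^*}}$ are defined in the same way with $a_{ji}$ in place of $a_{ij}$. Equations are understood in the weak $H^1(\Omega)$ sense. Nonlinearity: $a:\Omega\times\mathbb{R}\to\mathbb{R}$ is a Carathéodory function, of class $C^2$ in the second variable, such that for a.a. $x\in\Omega$: $a(\cdot,0)\in L^p(\Omega)$ for some $p>d/2$; $\frac{\partial a}{\partial y}(x,y)\ge a_0$ for all $y\in\mathbb{R}$, for some constant $a_0\ge0$; for every $M>0$ there is $C_{a,M}$ with $\sum_{j=1}^2|\frac{\partial^ja}{\partial y^j}(x,y)|\le C_{a,M}$ for all $|y|\le M$; for every $\varepsilon>0$ and $M>0$ there is $\rho>0$ with $|\frac{\partial^2a}{\partial y^2}(x,y_1)-\frac{\partial^2a}{\partial y^2}(x,y_2)|\le\varepsilon$ for all $|y_1|,|y_2|\le M$ with $|y_1-y_2|\le\rho$. Boundary datum: $g\in L^q(\Gamma)$,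 $q>d-1$. Cost integrand: $L:\Omega\times\mathbb{R}\to\mathbb{R}$ is Carathéodory, of class $C^2$ in the second variable, and for a.a. $x$: $L(\cdot,0)\in L^1(\Omega)$; for all $M>0$ there is $L_M\in L^p(\Omega)$ with $|\frac{\partial L}{\partial y}(x,y)|\le L_M(x)$ for $|y|\le M$; for all $M>0$ there is $C_{L,M}\in\mathbb{R}$ with $|\frac{\partial^2L}{\partial y^2}(x,y)|\le C_{L,M}$ for $|y|\le M$; for all $\varepsilon,M>0$ there is $\rho>0$ with $|\frac{\partial^2L}{\partial y^2}(x,y_1)-\frac{\partial^2L}{\partial y^2}(x,y_2)|\le\varepsilon$ for $|y_1|,|y_2|\le M$, $|y_1-y_2|\le\rho$. Control constraints: $\nu>0$, $-a_0<\alpha<\beta\le\infty$, $U_{\rm ad}=\{u\in L^2(\Omega):\alpha\le u(x)\le\beta\text{ a.e. in }\Omega\}$; $\operatorname{Proj}_{[\alpha,\beta]}(t)=\min\{\beta,\max\{\alpha,t\}\}$ (for $\beta=\infty$, $\max\{\alpha,t\}$). Exponent $\mu$: $\mu\in(0,1]$ is a fixed Hölder exponent provided by known elliptic regularity theory, i.e. such that, for $B\in\{A,A^*\}$, every weak solution $y\in H^1(\Omega)$ of $By+y=f$ in $\Omega$, $\partial_{n_B}y=h$ on $\Gamma$, with $f\in L^{\min\{p,2\}}(\Omega)$, $h\in L^q(\Gamma)$, belongs to $C^{0,\mu}(\bar\Omega)$ with $\|y\|_{C^{0,\mu}(\bar\Omega)}\le C(\|f\|_{L^{\min\{p,2\}}(\Omega)}+\|h\|_{L^q(\Gamma)})$.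 The open set $\mathcal{A}$ and the maps $G,\Phi$: let $m_u=\operatorname{ess\,inf}_\Omega u$, $\Lambda_u=\min\{\Lambda_A,a_0+m_u\}$, $\mathcal{A}_0=\{u\in L^2(\Omega):a_0+m_u>0\}$, and $C_{4,\Omega}$ a constant with $\|y\|_{L^4(\Omega)}\le C_{4,\Omega}\|y\|_{H^1(\Omega)}$ for all $y\in H^1(\Omega)$. Then $\mathcal{A}=\bigcup_{\bar u\in\mathcal{A}_0}B_{\varepsilon_{\bar u}}(\bar u)$ ($B_\varepsilon(\bar u)$ denotes an open ball in $L^2(\Omega)$), with radii $0<\varepsilon_{\bar u}<\Lambda_{\bar u}/C_{4,\Omega}^2$ chosen (this is possible) so that for every $u\in\mathcal{A}$ the state equation $Ay+a(x,y)+uy=0$ in $\Omega$, $\partial_{n_A}y=g$ on $\Gamma$, has a unique solution $y_u\in H^1(\Omega)\cap C^{0,\mu}(\bar\Omega)$ and $G:\mathcal{A}\to H^1(\Omega)\cap C^{0,\mu}(\bar\Omega)$, $G(u)=y_u$, is of class $C^2$. One has $U_{\rm ad}\subset\mathcal{A}_0\subset\mathcal{A}$. For $v\in L^2(\Omega)$, $z=z_{u,v}=G'(u)v$ is the unique solution of $Az+\frac{\partial a}{\partial y}(x,y_u)z+uz+vy_u=0$ in $\Omega$, $\partial_{n_A}z=0$ on $\Gamma$. The adjoint state $\varphi_u\in H^1(\Omega)\cap C^{0,\mu}(\bar\Omega)$ is the unique solution of $A^*\varphi+\frac{\partial a}{\partial y}(x,y_u)\varphi+u\varphi=\frac{\partial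 L}{\partial y}(x,y_u)$ in $\Omega$, $\partial_{n_{A^*}}\varphi=0$ on $\Gamma$. The map $\Phi(u)=\varphi_u$ is of class $C^1$ from $\mathcal{A}$ to $H^1(\Omega)\cap C^{0,\mu}(\bar\Omega)$ and $\eta=\eta_{u,v}=\Phi'(u)v$ is the unique solution of $A^*\eta+\frac{\partial a}{\partial y}(x,y_u)\eta+u\eta=[\frac{\partial^2L}{\partial y^2}(x,y_u)-\varphi_u\frac{\partial^2a}{\partial y^2}(x,y_u)]z_{u,v}-v\varphi_u$ in $\Omega$, $\partial_{n_{A^*}}\eta=0$ on $\Gamma$. Functional and problem: (P) is $\min_{u\in U_{\rm ad}}J(u)$, where $J:\mathcal{A}\to\mathbb{R}$, $J(u)=\int_\Omega L(x,y_u)\,dx+\frac{\nu}{2}\int_\Omega u^2\,dx$, is of class $C^2$ with $J''(u)(v_1,v_2)=\int_\Omega[\frac{\partial^2L}{\partial y^2}(x,y_u)-\varphi_u\frac{\partial^2a}{\partial y^2}(x,y_u)]z_{u,v_1}z_{u,v_2}\,dx-\int_\Omega[v_1z_{u,v_2}+v_2z_{u,v_1}]\varphi_u\,dx+\nu\int_\Omega v_1v_2\,dx$; $J''(u)v^2:=J''(u)(v,v)$. Sets associated with $(\bar u,\bar y,\bar\varphi)$ (conditions understood a.e. in $\Omega$; $|\cdot|$ of a set is Lebesgue measure): $\Sigma_{\bar u}=\{x\in\Omega:\bar u(x)\in\{\alpha,\beta\}\text{ and }\nu\bar u(x)-\bar y(x)\bar\varphi(x)=0\}$; $C_{\bar u}$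 is the set of $v\in L^2(\Omega)$ with $v(x)=0$ if $\nu\bar u(x)-\bar y(x)\bar\varphi(x)\ne0$, $v(x)\ge0$ if $\bar u(x)=\alpha$, and $v(x)\le0$ if $\bar u(x)=\beta$. Semismooth Newton algorithm for (P). Given $u_0$, for $j=0,1,2,\dots$: (i) compute $y_j=G(u_j)$ and $\varphi_j=\Phi(u_j)$; (ii) set $\mathbb{A}_j^+=\{x\in\Omega:y_j(x)\varphi_j(x)\ge\nu\beta\}$, $\mathbb{A}_j^-=\{x\in\Omega:y_j(x)\varphi_j(x)\le\nu\alpha\}$, $\mathbb{A}_j=\mathbb{A}_j^+\cup\mathbb{A}_j^-$, $\mathbb{I}_j=\Omega\setminus\mathbb{A}_j$, with characteristic functions $\chi_{\mathbb{A}_j},\chi_{\mathbb{I}_j}$; (iii) set $w_j=-u_j+\beta$ on $\mathbb{A}_j^+$, $w_j=-u_j+\frac1\nu\varphi_jy_j$ on $\mathbb{I}_j$, $w_j=-u_j+\alpha$ on $\mathbb{A}_j^-$ (that is, $w_j=-F(u_j)$ with $F(u)=u-\operatorname{Proj}_{[\alpha,\beta]}(\frac1\nu y_u\varphi_u)$); (iv) compute $z_j=z_{u_j,\chi_{\mathbb{A}_j}w_j}$ and $\eta_j=\eta_{u_j,\chi_{\mathbb{A}_j}w_j}$; (v) let $v_{\mathbb{I}_j}$ be the solution of $\min_{v\in L^2(\mathbb{I}_j)}\frac{1}{2\nu}J''(u_j)(\chi_{\mathbb{I}_j}v)^2-\int_{\mathbb{I}_j}\big(w_j+\frac1\nu[z_j\varphi_j+y_j\eta_j]\big)v\,dx$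 (with $\chi_{\mathbb{I}_j}v$ the extension of $v$ by zero); (vi) set $v_j=\chi_{\mathbb{A}_j}w_j+\chi_{\mathbb{I}_j}v_{\mathbb{I}_j}$ and $u_{j+1}=u_j+v_j$. *)

(* Defs.v *)
From HB Require Import structures.
From mathcomp Require Import all_boot all_order all_algebra.
From mathcomp Require Import all_classical all_reals all_analysis.
From mathcomp Require Import ring lra zify.
Set Implicit Arguments.
Unset Strict Implicit.
Unset Printing Implicit Defensive.
Import Order.TTheory GRing.Theory Num.Theory.
Import numFieldNormedType.Exports.
Local Open Scope classical_set_scope.
Local Open Scope ring_scope.

Section borel.
Context (R : realType) (m n : nat).
HB.instance Definition _ := @isMeasurable.Build (sigma_display (@open 'M[R]_(m, n)))
  'M[R]_(m, n) <<s @open 'M[R]_(m, n) >>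
  (@sigma_algebra0 _ setT _) (@sigma_algebraC _ _)
  (@sigma_algebra_bigcup _ setT _).

Lemma open_measurable_mx (A : set 'M[R]_(m, n)) : open A -> measurable A.
Proof. by move=> oA; apply: sub_sigma_algebra. Qed.

End borel.

Section open_boxes.
Context (R : realType) (n : nat).
Implicit Types (q : 'rV[rat]_n) (k : nat) (A : set 'rV[R]_n).

Definition qbox q k : set 'rV[R]_n :=
  [set x | forall i, ratr (q 0 i) - k.+1%:R^-1 < x 0 i < ratr (q 0 i) + k.+1%:R^-1].

Lemma open_qbox A : open A ->
  A = \bigcup_(p in [set p : 'rV[rat]_n * nat | qbox p.1 p.2 `<=` A]) qbox p.1 p.2.
Proof.
move=> oA; apply/seteqP; split => [x Ax|x [p /= + px]]; last exact.
have : nbhs x A by exact: open_nbhs_nbhs.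
move=> /nbhs_ballP[e /= e0 eA].
have [k ke] : exists k, 2 * k.+1%:R^-1 < e.
  have e20 : 0 < e / 2 by rewrite divr_gt0.
  have [N _ /(_ N (leqnn N)) /=] := near_infty_natSinv_lt (PosNum e20).
  by move=> h; exists N; move: h => /=; set K := _^-1; lra.
have h i : exists q : rat, x 0 i - k.+1%:R^-1 < ratr q < x 0 i + k.+1%:R^-1.
  have : x 0 i - k.+1%:R^-1 < x 0 i + k.+1%:R^-1.
    by have : 0 < k.+1%:R^-1 :> R by []; move: (_^-1) (x _ _) => K X; lra.
  by move=> /rat_in_itvoo[q]; rewrite in_itv/= => ?; exists q.
have [q hq] := choice h.
exists (\row_i q i, k) => /=; last first.
  move=> i; rewrite mxE; have /andP[] := hq i.
  by move: (_^-1) (x _ _) (ratr _) => K X Q ? ?; apply/andP; split; lra.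
move=> z zq; apply: eA; split => // i j; rewrite ord1.
have := zq j; rewrite mxE; have := hq j.
rewrite /ball /=.
move: ke; set K := _^-1; set X := x 0 j; set Z := z _ _; set Q := ratr _.
move=> ke /andP[? ?] /andP[? ?]; rewrite ltr_norml; apply/andP; split; lra.
Qed.
End open_boxes.

Section cons.
Context (R : realType) (n : nat).
Definition cons_rV (p : measurableTypeR R * 'rV[R]_n) : 'rV[R]_n.+1 :=
  \row_i oapp (fun j => p.2 0 j) p.1 (unlift 0 i).

Lemma cons_rV0 p : cons_rV p 0 0 = p.1.
Proof. by rewrite mxE unlift_none. Qed.

Lemma cons_rVS p (i : 'I_n) : cons_rV p 0 (lift 0 i) = p.2 0 i.
Proof. by rewrite mxE liftK. Qed.

Lemma measurable_box (q : 'rV[rat]_n) k : measurable (@qbox R n q k).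
Proof.
have -> : qbox q k = \bigcap_(i : 'I_n) [set x : 'rV[R]_n |
  ratr (q 0 i) - k.+1%:R^-1 < x 0 i < ratr (q 0 i) + k.+1%:R^-1].
  by apply/seteqP; split => [x h i _|x h i]; [exact: h|exact: (h i)].
apply: fin_bigcap_measurable => // i _.
apply: open_measurable_mx.
have -> : [set x : 'rV[R]_n | ratr (q 0 i) - k.+1%:R^-1 < x 0 i < ratr (q 0 i) + k.+1%:R^-1]
 = (fun x : 'rV[R]_n => x 0 i) @^-1` `]ratr (q 0 i) - k.+1%:R^-1, ratr (q 0 i) + k.+1%:R^-1[%classic.
  by apply/seteqP; split => x /=; rewrite in_itv.
apply: open_comp; last exact: interval_open.
by move=> x _; exact: coord_continuous.
Qed.

End cons.


Lemma cons_rV_qbox (R : realType) (n : nat) (q : 'rV[rat]_n.+1) k :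
  @cons_rV R n @^-1` qbox q k =
  `]ratr (q 0 0) - k.+1%:R^-1, ratr (q 0 0) + k.+1%:R^-1[%classic `*`
  qbox (\row_i q 0 (lift 0 i)) k.
Proof.
apply/seteqP; split => [p /= h|p /= [/= h1 h2] i].
  split => /=; first by have := h 0; rewrite cons_rV0 in_itv.
  by move=> i; have := h (lift 0 i); rewrite cons_rVS mxE.
case: (unliftP 0 i) => [j|] ->; last by rewrite cons_rV0; rewrite in_itv in h1.
by have := h2 j; rewrite cons_rVS mxE.
Qed.

Lemma measurable_cons_rV (R : realType) (n : nat) :
  measurable_fun [set: measurableTypeR R * 'rV[R]_n] (@cons_rV R n).
Proof.
apply: (@measurability _ _ _ _ setT (@cons_rV R n) (@open 'rV[R]_n.+1)) => //.
move=> _ [A oA <-]; rewrite setTI (open_qbox oA) preimage_bigcup.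
rewrite bigcup_mkcond; apply: countable_bigcupT_measurable; first exact: countableP.
move=> p; case: ifPn => // _; rewrite cons_rV_qbox; apply: measurableX => //.
exact: measurable_box.
Qed.

HB.instance Definition _ (R : realType) (n : nat) :=
  isMeasurableFun.Build _ _ _ _ _ (@measurable_cons_rV R n).

Section sigma_finite_pack.
Local Open Scope ereal_scope.
Context d (T : measurableType d) (R : realType) (m : {measure set T -> \bar R}).
Definition sf_measure of sigma_finite setT m : set T -> \bar R := m.
Hypothesis sf : sigma_finite setT m.
HB.instance Definition _ := Measure.copy (sf_measure sf) m.
Let sfs : sigma_finite setT (sf_measure sf). Proof. exact: sf. Qed.
HB.instance Definition _ := Measure_isSigmaFinite.Build _ _ _ (sf_measure sf) sfs.
End sigma_finite_pack.

Section lebesgue.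
Context (R : realType).

Fixpoint lebesgue_rV (n : nat) : set 'rV[R]_n -> \bar R :=
  match n with
  | 0 => \d_(0 : 'rV[R]_0)
  | m.+1 => pushforward (@lebesgue_measure R \x lebesgue_rV (n := m))%E
                        (@cons_rV R m)
  end.

Let cube n (k : nat) : set 'rV[R]_n := [set x | forall i, `|x 0 i| < k%:R].

Let cons_cube n k :
  @cons_rV R n @^-1` @cube n.+1 k = `](- k%:R), k%:R[%classic `*` @cube n k.
Proof.
apply/seteqP; split => [p /= h|p /= [/= h1 h2] i].
  split => /=; first by have := h 0; rewrite cons_rV0 in_itv/= ltr_norml.
  by move=> i; have := h (lift 0 i); rewrite cons_rVS.
case: (unliftP 0 i) => [j|] ->; last by move: h1; rewrite cons_rV0 in_itv/= ltr_norml.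
by have := h2 j; rewrite cons_rVS.
Qed.

Let mcube n k : measurable (@cube n k).
Proof.
elim: n => [|n ih].
  by rewrite (_ : cube k = setT)//; apply/seteqP; split => // x _ [].
have -> : @cube n.+1 k = \bigcap_(i : 'I_n.+1) [set x : 'rV[R]_n.+1 | `|x 0 i| < k%:R].
  by apply/seteqP; split => [x h i _|x h i]; [exact: h|exact: (h i)].
apply: fin_bigcap_measurable => // i _.
apply: open_measurable_mx.
have -> : [set x : 'rV[R]_n.+1 | `|x 0 i| < k%:R]
 = (fun x : 'rV[R]_n.+1 => x 0 i) @^-1` `](- k%:R), k%:R[%classic.
  by apply/seteqP; split => x /=; rewrite in_itv/= ltr_norml.
apply: open_comp; last exact: interval_open.
by move=> x _; exact: coord_continuous.
Qed.

Let cubeT n : [set: 'rV[R]_n] = \bigcup_k @cube n k.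
Proof.
apply/seteqP; split => // x _.
exists (\max_(i < n) (Num.truncn `|x ord0 i|).+1)%N => // i.
apply: (@lt_le_trans _ _ (Num.truncn `|x ord0 i|).+1%:R); first exact: truncnS_gt.
rewrite ler_nat.
exact: (leq_bigmax_cond (F := fun i => (Num.truncn `|x ord0 i|).+1)).
Qed.

Local Open Scope ereal_scope.

Let lebesgue_rVP n : exists m : {measure set 'rV[R]_n -> \bar R},
  (m : set _ -> _) = @lebesgue_rV n /\ forall k, m (cube k) < +oo.
Proof.
elim: n => [|n [m [mE moo]]].
  exists (\d_(0%R : 'rV[R]_0)); split => // k; rewrite /= /dirac; exact: ltry.
have sf : sigma_finite setT m.
  by exists (@cube n); [exact: cubeT|move=> k; split; [exact: mcube|exact: moo]].
pose m' : {sigma_finite_measure set 'rV[R]_n -> \bar R} := sf_measure sf.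
pose l : {measure set _ -> \bar R} := (@lebesgue_measure R \x m').
pose Q : {measure set 'rV[R]_n.+1 -> \bar R} :=
  measure_function_pushforward__canonical__measure_function_Measure l
    (@measurable_cons_rV R n).
exists Q; split; first by rewrite /= -mE.
move=> k; rewrite /= /pushforward cons_cube product_measure1E//=.
rewrite lebesgue_measure_itv/=; apply: lte_mul_pinfty => //.
- by case: ifP => // lt_k; rewrite -EFinD lee_fin subr_ge0 ltW.
- by case: ifP => // _; rewrite -EFinD ge0_fin_numE ?ltry// lee_fin opprK addr_ge0.
- exact: moo.
- exact: mcube.
Qed.

Let lebesgue_rV0 n : @lebesgue_rV n set0 = 0.
Proof. by have [m [<- _]] := lebesgue_rVP n; exact: measure0. Qed.

Let lebesgue_rV_ge0 n A : 0 <= @lebesgue_rV n A.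
Proof. by have [m [<- _]] := lebesgue_rVP n; exact: measure_ge0. Qed.

Let lebesgue_rV_sigma_additive n : semi_sigma_additive (@lebesgue_rV n).
Proof.
by have [m [<- _]] := lebesgue_rVP n; exact: measure_semi_sigma_additive.
Qed.

HB.instance Definition _ n := isMeasure.Build _ _ _ (@lebesgue_rV n)
  (lebesgue_rV0 n) (@lebesgue_rV_ge0 n) (@lebesgue_rV_sigma_additive n).

Let lebesgue_rV_sigma_finite n : sigma_finite setT (@lebesgue_rV n).
Proof.
exists (@cube n); first exact: cubeT.
move=> k; split; first exact: mcube.
by have [m [<- moo]] := lebesgue_rVP n; exact: moo.
Qed.

HB.instance Definition _ n := Measure_isSigmaFinite.Build _ _ _ (@lebesgue_rV n)
  (@lebesgue_rV_sigma_finite n).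

End lebesgue.


Lemma inv_gap (R : realType) (j : nat) : (0 < j)%N ->
  j.+1%:R^-1 ^+ 2 <= j%:R^-1 - j.+1%:R^-1 :> R.
Proof.
move=> jgt0; have j0 : (0 < j%:R :> R)%R by rewrite ltr0n.
rewrite -natr1; move: (j%:R) j0 => t t0.
have -> : t^-1 - (t + 1)^-1 = (t * (t + 1))^-1 by field; apply/andP; split; lra.
by rewrite expr2 -invfM lef_pV2 ?posrE; nra.
Qed.

Section hausdorff.
Context (R : realType) (n : nat).
Implicit Types (x y : 'rV[R]_n) (A B X : set 'rV[R]_n) (s : nat).

Definition enorm x : R := Num.sqrt (\sum_i x 0 i ^+ 2).

Definition ediam A : \bar R :=
  ereal_sup [set (enorm (x - y))%:E | x in A & y in A].

(* volume of the s-dimensional Euclidean ball of diameter 1, for s <= 2 *)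
Definition unit_diam_ball s : R := if s == 2%N then pi / 4 else 1.

Definition hausdorff_gauge s A : \bar R :=
  if `[< A = set0 >] then 0%E else ((unit_diam_ball s)%:E * ediam A ^+ s)%E.

Definition fine_cover (delta : R) A : set (nat -> set 'rV[R]_n) :=
  [set F | (forall k, (ediam (F k) <= delta%:E)%E) /\ A `<=` \bigcup_k F k].

Definition hausdorff_pre s (delta : R) A : \bar R :=
  ereal_inf [set (\sum_(k <oo) hausdorff_gauge s (F k))%E | F in fine_cover delta A].

Definition hausdorff s A : \bar R :=
  ereal_sup [set hausdorff_pre s delta A | delta in [set delta | 0 < delta]].

Local Open Scope ereal_scope.

Let gauge0 s : hausdorff_gauge s set0 = 0.
Proof. by rewrite /hausdorff_gauge asboolT. Qed.

Let gauge_ge0 s A : 0 <= hausdorff_gauge s A.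
Proof.
rewrite /hausdorff_gauge; case: asboolP => // /eqP/set0P[x Ax].
apply: mule_ge0.
  by rewrite lee_fin /unit_diam_ball; case: ifP => // _; rewrite divr_ge0// pi_ge0.
apply: expe_ge0; apply: ereal_sup_ubound => /=; exists x => //; exists x => //.
by rewrite subrr /enorm big1 ?sqrtr0// => i _; rewrite mxE expr0n.
Qed.

Let ediam0 : ediam set0 = -oo.
Proof. by rewrite -ereal_sup0; congr ereal_sup; apply/seteqP; split => // x [y []]. Qed.

(* restricting the gauge to delta-fine sets makes hausdorff_pre a mu_ext *)
Let dgauge s (delta : R) A : \bar R :=
  if ediam A <= delta%:E then hausdorff_gauge s A else +oo.

Let all_sets := g_sigma_algebraType [set: set 'rV[R]_n].

Let dgauge_ge0 s delta A : 0 <= dgauge s delta A.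
Proof. by rewrite /dgauge; case: ifP. Qed.

Let dgauge0 s delta : dgauge s delta set0 = 0.
Proof. by rewrite /dgauge ediam0 leNye gauge0. Qed.

Let hausdorff_preE s delta :
  hausdorff_pre s delta = @mu_ext _ all_sets R (dgauge s delta).
Proof.
apply/funext => A; apply/eqP; rewrite eq_le; apply/andP; split.
  apply: le_ereal_inf_tmp => _ [F [_ AF] <-].
  have [hF|] := pselect (forall k, ediam (F k) <= delta%:E).
    apply: ereal_inf_lbound; exists F => //.
    by apply: eq_eseriesr => k _; rewrite /dgauge hF.
  move=> /existsNP[k /negP Fk]; rewrite (@eseries_pinfty _ _ _ k) ?leey//.
    by move=> j _; rewrite -ltNye (lt_le_trans _ (dgauge_ge0 _ _ _)).
  by rewrite /dgauge (negbTE Fk).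
apply: ereal_inf_le_tmp => _ [F [hF AF] <-]; exists F.
  by split => // i; exact: sub_sigma_algebra.
by apply: eq_eseriesr => k _; rewrite /dgauge hF.
Qed.

Let pre_ge0 s delta A : 0 <= hausdorff_pre s delta A.
Proof. by rewrite hausdorff_preE; exact: mu_ext_ge0. Qed.

Let pre0 s delta : hausdorff_pre s delta set0 = 0.
Proof. by rewrite hausdorff_preE; apply: mu_ext0. Qed.

Let pre_le s delta A B : A `<=` B -> hausdorff_pre s delta A <= hausdorff_pre s delta B.
Proof. by move=> AB; rewrite hausdorff_preE; exact: le_mu_ext. Qed.

Let pre_sub s delta : sigma_subadditive (hausdorff_pre s delta).
Proof.
rewrite hausdorff_preE.
exact: (@mu_ext_sigma_subadditive _ all_sets R (dgauge s delta) (dgauge_ge0 s delta)).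
Qed.

Let pre_haus s delta A : (0 < delta)%R -> hausdorff_pre s delta A <= hausdorff s A.
Proof. by move=> d0; apply: ereal_sup_ubound; exists delta. Qed.

Let pre_mono s d1 d2 A : (d1 <= d2)%R -> hausdorff_pre s d2 A <= hausdorff_pre s d1 A.
Proof.
move=> d12; apply: ereal_inf_le_tmp => _ [F [hF AF] <-]; exists F => //; split => // k.
by rewrite (le_trans (hF k)).
Qed.

Let hausdorff0 s : hausdorff s set0 = 0.
Proof.
apply/eqP; rewrite eq_le; apply/andP; split.
  by apply: ge_ereal_sup => _ [d _ <-]; rewrite pre0.
by rewrite -(pre0 s 1%R); exact: pre_haus.
Qed.

Let hausdorff_ge0 s A : 0 <= hausdorff s A.
Proof. by apply: (le_trans (pre_ge0 s 1%R A)); exact: pre_haus. Qed.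

Let hausdorff_le s : {homo hausdorff s : A B / A `<=` B >-> A <= B}.
Proof.
move=> A B AB; apply: ge_ereal_sup => _ [d d0 <-].
by apply: (le_trans (pre_le _ _ AB)); exact: pre_haus.
Qed.

Let hausdorff_sub s : sigma_subadditive (hausdorff s).
Proof.
move=> F; apply: ge_ereal_sup => _ [d d0 <-]; apply: (le_trans (pre_sub _ _ _)).
by apply: lee_nneseries => // i _; exact: pre_haus.
Qed.

HB.instance Definition _ s := isOuterMeasure.Build R 'rV[R]_n (hausdorff s)
  (hausdorff0 s) (hausdorff_ge0 s) (@hausdorff_le s) (@hausdorff_sub s).

Let coord_le x i : (`|x 0 i| <= enorm x)%R.
Proof.
rewrite /enorm -sqrtr_sqr ler_wsqrtr// (bigD1 i)//= lerDl.
by apply: sumr_ge0 => j _; exact: sqr_ge0.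
Qed.

Let norm_le x : (`|x| <= enorm x)%R.
Proof.
rewrite [leLHS]mx_normrE; apply/bigmax_leP; split => [|[i j] _ /=].
  exact: sqrtr_ge0.
by rewrite ord1.
Qed.

Let pre_sep s (r delta : R) A B : (0 < delta < r)%R ->
  (forall x y, A x -> B y -> (r <= `|x - y|)%R) ->
  hausdorff_pre s delta A + hausdorff_pre s delta B <= hausdorff_pre s delta (A `|` B).
Proof.
move=> /andP[d0 dr] AB; apply: le_ereal_inf_tmp => _ [F [hF ABF] <-].
pose FA k := if `[< F k `&` A !=set0 >] then F k else set0.
pose FB k := if `[< F k `&` B !=set0 >] then F k else set0.
apply: (@le_trans _ _ (\sum_(k <oo) hausdorff_gauge s (FA k) +
                       \sum_(k <oo) hausdorff_gauge s (FB k))).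
  apply: leeD; apply: ereal_inf_lbound; [exists FA|exists FB] => //; split.
  - by move=> k; rewrite /FA; case: ifP => // _; rewrite ediam0 leNye.
  - move=> x Ax; have [k _ Fkx] := ABF _ (or_introl Ax); exists k => //.
    by rewrite /FA asboolT//; exists x.
  - by move=> k; rewrite /FB; case: ifP => // _; rewrite ediam0 leNye.
  - move=> x Ax; have [k _ Fkx] := ABF _ (or_intror Ax); exists k => //.
    by rewrite /FB asboolT//; exists x.
rewrite -nneseriesD; [|by move=> *; exact: gauge_ge0|by move=> *; exact: gauge_ge0].
apply: lee_nneseries => [k _ _|k _]; first by rewrite adde_ge0.
rewrite /FA /FB; case: asboolP => [[x [Fx Ax]]|_]; last first.
  by rewrite gauge0 add0e; case: ifP => // _; rewrite gauge0.
rewrite asboolF ?gauge0 ?adde0// => -[y [Fy By]].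
have /(le_lt_trans)/(_ dr) : (enorm (x - y) <= delta)%R.
  rewrite -lee_fin; apply: le_trans (hF k); apply: ereal_sup_ubound.
  by exists x => //; exists y.
by rewrite ltNge => /negP; apply; apply: le_trans (norm_le _); exact: AB.
Qed.

Let hausdorff_sep s (r : R) A B : (0 < r)%R ->
  (forall x y, A x -> B y -> (r <= `|x - y|)%R) ->
  hausdorff s A + hausdorff s B <= hausdorff s (A `|` B).
Proof.
move=> r0 AB.
have [->|] := eqVneq (hausdorff s (A `|` B)) +oo; first by rewrite leey.
rewrite -ltey => oo; have fU : hausdorff s (A `|` B) \is a fin_num by rewrite ge0_fin_numE.
have fB : hausdorff s B \is a fin_num.
  by rewrite ge0_fin_numE//; apply: le_lt_trans oo; apply: hausdorff_le => ? ?; right.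
rewrite -leeBrDr//; apply: ge_ereal_sup => _ [d1 /= d10 <-].
have f1 : hausdorff_pre s d1 A \is a fin_num.
  rewrite ge0_fin_numE//; apply: le_lt_trans oo.
  by apply: (le_trans (pre_haus _ _ d10)); apply: hausdorff_le => ? ?; left.
rewrite leeBrDr// addeC -leeBrDr//; apply: ge_ereal_sup => _ [d2 /= d20 <-].
rewrite leeBrDr// addeC.
pose d := (Num.min (Num.min d1 d2) (r / 2))%R.
have d0 : (0 < d)%R by rewrite !lt_min d10 d20 divr_gt0.
have dr : (d < r)%R by rewrite gt_min; apply/orP; right; lra.
apply: (le_trans _ (pre_haus s (A `|` B) d0)).
apply: (le_trans _ (@pre_sep s r d A B _ AB)); last by rewrite d0.
by apply: leeD; apply: pre_mono; rewrite !ge_min lexx ?orbT.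
Qed.

Let closed_caratheodory s A : closed A -> (hausdorff s).-caratheodory A.
Proof.
move=> cA; apply: le_caratheodory_measurable => X.
have [Xoo|] := eqVneq (hausdorff s X) +oo; first by rewrite [leRHS]Xoo leey.
rewrite -ltey => Xoo.
pose E k := [set x | X x /\ forall y, A y -> (k.+1%:R^-1 <= `|x - y|)%R].
have EE k l : (k <= l)%N -> E k `<=` E l.
  move=> kl x [Xx hx]; split => // y /hx; apply: le_trans.
  by rewrite lef_pV2 ?posrE// ler_nat.
have UE : X `&` ~` A `<=` \bigcup_k E k.
  move=> x [Xx nAx].
  have : nbhs x (~` A) by apply: open_nbhs_nbhs; split => //; exact: closed_openC.
  move=> /nbhs_ballP[e /= e0 eA].
  have [N _ /(_ N (leqnn N)) /=] := near_infty_natSinv_lt (PosNum e0).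
  move=> /= Ne; exists N => //; split => // y Ay.
  rewrite leNgt; apply/negP => xy; apply: (eA y) => //.
  by rewrite -ball_normE /=; exact: lt_trans Ne.
pose D k := E k.+1 `\` E k.
have sepD i j x y : (i.+1 <= j)%N -> E i x -> ~ E j y -> X y ->
    ((j.+1%:R^-1 ^+ 2) <= `|x - y|)%R.
  move=> ij [_ Ex] nE Xy.
  have [z [Az yz]] : exists z, A z /\ (`|y - z| < j.+1%:R^-1)%R.
    apply: contrapT => h; apply: nE; split => // z Az; rewrite leNgt; apply/negP => yz.
    by apply: h; exists z.
  have h2 := Ex _ Az; have h1 := ler_normD (x - y)%R (y - z)%R.
  rewrite addrA subrK in h1.
  have h3 : (i.+1%:R^-1 - j.+1%:R^-1 <= `|x - y|)%R.
    rewrite lerBlDr; apply: (le_trans h2); apply: (le_trans h1).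
    by apply: lerD => //; exact: ltW.
  apply: le_trans h3.
  have : (j%:R^-1 <= i.+1%:R^-1 :> R)%R.
    by rewrite lef_pV2 ?posrE ?ltr0n// ?ler_nat//; lia.
  move=> h4; apply: (@le_trans _ _ (j%:R^-1 - j.+1%:R^-1)%R); last exact: lerB.
  by apply: inv_gap; lia.
have sumD e m : \sum_(i < m) hausdorff s (D (i.*2 + e)%N) <= hausdorff s X.
  apply: (@le_trans _ _ (hausdorff s (\big[setU/set0]_(i < m) D (i.*2 + e)%N))); last first.
    by apply: hausdorff_le; rewrite -(bigcup_mkord _ (fun i => D (i.*2 + e)%N)) => x [i _ [[]]].
  elim: m => [|m ih]; first by rewrite !big_ord0 hausdorff0.
  rewrite !big_ord_recr /=; apply: (le_trans (leeD2r _ ih)).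
  apply: (@hausdorff_sep _ ((m.*2 + e).+1%:R^-1 ^+ 2)%R).
    by rewrite exprn_gt0.
  move=> x y; rewrite -(bigcup_mkord _ (fun i => D (i.*2 + e)%N)) => -[i /= im [Ex _]] [[Xy _] nEy].
  by apply: sepD Ex nEy Xy; lia.
have sumD2 m : \sum_(i < m) hausdorff s (D i) <= hausdorff s X + hausdorff s X.
  apply: (@le_trans _ _ (\sum_(i < m.*2) hausdorff s (D i))).
    rewrite -!(big_mkord xpredT (fun i => hausdorff s (D i))).
    by apply: lee_sum_nneg_natr => //; lia.
  apply: le_trans (leeD (sumD 0%N m) (sumD 1%N m)).
  rewrite -big_split /=.
  elim: m => [|m ih]; first by rewrite !big_ord0.
  by rewrite doubleS !big_ord_recr/= -addeA addn0 addn1 leeD2r.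
have sumoo : \sum_(0 <= i <oo) hausdorff s (D i) < +oo.
  apply: (@le_lt_trans _ _ (hausdorff s X + hausdorff s X)).
    apply: lime_le; first exact: is_cvg_nneseries.
    by apply: nearW => m; rewrite big_mkord.
  by rewrite lte_add_pinfty.
have tail := @nneseries_tail_cvg R _ xpredT sumoo (fun k _ => hausdorff_ge0 s (D k)).
have XE k : hausdorff s (X `&` A) + hausdorff s (X `&` ~` A) <=
    hausdorff s X + \sum_(k <= i <oo) hausdorff s (D i).
  have XA : X `&` ~` A `<=` E k `|` \bigcup_(i in ~` `I_k) D i.
    move=> x /UE[m _]; elim: m => [|m ih] Ex.
      by left; apply: EE Ex.
    have [Em|nEm] := pselect (E m x); first exact: ih.
    have [mk|km] := leqP m.+1 k; first by left; apply: EE Ex.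
    by right; exists m => //=; apply/negP; rewrite -leqNgt -ltnS.
  apply: (@le_trans _ _ (hausdorff s (X `&` A) +
     (hausdorff s (E k) + \sum_(k <= i <oo) hausdorff s (D i)))).
    apply: leeD2l; apply: (le_trans (@hausdorff_le s _ _ XA)).
    apply: (le_trans (outer_measureU2 _ _ _)).
    by apply: leeD2l; exact: outer_measure_sigma_subadditive_tail.
  rewrite addeA; apply: leeD2r.
  apply: (le_trans (@hausdorff_sep s k.+1%:R^-1 _ _ _ _)) => //.
    by move=> x y [_ Ax] [_ Ey]; rewrite -normrN opprB; exact: Ey.
  by apply: hausdorff_le => x [[]|[]].
have Xfin : hausdorff s X \is a fin_num by rewrite ge0_fin_numE.
have Xlim : hausdorff s X =
    lim (hausdorff s X + \sum_(k <= i <oo) hausdorff s (D i) @[k --> \oo]).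
  apply/esym/cvg_lim => //; rewrite -[X in _ --> X]adde0.
  by apply: cvgeD => //; [rewrite fin_num_adde_defr|exact: cvg_cst].
rewrite [leRHS]Xlim; apply: lime_ge; last exact: nearW.
apply/cvg_ex; exists (hausdorff s X); rewrite -[X in _ --> X]adde0.
by apply: cvgeD => //; [rewrite fin_num_adde_defr|exact: cvg_cst].
Qed.

Let borel_caratheodory s : @measurable _ 'rV[R]_n `<=` (hausdorff s).-caratheodory.
Proof.
apply: smallest_sub.
  exact: (@sigma_algebra_measurable _ (caratheodory_type (hausdorff s))).
move=> A oA; rewrite -(setCK A); apply: caratheodory_measurable_setC.
by apply: closed_caratheodory; exact: open_closedC.
Qed.

Let hausdorff_sigma_additive s : semi_sigma_additive (hausdorff s).
Proof.
move=> F mF tF mUF.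
apply: (@caratheodory_measure_sigma_additive _ _ (hausdorff s) F) => // [i|];
  exact: borel_caratheodory.
Qed.

HB.instance Definition _ s := isMeasure.Build _ _ _ (hausdorff s)
  (hausdorff0 s) (hausdorff_ge0 s) (@hausdorff_sigma_additive s).


End hausdorff.


(* Functions that agree almost everywhere are not identified: a space is a
   subset of a vector space of functions together with a seminorm, and two of
   its elements represent the same class when their difference has seminorm 0 *)
Record snspace (R : realType) := SnSpace {
  vec :> lmodType R;
  elements : set vec;
  nrm : vec -> R }.
Arguments elements {R} s.
Arguments nrm {R s}.

Section calculus.
Context (R : realType).
Implicit Types X Y : snspace R.

(* linear up to elements of seminorm 0 *)
Definition bounded_linear X Y : set (X -> Y) := [set T | [/\
  forall v, elements X v -> elements Y (T v),
  forall (k : R) u v, elements X u -> elements X v ->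
    nrm (T (k *: u + v) - (k *: T u + T v)) = 0 &
  exists K : R, forall v, elements X v -> nrm (T v) <= K * nrm v]].

Definition op_space X Y : snspace R :=
  @SnSpace R (X -> Y) (@bounded_linear X Y)
    (fun T => sup [set nrm (T v) | v in [set v | elements X v /\ nrm v <= 1]]).

Definition frechet_derivative X Y (F : X -> Y) (u : X) (T : op_space X Y) :=
  elements (op_space X Y) T /\
  forall e : R, 0 < e -> exists2 r : R, 0 < r & forall v, elements X v -> nrm v < r ->
    nrm (F (u + v) - F u - T v) <= e * nrm v.

Definition derivative_on X Y (U : set X) (F : X -> Y) (DF : X -> op_space X Y) :=
  forall u, U u -> frechet_derivative F u (DF u).

Definition continuous_in X Y (U : set X) (F : X -> Y) :=
  forall u, U u -> forall e : R, 0 < e -> exists2 r : R, 0 < r &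
    forall u', U u' -> nrm (u' - u) < r -> nrm (F u' - F u) < e.

Definition class_C1 X Y (U : set X) (F : X -> Y) :=
  exists DF : X -> op_space X Y, derivative_on U F DF /\ continuous_in U DF.

Definition class_C2 X Y (U : set X) (F : X -> Y) :=
  exists DF : X -> op_space X Y, derivative_on U F DF /\ class_C1 U DF.

Definition second_derivative X Y (U : set X) (F : X -> Y) (u : X) :
    op_space X (op_space X Y) :=
  xget 0 [set T | exists DF : X -> op_space X Y,
    derivative_on U F DF /\ frechet_derivative DF u T].

End calculus.

Section domains.
Context (R : realType) (d : nat).
Implicit Types O : set 'rV[R]_d.

Definition boundary O := closure O `\` interior O.

(* near each boundary point, and in suitable orthonormal coordinates, the     *)
(* domain is the set of points strictly above the graph of a Lipschitz map    *)
Definition lipschitz_boundary O := forall x0, boundary O x0 ->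
  exists (Q : 'M[R]_d) (k : 'I_d) (h : 'rV[R]_d.-1 -> R) (K r : R), [/\
    Q *m Q^T = 1%:M, 0 < r,
    forall s t, `|h s - h t| <= K * enorm (s - t) &
    forall x, enorm (x - x0) < r ->
      (O x <-> h (col' k (x *m Q)) < (x *m Q) 0 k)].

Definition Lp (m : {measure set 'rV[R]_d -> \bar R}) (D : set 'rV[R]_d)
    (p : \bar R) : set ('rV[R]_d -> R) :=
  [set f | f \_ D \in Lfun m p].

Definition eLp_norm (m : {measure set 'rV[R]_d -> \bar R}) D p
    (f : 'rV[R]_d -> R) : \bar R :=
  'N[m]_p[EFin \o (f \_ D)]%E.

Definition Lp_norm (m : {measure set 'rV[R]_d -> \bar R}) D p
    (f : 'rV[R]_d -> R) : R := fine (eLp_norm m D p f).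

Local Notation leb := (@lebesgue_rV R d).
Local Notation surf := (@hausdorff R d d.-1).

Definition ae_in O (P : 'rV[R]_d -> Prop) := \forall x \ae leb, O x -> P x.

Definition ess_inf_in O (u : 'rV[R]_d -> R) : \bar R :=
  ereal_sup [set m | ae_in O (fun x => (m <= (u x)%:E)%E)].

Definition L2_space O : snspace R :=
  @SnSpace R ('rV[R]_d -> R^o) (Lp leb O 2%:E) (Lp_norm leb O 2%:E).

Definition partial (i : 'I_d) (f : 'rV[R]_d -> R) (x : 'rV[R]_d) : R :=
  'D_(delta_mx 0 i) (f : 'rV[R]_d -> R^o) x.

(* weak derivatives are tested with C^1 functions of compact support *)
Definition test_function O (psi : 'rV[R]_d -> R) := [/\
  forall i x, derivable (psi : 'rV[R]_d -> R^o) x (delta_mx 0 i),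
  forall i, continuous (partial i psi),
  compact (closure [set x | psi x != 0]) &
  closure [set x | psi x != 0] `<=` O].

Definition is_weak_partial O (i : 'I_d) (y g : 'rV[R]_d -> R) :=
  Lp leb O 2%:E g /\ forall psi, test_function O psi ->
  \int[leb]_(x in O) (y x * partial i psi x) =
  - \int[leb]_(x in O) (g x * psi x).

Definition weak_partial O i y : 'rV[R]_d -> R :=
  xget (cst 0) (is_weak_partial O i y).

Definition H1 O : set ('rV[R]_d -> R) :=
  [set y | Lp leb O 2%:E y /\ forall i, exists g, is_weak_partial O i y g].

Definition H1_norm O y : R :=
  Num.sqrt (Lp_norm leb O 2%:E y ^+ 2 +
            \sum_i Lp_norm leb O 2%:E (weak_partial O i y) ^+ 2).

(* in the Hölder seminorm x = z contributes 0 / 0 = 0 *)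
Definition hoelder_norm O (mu : R) (y : 'rV[R]_d -> R) : \bar R :=
  (ereal_sup [set `|y x|%:E | x in closure O] +
   ereal_sup [set (`|y x - y z| / enorm (x - z) `^ mu)%:E |
              x in closure O & z in closure O])%E.

(* the intersection of H^1(O) and C^{0,mu}(closure O) *)
Definition H1C_space O (mu : R) : snspace R :=
  @SnSpace R ('rV[R]_d -> R^o)
    [set y | H1 O y /\ (hoelder_norm O mu y < +oo)%E]
    (fun y => H1_norm O y + fine (hoelder_norm O mu y)).

(* the trace is the extension by H^1-continuity of the restriction to the     *)
(* boundary of the H^1 functions that are continuous up to the boundary       *)
Definition is_trace O (v t : 'rV[R]_d -> R) :=
  measurable_fun (boundary O) t /\
  exists w : nat -> 'rV[R]_d -> R, [/\
    forall k, H1 O (w k),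
    forall k, {within closure O, continuous (w k)},
    H1_norm O (w k \- v) @[k --> \oo] --> (0 : R) &
    eLp_norm surf (boundary O) 2%:E (w k \- t) @[k --> \oo] --> 0%E].

(* B y = f in O, dy/dn_B = h on the boundary of O, where                      *)
(* B y = - \sum_(i, j) d_j (B_ij d_i y)                                       *)
Definition weak_solution O (B : 'rV[R]_d -> 'M[R]_d)
    (f h y : 'rV[R]_d -> R) :=
  H1 O y /\ forall v t, H1 O v -> is_trace O v t ->
  \int[leb]_(x in O)
    (\sum_i \sum_j B x i j * weak_partial O i y x * weak_partial O j v x) =
  \int[leb]_(x in O) (f x * v x) + \int[surf]_(x in boundary O) (h x * t x).

Definition adjoint_coef (B : 'rV[R]_d -> 'M[R]_d) x := (B x)^T.

End domains.

Section data.
Context (R : realType) (d : nat).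
Implicit Types (O : set 'rV[R]_d) (u v y phi : 'rV[R]_d -> R).
Local Notation leb := (@lebesgue_rV R d).
Local Notation surf := (@hausdorff R d d.-1).

Definition elliptic O (A : 'rV[R]_d -> 'M[R]_d) (MA LambdaA : R) := [/\
  0 < MA, 0 < LambdaA,
  forall i j, Lp leb O +oo%E (fun x => A x i j) &
  ae_in O (fun x => forall xi : 'rV[R]_d,
    LambdaA * enorm xi ^+ 2 <= \sum_i \sum_j A x i j * xi 0 i * xi 0 j
      <= MA * enorm xi ^+ 2)].

Definition dy (F : 'rV[R]_d -> R -> R) x (t : R) : R := derive1 (F x) t.

Definition dyy (F : 'rV[R]_d -> R -> R) x (t : R) : R := derive1n 2 (F x) t.

(* measurable in x, and of class C^2 in the second variable for a.a. x *)
Definition caratheodory_C2 O (F : 'rV[R]_d -> R -> R) :=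
  (forall t, measurable_fun O (F ^~ t)) /\ ae_in O (fun x => [/\
    forall t, derivable (F x : R -> R^o) t 1,
    forall t, derivable (dy F x : R -> R^o) t 1 &
    continuous (dyy F x)]).

Definition second_derivative_equicontinuous O (F : 'rV[R]_d -> R -> R) :=
  forall e M : R, 0 < e -> 0 < M -> exists2 rho : R, 0 < rho &
  ae_in O (fun x => forall t1 t2, `|t1| <= M -> `|t2| <= M -> `|t1 - t2| <= rho ->
    `|dyy F x t1 - dyy F x t2| <= e).

Definition nonlinearity O (p : \bar R) (a0 : R) (a : 'rV[R]_d -> R -> R) := [/\
  caratheodory_C2 O a,
  Lp leb O p (a ^~ 0),
  ae_in O (fun x => forall t, a0 <= dy a x t),
  forall M : R, 0 < M -> exists C : R,
    ae_in O (fun x => forall t, `|t| <= M ->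
      `|dy a x t| + `|dyy a x t| <= C) &
  second_derivative_equicontinuous O a].

Definition cost_integrand O (p : \bar R) (L : 'rV[R]_d -> R -> R) := [/\
  caratheodory_C2 O L,
  Lp leb O 1%:E (L ^~ 0),
  forall M : R, 0 < M -> exists2 LM, Lp leb O p LM &
    ae_in O (fun x => forall t, `|t| <= M -> `|dy L x t| <= LM x),
  forall M : R, 0 < M -> exists C : R,
    ae_in O (fun x => forall t, `|t| <= M -> `|dyy L x t| <= C) &
  second_derivative_equicontinuous O L].

Definition regularity_exponent O (A : 'rV[R]_d -> 'M[R]_d) (p q : \bar R)
    (mu : R) :=
  0 < mu <= 1 /\ forall B, B = A \/ B = adjoint_coef A ->
  exists C : R, forall f h y,
    Lp leb O (Order.min p 2%:E) f -> Lp surf (boundary O) q h ->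
    weak_solution O B (f \- y) h y ->
    exists2 y', ae_in O (fun x => y' x = y x) &
      (hoelder_norm O mu y' <= (C * (Lp_norm leb O (Order.min p 2%:E) f +
                                     Lp_norm surf (boundary O) q h))%:E)%E.

Definition embedding_L4 O (C4 : R) :=
  forall y, H1 O y -> (eLp_norm leb O 4%:E y <= (C4 * H1_norm O y)%:E)%E.

Definition calA0 O (a0 : R) : set ('rV[R]_d -> R) :=
  [set u | Lp leb O 2%:E u /\ (0 < a0%:E + ess_inf_in O u)%E].

Definition Lambda O (LambdaA a0 : R) u : R :=
  Num.min LambdaA (a0 + fine (ess_inf_in O u)).

Definition calA O (a0 : R) (eps : ('rV[R]_d -> R) -> R) : set (L2_space O) :=
  [set u | Lp leb O 2%:E u /\
    exists2 ubar, calA0 O a0 ubar & Lp_norm leb O 2%:E (u \- ubar) < eps ubar].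

Definition state_eq O A (a : 'rV[R]_d -> R -> R) g u y :=
  weak_solution O A (fun x => - (a x (y x) + u x * y x)) g y.

Definition adjoint_eq O A (a L : 'rV[R]_d -> R -> R) u y phi :=
  weak_solution O (adjoint_coef A)
    (fun x => dy L x (y x) - dy a x (y x) * phi x - u x * phi x)
    (cst 0) phi.

(* z = z_{u,v}, where y = y_u *)
Definition linearized_state_eq O A (a : 'rV[R]_d -> R -> R) u y v z :=
  weak_solution O A
    (fun x => - (dy a x (y x) * z x + u x * z x + v x * y x)) (cst 0) z.

(* eta = eta_{u,v}, where y = y_u, phi = phi_u and z = z_{u,v} *)
Definition linearized_adjoint_eq O A (a L : 'rV[R]_d -> R -> R) u y phi v z eta :=
  weak_solution O (adjoint_coef A)
    (fun x => (dyy L x (y x) - phi x * dyy a x (y x)) * z x - v x * phi x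
              - dy a x (y x) * eta x - u x * eta x)
    (cst 0) eta.

(* G and Phi are maps into the Hölder functions, whose values off closure O   *)
(* are irrelevant                                                             *)
Definition control_to_state O A a g mu (U : set (L2_space O))
    (G : L2_space O -> H1C_space O mu) :=
  (forall u, U u -> [/\ elements (H1C_space O mu) (G u), state_eq O A a g u (G u) &
    forall y, elements (H1C_space O mu) y -> state_eq O A a g u y ->
      {in closure O, y =1 G u}]) /\
  class_C2 U G.

Definition control_to_adjoint O A a L mu (U : set (L2_space O))
    (G Phi : L2_space O -> H1C_space O mu) :=
  (forall u, U u -> [/\ elements (H1C_space O mu) (Phi u),
    adjoint_eq O A a L u (G u) (Phi u) &
    forall phi, elements (H1C_space O mu) phi -> adjoint_eq O A a L u (G u) phi ->
      {in closure O, phi =1 Phi u}]) /\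
  class_C1 U Phi.

Definition admissible O (alpha : R) (beta : \bar R) u :=
  Lp leb O 2%:E u /\ ae_in O (fun x => (alpha%:E <= (u x)%:E <= beta)%E).

Definition proj (alpha : R) (beta : \bar R) (t : R) : R :=
  fine (Order.min beta (Order.max alpha%:E t%:E)).

Definition cost O (L : 'rV[R]_d -> R -> R) (nu : R) mu
    (G : L2_space O -> H1C_space O mu) (u : L2_space O) : R :=
  \int[leb]_(x in O) L x (G u x) + nu / 2 * \int[leb]_(x in O) (u x ^+ 2).

Definition real_space : snspace R := @SnSpace R R^o setT (fun t => `|t|).

Definition cost'' O L nu mu (U : set (L2_space O))
    (G : L2_space O -> H1C_space O mu) (u v1 v2 : L2_space O) : R :=
  second_derivative U (cost L nu G : L2_space O -> real_space) u v1 v2.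

Definition first_order_conditions O A a L g nu alpha beta u y phi := [/\
  state_eq O A a g u y, adjoint_eq O A a L u y phi &
  ae_in O (fun x => u x = proj alpha beta (nu^-1 * (y x * phi x)))].

Definition Sigma_set O (nu alpha : R) (beta : \bar R) u y phi :=
  [set x | [/\ O x, u x = alpha \/ (u x)%:E = beta &
               nu * u x - y x * phi x = 0]].

Definition critical_cone O (nu alpha : R) (beta : \bar R) u y phi :
    set ('rV[R]_d -> R) :=
  [set v | Lp leb O 2%:E v /\ ae_in O (fun x => [/\
    nu * u x - y x * phi x != 0 -> v x = 0,
    u x = alpha -> 0 <= v x &
    (u x)%:E = beta -> v x <= 0])].

End data.

Section newton.
Context (R : realType) (d : nat) (O : set 'rV[R]_d).
Local Notation leb := (@lebesgue_rV R d).
Context (A : 'rV[R]_d -> 'M[R]_d) (a L : 'rV[R]_d -> R -> R).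
Context (nu alpha : R) (beta : \bar R) (mu : R) (U : set (L2_space O)).
Context (G Phi : L2_space O -> H1C_space O mu).

Definition active_plus (u : L2_space O) : set 'rV[R]_d :=
  [set x | O x /\ (nu%:E * beta <= (G u x * Phi u x)%:E)%E].

Definition active_minus (u : L2_space O) : set 'rV[R]_d :=
  [set x | O x /\ G u x * Phi u x <= nu * alpha].

Definition active (u : L2_space O) := active_plus u `|` active_minus u.

Definition inactive (u : L2_space O) := O `\` active u.

(* active_plus u is empty if beta = +oo *)
Definition newton_residual (u : L2_space O) (x : 'rV[R]_d) : R :=
  if x \in active_plus u then - u x + fine beta
  else if x \in active_minus u then - u x + alpha
  else - u x + nu^-1 * (Phi u x * G u x).

Definition newton_functional (u : L2_space O) (z eta v : 'rV[R]_d -> R) : R :=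
  let vI := v \_ (inactive u) in
  (2 * nu)^-1 * cost'' L nu U G u vI vI -
  \int[leb]_(x in inactive u)
    ((newton_residual u x + nu^-1 * (z x * Phi u x + G u x * eta x)) * v x).

Definition newton_step (u u' : L2_space O) :=
  let wA := (newton_residual u) \_ (active u) in
  exists z eta v : 'rV[R]_d -> R, [/\
    elements (H1C_space O mu) z /\ linearized_state_eq O A a u (G u) wA z,
    elements (H1C_space O mu) eta /\
      linearized_adjoint_eq O A a L u (G u) (Phi u) wA z eta,
    Lp leb (inactive u) 2%:E v /\
      (forall v', Lp leb (inactive u) 2%:E v' ->
        newton_functional u z eta v <= newton_functional u z eta v') &
    elements (L2_space O) u' /\
      ae_in O (fun x => u' x = u x + (wA x + (v \_ (inactive u)) x))].

(* a step is possible only from a control in U, where G and Phi are defined *)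
Definition newton_sequence (u0 : L2_space O) (u : nat -> L2_space O) :=
  u 0%N = u0 /\ forall j, U (u j) /\ newton_step (u j) (u j.+1).

End newton.

(* Main.v *)
Require Import Defs.
From mathcomp Require Import all_boot all_order all_algebra.
From mathcomp Require Import all_classical all_reals all_analysis.
From mathcomp Require Import measurable_realfun ess_sup_inf.
From mathcomp Require Import ring lra zify.
Set Implicit Arguments.
Unset Strict Implicit.
Unset Printing Implicit Defensive.
Import Order.TTheory GRing.Theory Num.Theory.
Import numFieldNormedType.Exports.
Local Open Scope classical_set_scope.
Local Open Scope ring_scope.

(** Write theta_u = y_u phi_u and K_u v = phi_u z_{u,v} + y_u eta_{u,v}, the
    derivative of theta at u, so that J''(u)(v1, v2) = nu (v1, v2) - (K_u v1, v2).
    The error e = u_{j+1} - ubar of a Newton step from u satisfies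
    nu e - K_u e = nu r on the inactive set of u and e = r elsewhere, where r is
    controlled by the remainder theta_u - theta_ubar - K_u (u - ubar), except at
    the points where u and ubar lie in different regimes of the projection: there
    r is only O(|u - ubar|), but by strict complementarity the measure of these
    points tends to 0 as u -> ubar, so that r = o(|u - ubar|) in L^2. Hölder
    estimates make K_u compact and selfadjoint, hence the positivity of J'' on the
    functions that vanish off the inactive set of ubar is a coercivity. It carries
    over to the inactive sets of all u near ubar, and yields both the solvability
    of the step and |e| <= C |r|. *)

(** * Integrals up to null sets *)

Section ae_integral.
Context d (T : measurableType d) (R : realType).
Context (mu : {measure set T -> \bar R}) (D : set T).
Implicit Types (f g h : T -> R) (P Q S : T -> Prop).

(** Everything rests on a gain of integrability: [K_u] maps [L^2] into bounded functions, and
    theta_u - theta_ubar is bounded uniformly by a multiple of |u - ubar|. On a set [S] a uniform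
    bound costs only the factor [msqrt S] in [L^2], so a set of small measure makes even an error of
    the order of |u - ubar| small. The same factor controls the change of the inactive set in the
    coercivity. The smoothness assumed of [G] and [Phi] provides derivatives, not the equations that
    they solve. These are recovered by differentiating the state and adjoint equations along lines;
    the second derivative of the cost, a choice among abstract derivatives, is then identified
    through uniqueness. Functions equal almost everywhere are not identified, and null sets need not
    be Borel, so integrability is handled up to null sets. Completeness of [L^2] is avoided:
    compactness gives a uniform cluster point [k] of the [K v_n], and the limit of the [v_n] is
    written down as [(k + h) / nu] on the inactive set. *)

Definition aeD P := \forall x \ae mu, D x -> P x.

Lemma aeD_all P : (forall x, D x -> P x) -> aeD P.
Proof. by move=> h; apply: aeW. Qed.

Lemma aeD1 P Q : (forall x, D x -> P x -> Q x) -> aeD P -> aeD Q.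
Proof. by move=> PQ; rewrite /aeD; apply: filterS => x Px Dx; apply: PQ => //; exact: Px. Qed.

Lemma aeD2 P P' Q : (forall x, D x -> P x -> P' x -> Q x) -> aeD P -> aeD P' -> aeD Q.
Proof.
by move=> PQ; rewrite /aeD; apply: filterS2 => x Px Px' Dx; apply: PQ => //; [exact: Px|exact: Px'].
Qed.

Lemma aeD3 P P' P'' Q : (forall x, D x -> P x -> P' x -> P'' x -> Q x) ->
  aeD P -> aeD P' -> aeD P'' -> aeD Q.
Proof.
move=> PQ hP hP' hP''; have := aeD2 (fun x _ a b => conj a b) hP hP'.
by move=> h; apply: aeD2 h hP'' => x Dx [? ?] ?; exact: PQ.
Qed.

(** A function controlled only off a null set, such as a composition with a Carathéodory function,
    need not be Borel measurable itself; a measurable representative is all that integration sees.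
    The same holds for [aei]. *)
Definition aem f := exists2 g, measurable_fun D g & aeD (fun x => f x = g x).
Definition aei f := exists2 g, mu.-integrable D (EFin \o g) & aeD (fun x => f x = g x).
Local Notation I := (Rintegral mu D).

Import HBNNSimple.

(** Valid for arbitrary nonnegative functions: the integral is a supremum over simple functions [h]
    below [f], and cutting [h] off on the null set [N] keeps its integral but brings it below
    [g]. *)
Lemma integral_ae_le (f g : T -> \bar R) : (forall x, 0 <= f x)%E -> (forall x, 0 <= g x)%E ->
  (\forall x \ae mu, f x = g x) -> (\int[mu]_x f x <= \int[mu]_x g x)%E.
Proof.
move=> f0 g0 [N [mN N0 fgN]]; rewrite !ge0_integralTE//.
apply: ge_ereal_sup => _ [h /= hf <-].
have mC : measurable (~` N) by exact: measurableC.
pose h' := proj_nnsfun h mC.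
have E (k : {nnsfun T >-> R}) : sintegral mu k = (\int[mu]_x (k x)%:E)%E.
  by rewrite (@integral_nnsfun _ _ _ mu setT measurableT k) patch_setT.
have -> : sintegral mu h = sintegral mu h'.
  rewrite !E; apply: ge0_ae_eq_integral => //.
  - exact/measurable_EFinP.
  - by apply/measurable_EFinP; exact: (@measurable_funPT _ _ _ _ h').
  - by move=> x _; rewrite lee_fin; exact: fun_ge0.
  - by move=> x _; rewrite lee_fin; exact: (@fun_ge0 _ _ h').
  exists N; split => // x /=; apply: contra_notP => nN _.
  by rewrite mindicE mem_set ?mulr1.
apply: ereal_sup_ubound; exists h' => //= x.
rewrite mindicE; case: (boolP (x \in _)) => xN; last by rewrite mulr0.
rewrite mulr1; apply: (le_trans (hf x)); rewrite inE /= in xN.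
have -> // : f x = g x.
by apply: contrapT => h1; apply: xN; exact: fgN.
Qed.

Lemma integral_ae (f g : T -> \bar R) : aeD (fun x => f x = g x) ->
  (\int[mu]_(x in D) f x = \int[mu]_(x in D) g x)%E.
Proof.
have aux (f' g' : T -> \bar R) : (forall x, 0 <= f' x)%E -> (forall x, 0 <= g' x)%E ->
    (\forall x \ae mu, D x -> f' x = g' x) -> (\int[mu]_(x in D) f' x = \int[mu]_(x in D) g' x)%E.
  move=> f0 g0 fg; rewrite [LHS]integral_mkcond [RHS]integral_mkcond.
  have r0 (k : T -> \bar R) : (forall x, 0 <= k x)%E -> forall x, (0 <= (k \_ D) x)%E.
    by move=> k0 x; rewrite patchE; case: ifP.
  apply/eqP; rewrite eq_le; apply/andP; split; apply: integral_ae_le; do ?exact: r0.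
    apply: filterS fg => x fg; rewrite !patchE; case: ifPn => //.
    by rewrite inE => /fg.
  apply: filterS fg => x fg; rewrite !patchE; case: ifPn => //.
  by rewrite inE => /fg.
move=> fg; rewrite integralE [RHS]integralE; congr (_ - _)%E; apply: aux => //.
  by move: fg; rewrite /aeD; apply: filterS => x fg /fg {}fg; rewrite !funeposE fg.
by move: fg; rewrite /aeD; apply: filterS => x fg /fg {}fg; rewrite !funenegE fg.
Qed.

Lemma Rint_ae f g : aeD (fun x => f x = g x) -> I f = I g.
Proof. by move=> fg; rewrite /Rintegral (@integral_ae _ (EFin \o g))//; apply: aeD1 fg => x _ /= ->. Qed.

Hypothesis mD : measurable D.

Lemma aem_mfun f : measurable_fun D f -> aem f.
Proof. by move=> mf; exists f => //; exact: aeD_all. Qed.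

Lemma aei_int f : mu.-integrable D (EFin \o f) -> aei f.
Proof. by move=> mf; exists f => //; exact: aeD_all. Qed.

Lemma aei_aem f : aei f -> aem f.
Proof. by move=> [g /integrableP[/measurable_EFinP mg _] fg]; exists g. Qed.

Lemma aem_ae f g : aeD (fun x => f x = g x) -> aem f -> aem g.
Proof. by move=> fg [h mh fh]; exists h => //; apply: aeD2 fg fh => x _ <-. Qed.

Lemma aei_ae f g : aeD (fun x => f x = g x) -> aei f -> aei g.
Proof. by move=> fg [h mh fh]; exists h => //; apply: aeD2 fg fh => x _ <-. Qed.

Lemma aem_cst (k : R) : aem (fun=> k).
Proof. by apply: aem_mfun; exact: measurable_cst. Qed.

Lemma aemD f g : aem f -> aem g -> aem (fun x => f x + g x).
Proof.
move=> [f' mf ff] [g' mg gg]; exists (f' \+ g'); first exact: measurable_funD.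
by apply: aeD2 ff gg => x _ -> ->.
Qed.

Lemma aemM f g : aem f -> aem g -> aem (fun x => f x * g x).
Proof.
move=> [f' mf ff] [g' mg gg]; exists (f' \* g'); first exact: measurable_funM.
by apply: aeD2 ff gg => x _ -> ->.
Qed.

Lemma aemZ (k : R) f : aem f -> aem (fun x => k * f x).
Proof. by move=> mf; apply: aemM => //; exact: aem_cst. Qed.

Lemma aemN f : aem f -> aem (fun x => - f x).
Proof. by move=> /(aemZ (-1)); apply: aem_ae; apply: aeD_all => x _; rewrite mulN1r. Qed.

Lemma aemB f g : aem f -> aem g -> aem (fun x => f x - g x).
Proof. by move=> mf /aemN mg; exact: aemD. Qed.

Lemma aem_norm f : aem f -> aem (fun x => `|f x|).
Proof.
move=> [f' mf ff]; exists (Num.norm \o f'); first exact: measurableT_comp.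
by apply: aeD1 ff => x _ /= ->.
Qed.

Lemma aei_dom f g : aem f -> aei g -> aeD (fun x => `|f x| <= g x) -> aei f.
Proof.
move=> [f' mf ff] [g' ig gg] fg.
(* The bound by [g] holds only almost everywhere; putting 0 where it fails gives a measurable
   representative that is dominated everywhere. *)
pose b x := (`|f' x| <= `|g' x|).
exists (fun x => if b x then f' x else 0); last first.
  have h := aeD2 (fun x _ a b => conj a b) ff gg.
  apply: aeD2 h fg => x Dx [fx gx]; rewrite fx gx => le.
  by rewrite /b (le_trans le)// ler_norm.
have mg : measurable_fun D g' by have /integrableP[/measurable_EFinP] := ig.
apply: le_integrable ig => //.
  have mb : measurable_fun D b by apply: measurable_fun_ler; exact: measurableT_comp.
  apply/measurable_EFinP; apply: measurable_fun_if => //.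
  by apply: measurable_funS mf => // x [].
move=> x Dx /=; rewrite lee_fin; case: ifPn => //; by rewrite normr0.
Qed.

Lemma aei0 : aei (fun=> 0).
Proof. by apply: aei_int; exact: integrable0. Qed.

Lemma aeiD f g : aei f -> aei g -> aei (fun x => f x + g x).
Proof.
move=> [f' mf ff] [g' mg gg]; exists (f' \+ g').
  by have := integrableD mD mf mg; apply: eq_integrable.
by apply: aeD2 ff gg => x _ -> ->.
Qed.

Lemma aeiZ (k : R) f : aei f -> aei (fun x => k * f x).
Proof.
move=> [f' mf ff]; exists (fun x => k * f' x).
  by have := integrableZl mD k mf; apply: eq_integrable.
by apply: aeD1 ff => x _ ->.
Qed.

Lemma aeiN f : aei f -> aei (fun x => - f x).
Proof. by move=> /(aeiZ (-1)); apply: aei_ae; apply: aeD_all => x _; rewrite mulN1r. Qed.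

Lemma aeiB f g : aei f -> aei g -> aei (fun x => f x - g x).
Proof. by move=> mf /aeiN mg; exact: aeiD. Qed.

Lemma aei_norm f : aei f -> aei (fun x => `|f x|).
Proof.
move=> [f' mf ff]; exists (Num.norm \o f'); first exact: integrable_norm.
by apply: aeD1 ff => x _ /= ->.
Qed.

Lemma RintD f g : aei f -> aei g -> I (fun x => f x + g x) = I f + I g.
Proof.
move=> [f' mf ff] [g' mg gg]; rewrite (Rint_ae ff) (Rint_ae gg) -RintegralD//.
by apply: Rint_ae; apply: aeD2 ff gg => x _ -> ->.
Qed.

Lemma RintZ (k : R) f : aei f -> I (fun x => k * f x) = k * I f.
Proof.
move=> [f' mf ff]; rewrite (Rint_ae ff) -RintegralZl//.
by apply: Rint_ae; apply: aeD1 ff => x _ ->.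
Qed.

Lemma RintN f : aei f -> I (fun x => - f x) = - I f.
Proof.
by move=> mf; rewrite -mulN1r -RintZ//; congr Rintegral; apply/funext => x; rewrite mulN1r.
Qed.

Lemma RintB f g : aei f -> aei g -> I (fun x => f x - g x) = I f - I g.
Proof. by move=> mf mg; rewrite RintD// ?RintN//; exact: aeiN. Qed.

Lemma Rint_ge0 f : aeD (fun x => 0 <= f x) -> 0 <= I f.
Proof.
move=> f0; rewrite (@Rint_ae _ (fun x => Num.max (f x) 0)); last first.
  by apply: aeD1 f0 => x _ /max_idPl.
by apply: Rintegral_ge0 => x _; rewrite le_max lexx orbT.
Qed.

Lemma Rint_le f g : aei f -> aei g -> aeD (fun x => f x <= g x) -> I f <= I g.
Proof.
move=> mf mg fg; rewrite -subr_ge0 -RintB//; apply: Rint_ge0.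
by apply: aeD1 fg => x _; rewrite subr_ge0.
Qed.

Lemma Rint_norm f : aei f -> `|I f| <= I (fun x => `|f x|).
Proof.
move=> mf; rewrite ler_norml -RintN; last exact: aei_norm.
apply/andP; split; apply: Rint_le => //; do ?[exact: aei_norm|apply: aeiN; exact: aei_norm].
  by apply: aeD_all => x _; rewrite lerNl -normrN ler_norm.
by apply: aeD_all => x _; exact: ler_norm.
Qed.

Lemma Rint_eq0 f : aei f -> aeD (fun x => 0 <= f x) -> I f = 0 -> aeD (fun x => f x = 0).
Proof.
move=> [g ig fg] f0; rewrite (Rint_ae fg) => If0.
have /integrableP[mg goo] := ig.
have g0 : aeD (fun x => 0 <= g x) by apply: aeD2 fg f0 => x _ <-.
have E : (\int[mu]_(x in D) `|(g x)%:E| = 0)%E.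
  have -> : (\int[mu]_(x in D) `|(g x)%:E| = \int[mu]_(x in D) (g x)%:E)%E.
    by apply: integral_ae; apply: aeD1 g0 => x _ gx; rewrite gee0_abs.
  move: If0; rewrite /Rintegral => If0.
  rewrite -[LHS]fineK ?If0//; exact: integrable_fin_num.
have /(ae_eq_integral_abs _ mD mg) h := E.
apply: aeD2 fg h => x _ -> [] //.
Qed.

End ae_integral.

Lemma normr_sqrE (R : realDomainType) (x : R) : `|x| ^+ 2 = x ^+ 2.
Proof. by rewrite real_normK ?num_real. Qed.

(** The discriminant argument, asking of [b] only its expansion along lines inside [P]. It serves
    [ip] on square-integrable functions, and later [qform] on functions that vanish off a set, where
    the form is merely semidefinite. *)
Lemma psd_cauchy_schwarz (R : realType) (V : lmodType R) (P : V -> Prop) (b : V -> V -> R) :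
  (forall x y t, P x -> P y -> P (x + t *: y)) ->
  (forall x, P x -> 0 <= b x x) ->
  (forall x y t, P x -> P y ->
     b (x + t *: y) (x + t *: y) = b x x + 2 * t * b x y + t ^+ 2 * b y y) ->
  forall x y, P x -> P y -> b x y ^+ 2 <= b x x * b y y.
Proof.
move=> PD b0 bq x y Px Py.
have h t : 0 <= b x x + 2 * t * b x y + t ^+ 2 * b y y by rewrite -bq//; exact/b0/PD.
have byy := b0 _ Py; have bxx := b0 _ Px.
have [y0|y0] := eqVneq (b y y) 0.
  rewrite y0 mulr0; have [->|xy0] := eqVneq (b x y) 0; first by rewrite expr0n.
  (* When [b y y = 0] the expansion is affine in [t], and this [t] gives it the value -1. *)
  have := h (- (b x x + 1) / (2 * b x y)).
  rewrite y0 mulr0 addr0.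
  have -> : 2 * (- (b x x + 1) / (2 * b x y)) * b x y = - (b x x + 1).
    by field.
  by lra.
have := h (- b x y / b y y).
have -> : b x x + 2 * (- b x y / b y y) * b x y + (- b x y / b y y) ^+ 2 * b y y =
  b x x - b x y ^+ 2 / b y y by field.
by rewrite subr_ge0 ler_pdivrMr// lt_neqAle eq_sym y0.
Qed.

(** * The seminormed space of square-integrable functions *)

Section L2.
Context d (T : measurableType d) (R : realType).
Context (mu : {measure set T -> \bar R}) (D : set T) (mD : measurable D).
Implicit Types (f g h : T -> R).
Local Notation I := (Rintegral mu D).
Local Notation aeD := (aeD mu D).
Local Notation aei := (aei mu D).
Local Notation aem := (aem mu D).

(** Measurability of [f] itself is kept, so that this agrees with [Lp] at exponent 2. *)
Definition L2 f := measurable_fun D f /\ aei (fun x => f x ^+ 2).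
Definition ip f g := I (fun x => f x * g x).
Definition n2 f := Num.sqrt (ip f f).

Lemma L2_aem f : L2 f -> aem f. Proof. by case=> mf _; exact: aem_mfun. Qed.

Lemma L2M f g : L2 f -> L2 g -> aei (fun x => f x * g x).
Proof.
move=> f2 g2; apply: (aei_dom mD (g := fun x => f x ^+ 2 + g x ^+ 2)).
- by apply: aemM; exact: L2_aem.
- by apply: aeiD => //; [case: f2|case: g2].
apply: aeD_all => x _; rewrite normrM.
rewrite -[f x ^+ 2]normr_sqrE -[g x ^+ 2]normr_sqrE.
by have := sqr_ge0 (`|f x| - `|g x|); have := normr_ge0 (f x); have := normr_ge0 (g x); nra.
Qed.

Lemma L2_lin f g t : L2 f -> L2 g -> L2 (fun x => f x + t * g x).
Proof.
move=> f2 g2; split.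
  apply: measurable_funD; first by case: f2.
  by apply: measurable_funM => //; case: g2.
apply: (@aei_ae _ _ _ _ _ (fun x => f x ^+ 2 + ((2 * t) * (f x * g x) + t ^+ 2 * g x ^+ 2))).
  by apply: aeD_all => x _; ring.
apply: aeiD => //; first by case: f2.
by apply: aeiD => //; apply: aeiZ => //; [exact: L2M|case: g2].
Qed.

Lemma L2_0 : L2 (fun=> 0).
Proof.
split; first exact: measurable_cst.
by have := @aei0 _ _ _ mu D; apply: aei_ae; apply: aeD_all => x _; rewrite expr0n.
Qed.

Lemma L2_eq f g : (forall x, D x -> f x = g x) -> L2 f -> L2 g.
Proof.
move=> fg [mf fi]; split.
  by apply: eq_measurable_fun mf => x; rewrite inE => /fg.
by apply: aei_ae fi; apply: aeD_all => x Dx; rewrite fg.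
Qed.

Lemma L2Z t f : L2 f -> L2 (fun x => t * f x).
Proof.
move=> f2; apply: L2_eq (L2_lin t L2_0 f2) => x _; by rewrite add0r.
Qed.

Lemma L2D f g : L2 f -> L2 g -> L2 (fun x => f x + g x).
Proof. by move=> f2 g2; apply: L2_eq (L2_lin 1 f2 g2) => x _; rewrite mul1r. Qed.

Lemma L2B f g : L2 f -> L2 g -> L2 (fun x => f x - g x).
Proof. by move=> f2 g2; apply: L2_eq (L2_lin (-1) f2 g2) => x _; rewrite mulN1r. Qed.

Lemma L2_dom f g : measurable_fun D f -> L2 g -> aeD (fun x => `|f x| <= `|g x|) -> L2 f.
Proof.
move=> mf [mg gi] fg; split => //; apply: (aei_dom mD _ gi).
  by apply: aem_mfun; exact: measurable_funX.
by apply: aeD1 fg => x _ fg; rewrite ger0_norm ?sqr_ge0// -normr_sqrE -[leRHS]normr_sqrE lerXn2r ?nnegrE.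
Qed.

Lemma L2_patch f E : measurable E -> L2 f -> L2 (f \_ E).
Proof.
move=> mE f2; apply: (L2_dom _ f2).
  have -> : f \_ E = (fun x => \1_E x * f x).
    by apply/funext => x; rewrite patchE indicE; case: ifPn => _; rewrite ?mul1r ?mul0r.
  by apply: measurable_funM; [exact: measurable_indic|case: f2].
by apply: aeD_all => x _; rewrite patchE; case: ifPn => //; rewrite normr0.
Qed.

Lemma ipC f g : ip f g = ip g f.
Proof. by rewrite /ip; congr Rintegral; apply/funext => x; rewrite mulrC. Qed.

Lemma ip_ae f g f' g' : aeD (fun x => f x = f' x) -> aeD (fun x => g x = g' x) ->
  ip f g = ip f' g'.
Proof. by move=> ff gg; apply: Rint_ae; apply: aeD2 ff gg => x _ -> ->. Qed.

Lemma ip_linl f g h t : L2 f -> L2 g -> L2 h ->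
  ip (fun x => f x + t * g x) h = ip f h + t * ip g h.
Proof.
move=> f2 g2 h2; rewrite /ip -RintZ//; last exact: L2M.
rewrite -RintD//; [|exact: L2M|apply: aeiZ => //; exact: L2M].
by congr Rintegral; apply/funext => x; rewrite mulrDl mulrA.
Qed.

Lemma ip_linr f g h t : L2 f -> L2 g -> L2 h ->
  ip h (fun x => f x + t * g x) = ip h f + t * ip h g.
Proof. by move=> f2 g2 h2; rewrite ipC ip_linl// !(ipC h). Qed.

Lemma ipBl f g h : L2 f -> L2 g -> L2 h -> ip (fun x => f x - g x) h = ip f h - ip g h.
Proof.
move=> f2 g2 h2; rewrite -[ip g h]mul1r -mulNr -ip_linl//.
by congr ip; apply/funext => x; rewrite mulN1r.
Qed.

Lemma ipZl f h t : L2 f -> L2 h -> ip (fun x => t * f x) h = t * ip f h.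
Proof.
move=> f2 h2; rewrite /ip -RintZ//; last exact: L2M.
by congr Rintegral; apply/funext => x; rewrite mulrA.
Qed.

Lemma ip_ge0 f : 0 <= ip f f.
Proof. by apply: Rint_ge0; apply: aeD_all => x _; exact: sqr_ge0. Qed.

Lemma n2_ge0 f : 0 <= n2 f. Proof. exact: sqrtr_ge0. Qed.

Lemma n2_sqr f : n2 f ^+ 2 = ip f f. Proof. by rewrite sqr_sqrtr// ip_ge0. Qed.

Lemma ip_sqr f g t : L2 f -> L2 g ->
  ip (fun x => f x + t * g x) (fun x => f x + t * g x) =
  ip f f + 2 * t * ip f g + t ^+ 2 * ip g g.
Proof.
move=> f2 g2; rewrite ip_linl ?ip_linr// ?(ipC g f); [ring|exact: L2_lin].
Qed.

Lemma ip_cauchy_schwarz f g : L2 f -> L2 g -> `|ip f g| <= n2 f * n2 g.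
Proof.
move=> f2 g2; rewrite -(@ler_pXn2r _ 2)// ?nnegrE ?mulr_ge0 ?n2_ge0//.
rewrite exprMn !n2_sqr normr_sqrE.
apply: (@psd_cauchy_schwarz _ (T -> R^o) L2 ip) => //.
- by move=> x y t; exact: L2_lin.
- by move=> x _; exact: ip_ge0.
- by move=> x y t; exact: ip_sqr.
Qed.

Lemma n2_ae f g : aeD (fun x => f x = g x) -> n2 f = n2 g.
Proof. by move=> fg; rewrite /n2 (ip_ae fg fg). Qed.

Lemma n2Z t f : L2 f -> n2 (fun x => t * f x) = `|t| * n2 f.
Proof.
move=> f2; have f2' := L2Z t f2; rewrite /n2 ipZl// (ipC f) ipZl//.
by rewrite mulrA -expr2 sqrtrM ?sqr_ge0// sqrtr_sqr.
Qed.

Lemma n2_tri f g : L2 f -> L2 g -> n2 (fun x => f x + g x) <= n2 f + n2 g.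
Proof.
move=> f2 g2; rewrite -(@ler_pXn2r _ 2)// ?nnegrE ?addr_ge0 ?n2_ge0//.
have -> : (fun x => f x + g x) = (fun x => f x + 1 * g x) by apply/funext => x; rewrite mul1r.
rewrite n2_sqr ip_sqr// sqrrD !n2_sqr.
have := ip_cauchy_schwarz f2 g2; have := ler_norm (ip f g).
by rewrite mulr2n; lra.
Qed.

Lemma n2_triB f g : L2 f -> L2 g -> n2 (fun x => f x - g x) <= n2 f + n2 g.
Proof.
move=> f2 g2; have -> : (fun x => f x - g x) = (fun x => f x + (-1) * g x).
  by apply/funext => x; rewrite mulN1r.
apply: (le_trans (n2_tri f2 (L2Z (-1) g2))).
by rewrite n2Z// normrN1 mul1r.
Qed.

Lemma n2_eq0 f : L2 f -> n2 f = 0 -> aeD (fun x => f x = 0).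
Proof.
move=> f2 /eqP; rewrite sqrtr_eq0 => f0.
have : aeD (fun x => f x ^+ 2 = 0).
  apply: (Rint_eq0 mD); [by case: f2| |].
    by apply: aeD_all => x _; exact: sqr_ge0.
  by apply/eqP; rewrite eq_le -[X in X <= _]/(ip f f) f0 -[X in _ <= X]/(ip f f) ip_ge0.
by apply: aeD1 => x _ /eqP; rewrite sqrf_eq0 => /eqP.
Qed.

Lemma n2_le f g : L2 f -> L2 g -> aeD (fun x => `|f x| <= `|g x|) -> n2 f <= n2 g.
Proof.
move=> f2 g2 fg; rewrite ler_wsqrtr//; apply: Rint_le => //; [exact: L2M|exact: L2M|].
by apply: aeD1 fg => x _ fg; rewrite -!expr2 -normr_sqrE -[leRHS]normr_sqrE lerXn2r ?nnegrE.
Qed.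

End L2.

(** * Compact perturbations of a multiple of the identity *)

Lemma natSinv_small (R : realType) (e : R) : 0 < e ->
  exists N, forall n, (N <= n)%N -> n.+1%:R^-1 < e.
Proof.
move=> e0; have [N _ h] := near_infty_natSinv_lt (PosNum e0).
by exists N => n Nn; exact: h.
Qed.

Lemma expr_small (R : realType) (z c e : R) : 0 <= z < 1 -> 0 < e ->
  exists N, forall n, (N <= n)%N -> c * z ^+ n <= e.
Proof.
move=> /andP[z0 z1] e0.
have : geometric c z @ \oo --> (0 : R) by apply: cvg_geometric; rewrite ger0_norm.
move=> /cvgrPdist_le/(_ _ e0) [N _ h]; exists N => n Nn.
by have := h n Nn; rewrite /= sub0r normrN; apply: le_trans; exact: ler_norm.
Qed.

Section finite_L2.
Context d (T : measurableType d) (R : realType).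
Context (mu : {measure set T -> \bar R}) (D : set T) (mD : measurable D).
Hypothesis Dfin : (mu D < +oo)%E.
Implicit Types (f g h v k : T -> R) (E : set T).
Local Notation L2 := (L2 mu D).
Local Notation ip := (ip mu D).
Local Notation n2 := (n2 mu D).
Local Notation aeD := (aeD mu D).

Definition vanishes_off E f := forall x, ~ E x -> f x = 0.

Lemma patch_off E f : vanishes_off E (f \_ E).
Proof. by move=> x nE; rewrite patchE memNset. Qed.

Lemma patch_on E f x : E x -> (f \_ E) x = f x.
Proof. by move=> Ex; rewrite patchE mem_set. Qed.

Lemma vanishes_patch E f : vanishes_off E f -> f \_ E = f.
Proof.
by move=> fE; apply/funext => x; rewrite patchE; case: ifPn => //; rewrite notin_setE => /fE.
Qed.

(** The [L^2] norm of the indicator of [E]: the factor that turns a uniform bound on [E] into an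
    [L^2] bound. *)
Definition msqrt E := Num.sqrt (fine (mu (D `&` E))).

Lemma msqrt_ge0 E : 0 <= msqrt E. Proof. exact: sqrtr_ge0. Qed.

Lemma mDE_fin E : measurable E -> (mu (D `&` E) < +oo)%E.
Proof.
move=> mE; apply: le_lt_trans Dfin; apply: le_measure; rewrite ?inE//; exact: measurableI.
Qed.

Lemma L2_cst (c : R) : L2 (fun=> c).
Proof.
split; first exact: measurable_cst.
apply: aei_int => //; apply/integrableP; split; first exact: measurable_cst.
by rewrite integral_cst// lte_mul_pinfty.
Qed.

Lemma L2_bounded f (M : R) : measurable_fun D f -> aeD (fun x => `|f x| <= M) -> L2 f.
Proof.
move=> mf fM; apply: (L2_dom mD mf (L2_cst M)).
by apply: aeD1 fM => x _ fM; rewrite (ger0_norm (le_trans _ fM)).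
Qed.

Lemma L2_indic E : measurable E -> L2 (\1_E : T -> R).
Proof.
move=> mE; apply: (@L2_bounded _ 1); first exact: measurable_indic.
by apply: aeD_all => x _; rewrite indicE; case: (x \in E); rewrite ?normr1 ?normr0.
Qed.

Lemma n2_bounded f (M : R) E : measurable E -> L2 f -> 0 <= M -> aeD (fun x => `|f x| <= M) ->
  aeD (fun x => ~ E x -> f x = 0) -> n2 f <= M * msqrt E.
Proof.
move=> mE f2 M0 fM fE.
have -> : M * msqrt E = n2 (fun x => M * \1_E x).
  have E2 := L2_indic mE.
  rewrite n2Z// ger0_norm//; congr (_ * Num.sqrt (fine _)).
  rewrite setIC -integral_indic//; apply: eq_integral => x _.
  by rewrite indicE; case: (x \in E); rewrite ?mulr1 ?mulr0.
apply: n2_le => //.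
  by apply: L2Z => //; exact: L2_indic.
apply: aeD2 fM fE => x _ fM fE; rewrite indicE.
case: (boolP (x \in E)) => [_|]; first by rewrite mulr1 [leRHS]ger0_norm.
by rewrite notin_setE => /fE ->; rewrite normr0.
Qed.

Lemma n2_boundedT f (M : R) : L2 f -> 0 <= M -> aeD (fun x => `|f x| <= M) -> n2 f <= M * msqrt setT.
Proof. by move=> f2 M0 fM; apply: n2_bounded => //; apply: aeD_all => x _ /(_ Logic.I). Qed.

(** The form in which small sets are exploited: [f] matters only where [g] may be nonzero, and there
    its uniform bound costs [msqrt E]. *)
Lemma ip_bounded f g (M : R) E : measurable E -> L2 f -> L2 g -> 0 <= M ->
  aeD (fun x => `|f x| <= M) -> vanishes_off E g -> `|ip f g| <= M * msqrt E * n2 g.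
Proof.
move=> mE f2 g2 M0 fM gE.
have -> : ip f g = ip (f \_ E) g.
  congr Rintegral; apply/funext => x; rewrite patchE; case: ifPn => //.
  by rewrite notin_setE => /gE ->; rewrite !mulr0.
have fE2 : L2 (f \_ E) by exact: L2_patch.
apply: (le_trans (ip_cauchy_schwarz mD fE2 g2)); apply: ler_wpM2r; first exact: n2_ge0.
apply: n2_bounded => //; last by apply: aeD_all => x _; exact: patch_off.
by apply: aeD1 fM => x _ fM; rewrite patchE; case: ifP => //; rewrite normr0.
Qed.

(* csa_cluster asks for a uniform cluster point outside the range of K, so that no
   completeness of L^2 is needed *)
Record compact_selfadjoint (K : (T -> R) -> T -> R) (C : R) : Prop := {
  csa_ge0 : 0 <= C ;
  csa_lin : forall f g t, L2 f -> L2 g -> forall x, D x ->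
    K (fun x => f x + t * g x) x = K f x + t * K g x ;
  csa_meas : forall f, L2 f -> measurable_fun D (K f) ;
  csa_bound : forall f, L2 f -> forall x, D x -> `|K f x| <= C * n2 f ;
  csa_sym : forall f g, L2 f -> L2 g -> ip (K f) g = ip f (K g) ;
  csa_cluster : forall (v : nat -> T -> R) (M : R), (forall n, L2 (v n)) -> (forall n, n2 (v n) <= M) ->
    exists k : T -> R, forall e : R, 0 < e -> forall N, exists2 n, (N <= n)%N &
      forall x, D x -> `|K (v n) x - k x| <= e }.

Section operator.
Context (nu : R) (nu0 : 0 < nu) (K : (T -> R) -> T -> R) (C : R).
Hypothesis HK : compact_selfadjoint K C.
Context (E : set T) (mE : measurable E).

Lemma csa_L2 f : L2 f -> L2 (K f).
Proof.
move=> f2; apply: (@L2_bounded _ (C * n2 f)); first exact: (csa_meas HK).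
by apply: aeD_all => x Dx; exact: (csa_bound HK).
Qed.

Definition qform f g := nu * ip f g - ip (K f) g.
Definition opS f x := nu * f x - K f x.

Lemma opS_L2 f : L2 f -> L2 (opS f).
Proof. by move=> f2; apply: L2B => //; [exact: L2Z|exact: csa_L2]. Qed.

Lemma opS_lin f g t : L2 f -> L2 g -> forall x, D x ->
  opS (fun x => f x + t * g x) x = opS f x + t * opS g x.
Proof. by move=> f2 g2 x Dx; rewrite /opS (csa_lin HK)//; ring. Qed.

Lemma qformE f g : L2 f -> L2 g -> qform f g = ip (opS f) g.
Proof. by move=> f2 g2; rewrite /qform /opS ipBl ?ipZl//; [exact: L2Z|exact: csa_L2]. Qed.

Lemma qformC f g : L2 f -> L2 g -> qform f g = qform g f.
Proof. by move=> f2 g2; rewrite /qform (csa_sym HK)// (ipC _ _ f g) (ipC _ _ f (K g)). Qed.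

Lemma qform_patch f g : L2 f -> L2 g -> vanishes_off E g -> qform f g = ip (opS f \_ E) g.
Proof.
move=> f2 g2 gE; rewrite qformE//; congr Rintegral; apply/funext => x; rewrite patchE.
by case: ifPn => //; rewrite notin_setE => /gE ->; rewrite !mulr0.
Qed.

Lemma qform_sqr f g t : L2 f -> L2 g ->
  qform (fun x => f x + t * g x) (fun x => f x + t * g x) =
  qform f f + 2 * t * qform f g + t ^+ 2 * qform g g.
Proof.
move=> f2 g2; have fg2 := L2_lin mD t f2 g2.
have e h : L2 h -> qform (fun x => f x + t * g x) h = qform f h + t * qform g h.
  move=> h2; rewrite !qformE// -ip_linl//; try exact: opS_L2.
  by apply: ip_ae; apply: aeD_all => x Dx //; rewrite opS_lin.
rewrite e// (qformC f2 fg2) (qformC g2 fg2) !e// (qformC g2 f2); ring.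
Qed.

Definition qbound := nu + C * msqrt setT.

Lemma qbound_gt0 : 0 < qbound.
Proof. by rewrite ltr_wpDr// mulr_ge0 ?msqrt_ge0// (csa_ge0 HK). Qed.

Lemma qform_bound f g : L2 f -> L2 g -> `|qform f g| <= qbound * n2 f * n2 g.
Proof.
move=> f2 g2; apply: (le_trans (ler_normB _ _)).
rewrite /qbound !mulrDl; apply: lerD.
  by rewrite normrM gtr0_norm// -mulrA ler_pM2l//; exact: ip_cauchy_schwarz.
have -> : C * msqrt setT * n2 f * n2 g = C * n2 f * msqrt setT * n2 g by ring.
apply: ip_bounded => //.
- exact: csa_L2.
- by rewrite mulr_ge0 ?n2_ge0// (csa_ge0 HK).
- by apply: aeD_all => x Dx; exact: (csa_bound HK).
- by move=> x /(_ Logic.I).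
Qed.

(** Approximate solutions on [E] yield an exact one. Since [v n] is [(K (v n) + opS (v n)) / nu],
    where the second term approaches [h] on [E] and the first has a uniform cluster point [k], the
    only candidate is [(k + h) / nu] on [E]. *)
Lemma cluster_solution (v : nat -> T -> R) h (M : R) :
  (forall n, L2 (v n)) -> (forall n, vanishes_off E (v n)) -> (forall n, n2 (v n) <= M) ->
  L2 h ->
  (forall e : R, 0 < e -> exists N, forall n, (N <= n)%N ->
     n2 ((fun x => opS (v n) x - h x) \_ E) <= e) ->
  exists f, [/\ L2 f, vanishes_off E f,
    forall e : R, 0 < e -> forall N, exists2 n, (N <= n)%N & n2 (fun x => f x - v n x) <= e &
    forall x, D x -> E x -> opS f x = h x].
Proof.
move=> v2 vE vM h2 res.
have [k hk] := csa_cluster HK v2 vM.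
have mk : measurable_fun D k.
  (* Indices with errors 1/(j+1) exhibit [k] as a pointwise limit of measurable functions. *)
  have [n hn] := choice (fun j : nat => let: ex_intro2 n _ h := hk (j.+1%:R^-1) ltac:(by []) 0%N
    in ex_intro (fun n => forall x, D x -> `|K (v n) x - k x| <= j.+1%:R^-1) n h).
  apply: (@measurable_fun_cvg _ _ _ D (fun j => K (v (n j)))).
    by move=> j; exact: (csa_meas HK).
  move=> x Dx; apply/cvgrPdist_lt => e e0.
  have [N hN] := natSinv_small e0; exists N => // j /= Nj.
  by rewrite distrC; apply: le_lt_trans (hn j x Dx) (hN _ Nj).
have k2 : L2 k.
  have [n _ hn] := hk 1 ltr01 0%N.
  apply: (@L2_bounded k (C * M + 1)) => //; apply: aeD_all => x Dx.
  have := hn x Dx; have := csa_bound HK (v2 n) Dx.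
  have : C * n2 (v n) <= C * M by apply: ler_wpM2l => //; exact: (csa_ge0 HK).
  have := ler_normB (K (v n) x) (K (v n) x - k x).
  by rewrite opprB addrC subrK; lra.
pose f := (fun x => nu^-1 * (k x + h x)) \_ E.
have f2 : L2 f by apply: L2_patch => //; apply: L2Z => //; exact: L2D.
have fE : vanishes_off E f by exact: patch_off.
have s0 := msqrt_ge0 setT.
have approx (e : R) : 0 < e -> forall N, exists2 n, (N <= n)%N &
    n2 (fun x => f x - v n x) <= e /\ forall x, D x -> `|K (v n) x - k x| <= e.
  move=> e0 N.
  have en0 : 0 < nu * e / 2 by rewrite divr_gt0// mulr_gt0.
  have [N' hN'] := res _ en0.
  (* The uniform error on [K (v n)] enters the [L^2] norm with the factor [msqrt setT], which may be
     0, hence the [+ 1]. The other half of [e] is spent on the residual. *)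
  have e1 : 0 < nu * e / (2 * (msqrt setT + 1)).
    by rewrite divr_gt0 ?mulr_gt0// ltr_wpDl.
  have e3 : 0 < Num.min e (nu * e / (2 * (msqrt setT + 1))) by rewrite lt_min e0.
  have [n Nn hn'] := hk _ e3 (maxn N N').
  have hn x : D x -> `|K (v n) x - k x| <= nu * e / (2 * (msqrt setT + 1)).
    by move=> /hn' /le_trans; apply; rewrite ge_min lexx orbT.
  exists n; first by apply: leq_trans Nn; rewrite leq_maxl.
  split; last by move=> x /hn' /le_trans; apply; rewrite ge_min lexx.
  have rn := hN' n (leq_trans (leq_maxr _ _) Nn).
  pose a := (fun x => nu^-1 * (k x - K (v n) x)) \_ E.
  pose b := fun x => nu^-1 * ((fun x => opS (v n) x - h x) \_ E) x.
  have r2 : L2 ((fun x => opS (v n) x - h x) \_ E).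
    by apply: L2_patch => //; apply: L2B => //; exact: opS_L2.
  have a2 : L2 a by apply: L2_patch => //; apply: L2Z => //; apply: L2B => //; exact: csa_L2.
  have b2 : L2 b by exact: L2Z.
  have -> : (fun x => f x - v n x) = (fun x => a x - b x).
    apply/funext => x; rewrite /f /a /b; have [Ex|nEx] := pselect (E x).
      by rewrite !patch_on// /opS; field; rewrite gt_eqF.
    by rewrite !patch_off// vE// mulr0.
  apply: (le_trans (n2_triB mD a2 b2)).
  have bb : n2 b <= e / 2.
    rewrite /b n2Z// gtr0_norm ?invr_gt0// mulrC ler_pdivrMr//.
    by have -> : e / 2 * nu = nu * e / 2 by field.
  have aa : n2 a <= (e / (2 * (msqrt setT + 1))) * msqrt setT.
    apply: n2_boundedT => //; first by rewrite divr_ge0 ?mulr_ge0 ?addr_ge0// ltW.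
    apply: aeD_all => x Dx; rewrite /a patchE; case: ifP => _; last first.
      by rewrite normr0 divr_ge0 ?mulr_ge0 ?addr_ge0// ltW.
    rewrite normrM gtr0_norm ?invr_gt0// mulrC ler_pdivrMr// distrC.
    rewrite (_ : _ * nu = nu * e / (2 * (msqrt setT + 1))) ?hn//.
    by field; rewrite gt_eqF// ltr_wpDl.
  have cc : (e / (2 * (msqrt setT + 1))) * msqrt setT <= e / 2.
    rewrite mulrAC ler_pdivrMr ?mulr_gt0 ?ltr_wpDl//.
    have -> : e / 2 * (2 * (msqrt setT + 1)) = e * (msqrt setT + 1) by field.
    by rewrite ler_pM2l// lerDl.
  by lra.
exists f; split => //.
  by move=> e e0 N; have [n Nn [? _]] := approx e e0 N; exists n.
move=> x Dx Ex.
(* [K f] is close to [K (v n)] because [f] is close to [v n] in [L^2], and [K (v n)] is close to [k]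
   for the same indices; the shares of [e] are weighted by [C] and 1. *)
have Kf : K f x = k x.
  have C0 := csa_ge0 HK.
  apply/eqP; rewrite -subr_eq0 -normr_le0; apply/ler_addgt0Pl => e e0; rewrite addr0.
  have [|n _ [hn hk']] := approx (e / (C + 1)) _ 0%N; first by rewrite divr_gt0// ltr_wpDl.
  have := csa_bound HK (L2_lin mD (-1) f2 (v2 n)) Dx.
  rewrite (csa_lin HK)// mulN1r.
  rewrite (_ : (fun y => f y + -1 * v n y) = (fun y => f y - v n y)); last first.
    by apply/funext => y; rewrite mulN1r.
  have Ce : C * n2 (fun y => f y - v n y) <= C * (e / (C + 1)) by exact: ler_wpM2l.
  have -> : e = C * (e / (C + 1)) + e / (C + 1) by field; rewrite gt_eqF// ltr_wpDl.
  have := hk' x Dx; have := ler_normD (K f x - K (v n) x) (K (v n) x - k x).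
  by rewrite addrA subrK; lra.
by rewrite /opS Kf /f patch_on//; field; rewrite gt_eqF.
Qed.

Definition coercive_on (gam : R) (E' : set T) := forall f, L2 f -> vanishes_off E' f ->
  gam * n2 f ^+ 2 <= qform f f.

Lemma qform0 f : L2 f -> n2 f = 0 -> qform f f = 0.
Proof.
move=> f2 f0; have := qform_bound f2 f2; rewrite f0 !mulr0.
by rewrite normr_le0 => /eqP.
Qed.

(** By contradiction: normalized functions on which the form is at most 1/(n+1) have small
    residuals, so [cluster_solution] with right-hand side 0 gives a function that is not null and on
    which the form vanishes. *)
Lemma coercive_of_positive :
  (forall f, L2 f -> vanishes_off E f -> n2 f != 0 -> 0 < qform f f) ->
  exists2 gam : R, 0 < gam & coercive_on gam E.
Proof.
move=> pos; apply: contrapT => nco.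
have q0 f : L2 f -> vanishes_off E f -> 0 <= qform f f.
  move=> f2 fE; have [f0|f0] := eqVneq (n2 f) 0; first by rewrite qform0.
  exact/ltW/pos.
have hv (n : nat) : exists v, [/\ L2 v, vanishes_off E v, n2 v = 1 & qform v v <= n.+1%:R^-1].
  have : ~ coercive_on (n.+1%:R^-1) E by move=> h; apply: nco; exists (n.+1%:R^-1).
  move=> /existsNP[f] /not_implyP[f2] /not_implyP[fE] /negP; rewrite -ltNge => qf.
  have f0 : 0 < n2 f.
    rewrite lt_neqAle n2_ge0 andbT eq_sym; apply/eqP => f0.
    by move: qf; rewrite f0 expr0n mulr0 qform0// ltxx.
  exists (fun x => (n2 f)^-1 * f x); split.
  - exact: L2Z.
  - by move=> x /fE ->; rewrite mulr0.
  - by rewrite n2Z// gtr0_norm ?invr_gt0// mulVf// gt_eqF.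
  have := qform_sqr (n2 f)^-1 (L2_0 mu D) f2.
  have z0 : n2 (fun=> 0) = 0.
    by rewrite /n2 /ip; under eq_Rintegral do rewrite mulr0; rewrite Rintegral_cst// mul0r sqrtr0.
  rewrite (qform0 (L2_0 mu D))//.
  have -> : qform (fun=> 0) f = 0.
    by have := qform_bound (L2_0 mu D) f2; rewrite z0 mulr0 mul0r normr_le0 => /eqP.
  rewrite mulr0 !add0r.
  rewrite (_ : (fun x => 0 + _) = (fun x => (n2 f)^-1 * f x)); last first.
    by apply/funext => x; rewrite add0r.
  move=> ->; rewrite exprVn mulrC ler_pdivrMr ?exprn_gt0//; exact: ltW.
have [v hv'] := choice hv.
have v2 n : L2 (v n) by case: (hv' n).
have vE n : vanishes_off E (v n) by case: (hv' n).
have v1 n : n2 (v n) = 1 by case: (hv' n).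
have qv n : qform (v n) (v n) <= n.+1%:R^-1 by case: (hv' n).
have B0 := qbound_gt0.
(* With [r] the residual, [|r|^2 = q(v, r)], and Cauchy-Schwarz for the semidefinite form [q] gives
   [|r|^4 <= q(v, v) q(r, r) <= q(v, v) B |r|^2], where [B] is [qbound]. *)
have resid n : n2 (opS (v n) \_ E) ^+ 2 <= qbound * n.+1%:R^-1.
  pose r := opS (v n) \_ E.
  have r2 : L2 r by apply: L2_patch => //; exact: opS_L2.
  have rE : vanishes_off E r by exact: patch_off.
  have rr : n2 r ^+ 2 = qform (v n) r by rewrite qform_patch// n2_sqr.
  have cs : qform (v n) r ^+ 2 <= qform (v n) (v n) * qform r r.
    apply: (@psd_cauchy_schwarz _ (T -> R^o) (fun f => L2 f /\ vanishes_off E f) qform) => //.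
    - move=> x y t [x2 xE] [y2 yE]; split; first exact: L2_lin.
      by move=> z nEz /=; rewrite !fctE xE// yE// scaler0 addr0.
    - by move=> x [? ?]; exact: q0.
    - by move=> x y t [x2 _] [y2 _]; exact: qform_sqr.
  have qr : qform r r <= qbound * n2 r ^+ 2.
    by rewrite expr2 mulrA; apply: le_trans (qform_bound r2 r2); exact: ler_norm.
  have [r0|r0] := eqVneq (n2 r) 0; first by rewrite -/r r0 expr0n mulr_ge0// ltW.
  have rp : 0 < n2 r ^+ 2 by rewrite exprn_gt0// lt_neqAle eq_sym r0 n2_ge0.
  rewrite -/r -(ler_pM2r rp) -expr2 {1}rr; apply: (le_trans cs).
  rewrite mulrAC mulrC; apply: ler_pM => //; exact: q0.
have vb n : n2 (v n) <= 1 by rewrite v1.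
have resv (e : R) : 0 < e -> exists N, forall n, (N <= n)%N ->
    n2 ((fun x => opS (v n) x - 0) \_ E) <= e.
  move=> e0; have e1 : 0 < e ^+ 2 / qbound by rewrite divr_gt0// exprn_gt0.
  have [N hN] := natSinv_small e1.
  exists N => n Nn.
  rewrite (_ : (fun x => opS (v n) x - 0) = opS (v n)); last by apply/funext => x; rewrite subr0.
  rewrite -(@ler_pXn2r _ 2)// ?nnegrE ?n2_ge0 ?(ltW e0)//; apply: (le_trans (resid n)).
  by rewrite mulrC -ler_pdivlMr// ltW// hN.
have [f [f2 fE fapp feq]] := cluster_solution v2 vE vb (L2_0 mu D) resv.
have : 0 < qform f f.
  apply: pos => //; apply/eqP => f0.
  (* Every [v n] has norm 1, so a function within 1/2 of one of them is not null. *)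
  have [n _] := fapp (1/2) ltac:(lra) 0%N.
  have := n2_triB mD f2 (L2B mD f2 (v2 n)).
  rewrite (_ : (fun x => f x - (f x - v n x)) = v n); last by apply/funext => x; ring.
  by rewrite v1 f0; lra.
rewrite qform_patch// (@ip_ae _ _ _ _ _ _ _ (fun=> 0) f).
- by rewrite /ip; under eq_Rintegral do rewrite mul0r; rewrite Rintegral_cst// mul0r ltxx.
- apply: aeD_all => x Dx; rewrite patchE; case: ifPn => //; rewrite inE => Ex; exact: feq.
- exact: aeD_all.
Qed.

(* The Richardson iteration makes the residual small; a cluster point of the images
   under K of the iterates then gives an exact solution. *)
Lemma coercive_solvable (gam : R) h : 0 < gam -> coercive_on gam E -> L2 h ->
  exists f, [/\ L2 f, vanishes_off E f & forall x, D x -> E x -> opS f x = h x].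
Proof.
move=> gam0 co h2.
have B0 := qbound_gt0.
pose B := qbound.
(* Ensures [g <= B], hence a nonnegative contraction factor [kap]. *)
pose g := Num.min gam B.
have g0 : 0 < g by rewrite lt_min gam0.
have gB : g <= B by rewrite ge_min lexx orbT.
have cog f : L2 f -> vanishes_off E f -> g * n2 f ^+ 2 <= qform f f.
  move=> f2 fE; apply: le_trans (co _ f2 fE); apply: ler_wpM2r; first exact: sqr_ge0.
  by rewrite ge_min lexx.
pose res f := (fun x => opS f x - h x) \_ E.
have res2 f : L2 f -> L2 (res f) by move=> f2; apply: L2_patch => //; apply: L2B => //; exact: opS_L2.
(* The minimizer of [1 - 2 tau g + tau^2 B^2], which bounds the factor gained by the squared
   residual in one step; the minimum is [kap]. *)
pose tau := g / B ^+ 2.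
pose step f x := f x - tau * res f x.
have step2 f : L2 f -> L2 (step f).
  move=> f2; have := L2_lin mD (- tau) f2 (res2 f f2).
  by apply: L2_eq => x _; rewrite mulNr.
have stepE f : vanishes_off E f -> vanishes_off E (step f).
  by move=> fE x nE; rewrite /step /res patch_off// fE// mulr0 subr0.
pose kap := 1 - g ^+ 2 / B ^+ 2.
have kap01 : 0 <= kap < 1.
  rewrite /kap subr_ge0 ler_pdivrMr ?exprn_gt0// mul1r lerXn2r ?gB ?nnegrE ?ltW//=.
  by rewrite gtrDl oppr_lt0 divr_gt0// exprn_gt0.
have contr f : L2 f -> vanishes_off E f -> n2 (res (step f)) ^+ 2 <= kap * n2 (res f) ^+ 2.
  move=> f2 fE; pose r := res f; have r2 : L2 r := res2 f f2.
  have rE : vanishes_off E r by exact: patch_off.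
  pose s := opS r \_ E; have s2 : L2 s by apply: L2_patch => //; exact: opS_L2.
  have -> : n2 (res (step f)) = n2 (fun x => r x + (- tau) * s x).
    apply: n2_ae; apply: aeD_all => x Dx.
    rewrite /r /s /res !patchE; case: ifPn => _; last by rewrite mulr0 addr0.
    have := opS_lin (- tau) f2 r2 Dx.
    rewrite (_ : (fun x => f x + - tau * r x) = step f); last first.
      by apply/funext => y; rewrite mulNr.
    by move=> ->; rewrite addrAC.
  rewrite n2_sqr ip_sqr// -!n2_sqr.
  have -> : ip r s = qform r r by rewrite ipC qform_patch.
  have sb : n2 s <= B * n2 r.
    have [s0|s0] := eqVneq (n2 s) 0; first by rewrite s0 mulr_ge0 ?n2_ge0// ltW.
    have sp : 0 < n2 s by rewrite lt_neqAle eq_sym s0 n2_ge0.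
    rewrite -(ler_pM2r sp) -expr2 n2_sqr.
    have -> : ip s s = qform r s by rewrite qform_patch//; exact: patch_off.
    by apply: le_trans (qform_bound r2 s2); exact: ler_norm.
  have sb2 : n2 s ^+ 2 <= B ^+ 2 * n2 r ^+ 2.
    by rewrite -exprMn lerXn2r ?nnegrE ?mulr_ge0 ?n2_ge0// ltW.
  have t2 : tau ^+ 2 * n2 s ^+ 2 <= tau ^+ 2 * (B ^+ 2 * n2 r ^+ 2).
    by apply: ler_wpM2l => //; exact: sqr_ge0.
  have t1 : tau * (g * n2 r ^+ 2) <= tau * qform r r.
    by apply: ler_wpM2l; [rewrite divr_ge0 ?sqr_ge0// ltW|exact: cog].
  have -> : kap * n2 (res f) ^+ 2 =
    n2 r ^+ 2 - 2 * (tau * (g * n2 r ^+ 2)) + tau ^+ 2 * (B ^+ 2 * n2 r ^+ 2).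
    by rewrite /kap /tau -/r; field; rewrite gt_eqF.
  by lra.
pose v n := iter n step (fun=> 0).
have v2 n : L2 (v n) by elim: n => [|n ih] /=; [exact: L2_0|exact: step2].
have vE n : vanishes_off E (v n) by elim: n => [|n ih] //=; exact: stepE.
pose r0 := n2 (res (v 0%N)) ^+ 2.
have rn n : n2 (res (v n)) ^+ 2 <= r0 * kap ^+ n.
  elim: n => [|n ih]; first by rewrite expr0 mulr1.
  apply: (le_trans (contr _ (v2 n) (vE n))).
  have -> : r0 * kap ^+ n.+1 = kap * (r0 * kap ^+ n) by rewrite exprS; ring.
  by apply: ler_wpM2l => //; case/andP: kap01.
have rn0 n : n2 (res (v n)) <= n2 (res (v 0%N)).
  rewrite -(@ler_pXn2r _ 2)// ?nnegrE ?n2_ge0//; apply: (le_trans (rn n)).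
  rewrite -[leRHS]mulr1; apply: ler_wpM2l; first exact: sqr_ge0.
  by case/andP: kap01 => k0 k1; rewrite exprn_ile1// ltW.
(* Coercivity bounds the iterates: [g |v|^2 <= q(v, v)], and [q(v, v)] is the pairing of [v] with
   the residual plus [h] on [E]. *)
have vb n : n2 (v n) <= (n2 (res (v 0%N)) + n2 (h \_ E)) / g.
  have [v0|v0] := eqVneq (n2 (v n)) 0.
    by rewrite v0 divr_ge0 ?addr_ge0 ?n2_ge0// ltW.
  have vp : 0 < n2 (v n) by rewrite lt_neqAle eq_sym v0 n2_ge0.
  rewrite ler_pdivlMr// mulrC -(ler_pM2r vp) -mulrA -expr2.
  apply: (le_trans (cog _ (v2 n) (vE n))); rewrite qform_patch//.
  have hE2 : L2 (h \_ E) by exact: L2_patch.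
  have -> : ip (opS (v n) \_ E) (v n) = ip (fun x => res (v n) x + (h \_ E) x) (v n).
    congr Rintegral; apply/funext => x; rewrite /res !patchE; case: ifPn => _; by rewrite ?subrK ?addr0.
  have s2 := L2D mD (res2 _ (v2 n)) hE2.
  apply: (le_trans (ler_norm _)); apply: (le_trans (ip_cauchy_schwarz mD s2 (v2 n))).
  apply: ler_wpM2r => //; first exact: n2_ge0.
  by apply: (le_trans (n2_tri mD (res2 _ (v2 n)) hE2)); rewrite lerD2r.
have [|f [? ? _ ?]] := cluster_solution v2 vE vb h2; last by exists f.
move=> e e0; have e1 : 0 < e ^+ 2 by rewrite exprn_gt0.
have [N hN] := expr_small r0 kap01 e1.
exists N => n Nn; rewrite -(@ler_pXn2r _ 2)// ?nnegrE ?n2_ge0 ?(ltW e0)//.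
exact: le_trans (rn n) (hN n Nn).
Qed.

(** Off [E] the error equals [r]; its image under [K] joins the right-hand side on [E], where
    coercivity applies. [C * msqrt setT] bounds [K] in [L^2], and the summand 1 is the part of the
    error off [E]. *)
Lemma coercive_residual (gam : R) e r : 0 < gam -> coercive_on gam E -> L2 e -> L2 r ->
  aeD (fun x => if x \in E then opS e x = nu * r x else e x = r x) ->
  n2 e <= ((nu + C * msqrt setT) / gam + 1) * n2 r.
Proof.
move=> gam0 co e2 r2 er.
pose eE := e \_ E; have eE2 : L2 eE := L2_patch mD mE e2.
have eEE : vanishes_off E eE by exact: patch_off.
have mCE : measurable (~` E) by exact: measurableC.
pose rA := r \_ (~` E); have rA2 : L2 rA := L2_patch mD mCE r2.
have rAr : n2 rA <= n2 r.
  apply: n2_le => //; apply: aeD_all => x _; rewrite /rA patchE; case: ifP => //; by rewrite normr0.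
have eS : aeD (fun x => e x = eE x + 1 * rA x).
  apply: aeD1 er => x _; rewrite /eE /rA !patchE in_setC; case: (x \in E) => /=.
    by rewrite mulr0 addr0.
  by rewrite mul1r add0r.
have eEb : n2 eE <= (nu + C * msqrt setT) / gam * n2 r.
  have [z|z] := eqVneq (n2 eE) 0.
    by rewrite z mulr_ge0 ?n2_ge0// divr_ge0 ?(ltW gam0)// ltW// qbound_gt0.
  have zp : 0 < n2 eE by rewrite lt_neqAle eq_sym z n2_ge0.
  rewrite mulrAC ler_pdivlMr// mulrC -(ler_pM2r zp) -mulrA -expr2.
  apply: (le_trans (co _ eE2 eEE)); rewrite qform_patch//.
  (* The splitting of [e] holds almost everywhere, whereas [K e] is evaluated at a point; the bound
     of [K] by the [L^2] seminorm bridges the two. *)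
  have Ke x : D x -> n2 (fun x => e x - (eE x + 1 * rA x)) = 0 ->
    K e x = K eE x + K rA x.
    move=> Dx n0; have s2 := L2_lin mD 1 eE2 rA2.
    have := csa_bound HK (L2B mD e2 s2) Dx; rewrite n0 mulr0.
    rewrite (_ : (fun y => e y - _) = (fun y => e y + (-1) * (eE y + 1 * rA y))); last first.
      by apply/funext => y; rewrite mulN1r.
    rewrite (csa_lin HK)// (csa_lin HK)// normr_le0 => /eqP; lra.
  have n0 : n2 (fun x => e x - (eE x + 1 * rA x)) = 0.
    rewrite (@n2_ae _ _ _ _ _ _ (fun=> 0)).
      by rewrite /n2 /ip; under eq_Rintegral do rewrite mulr0; rewrite Rintegral_cst// mul0r sqrtr0.
    by apply: aeD1 eS => x _ ->; rewrite subrr.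
  have rhs2 : L2 (fun x => nu * r x + 1 * K rA x) by apply: L2_lin => //; [exact: L2Z|exact: csa_L2].
  rewrite (@ip_ae _ _ _ _ _ _ _ ((fun x => nu * r x + 1 * K rA x) \_ E) eE); last first.
  - exact: aeD_all.
  - apply: aeD1 er => x Dx; rewrite !patchE /eE; case: ifPn => // xE.
    rewrite /opS (Ke x Dx n0) /= => h; rewrite patchE xE; lra.
  apply: (le_trans (ler_norm _)).
  apply: (le_trans (ip_cauchy_schwarz mD (L2_patch mD mE rhs2) eE2)).
  apply: ler_wpM2r; first exact: n2_ge0.
  apply: (@le_trans _ _ (n2 (fun x => nu * r x + 1 * K rA x))).
    apply: n2_le => //; first exact: L2_patch.
    apply: aeD_all => x _; rewrite patchE; case: ifP => //; by rewrite normr0.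
  apply: (le_trans (n2_tri mD (L2Z mD nu r2) (L2Z mD 1 (csa_L2 rA2)))).
  rewrite !n2Z//; last exact: csa_L2.
  rewrite normr1 mul1r gtr0_norm// mulrDl lerD2l.
  have : n2 (K rA) <= C * n2 rA * msqrt setT.
    apply: n2_boundedT; first exact: csa_L2.
      by rewrite mulr_ge0 ?n2_ge0// (csa_ge0 HK).
    by apply: aeD_all => x Dx; exact: (csa_bound HK).
  move=> /le_trans; apply; rewrite mulrAC; apply: ler_wpM2l => //.
  by rewrite mulr_ge0 ?msqrt_ge0// (csa_ge0 HK).
rewrite (n2_ae eS) mulrDl mul1r; apply: (le_trans (n2_tri mD eE2 (L2Z mD 1 rA2))).
by rewrite n2Z// normr1 mul1r; exact: lerD.
Qed.

End operator.

(** The part of [f] outside [E] lives on [E'] minus [E]. There the multiple [nu] of the identity is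
    coercive by itself, as [gam <= nu], and the terms with [K] carry the factor [msqrt] of this set
    because images under [K] are bounded. Replacing [K] by [K'] costs the last term. *)
Lemma coercive_perturb (nu : R) K K' (C C' gam eps : R) E E' : 0 < nu ->
  compact_selfadjoint K C -> compact_selfadjoint K' C' ->
  measurable E -> measurable E' -> coercive_on nu K gam E -> 0 <= gam <= nu -> 0 <= eps ->
  (forall f, L2 f -> forall x, D x -> `|K' f x - K f x| <= eps * n2 f) ->
  coercive_on nu K' (gam - 3 * C * msqrt (E' `\` E) - eps * msqrt setT) E'.
Proof.
move=> nu0 HK HK' mE mE' co /andP[gam0 gamnu] eps0 KK f f2 fE'.
have C0 := csa_ge0 HK.
pose f1 := f \_ E; have f12 : L2 f1 := L2_patch mD mE f2.
have f1E : vanishes_off E f1 by exact: patch_off.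
have mC : measurable (~` E) by exact: measurableC.
pose f3 := f \_ (~` E); have f32 : L2 f3 := L2_patch mD mC f2.
have f3E : vanishes_off (E' `\` E) f3.
  move=> x nx; rewrite /f3 patchE; case: ifPn => //; rewrite inE /= => nE.
  by apply: fE' => Ex; apply: nx.
have mEE : measurable (E' `\` E) by exact: measurableD.
have fS : f = (fun x => f1 x + 1 * f3 x).
  apply/funext => x; rewrite /f1 /f3 !patchE in_setC; case: (x \in E) => /=.
    by rewrite mulr0 addr0.
  by rewrite mul1r add0r.
have o13 : ip f1 f3 = 0.
  rewrite /ip (_ : (fun x => _) = fun=> 0) ?Rintegral_cst ?mul0r//.
  apply/funext => x; rewrite /f1 /f3 !patchE in_setC; case: (x \in E) => /=;
  by rewrite ?mulr0 ?mul0r.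
have nf : n2 f ^+ 2 = n2 f1 ^+ 2 + n2 f3 ^+ 2.
  by rewrite {1}fS n2_sqr ip_sqr// o13 !n2_sqr; ring.
have qf : qform nu K f f = qform nu K f1 f1 + 2 * 1 * qform nu K f1 f3 + 1 ^+ 2 * qform nu K f3 f3.
  by rewrite {1 2}fS (qform_sqr nu HK).
set s := msqrt (E' `\` E); have s0 : 0 <= s := msqrt_ge0 _.
have b13 : `|ip (K f1) f3| <= C * n2 f1 * s * n2 f3.
  apply: ip_bounded => //; first exact: (csa_L2 HK).
    by rewrite mulr_ge0// n2_ge0.
  by apply: aeD_all => x Dx; exact: (csa_bound HK).
have b33 : `|ip (K f3) f3| <= C * n2 f3 * s * n2 f3.
  apply: ip_bounded => //; first exact: (csa_L2 HK).
    by rewrite mulr_ge0// n2_ge0.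
  by apply: aeD_all => x Dx; exact: (csa_bound HK).
have q13 : qform nu K f1 f3 = - ip (K f1) f3 by rewrite /qform o13 mulr0 sub0r.
have q33 : qform nu K f3 f3 = nu * n2 f3 ^+ 2 - ip (K f3) f3 by rewrite /qform n2_sqr.
have q11 := co _ f12 f1E.
have KfL := csa_L2 HK f2; have KfL' := csa_L2 HK' f2.
have qK : qform nu K' f f = qform nu K f f - ip (fun x => K' f x - K f x) f.
  by rewrite /qform ipBl//; ring.
have bK : `|ip (fun x => K' f x - K f x) f| <= eps * n2 f * msqrt setT * n2 f.
  apply: ip_bounded => //; first exact: L2B.
  - by rewrite mulr_ge0// n2_ge0.
  - by apply: aeD_all => x Dx; exact: KK.
  - by move=> x /(_ Logic.I).
have := ler_norm (ip (fun x => K' f x - K f x) f).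
have := ler_norm (ip (K f1) f3); have := ler_norm (ip (K f3) f3).
have n10 := n2_ge0 mu D f1; have n30 := n2_ge0 mu D f3.
have ab : 2 * (n2 f1 * n2 f3) <= n2 f1 ^+ 2 + n2 f3 ^+ 2.
  by have := sqr_ge0 (n2 f1 - n2 f3); rewrite sqrrB; lra.
have Cs : 0 <= C * s by rewrite mulr_ge0.
have h1 : C * n2 f1 * s * n2 f3 * 2 <= C * s * n2 f ^+ 2.
  have -> : C * n2 f1 * s * n2 f3 * 2 = C * s * (2 * (n2 f1 * n2 f3)) by ring.
  by rewrite nf; exact: ler_wpM2l.
have h2 : C * n2 f3 * s * n2 f3 <= C * s * n2 f ^+ 2.
  have -> : C * n2 f3 * s * n2 f3 = C * s * (n2 f3 ^+ 2) by ring.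
  by apply: ler_wpM2l => //; rewrite nf lerDr sqr_ge0.
have h3 : gam * n2 f ^+ 2 <= gam * n2 f1 ^+ 2 + nu * n2 f3 ^+ 2.
  by rewrite nf mulrDr lerD2l; apply: ler_wpM2r => //; exact: sqr_ge0.
have h4 : 0 <= C * s * n2 f ^+ 2 by rewrite mulr_ge0// sqr_ge0.
have -> : (gam - 3 * C * s - eps * msqrt setT) * n2 f ^+ 2 =
  gam * n2 f ^+ 2 - 3 * (C * s * n2 f ^+ 2) - eps * n2 f * msqrt setT * n2 f by ring.
by rewrite qK qf q13 q33; lra.
Qed.

End finite_L2.

(** * Weak partial derivatives *)

Section bounded_sets.
Context (R : realType).

Definition box n (a b : 'I_n -> R) : set 'rV[R]_n := [set x | forall i, a i < x 0 i < b i].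

Lemma open_coord_itv n (i : 'I_n) (a b : R) : open [set x : 'rV[R]_n | a < x 0 i < b].
Proof.
have -> : [set x : 'rV[R]_n | a < x 0 i < b] =
  (fun x : 'rV[R]_n => x 0 i) @^-1` `]a, b[%classic.
  by apply/seteqP; split => x /=; rewrite in_itv.
apply: open_comp; last exact: interval_open.
by move=> x _; exact: coord_continuous.
Qed.

Lemma measurable_ebox n (a b : 'I_n -> R) : measurable (box a b).
Proof.
have -> : box a b = \bigcap_(i : 'I_n) [set x : 'rV[R]_n | a i < x 0 i < b i].
  by apply/seteqP; split => [x h i _|x h i]; [exact: h|exact: (h i)].
apply: fin_bigcap_measurable => // i _; apply: open_measurable_mx; exact: open_coord_itv.
Qed.

Lemma lebesgue_box_fin n (r : R) : (lebesgue_rV (box (fun _ : 'I_n => - r)%R (fun=> r)%R) < +oo)%E.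
Proof.
elim: n => [|n ih]; first by rewrite /= /dirac indicE ltry.
rewrite /= /pushforward.
have -> : @cons_rV R n @^-1` box (fun _ : 'I_n.+1 => - r) (fun=> r) =
    `](- r), r[%classic `*` box (fun _ : 'I_n => - r) (fun=> r).
  apply/seteqP; split => [p /= h|p /= [/= h1 h2] i].
    split => /=; first by have := h 0; rewrite cons_rV0 in_itv.
    by move=> i; have := h (lift 0 i); rewrite cons_rVS.
  case: (unliftP 0 i) => [j|] ->; last by move: h1; rewrite cons_rV0 in_itv.
  by have := h2 j; rewrite cons_rVS.
rewrite product_measure1E//=; last exact: measurable_ebox.
rewrite lebesgue_measure_itv/= lte_mul_pinfty//.
- by case: ifP => // h; rewrite -EFinD lee_fin subr_ge0 ltW.
- by case: ifP => // h; rewrite -EFinD.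
Qed.

Lemma coord_le_norm n (x : 'rV[R]_n) i : `|x 0 i| <= `|x|.
Proof. by rewrite [leRHS]mx_normrE; apply/bigmax_geP; right => /=; exists (0, i). Qed.

Lemma lebesgue_bounded_fin n (O : set 'rV[R]_n) : measurable O -> bounded_set O ->
  (lebesgue_rV O < +oo)%E.
Proof.
move=> mO [M [_ hM]]; apply: (le_lt_trans _ (lebesgue_box_fin n (M + 2))).
apply: le_measure; rewrite ?inE//; first exact: measurable_ebox.
move=> x Ox i; have h : `|x| <= M + 1 by apply: hM => //; rewrite ltrDl.
rewrite -ltr_norml; apply: (le_lt_trans (coord_le_norm x i)); apply: (le_lt_trans h).
by rewrite ltrD2l ltr1n.
Qed.

End bounded_sets.

(** * Functions of class C^1, as raw material for cutoffs *)

Section C1_functions.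
Context (R : realType) (n : nat).
Implicit Types (f g : 'rV[R]_n -> R).

(** The partial derivatives are exhibited, so that their continuity passes along with sums, products
    and inverses. *)
Definition C1f f := exists df : 'I_n -> 'rV[R]_n -> R,
  [/\ continuous f, forall i, continuous (df i) &
    forall i x, is_derive x (delta_mx 0 i : 'rV[R]_n) (f : _ -> R^o) (df i x : R^o)].

Lemma C1f_cst (c : R) : C1f (fun=> c).
Proof.
by exists (fun _ _ => 0); split => [|i|i x]; [exact: cst_continuous|exact: cst_continuous|exact: is_derive_cst].
Qed.

Lemma C1f_coord j : C1f (fun x => x 0 j).
Proof.
exists (fun i _ => (i == j)%:R); split => [|i|i x]; [exact: coord_continuous|exact: cst_continuous|].
have E : (fun h : R => h^-1 *: (((fun x : 'rV[R]_n => x 0 j) \o shift x) (h *: delta_mx 0 i) - x 0 j : R^o))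
   @ 0^' --> ((i == j)%:R : R^o).
  apply: cvg_near_cst; near=> h; rewrite /= !mxE addrK eqxx/= eq_sym scalerA mulVf ?scale1r//.
  by near: h; exact: nbhs_dnbhs_neq.
apply: DeriveDef; first by apply/cvg_ex; exists (i == j)%:R.
exact: (cvg_lim _ E).
Unshelve. all: by end_near. Qed.

Lemma C1fD f g : C1f f -> C1f g -> C1f (fun x => f x + g x).
Proof.
move=> [df [cf cdf hf]] [dg [cg cdg hg]]; exists (fun i x => df i x + dg i x); split.
- by move=> x; exact: (cvgD (cf x) (cg x)).
- by move=> i x; exact: (cvgD (cdf i x) (cdg i x)).
- by move=> i x; exact: is_deriveD.
Qed.

Lemma C1fM f g : C1f f -> C1f g -> C1f (fun x => f x * g x).
Proof.
move=> [df [cf cdf hf]] [dg [cg cdg hg]]; exists (fun i x => f x * dg i x + g x * df i x); split.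
- by move=> x; exact: (cvgM (cf x) (cg x)).
- by move=> i x; exact: (cvgD (cvgM (cf x) (cdg i x)) (cvgM (cg x) (cdf i x))).
- by move=> i x; exact: (@is_deriveM _ _ f g).
Qed.

Lemma C1fV f : C1f f -> (forall x, f x != 0) -> C1f (fun x => (f x)^-1).
Proof.
move=> [df [cf cdf hf]] f0; exists (fun i x => - (f x) ^- 2 * df i x); split.
- by move=> x; exact: (cvgV (f0 x) (cf x)).
- move=> i x; have f20 : f x * f x != 0 by rewrite mulf_neq0.
  exact: (cvgM (cvgN (cvgV f20 (cvgM (cf x) (cf x)))) (cdf i x)).
- move=> i x; have [h1 <-] := hf i x; apply: DeriveDef; first exact: derivableV.
  by rewrite deriveV.
Qed.

(** Squaring removes the kink of the positive part: this quadratic remainder gives the derivative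
    [2 max(0, t)] at every point, 0 included. *)
Lemma sqr_pospart_quad (t h : R) :
  `|Num.max 0 (t + h) ^+ 2 - Num.max 0 t ^+ 2 - 2 * Num.max 0 t * h| <= h ^+ 2.
Proof.
rewrite ler_norml; case: (leP 0 t) => t0; case: (leP 0 (t + h)) => th0;
  apply/andP; split; nra.
Qed.

Lemma is_derive_sqr_pospart (t : R) :
  is_derive t 1 (fun s : R => Num.max 0 s ^+ 2 : R^o) (2 * Num.max 0 t : R^o).
Proof.
have E : (fun h : R => h^-1 *: (((fun s : R => Num.max 0 s ^+ 2 : R^o) \o shift t) (h *: (1 : R^o)) - Num.max 0 t ^+ 2 : R^o))
   @ 0^' --> (2 * Num.max 0 t : R^o).
  apply/cvgrPdist_le => e e0; near=> h.
  have h0 : h != 0 by near: h; exact: nbhs_dnbhs_neq.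
  have he : `|h| <= e.
    by near: h; apply: dnbhs0_le.
  rewrite /= [h%:A]mulr1 (addrC h) distrC.
  have -> : h^-1 *: (Num.max 0 (t + h) ^+ 2 - Num.max 0 t ^+ 2 : R^o) - 2 * Num.max 0 t =
    h^-1 * (Num.max 0 (t + h) ^+ 2 - Num.max 0 t ^+ 2 - 2 * Num.max 0 t * h).
    rewrite [in RHS]mulrBr; congr (_ - _); by field.
  rewrite normrM normfV mulrC ler_pdivrMr ?normr_gt0//.
  apply: (le_trans (sqr_pospart_quad t h)); rewrite -normr_sqrE expr2.
  by rewrite ler_pM2r// normr_gt0.
apply: DeriveDef; first by apply/cvg_ex; exists (2 * Num.max 0 t).
exact: (cvg_lim _ E).
Unshelve. all: by end_near. Qed.

(** Reduces a directional derivative to one real variable, where the chain rule with the squared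
    positive part applies. *)
Lemma line_derive (f : 'rV[R]_n -> R) (x v : 'rV[R]_n) :
  'D_1 (fun h : R => f (h *: v + x) : R^o) (0 : R) = 'D_v (f : _ -> R^o) x.
Proof.
rewrite /derive; set g1 := fun h => _; set g2 := fun h => _.
suff -> : g1 = g2 by [].
by apply/funext => h; rewrite /g1 /g2 /= addr0 scale0r add0r [h%:A]mulr1.
Qed.

Lemma C1f_sqr_pospart f : C1f f -> C1f (fun x => Num.max 0 (f x) ^+ 2).
Proof.
move=> [df [cf cdf hf]]; exists (fun i x => 2 * Num.max 0 (f x) * df i x).
have cm : continuous (fun x => Num.max 0 (f x)).
  rewrite (_ : (fun x => _) = (fun x => 2^-1 * (f x + `|f x|))); last first.
    apply/funext => x; case: (leP 0 (f x)) => fx; last by rewrite ltr0_norm// subrr mulr0.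
    by rewrite ger0_norm//; field.
  by move=> x; exact: (cvgM (cvg_cst _) (cvgD (cf x) (cvg_norm (cf x)))).
split.
- by move=> x; exact: (cvgM (cm x) (cm x)).
- by move=> i x; exact: (cvgM (cvgM (cvg_cst _) (cm x)) (cdf i x)).
- move=> i x; have [h1 h2] := hf i x.
  have h3 : is_derive (0 : R) 1 (fun h : R => f (h *: delta_mx 0 i + x) : R^o) (df i x : R^o).
    apply: DeriveDef; first exact: (@derivable1P R 'rV[R]_n R^o f x (delta_mx 0 i)).1 h1.
    rewrite -h2; exact: line_derive.
  have e0 : f (0 *: delta_mx 0 i + x) = f x by rewrite scale0r add0r.
  have h4 := @is_derive1_comp _ (fun s : R => Num.max 0 s ^+ 2) (fun h : R => f (h *: delta_mx 0 i + x)) 0 _ _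
    (is_derive_sqr_pospart _) h3.
  have [k1 k2] := h4; rewrite e0 in k2.
  apply: DeriveDef.
    exact: (@derivable1P R 'rV[R]_n R^o (fun x => Num.max 0 (f x) ^+ 2) x (delta_mx 0 i)).2 k1.
  by rewrite -k2; apply/esym; exact: (line_derive (fun x => Num.max 0 (f x) ^+ 2)).
Qed.

Lemma C1f_prod (I : Type) (r : seq I) (F : I -> 'rV[R]_n -> R) :
  (forall i, C1f (F i)) -> C1f (fun x => \prod_(i <- r) F i x).
Proof.
move=> hF; elim: r => [|i r ih].
  by rewrite (_ : (fun _ => _) = fun=> 1); [exact: C1f_cst|apply/funext => x; rewrite big_nil].
rewrite (_ : (fun _ => _) = (fun x => F i x * \prod_(j <- r) F j x)); first exact: C1fM.
by apply/funext => x; rewrite big_cons.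
Qed.

Lemma C1f_test O f K : C1f f -> (forall x, f x != 0 -> K x) -> closed K -> bounded_set K -> K `<=` O ->
  test_function O f.
Proof.
move=> [df [cf cdf hf]] fK cK bK KO.
have sub : closure [set x | f x != 0] `<=` K.
  by rewrite closure_id in cK; rewrite cK; apply: closureS => x /= /fK.
split.
- by move=> i x; have [] := hf i x.
- move=> i; have -> : partial i f = df i by apply/funext => x; have [_] := hf i x.
  exact: cdf.
- apply: (@subclosed_compact _ _ K) => //; first exact: closed_closure.
  exact: bounded_closed_compact.
- exact: subset_trans KO.
Qed.

End C1_functions.

(** * The fundamental lemma of the calculus of variations *)

Section vanishing_against_tests.
Context (R : realType) (n : nat).
Local Notation leb := (@lebesgue_rV R n).

(** Boxes with real ends form a generating class stable under intersection, as Dynkin's lemma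
    requires. *)
Lemma rV_measurable_boxes :
  @measurable _ 'rV[R]_n = <<s [set box ab.1 ab.2 | ab in [set: ('I_n -> R) * ('I_n -> R)]] >>.
Proof.
set G := [set _ | _ in _].
apply/seteqP; split.
  apply: smallest_sub; first exact: smallest_sigma_algebra.
  move=> A oA; rewrite (open_qbox oA) bigcup_mkcond.
  apply: (@countable_bigcupT_measurable _ (g_sigma_algebraType G)); first exact: countableP.
  move=> p; case: ifPn => // _; apply: sub_sigma_algebra.
  exists (fun i => ratr (p.1 0 i) - p.2.+1%:R^-1, fun i => ratr (p.1 0 i) + p.2.+1%:R^-1) => //.
apply: smallest_sub; first exact: sigma_algebra_measurable.
by move=> _ [ab _ <-]; exact: measurable_ebox.
Qed.

Lemma box_setI (a b a' b' : 'I_n -> R) :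
  box a b `&` box a' b' = box (fun i => Num.max (a i) (a' i)) (fun i => Num.min (b i) (b' i)).
Proof.
apply/seteqP; split => [x /= [h h'] i|x /= h].
  by rewrite gt_max lt_min; have /andP[-> ->] := h i; have /andP[-> ->] := h' i.
by split => i; have := h i; rewrite gt_max lt_min => /andP[/andP[? ?] /andP[? ?]]; apply/andP.
Qed.

(** Within one box, the Borel sets over which [h] integrates to 0 form a Dynkin system that contains
    the boxes, hence they are all the Borel sets. The open set [O] is a countable union of rational
    boxes. *)
Lemma ae0_of_boxes (O : set 'rV[R]_n) (h : 'rV[R]_n -> R) :
  open O -> leb.-integrable O (EFin \o h) ->
  (forall a b, box a b `<=` O -> (\int[leb]_(x in box a b) (h x)%:E = 0)%E) ->
  aeD leb O (fun x => h x = 0).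
Proof.
move=> oO ih h0.
have step a b : box a b `<=` O -> aeD leb (box a b) (fun x => h x = 0).
  move=> abO; have mB := measurable_ebox a b.
  have iB : leb.-integrable (box a b) (EFin \o h).
    by apply: integrableS ih => //; exact: open_measurable_mx.
  have P E : measurable E -> (\int[leb]_(x in box a b `&` E) (h x)%:E = 0)%E.
    move=> mE; have mE' := mE; rewrite rV_measurable_boxes in mE'.
    move: E mE' {mE}; apply: dynkin_induction.
    - exact: rV_measurable_boxes.
    - move=> _ _ [[a1 b1] _ <-] [[a2 b2] _ <-] /=.
      by rewrite box_setI; eexists (_, _).
    - by rewrite setIT h0.
    - move=> _ [[a1 b1] _ <-] /=; rewrite box_setI; apply: h0.
      by rewrite -box_setI => x [+ _]; exact: abO.
    - move=> S mS PS; have := h0 _ _ abO.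
      have BE : box a b = (box a b `&` S) `|` (box a b `&` ~` S) by rewrite -setIUr setUv setIT.
      rewrite {1}BE integral_setU_EFin//.
      + by rewrite PS add0e.
      + exact: measurableI.
      + by apply: measurableI => //; exact: measurableC.
      + by rewrite -BE; have /integrableP[/measurable_EFinP] := iB.
      + by apply/disj_setPS => x [[_ Sx] [_ nS]]; exact: nS.
    - move=> F mF tF PF; rewrite setI_bigcupr integral_bigcup//.
      + by rewrite eseries0.
      + by apply: trivIset_setIl.
      + by move=> k; apply: measurableI.
      + by apply: integrableS iB => //; [apply: bigcup_measurable => k _; exact: measurableI|move=> x [k _ []]].
  have : ae_eq leb (box a b) (EFin \o h) (cst 0%E).
    apply: (integral_ae_eq mB iB); first exact: measurable_cst.
    move=> E EB mE; rewrite integral0.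
    have -> : E = box a b `&` E by rewrite setIC; apply/esym/setIidl.
    exact: P.
  by rewrite /aeD; apply: filterS => x hx Bx; have [] := hx Bx.
have := open_qbox oO; set S := [set p | _] => OE.
have hp (p : 'rV[rat]_n * nat) : \forall x \ae leb, S p -> qbox p.1 p.2 x -> h x = 0.
  have [Sp|nS] := pselect (S p); last by apply: aeW.
  have := step (fun i => ratr (p.1 0 i) - p.2.+1%:R^-1) (fun i => ratr (p.1 0 i) + p.2.+1%:R^-1) Sp.
  by rewrite /aeD; apply: filterS => x hx _ /hx.
(* The exceptional null sets of the rational boxes are joined along their enumeration. *)
have : \forall x \ae leb, forall m, if unpickle m is Some p then
    S p -> qbox p.1 p.2 x -> h x = 0 else True.
  apply: ae_foralln => m; case: (unpickle m) => [p|]; [exact: hp|exact: aeW].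
rewrite /aeD; apply: filterS => x hx; rewrite OE => -[p Sp px].
by have := hx (pickle p); rewrite pickleK; exact.
Qed.

Lemma within_continuous_measurable (D : set 'rV[R]_n) (f : 'rV[R]_n -> R) :
  measurable D -> {within D, continuous f} -> measurable_fun D f.
Proof.
move=> mD /continuousP cf; apply: (measurability _ (RGenOpens.measurableE R)).
move=> _ [_ [a [b ->] <-]]; have oI : open `]a, b[%classic by exact: interval_open.
have /open_subspaceP[V oV VE] := cf _ oI.
by rewrite setIC -VE; apply: measurableI => //; exact: open_measurable_mx.
Qed.

Section bump.
Context (a b : 'I_n -> R) (ab : forall i, a i < b i).

(** Positive exactly where each product [(x_i - a_i) (b_i - x_i)] exceeds 1/(k+1), which keeps the
    support inside a compact part of the box; the squares make it C^1. *)
Definition bump_base (k : nat) (x : 'rV[R]_n) : R :=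
  \prod_(i < n) Num.max 0 ((x 0 i - a i) * (b i - x 0 i) - k.+1%:R^-1) ^+ 2.

(** This is [1 - 1 / (1 + t)] with [t] equal to [k + 1] times a square: it lies in [0, 1], vanishes
    with [bump_base], and tends to 1 wherever [bump_base] stays away from 0. *)
Definition bump (k : nat) (x : 'rV[R]_n) : R :=
  1 + (-1) * (1 + k.+1%:R * (bump_base k x * bump_base k x))^-1.

Lemma bump_base_ge0 k x : 0 <= bump_base k x.
Proof. by apply: prodr_ge0 => i _; exact: sqr_ge0. Qed.

Lemma bump_den_ge1 k x : 1 <= 1 + k.+1%:R * (bump_base k x * bump_base k x).
Proof. by rewrite lerDl mulr_ge0// mulr_ge0// bump_base_ge0. Qed.

Lemma C1f_bump k : C1f (bump k).
Proof.
have cb : C1f (bump_base k).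
  apply: C1f_prod => i; apply: C1f_sqr_pospart; apply: C1fD; last exact: C1f_cst.
  apply: C1fM; first by apply: C1fD; [exact: C1f_coord|exact: C1f_cst].
  apply: C1fD; first exact: C1f_cst.
  rewrite (_ : (fun x => _) = fun x : 'rV[R]_n => (-1) * x 0 i); last by apply/funext => x; rewrite mulN1r.
  by apply: C1fM; [exact: C1f_cst|exact: C1f_coord].
apply: C1fD; first exact: C1f_cst.
apply: C1fM; first exact: C1f_cst.
apply: C1fV; last by move=> x; rewrite gt_eqF// (lt_le_trans ltr01 (bump_den_ge1 k x)).
by apply: C1fD; [exact: C1f_cst|apply: C1fM; [exact: C1f_cst|exact: C1fM]].
Qed.

Lemma bump_ge0_le1 k x : 0 <= bump k x <= 1.
Proof.
have h := bump_den_ge1 k x; have h0 := lt_le_trans ltr01 h.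
rewrite /bump mulN1r subr_ge0 invf_le1// h /= gerDl oppr_le0 invr_ge0; exact: ltW.
Qed.

Lemma bump_off k x : bump_base k x = 0 -> bump k x = 0.
Proof. by move=> h; rewrite /bump h mulr0 mulr0 addr0 invr1 mulr1 subrr. Qed.

Lemma bump_base_neq0 k x : bump_base k x != 0 ->
  forall i, k.+1%:R^-1 <= (x 0 i - a i) * (b i - x 0 i).
Proof.
move=> h i; rewrite leNgt; apply/negP => lt; move/negP: h; apply.
by rewrite /bump_base (bigD1 i)//= max_l ?expr0n ?mul0r// subr_le0 ltW.
Qed.

Lemma coord_prod_gt0 (x : 'rV[R]_n) i : 0 < (x 0 i - a i) * (b i - x 0 i) -> a i < x 0 i < b i.
Proof. by have := ab i; move=> abi h; apply/andP; split; nra. Qed.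

Lemma bump_test O k : box a b `<=` O -> bounded_set O -> test_function O (bump k).
Proof.
move=> BO [M [Mr hM]].
pose K := \bigcap_(i in [set: 'I_n]) [set x : 'rV[R]_n | k.+1%:R^-1 <= (x 0 i - a i) * (b i - x 0 i)].
have KB : K `<=` box a b.
  by move=> x Kx i; apply: coord_prod_gt0; apply: lt_le_trans (Kx i Logic.I).
apply: (@C1f_test _ _ _ _ K); first exact: C1f_bump.
- move=> x; apply: contra_neqP => nK.
  by apply: bump_off; apply: contra_notP nK => /eqP h i _; exact: bump_base_neq0.
- apply: closed_bigI => i _.
  have c : continuous (fun x : 'rV[R]_n => (x 0 i - a i) * (b i - x 0 i)).
    move=> x; have ci := @coord_continuous R 1 n 0 i x.
    exact: (cvgM (cvgB ci (cvg_cst _)) (cvgB (cvg_cst _) ci)).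
  rewrite (_ : [set x | _] = (fun x : 'rV[R]_n => (x 0 i - a i) * (b i - x 0 i)) @^-1` [set t | k.+1%:R^-1 <= t])//.
  by apply: preimage_closed => //; exact: closed_ge.
- by exists M; split => // t Mt x /KB/BO Ox; exact: hM Ox.
- exact: subset_trans BO.
Qed.

Lemma bump_cvg x : bump k x @[k --> \oo] --> (\1_(box a b) x : R).
Proof.
have [xB|xB] := pselect (box a b x); last first.
  rewrite indicE memNset// (_ : false%:R = 0)//; apply: cvg_near_cst; near=> k.
  apply: bump_off; apply: contra_notP xB => /eqP h i; apply: coord_prod_gt0.
  by apply: lt_le_trans (bump_base_neq0 h i).
rewrite indicE mem_set// (_ : true%:R = 1)//.
have hN (i : 'I_n) : exists N, forall k, (N <= k)%N -> k.+1%:R^-1 < (x 0 i - a i) * (b i - x 0 i).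
  by apply: natSinv_small; have /andP[? ?] := xB i; rewrite mulr_gt0// subr_gt0.
have [N hN'] := choice hN.
(* At this index all factors are positive at [x]. As [bump_base] increases with its index, the value
   [c] there bounds the later ones from below. *)
pose m := (\max_(i < n) N i)%N.
have mi i : m.+1%:R^-1 < (x 0 i - a i) * (b i - x 0 i).
  by apply: hN'; exact: (leq_bigmax_cond (F := N)).
pose c := bump_base m x.
have c0 : 0 < c.
  by apply: prodr_gt0 => i _; rewrite max_r ?exprn_gt0 ?subr_gt0 ?subr_ge0// ltW.
have ck k : (m <= k)%N -> c <= bump_base k x.
  move=> mk; apply: ler_prod => i _; rewrite sqr_ge0 /=.
  have le1 : k.+1%:R^-1 <= m.+1%:R^-1 :> R by rewrite lef_pV2 ?posrE// ler_nat.
  have p1 := mi i; have p2 := le_lt_trans le1 p1.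
  rewrite !max_r ?subr_ge0 ?(ltW p1) ?(ltW p2)//.
  by rewrite lerXn2r ?nnegrE ?subr_ge0 ?(ltW p1) ?(ltW p2)// lerD2l lerN2.
apply/cvgrPdist_le => e e0.
have ec0 : 0 < e * (c * c) by rewrite !mulr_gt0.
have [N' hN''] := natSinv_small ec0.
exists (maxn m N') => // k /=; rewrite geq_max => /andP[mk Nk].
have h1 := hN'' _ Nk.
rewrite /bump mulN1r opprD addrA subrr sub0r opprK.
have den0 := lt_le_trans ltr01 (bump_den_ge1 k x).
rewrite ger0_norm ?invr_ge0 ?(ltW den0)//.
have cc : c * c <= bump_base k x * bump_base k x by apply: ler_pM; rewrite ?ck// ltW.
have k0 : 0 < k.+1%:R :> R by [].
rewrite -[leLHS]mul1r ler_pdivrMr//.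
move: h1; rewrite -[X in X < _]mul1r ltr_pdivrMr// => h1.
set X := bump_base k x * bump_base k x in cc *.
have : e * (c * c) * k.+1%:R <= e * X * k.+1%:R.
  by rewrite ler_pM2r// ler_pM2l.
nra.
Unshelve. all: by end_near. Qed.

End bump.

(** The functions [bump] tend to the indicator of a box and stay in [0, 1], so dominated convergence
    carries the hypothesis from test functions to boxes. *)
Lemma ae0_of_tests (O : set 'rV[R]_n) (h : 'rV[R]_n -> R) :
  open O -> bounded_set O -> leb.-integrable O (EFin \o h) ->
  (forall psi, test_function O psi -> \int[leb]_(x in O) (h x * psi x) = 0) ->
  aeD leb O (fun x => h x = 0).
Proof.
move=> oO bO ih ht; have mO := open_measurable_mx oO.
have /integrableP[/measurable_EFinP mh _] := ih.
apply: ae0_of_boxes => // a b abO; have mB := measurable_ebox a b.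
have [ab|] := pselect (forall i, a i < b i); last first.
  move=> /existsNP[i /negP]; rewrite -leNgt => ba.
  rewrite (_ : box a b = set0) ?integral_set0//; apply/seteqP; split => // x /(_ i)/andP[u v].
  by have := lt_le_trans (lt_trans u v) ba; rewrite ltxx.
have mb k : measurable_fun O (bump a b k).
  have [_ [cb _ _]] := C1f_bump a b k.
  apply: (measurable_funS measurableT) => //; apply: within_continuous_measurable => //.
  by apply: continuous_subspaceT => x; exact: cb.
have := @dominated_cvg _ _ _ leb O mO (fun k x => (h x * bump a b k x)%:E)
  (fun x => (h x * \1_(box a b) x)%:E) (fun x => `|h x|%:E).
have -> : (\int[leb]_(x in O) (h x * \1_(box a b) x)%:E = \int[leb]_(x in box a b) (h x)%:E)%E.
  rewrite -[X in (\int[leb]_(x in X) (h x)%:E)%E](setIidr abO) integral_mkcondr.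
  apply: eq_integral => x _; rewrite patchE indicE; case: (x \in _) => /=.
    by rewrite mulr1.
  by rewrite mulr0.
have z k : (\int[leb]_(x in O) (h x * bump a b k x)%:E = 0)%E.
  have := ht _ (bump_test ab k abO bO); rewrite /Rintegral => e0.
  rewrite -[LHS]fineK ?e0//; apply: integrable_fin_num => //.
  apply: le_integrable (integrable_norm ih) => //.
    by apply/measurable_EFinP; exact: measurable_funM.
  move=> x _ /=; rewrite lee_fin normr_id normrM ler_piMr//.
  by have /andP[u v] := bump_ge0_le1 a b k x; rewrite ger0_norm.
have le1 k x : `|h x * bump a b k x| <= `|h x|.
  rewrite normrM ler_piMr//.
  by have /andP[u v] := bump_ge0_le1 a b k x; rewrite ger0_norm.
have mhb k : measurable_fun O (fun x => (h x * bump a b k x)%:E).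
  by apply/measurable_EFinP; exact: measurable_funM.
have hcvg x : O x -> (h x * bump a b k x)%:E @[k --> \oo] --> (h x * \1_(box a b) x)%:E.
  move=> Ox; apply: cvg_EFin; first exact: nearW.
  have c : (fun _ : nat => h x) @ \oo --> h x by exact: cvg_cst.
  rewrite (_ : _ \o _ = (fun k => h x * bump a b k x))//.
  by apply: cvgM => //; exact: bump_cvg.
move=> /(_ mhb hcvg (fun _ _ => erefl) (integrable_norm ih) (fun k x _ => le1 k x)).
have -> : (fun k => \int[leb]_(x in O) (h x * bump a b k x)%:E)%E = (fun=> 0%E) by apply/funext.
by move=> lim; exact: (cvg_unique (@ereal_hausdorff R) lim (cvg_cst _)).
Qed.

End vanishing_against_tests.

(** The parameter [th] treats [s < t], [t < s] and [s = t] alike. *)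
Lemma mean_value (R : realType) (f : R -> R) (s t : R) :
  (forall x : R, derivable (f : R -> R^o) x 1) ->
  exists2 th, 0 <= th <= 1 & f t - f s = derive1 f (s + th * (t - s)) * (t - s).
Proof.
move=> df.
have dd (x : R) : is_derive x (1 : R) (f : R -> R^o) (derive1 f x).
  by rewrite derive1E; apply: DeriveDef.
have cf (x : R) : {for x, continuous f} by apply/differentiable_continuous/derivable1_diffP; exact: df.
have [<-|st] := eqVneq s t; first by exists 0; rewrite ?lexx ?ler01// !subrr mulr0.
have st0 : t - s != 0 by rewrite subr_eq0 eq_sym.
have [{}st|ts] := leP s t.
  have [c /[!in_itv]/= /andP[sc ct] e] := @MVT_segment R f _ s t st (fun x _ => dd x) (continuous_subspaceT cf).
  have st1 : 0 < t - s by rewrite lt_neqAle eq_sym st0 subr_ge0.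
  exists ((c - s) / (t - s)); last first.
    by rewrite divfK// (_ : s + (c - s) = c)//; ring.
  by rewrite divr_ge0 ?subr_ge0//= ler_pdivrMr// mul1r lerD2r.
have [c /[!in_itv]/= /andP[sc ct] e] := @MVT_segment R f _ t s (ltW ts) (fun x _ => dd x) (continuous_subspaceT cf).
have st1 : 0 < s - t by rewrite subr_gt0.
exists ((s - c) / (s - t)).
  apply/andP; split; first by rewrite divr_ge0 ?subr_ge0// ltW.
  by rewrite ler_pdivrMr// mul1r lerD2l lerN2.
have -> : s + (s - c) / (s - t) * (t - s) = c by field; rewrite gt_eqF.
by rewrite -opprB e; ring.
Qed.

Section test_functions.
Context (R : realType) (n : nat).

Lemma continuous_bounded_ball (f : 'rV[R]_n -> R) (r : R) : continuous f ->
  exists M : R, forall x, `|x| <= r -> `|f x| <= M.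
Proof.
move=> cf; pose K : set 'rV[R]_n := [set x | `|x| <= r].
have cK : compact K.
  apply: bounded_closed_compact.
    by exists r; split => [|t rt x /= xr]; [exact: num_real|rewrite (le_trans xr)// ltW].
  rewrite (_ : K = (fun x : 'rV[R]_n => `|x|) @^-1` [set t | t <= r])//.
  by apply: (preimage_closed _ (@closed_le R r)) => x _; exact: (@norm_continuous R 'rV[R]_n x).
have : compact (f @` K) by apply: continuous_compact => //; exact: continuous_subspaceT.
move=> /compact_bounded[M [_ hM]]; exists (M + 1) => x xr.
by apply: (hM (M + 1)); [rewrite ltrDl|exists x].
Qed.

(** A test function is only given with continuous partial derivatives, so its own continuity must be
    derived: one coordinate is changed at a time, and the mean value theorem applies to each
    change. *)
Lemma test_lipschitz (O : set 'rV[R]_n) psi (r : R) : test_function O psi ->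
  exists2 M : R, 0 <= M & forall x y, `|x| <= r -> `|y| <= r -> `|psi y - psi x| <= M * `|y - x|.
Proof.
move=> [dpsi cpsi _ _].
have hM i : exists M : R, forall x, `|x| <= r -> `|partial i psi x| <= M.
  exact: continuous_bounded_ball.
have [M0 hM0] := choice hM.
pose M := \sum_i `|M0 i|.
have M_ge0 : 0 <= M by exact: sumr_ge0.
have MM i x : `|x| <= r -> `|partial i psi x| <= M.
  move=> /(hM0 i)/le_trans; apply; rewrite (le_trans (ler_norm _))// /M (bigD1 i)//= lerDl.
  exact: sumr_ge0.
exists (n%:R * M); first by rewrite mulr_ge0.
move=> x y xr yr.
(* The point whose first [k] coordinates are already those of [y]. In the maximum norm it stays
   within the radius [r], as do the points between two consecutive ones. *)
pose z (k : nat) : 'rV[R]_n := \row_j if (j < k)%N then y 0 j else x 0 j.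
have zb (k : nat) (th : R) (i : 'I_n) : nat_of_ord i = k -> 0 <= th <= 1 ->
    `|(th * (y 0 i - x 0 i)) *: delta_mx 0 i + z k| <= r.
  move=> ik /andP[th0 th1].
  have r0 : 0 <= r := le_trans (normr_ge0 _) xr.
  rewrite [leLHS]mx_normrE; apply/bigmax_leP; split => // -[a j] _ /=; rewrite ord1 !mxE eqxx /=.
  have xj := le_trans (coord_le_norm x j) xr; have yj := le_trans (coord_le_norm y j) yr.
  have [->|ji] := eqVneq j i; last by rewrite mulr0 add0r; case: ifP.
  rewrite ik ltnn mulr1.
  have xi := le_trans (coord_le_norm x i) xr; have yi := le_trans (coord_le_norm y i) yr.
  move: xi yi; rewrite !ler_norml => /andP[? ?] /andP[? ?]; apply/andP; split; nra.
have step (k : nat) : (k <= n)%N -> `|psi (z k) - psi x| <= k%:R * M * `|y - x|.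
  elim: k => [_|k ih kn].
    rewrite (_ : z 0%N = x) ?subrr ?normr0 ?mul0r//.
    by apply/rowP => j; rewrite mxE.
  pose i := Ordinal kn.
  have zS : z k.+1 = z k + (y 0 i - x 0 i) *: delta_mx 0 i.
    apply/rowP => j; rewrite !mxE eqxx /= ltnS leq_eqVlt.
    have [->|ji] := eqVneq j i; first by rewrite eqxx /= ltnn mulr1 addrC subrK.
    have -> : (nat_of_ord j == k) = false by apply/negbTE; apply: contra_neq ji => jk; exact: val_inj.
    by rewrite mulr0 addr0.
  pose F (s : R) := psi (s *: delta_mx 0 i + z k).
  have dF (s : R) : is_derive s (1 : R) (F : R -> R^o) (partial i psi (s *: delta_mx 0 i + z k)).
    have E (h : R) : F (h + s) = psi (h *: delta_mx 0 i + (s *: delta_mx 0 i + z k)).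
      by rewrite /F scalerDl addrA.
    have d1 := (derivable1P _ _ _).1 (dpsi i (s *: delta_mx 0 i + z k)).
    have ee : (fun h : R => h^-1 *: ((F \o shift s) (h *: (1 : R)) - F s : R^o)) =
      (fun h : R => h^-1 *: (((psi : _ -> R^o) \o shift (s *: delta_mx 0 i + z k)) (h *: delta_mx 0 i) -
         psi (s *: delta_mx 0 i + z k))).
      by apply/funext => h /=; rewrite [h%:A]mulr1 E.
    have := dpsi i (s *: delta_mx 0 i + z k); rewrite /derivable -ee => d2.
    apply: DeriveDef => //.
    by rewrite /partial /derive -ee.
  have [th th01 e] := mean_value 0 (y 0 i - x 0 i) (fun s => @ex_derive _ _ _ _ _ _ _ (dF s)).
  move: e; rewrite {1 2}/F scale0r add0r (addrC _ (z k)) -zS derive1E (@derive_val _ _ _ _ _ _ _ (dF _)).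
  rewrite subr0 add0r => e.
  have -> : psi (z k.+1) - psi x = (psi (z k.+1) - psi (z k)) + (psi (z k) - psi x) by ring.
  apply: (le_trans (ler_normD _ _)); rewrite -natr1 !mulrDl mul1r addrC.
  apply: lerD; first exact: ih (ltnW kn).
  rewrite e normrM; apply: ler_pM => //.
    by apply: MM; exact: zb.
  by have := coord_le_norm (y - x) i; rewrite !mxE.
have := step n (leqnn n).
by rewrite (_ : z n = y)//; apply/rowP => j; rewrite mxE ltn_ord.
Qed.
End test_functions.

Lemma aei_integrable d (T : measurableType d) (R : realType) (mu : {measure set T -> \bar R})
    (D : set T) (f : T -> R) :
  measurable_fun D f -> aei mu D f -> mu.-integrable D (EFin \o f).
Proof.
move=> mf [g /integrableP[_ gi] fg]; apply/integrableP; split; first exact/measurable_EFinP.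
apply: le_lt_trans gi; rewrite le_eqVlt; apply/orP; left; apply/eqP.
by apply: integral_ae; apply: aeD1 fg => x _ /= ->.
Qed.

(** * The Lebesgue spaces of the statement in terms of integrals up to null sets *)

Section Lp_bridge.
Context (R : realType) (n : nat) (O : set 'rV[R]_n) (mO : measurable O).
Local Notation leb := (@lebesgue_rV R n).
Implicit Types (f g y : 'rV[R]_n -> R).

Lemma Lp_measurable p f : Lp leb O p f -> measurable_fun O f.
Proof.
rewrite /Lp /= inE => /andP[]; rewrite !inE /= => mf _.
by have /(measurable_restrict _ mO measurableT) := mf; rewrite setTI.
Qed.

Lemma Lp_integrable_powR (p : R) f : 1 <= p -> Lp leb O p%:E f ->
  aei leb O (fun x => `|f x| `^ p).
Proof.
move=> p1 h; have := Lfun_integrable p1 h => ih.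
apply: aei_int; apply/(integrable_mkcond _ mO).
apply: eq_integrable ih => // x _; rewrite /= !patchE; case: ifP => // _.
by rewrite normr0 powR0// gt_eqF// (lt_le_trans ltr01).
Qed.

Lemma integral_abs_sqr f : (\int[leb]_x (`|(EFin \o (f \_ O)) x| `^ 2) = \int[leb]_(x in O) (f x ^+ 2)%:E)%E.
Proof.
rewrite [RHS]integral_mkcond; apply: eq_integral => x _ /=; rewrite !patchE; case: ifP => _.
  by rewrite powR_mulrn// normr_sqrE.
by rewrite normr0 powR_mulrn// expr0n.
Qed.

Lemma eLp_norm_n2 f : aei leb O (fun x => f x ^+ 2) -> eLp_norm leb O 2%:E f = (n2 leb O f)%:E.
Proof.
move=> fi; rewrite /eLp_norm unlock integral_abs_sqr.
have [g ig fg] := fi.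
have ii : (\int[leb]_(x in O) (f x ^+ 2)%:E)%E \is a fin_num.
  by rewrite (integral_ae (g := EFin \o g)) ?integrable_fin_num//; apply: aeD1 fg => x _ /= ->.
rewrite -[X in (X `^ _)%E]fineK// poweR_EFin powR12_sqrt; last first.
  by apply: fine_ge0; apply: integral_ge0 => x _; rewrite lee_fin sqr_ge0.
by [].
Qed.

Lemma Lp2P f : Lp leb O 2%:E f <-> L2 leb O f.
Proof.
split=> [h|[mf fi]].
  split; first exact: Lp_measurable h.
  apply: aei_int; apply/(integrable_mkcond _ mO).
  have := Lfun2_integrable_sqr h; apply: eq_integrable => // x _ /=.
  by rewrite !patchE; case: ifP => // _; rewrite expr0n.
rewrite /Lp /= inE; apply/andP; split; rewrite !inE /=.
  by apply/(measurable_restrict _ mO measurableT); rewrite setTI.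
by rewrite /finite_norm -/(eLp_norm leb O 2%:E f) eLp_norm_n2// ltry.
Qed.

Lemma Lp_norm_n2 f : L2 leb O f -> Lp_norm leb O 2%:E f = n2 leb O f.
Proof. by move=> [_ fi]; rewrite /Lp_norm eLp_norm_n2. Qed.

Lemma Lp_integrable p f : (leb O < +oo)%E -> (1%:E <= p)%E -> Lp leb O p f -> aei leb O f.
Proof.
move=> Ofin p1 h; have mf := Lp_measurable h.
have i1 (c : R) : aei leb O (fun=> c).
  apply: aei_int; apply/integrableP; split; first exact: measurable_cst.
  by rewrite integral_cst// lte_mul_pinfty.
case: p p1 h => [p| |] // p1 h.
  have ip := Lp_integrable_powR p1 h.
  apply: (aei_dom mO (aem_mfun leb mf) (aeiD mO (i1 1) ip)).
  (* The pointwise bound is [|f| <= 1 + |f|^p], integrable on a set of finite measure. *)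
  apply: aeD_all => x _; have [le1|gt1] := leP `|f x| 1.
    by rewrite (le_trans le1)// lerDl powR_ge0.
  by rewrite -[leLHS]powRr1// (le_trans (ler_powR (ltW gt1) p1))// lerDr.
have [M hM] : exists M : R, aeD leb O (fun x => `|f x| <= M).
  (* The norm at exponent [+oo] distinguishes whether the whole space is null; if it is, anything
     holds almost everywhere. *)
  have [T0|T0] := eqVneq (leb setT) 0%E.
    exists 0; exists setT; split => //.
  have T1 : (0 < leb setT)%E by rewrite lt_neqAle eq_sym T0 measure_ge0.
  move: h; rewrite /Lp /= inE => /andP[_]; rewrite !inE /= /finite_norm unlock T1.
  move=> /ess_supr_bounded[M hM]; exists M; rewrite /aeD; apply: filterS hM => x + Ox.
  by rewrite /= patchE mem_set.
exact: (aei_dom mO (aem_mfun leb mf) (i1 M)).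
Qed.

Lemma Lp_infty_bounded f : Lp leb O +oo%E f -> exists M : R, aeD leb O (fun x => `|f x| <= M).
Proof.
move=> h; have [T0|T0] := eqVneq (leb setT) 0%E.
  by exists 0; exists setT; split => //.
have T1 : (0 < leb setT)%E by rewrite lt_neqAle eq_sym T0 measure_ge0.
move: h; rewrite /Lp /= inE => /andP[_]; rewrite !inE /= /finite_norm unlock T1.
move=> /ess_supr_bounded[M hM]; exists M; rewrite /aeD; apply: filterS hM => x + Ox.
by rewrite /= patchE mem_set.
Qed.

(** Translates the embedding into [L^4] into the [L^2] calculus: the square of the function can then
    be paired with an [L^2] perturbation of the control. *)
Lemma L4_sqr f (M : R) : measurable_fun O f -> (eLp_norm leb O 4%:E f <= M%:E)%E ->
  [/\ 0 <= M, L2 leb O (fun x => f x ^+ 2) & n2 leb O (fun x => f x ^+ 2) <= M ^+ 2].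
Proof.
move=> mf; rewrite /eLp_norm unlock.
have -> : (\int[leb]_x (`|(EFin \o (f \_ O)) x| `^ 4) = \int[leb]_(x in O) (f x ^+ 4)%:E)%E.
  rewrite [RHS]integral_mkcond; apply: eq_integral => x _ /=; rewrite !patchE; case: ifP => _.
    by rewrite powR_mulrn// -[4%N]/(2 * 2)%N exprM normr_sqrE -exprM.
  by rewrite normr0 powR_mulrn// expr0n.
set X := (\int[leb]_(x in O) (f x ^+ 4)%:E)%E.
have X0 : (0 <= X)%E.
  by apply: integral_ge0 => x _; rewrite lee_fin -[4%N]/(2 * 2)%N exprM sqr_ge0.
have X4 : X = (\int[leb]_(x in O) (f x ^+ 2 * f x ^+ 2)%:E)%E.
  by apply: eq_integral => x _; rewrite -exprD.
case EX: X X0 => [e| |] // e0 h; last by move: h; rewrite poweRyr ?invr_neq0// leye_eq.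
have M0 : 0 <= M by rewrite -lee_fin; apply: le_trans h; exact: poweR_ge0.
have L2f : L2 leb O (fun x => f x ^+ 2).
  split; first exact: measurable_funX.
  apply: aei_int; apply/integrableP; split.
    by apply/measurable_EFinP; apply: measurable_funX; exact: measurable_funX.
  apply: (@le_lt_trans _ _ X); last by rewrite EX ltry.
  rewrite le_eqVlt; apply/orP; left; apply/eqP; apply: eq_integral => x _ /=.
  by rewrite ger0_norm ?sqr_ge0// -exprM.
split => //.
rewrite -(@ler_pXn2r _ 2)// ?nnegrE ?n2_ge0 ?sqr_ge0// n2_sqr.
have -> : ip leb O (fun x => f x ^+ 2) (fun x => f x ^+ 2) = e.
  by rewrite /ip /Rintegral -X4 EX.
move: h; rewrite poweR_EFin lee_fin => h.
have e0' : 0 <= e by rewrite -lee_fin.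
have -> : e = (e `^ 4^-1) ^+ 4 by rewrite -powR_mulrn ?powR_ge0// -powRrM mulVf// powRr1.
by rewrite -exprM lerXn2r ?nnegrE ?powR_ge0.
Qed.

End Lp_bridge.

(** * Sobolev functions and the elliptic bilinear form *)

Section weak_partials.
Context (R : realType) (n : nat) (O : set 'rV[R]_n) (oO : open O) (bO : bounded_set O).
Local Notation leb := (@lebesgue_rV R n).
Implicit Types (f g y v w : 'rV[R]_n -> R).
Local Notation L2 := (L2 leb O).
Local Notation n2 := (n2 leb O).
Local Notation ip := (ip leb O).
Local Notation aeO := (aeD leb O).
Local Notation I := (Rintegral leb O).
Local Notation wp := (weak_partial O).

Let mO : measurable O := open_measurable_mx oO.
Let Ofin : (leb O < +oo)%E := lebesgue_bounded_fin mO bO.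

Lemma test_L2 psi : test_function O psi -> L2 psi.
Proof.
move=> tpsi; have [M [_ hM]] := bO.
have Or x : O x -> `|x| <= `|M| + 1.
  by move=> Ox; apply: hM Ox; rewrite (le_lt_trans (ler_norm M))// ltrDl.
have r0 : 0 <= `|M| + 1 by rewrite addr_ge0.
have [K K0 hK] := test_lipschitz (`|M| + 1) tpsi.
apply: (L2_bounded mO Ofin (M := `|psi 0| + K * (`|M| + 1))); last first.
  apply: aeD_all => x /Or xr; rewrite -lerBlDl; apply: (le_trans (lerB_dist _ _)).
  have := hK 0 x; rewrite normr0 => /(_ r0 xr) /le_trans; apply.
  by rewrite subr0 ler_wpM2l.
apply: within_continuous_measurable => //.
suff cx (x : 'rV[R]_n) : psi y @[y --> x] --> psi x by apply: continuous_subspaceT => x; exact: cx.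
apply/(@cvgrPdist_le _ _ _ _ (nbhs_filter x)) => e e0.
have [Kx K'0 hK'] := test_lipschitz (`|x| + 1) tpsi.
have e1 : 0 < Num.min 1 (e / (Kx + 1)) by rewrite lt_min ltr01 divr_gt0// ltr_wpDl.
apply/nbhs_ballP; exists (Num.min 1 (e / (Kx + 1))) => //= y.
rewrite -ball_normE /= lt_min => /andP[y1 y2].
have yx : `|y| <= `|x| + 1.
  have -> : y = x - (x - y) by rewrite opprB addrC subrK.
  by apply: (le_trans (ler_normB _ _)); rewrite lerD2l ltW.
have xx : `|x| <= `|x| + 1 by rewrite lerDl.
apply: (le_trans (hK' y x yx xx)).
rewrite (@le_trans _ _ (Kx * (e / (Kx + 1))))//; first by rewrite ler_wpM2l// ltW.
by rewrite mulrA ler_pdivrMr ?ltr_wpDl// mulrC ler_pM2l// lerDl.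
Qed.

Lemma test_partial_L2 psi i : test_function O psi -> L2 (partial i psi).
Proof.
move=> [_ cpsi _ _]; have [M [_ hM]] := bO.
have [K hK] := continuous_bounded_ball (M + 1) (cpsi i).
apply: (L2_bounded mO Ofin (M := K)).
  by apply: within_continuous_measurable => //; exact: continuous_subspaceT (cpsi i).
by apply: aeD_all => x Ox; apply: hK; apply: hM Ox; rewrite ltrDl.
Qed.

Lemma weak_partialE i y g : L2 y -> is_weak_partial O i y g <->
  L2 g /\ forall psi, test_function O psi -> ip y (partial i psi) = - ip g psi.
Proof.
move=> y2; split => -[/(Lp2P mO) g2 h]; split=> //; exact/(Lp2P mO).
Qed.

(** [weak_partial] is a chosen representative, so even its linearity holds only almost everywhere
    and rests on this consequence of the fundamental lemma. *)
Lemma weak_partial_unique i y g g' : L2 y ->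
  is_weak_partial O i y g -> is_weak_partial O i y g' -> aeO (fun x => g x = g' x).
Proof.
move=> y2 /(weak_partialE _ _ y2)[g2 hg] /(weak_partialE _ _ y2)[g'2 hg'].
have d2 : L2 (fun x => g x - g' x) by exact: L2B.
have : aeO (fun x => g x - g' x = 0).
  apply: (ae0_of_tests oO bO).
    apply: aei_integrable; first by case: d2.
    by have := L2M mO d2 (L2_cst mO Ofin 1); apply: aei_ae; apply: aeD_all => x _; rewrite mulr1.
  move=> psi tpsi; have p2 := test_L2 tpsi.
  rewrite -/(ip (fun x => g x - g' x) psi) ipBl// -[ip g psi]opprK -hg// hg'// opprK subrr//.
by apply: aeD1 => x _ /eqP; rewrite subr_eq0 => /eqP.
Qed.

Lemma H1_L2 y : H1 O y -> L2 y. Proof. by case=> /(Lp2P mO). Qed.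

Lemma wpP i y : H1 O y -> is_weak_partial O i y (wp i y).
Proof. by case=> _ /(_ i) h; exact: xgetPex. Qed.

Lemma wp_L2 i y : H1 O y -> L2 (wp i y).
Proof. by move=> hy; have /(weak_partialE _ _ (H1_L2 hy))[] := wpP i hy. Qed.

Lemma is_weak_partial_lin i y y' g g' t : L2 y -> L2 y' ->
  is_weak_partial O i y g -> is_weak_partial O i y' g' ->
  is_weak_partial O i (fun x => y x + t * y' x) (fun x => g x + t * g' x).
Proof.
move=> y2 y'2 /(weak_partialE _ _ y2)[g2 hg] /(weak_partialE _ _ y'2)[g'2 hg'].
apply/weak_partialE; first exact: L2_lin.
split; first exact: L2_lin.
move=> psi tpsi; have p2 := test_L2 tpsi; have dp2 := test_partial_L2 i tpsi.
by rewrite !ip_linl// hg// hg'//; ring.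
Qed.

Lemma H1_lin y y' t : H1 O y -> H1 O y' -> H1 O (fun x => y x + t * y' x).
Proof.
move=> hy hy'; split; first by apply/(Lp2P mO); apply: L2_lin => //; exact: H1_L2.
move=> i; exists (fun x => wp i y x + t * wp i y' x).
by apply: is_weak_partial_lin; do ?[exact: H1_L2|exact: wpP].
Qed.

Lemma wp_lin i y y' t : H1 O y -> H1 O y' ->
  aeO (fun x => wp i (fun x => y x + t * y' x) x = wp i y x + t * wp i y' x).
Proof.
move=> hy hy'; apply: (@weak_partial_unique i (fun x => y x + t * y' x)).
- by apply: L2_lin => //; exact: H1_L2.
- by apply: wpP; exact: H1_lin.
- by apply: is_weak_partial_lin; do ?[exact: H1_L2|exact: wpP].
Qed.

Lemma is_weak_partial_eq i y y' g : (forall x, O x -> y x = y' x) ->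
  is_weak_partial O i y g -> is_weak_partial O i y' g.
Proof.
move=> yy [g2 hg]; split => // psi /hg <-; apply: Rint_ae; apply: aeD_all => x /yy ->//.
Qed.

Lemma H1_eq y y' : (forall x, O x -> y x = y' x) -> H1 O y -> H1 O y'.
Proof.
move=> yy hy; split.
  by apply/(Lp2P mO); apply: L2_eq (H1_L2 hy).
by move=> i; exists (wp i y); apply: is_weak_partial_eq yy _; exact: wpP.
Qed.

Lemma wp_eq i y y' : (forall x, O x -> y x = y' x) -> H1 O y ->
  aeO (fun x => wp i y x = wp i y' x).
Proof.
move=> yy hy; apply: (@weak_partial_unique i y'); first by apply: L2_eq yy (H1_L2 hy).
  by apply: is_weak_partial_eq yy _; exact: wpP.
by apply: wpP; exact: H1_eq hy.
Qed.

Lemma H1_0 : H1 O (fun=> 0).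
Proof.
split; first by apply/(Lp2P mO); exact: L2_0.
move=> i; exists (fun=> 0); apply/weak_partialE; first exact: L2_0.
split; first exact: L2_0.
have z f : ip (fun=> 0) f = 0.
  by rewrite /ip; under eq_Rintegral do rewrite mul0r; rewrite Rintegral_cst// mul0r.
by move=> psi _; rewrite !z oppr0.
Qed.

Lemma H1B y y' : H1 O y -> H1 O y' -> H1 O (fun x => y x - y' x).
Proof. by move=> hy hy'; apply: H1_eq (H1_lin (-1) hy hy') => x _; rewrite mulN1r. Qed.

Lemma H1_normE y : H1 O y -> H1_norm O y = Num.sqrt (n2 y ^+ 2 + \sum_i n2 (wp i y) ^+ 2).
Proof.
move=> hy; rewrite /H1_norm (Lp_norm_n2 mO (H1_L2 hy)); congr (Num.sqrt (_ + _)).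
by apply: eq_bigr => i _; rewrite (Lp_norm_n2 mO (wp_L2 i hy)).
Qed.

Lemma H1_norm_ge0 y : 0 <= H1_norm O y. Proof. exact: sqrtr_ge0. Qed.

Lemma H1_norm_sqr y : H1 O y -> H1_norm O y ^+ 2 = n2 y ^+ 2 + \sum_i n2 (wp i y) ^+ 2.
Proof.
move=> hy; rewrite H1_normE// sqr_sqrtr// addr_ge0 ?sqr_ge0//.
by apply: sumr_ge0 => i _; exact: sqr_ge0.
Qed.

Lemma n2_le_H1 y : H1 O y -> n2 y <= H1_norm O y.
Proof.
move=> hy; rewrite -(@ler_pXn2r _ 2)// ?nnegrE ?n2_ge0 ?H1_norm_ge0// H1_norm_sqr// lerDl.
by apply: sumr_ge0 => i _; exact: sqr_ge0.
Qed.

Lemma n2_wp_le_H1 y i : H1 O y -> n2 (wp i y) <= H1_norm O y.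
Proof.
move=> hy; rewrite -(@ler_pXn2r _ 2)// ?nnegrE ?n2_ge0 ?H1_norm_ge0// H1_norm_sqr//.
rewrite (bigD1 i)//= addrCA lerDl addr_ge0 ?sqr_ge0//.
by apply: sumr_ge0 => j _; exact: sqr_ge0.
Qed.

Section bilinear_form.
Context (B : 'rV[R]_n -> 'M[R]_n) (MB : R) (MB0 : 0 <= MB).
Hypothesis mB : forall i j, measurable_fun O (fun x => B x i j).
Hypothesis bB : forall i j, aeO (fun x => `|B x i j| <= MB).

Definition Aform (y v : 'rV[R]_n -> R) : R :=
  \int[leb]_(x in O) (\sum_i \sum_j B x i j * wp i y x * wp j v x).

Lemma aei_sum (J : Type) (r : seq J) (F : J -> 'rV[R]_n -> R) :
  (forall j, aei leb O (F j)) -> aei leb O (fun x => \sum_(j <- r) F j x).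
Proof.
move=> hF; elim: r => [|j r ih].
  have := aei0 leb O; apply: aei_ae; apply: aeD_all => x _; by rewrite big_nil.
have := aeiD mO (hF j) ih; apply: aei_ae; apply: aeD_all => x _; by rewrite big_cons.
Qed.

Lemma Rint_sum (J : Type) (r : seq J) (F : J -> 'rV[R]_n -> R) :
  (forall j, aei leb O (F j)) -> I (fun x => \sum_(j <- r) F j x) = \sum_(j <- r) I (F j).
Proof.
move=> hF; elim: r => [|j r ih].
  by rewrite big_nil; under eq_Rintegral do rewrite big_nil; rewrite Rintegral_cst// mul0r.
rewrite big_cons -ih -RintD//; last exact: aei_sum.
by apply: Rint_ae; apply: aeD_all => x _; rewrite big_cons.
Qed.

Lemma mulB_L2 i j f : L2 f -> L2 (fun x => B x i j * f x).
Proof.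
move=> f2; apply: (L2_dom mO _ (L2Z mO MB f2)).
  by apply: measurable_funM; [exact: mB|case: f2].
apply: aeD1 (bB i j) => x _ h; rewrite !normrM (ger0_norm MB0); exact: ler_wpM2r.
Qed.

Lemma n2_mulB i j f : L2 f -> n2 (fun x => B x i j * f x) <= MB * n2 f.
Proof.
move=> f2; rewrite -[X in X * _](ger0_norm MB0) -n2Z//.
apply: n2_le => //; [exact: mulB_L2|exact: L2Z|].
apply: aeD1 (bB i j) => x _ h; rewrite !normrM (ger0_norm MB0); exact: ler_wpM2r.
Qed.

Lemma AformE y v : H1 O y -> H1 O v ->
  Aform y v = \sum_i \sum_j ip (fun x => B x i j * wp i y x) (wp j v).
Proof.
move=> hy hv.
have h i j : aei leb O (fun x => B x i j * wp i y x * wp j v x).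
  by apply: (L2M mO) => //; [apply: mulB_L2|]; exact: wp_L2.
rewrite /Aform Rint_sum; last by move=> i; exact: aei_sum.
by apply: eq_bigr => i _; rewrite Rint_sum.
Qed.

Lemma Aform_linl y y' v t : H1 O y -> H1 O y' -> H1 O v ->
  Aform (fun x => y x + t * y' x) v = Aform y v + t * Aform y' v.
Proof.
move=> hy hy' hv; have hl := H1_lin t hy hy'.
rewrite !AformE// mulr_sumr -big_split /=; apply: eq_bigr => i _.
rewrite mulr_sumr -big_split /=; apply: eq_bigr => j _.
have a1 := mulB_L2 i j (wp_L2 i hy); have a2 := mulB_L2 i j (wp_L2 i hy').
rewrite -ip_linl//; last exact: wp_L2.
apply: ip_ae; last exact: aeD_all.
by apply: aeD1 (wp_lin i t hy hy') => x _ ->; ring.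
Qed.

Lemma Aform_linr y v v' t : H1 O y -> H1 O v -> H1 O v' ->
  Aform y (fun x => v x + t * v' x) = Aform y v + t * Aform y v'.
Proof.
move=> hy hv hv'; have hl := H1_lin t hv hv'.
rewrite !AformE// mulr_sumr -big_split /=; apply: eq_bigr => i _.
rewrite mulr_sumr -big_split /=; apply: eq_bigr => j _.
have a1 := mulB_L2 i j (wp_L2 i hy); have a2 := wp_L2 j hv; have a3 := wp_L2 j hv'.
rewrite -ip_linr//; apply: ip_ae; first exact: aeD_all.
exact: (wp_lin j t hv hv').
Qed.

Lemma Aform_bound y v : H1 O y -> H1 O v ->
  `|Aform y v| <= (n%:R ^+ 2 * MB) * H1_norm O y * H1_norm O v.
Proof.
move=> hy hv; rewrite AformE//.
have b i j : `|ip (fun x => B x i j * wp i y x) (wp j v)| <= MB * H1_norm O y * H1_norm O v.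
  have a1 := wp_L2 i hy; have a2 := wp_L2 j hv.
  apply: (le_trans (ip_cauchy_schwarz mO (mulB_L2 i j a1) a2)).
  apply: ler_pM; do ?exact: n2_ge0; last exact: n2_wp_le_H1.
  apply: (le_trans (n2_mulB i j a1)); apply: ler_wpM2l => //; exact: n2_wp_le_H1.
apply: (le_trans (ler_norm_sum _ _ _)).
apply: (@le_trans _ _ (\sum_(i < n) \sum_(j < n) MB * H1_norm O y * H1_norm O v)).
  apply: ler_sum => i _; apply: (le_trans (ler_norm_sum _ _ _)); exact: ler_sum.
by rewrite !sumr_const !card_ord -mulrnA -[leLHS]mulr_natl natrM expr2 !mulrA.
Qed.

End bilinear_form.

Lemma Aform_adjoint (B : 'rV[R]_n -> 'M[R]_n) y v :
  Aform (adjoint_coef B) y v = Aform B v y.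
Proof.
apply: Rint_ae; apply: aeD_all => x _.
rewrite exchange_big; apply: eq_bigr => i _; apply: eq_bigr => j _.
have -> : adjoint_coef B x j i = B x i j by rewrite /adjoint_coef mxE.
exact: mulrAC.
Qed.

Lemma Aform_coercive (B : 'rV[R]_n -> 'M[R]_n) (LamA : R) y : H1 O y -> 
  (aei leb O (fun x => \sum_i \sum_j B x i j * wp i y x * wp j y x)) ->
  aeO (fun x => forall xi : 'rV[R]_n, LamA * enorm xi ^+ 2 <= \sum_i \sum_j B x i j * xi 0 i * xi 0 j) ->
  LamA * \sum_i n2 (wp i y) ^+ 2 <= Aform B y y.
Proof.
move=> hy ia co.
have -> : LamA * \sum_i n2 (wp i y) ^+ 2 = I (fun x => LamA * \sum_i wp i y x * wp i y x).
  rewrite RintZ//; last by apply: aei_sum => i; apply: (L2M mO); exact: wp_L2.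
  rewrite Rint_sum; last by move=> i; apply: (L2M mO); exact: wp_L2.
  by congr (_ * _); apply: eq_bigr => i _; rewrite n2_sqr.
apply: Rint_le => //.
  by apply: aeiZ => //; apply: aei_sum => i; apply: (L2M mO); exact: wp_L2.
apply: aeD1 co => x _ /(_ (\row_i wp i y x)).
rewrite /enorm sqr_sqrtr; last by apply: sumr_ge0 => i _; exact: sqr_ge0.
under eq_bigr do rewrite mxE expr2.
by under [X in _ <= X -> _]eq_bigr do under eq_bigr do rewrite !mxE.
Qed.

End weak_partials.

(** * Hölder functions and derivatives of the control-to-state maps *)

Section arzela_ascoli.
Context (R : realType) (n : nat).

Lemma prod_near_finite (k : prod_topology (fun _ : 'rV[R]_n => R)) (s : seq 'rV[R]_n) (e : R) :
  0 < e -> nbhs k [set f : prod_topology (fun _ : 'rV[R]_n => R) | forall x, x \in s -> `|k x - f x| < e].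
Proof.
move=> e0; elim: s => [|a s ih].
  by apply: filterS (filterT (F := nbhs k)) => f _ x; rewrite in_nil.
have h1 : nbhs k [set f : prod_topology (fun _ : 'rV[R]_n => R) | `|k a - f a| < e].
  have h := @proj_continuous _ (fun _ : 'rV[R]_n => R) a k _ (nbhsx_ballx (k a) e e0).
  apply: (@filterS _ _ (nbhs_filter k) ((fun f => f a) @^-1` ball (k a) e)); last exact: h.
  by move=> f; rewrite /preimage /= -ball_normE.
apply: filterS2 h1 ih => f fa fs x; rewrite inE => /orP[/eqP -> //|]; exact: fs.
Qed.

(** The Arzelà-Ascoli theorem in terms of cluster points: Tychonoff's theorem gives a pointwise one
    in a product of segments, equicontinuity passes to it, and a finite net of [C] upgrades
    closeness at finitely many points to uniform closeness. *)
Lemma equicontinuous_cluster (C : set 'rV[R]_n) (v : nat -> 'rV[R]_n -> R) (M : R) :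
  compact C -> (forall m x, C x -> `|v m x| <= M) ->
  (forall e : R, 0 < e -> exists2 del : R, 0 < del & forall m x z, C x -> C z -> `|x - z| < del ->
     `|v m x - v m z| <= e) ->
  exists k : 'rV[R]_n -> R, forall e : R, 0 < e -> forall N, exists2 m, (N <= m)%N &
    forall x, C x -> `|v m x - k x| <= e.
Proof.
move=> cC vM equi.
have [M0|M0] := ltP M 0.
  exists (fun=> 0) => e e0 N; exists N => // x Cx.
  by have := le_lt_trans (le_trans (normr_ge0 _) (vM N x Cx)) M0; rewrite ltxx.
pose A := fun _ : 'rV[R]_n => (`[- M, M]%classic : set R).
have cA := @tychonoff 'rV[R]_n (fun _ => R) A (fun _ => @segment_compact R (- M) M).
(* Extension by 0 puts every term in the product of the segments from [-M] to [M] over all points;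
   these contain 0 since [M] is now nonnegative. *)
pose w m : prod_topology (fun _ : 'rV[R]_n => R) := v m \_ C.
have FA : (w @ \oo) [set f : prod_topology (fun _ : 'rV[R]_n => R) | forall i, A i (f i)].
  exists 0%N => // m _ x; rewrite /A /= in_itv /= -ler_norml /w patchE.
  by case: ifPn => [/[1!inE] /vM //|_]; rewrite normr0.
have [k [Ak clk]] := cA _ (fmap_proper_filter w _) FA.
have near_k (t : seq 'rV[R]_n) (e : R) N : 0 < e -> exists2 m, (N <= m)%N &
    forall x, x \in t -> C x -> `|k x - v m x| < e.
  move=> e0; have h1 := prod_near_finite k t e0.
  have h2 : (w @ \oo) [set f | exists2 m, (N <= m)%N & f = w m].
    by exists N => // m /= Nm; exists m.
  have [f [[m Nm ->] hf]] := clk _ _ h2 h1.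
  by exists m => // x xt Cx; have := hf x xt; rewrite /w patchE mem_set.
have kequi (e : R) (del : R) : (forall m x z, C x -> C z -> `|x - z| < del -> `|v m x - v m z| <= e) ->
    forall x z, C x -> C z -> `|x - z| < del -> `|k x - k z| <= e.
  move=> h x z Cx Cz xz; apply/ler_addgt0Pl => eta eta0.
  have eta2 : 0 < eta / 2 by rewrite divr_gt0.
  have [m _ hm] := near_k [:: x; z] _ 0%N eta2.
  have a1 := hm x ltac:(by rewrite !inE eqxx) Cx.
  have a2 := hm z ltac:(by rewrite !inE eqxx orbT) Cz.
  have a3 := h m x z Cx Cz xz.
  have -> : k x - k z = (k x - v m x) + ((v m x - v m z) - (k z - v m z)) by ring.
  apply: (le_trans (ler_normD _ _)).
  have := ler_normB (v m x - v m z) (k z - v m z).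
  by lra.
exists k => e e0 N.
(* A third for the way from [x] to a net point along [v m], a third for the difference at the net
   point, and a third for the way back along [k]. *)
have e3 : 0 < e / 3 by rewrite divr_gt0.
have [del del0 hdel] := equi _ e3.
have cC' := cC; rewrite compact_cover in cC'.
have [D' D'C cov] : finite_subset_cover C (fun x => ball x del) C.
  apply: cC'; first by move=> x _; exact: ball_open.
  by move=> x Cx; exists x => //; exact: ballxx.
have [m Nm hm] := near_k (finmap.enum_fset D') _ N e3.
exists m => // x Cx; have [c cD' cx] := cov x Cx.
have Cc : C c by have := D'C c cD'; rewrite inE.
have xc : `|x - c| < del by move: cx; rewrite -ball_normE /= distrC.
have a1 := hdel m x c Cx Cc xc; have a2 := kequi _ _ hdel x c Cx Cc xc; have a3 := hm c cD' Cc.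
have -> : v m x - k x = (v m x - v m c) + (- (k c - v m c) - (k x - k c)) by ring.
apply: (le_trans (ler_normD _ _)).
have := ler_normB (- (k c - v m c)) (k x - k c); rewrite normrN.
by lra.
Qed.

End arzela_ascoli.

(** * Hölder functions on the closure of the domain *)

Section hoelder_elements.
Context (R : realType) (n : nat) (O : set 'rV[R]_n) (mu : R).
Hypotheses (oO : open O) (bO : bounded_set O) (On0 : O !=set0).
Local Notation clO := (closure O).
Implicit Types (y : 'rV[R]_n -> R) (x z : 'rV[R]_n).

(** One real constant for the supremum and for the quotient replaces the extended-valued
    [hoelder_norm] in estimates. *)
Definition hoelder_bound (M : R) y := (forall x, clO x -> `|y x| <= M) /\
  forall x z, clO x -> clO z -> `|y x - y z| / enorm (x - z) `^ mu <= M.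

Lemma enorm_ge0 (x : 'rV[R]_n) : 0 <= enorm x. Proof. exact: sqrtr_ge0. Qed.

Lemma hoelder_fin_bound y : (hoelder_norm O mu y < +oo)%E ->
  hoelder_bound (fine (hoelder_norm O mu y)) y.
Proof.
have [x0 Ox0] := On0; have cx0 : clO x0 by exact: subset_closure.
rewrite /hoelder_norm; set a := ereal_sup _; set b := ereal_sup _ => h.
have a0 : (0 <= a)%E.
  by apply: (@le_trans _ _ `|y x0|%:E); [rewrite lee_fin|apply: ereal_sup_ubound; exists x0].
have b0 : (0 <= b)%E.
  apply: (@le_trans _ _ (`|y x0 - y x0| / enorm (x0 - x0) `^ mu)%:E).
    by rewrite lee_fin divr_ge0// powR_ge0.
  by apply: ereal_sup_ubound; exists x0 => //; exists x0.
have af : a \is a fin_num by rewrite ge0_fin_numE//; apply: le_lt_trans h; rewrite leeDl.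
have bf : b \is a fin_num by rewrite ge0_fin_numE//; apply: le_lt_trans h; rewrite leeDr.
rewrite fineD//; have fa0 := fine_ge0 a0; have fb0 := fine_ge0 b0.
split=> [x cx|x z cx cz].
  apply: (@le_trans _ _ (fine a)); last by rewrite lerDl.
  by rewrite -lee_fin fineK//; apply: ereal_sup_ubound; exists x.
apply: (@le_trans _ _ (fine b)); last by rewrite lerDr.
by rewrite -lee_fin fineK//; apply: ereal_sup_ubound; exists x => //; exists z.
Qed.

Lemma hoelder_bound_fin (M : R) y : hoelder_bound M y ->
  (hoelder_norm O mu y < +oo)%E.
Proof.
move=> [h1 h2]; apply: (@le_lt_trans _ _ (M%:E + M%:E)%E); last by rewrite -EFinD ltry.
apply: leeD; apply: ge_ereal_sup.
  by move=> _ [x cx <-]; rewrite lee_fin h1.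
by move=> _ [x cx [z cz <-]]; rewrite lee_fin h2.
Qed.

Lemma hoelder_norm_fine_ge0 y : (hoelder_norm O mu y < +oo)%E -> 0 <= fine (hoelder_norm O mu y).
Proof.
move=> /hoelder_fin_bound[h _]; have [x0 Ox0] := On0.
exact: le_trans (normr_ge0 _) (h x0 (subset_closure Ox0)).
Qed.

Lemma hoelder_bound_lin y (z : 'rV[R]_n -> R) (M N t : R) : hoelder_bound M y -> hoelder_bound N z ->
  hoelder_bound (M + `|t| * N) (fun x => y x + t * z x).
Proof.
move=> [y1 y2] [z1 z2]; split=> [x cx|x x' cx cx'].
  by apply: (le_trans (ler_normD _ _)); rewrite normrM lerD ?y1// ler_wpM2l ?z1.
have -> : y x + t * z x - (y x' + t * z x') = (y x - y x') + t * (z x - z x') by ring.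
apply: (@le_trans _ _ ((`|y x - y x'| + `|t| * `|z x - z x'|) / enorm (x - x') `^ mu)).
  apply: ler_wpM2r; first by rewrite invr_ge0 powR_ge0.
  by apply: (le_trans (ler_normD _ _)); rewrite normrM.
by rewrite mulrDl -mulrA lerD ?y2// ler_wpM2l ?z2.
Qed.

Local Notation el := (elements (H1C_space O mu)).
Local Notation nH := (@nrm R (H1C_space O mu)).

Lemma elH1 y : el y -> H1 O y. Proof. by case. Qed.

Lemma el_lin y (z : 'rV[R]_n -> R) (t : R) : el y -> el z -> el (fun x => y x + t * z x).
Proof.
move=> [hy fy] [hz fz]; split; first exact: H1_lin.
exact: hoelder_bound_fin (hoelder_bound_lin t (hoelder_fin_bound fy) (hoelder_fin_bound fz)).
Qed.

Lemma el_eq y (z : 'rV[R]_n -> R) : (forall x, y x = z x) -> el y -> el z.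
Proof. by move=> /funext ->. Qed.

Lemma elB y (z : 'rV[R]_n -> R) : el y -> el z -> el (fun x => y x - z x).
Proof. by move=> hy hz; apply: el_eq (el_lin (-1) hy hz) => x; rewrite mulN1r. Qed.

Lemma nH_ge0 y : el y -> 0 <= nH y.
Proof. by move=> [_ fy]; rewrite /= addr_ge0 ?H1_norm_ge0// hoelder_norm_fine_ge0. Qed.

Lemma H1_norm_le_nH y : el y -> H1_norm O y <= nH y.
Proof. by move=> [_ fy]; rewrite /= lerDl hoelder_norm_fine_ge0. Qed.

Lemma nH_bound y : el y -> hoelder_bound (nH y) y.
Proof.
move=> [_ fy]; have [h1 h2] := hoelder_fin_bound fy.
have le : fine (hoelder_norm O mu y) <= nH y by rewrite /= lerDr H1_norm_ge0.
by split=> [x cx|x z cx cz]; apply: le_trans le; [exact: h1|exact: h2].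
Qed.

Lemma sup_le_nH y x : el y -> clO x -> `|y x| <= nH y.
Proof. by move=> /nH_bound[h _]; exact: h. Qed.

Lemma enorm_le (x : 'rV[R]_n) : enorm x <= n%:R * `|x|.
Proof.
have nx : 0 <= n%:R * `|x| by rewrite mulr_ge0.
rewrite -[leRHS](ger0_norm nx) -sqrtr_sqr ler_wsqrtr//.
apply: (@le_trans _ _ (\sum_(i < n) `|x| ^+ 2)).
  by apply: ler_sum => i _; rewrite -normr_sqrE lerXn2r ?nnegrE// coord_le_norm.
rewrite sumr_const card_ord -[leLHS]mulr_natl exprMn; apply: ler_wpM2r; first exact: sqr_ge0.
by rewrite expr2 -natrM ler_nat; case: (posnP n) => [->//|n0]; exact: leq_pmull.
Qed.

Lemma enorm_eq0 (x : 'rV[R]_n) : enorm x = 0 -> x = 0.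
Proof.
move=> /eqP; rewrite sqrtr_eq0 => h; apply/rowP => i; rewrite mxE.
apply/eqP; rewrite -sqrf_eq0 eq_le sqr_ge0 andbT; apply: le_trans h.
by rewrite (bigD1 i)//= lerDl; apply: sumr_ge0 => j _; exact: sqr_ge0.
Qed.

Lemma hoelder_bound_dist y (M : R) x z : hoelder_bound M y -> clO x -> clO z ->
  `|y x - y z| <= M * enorm (x - z) `^ mu.
Proof.
move=> [_ h] cx cz; have [xz|xz] := eqVneq (enorm (x - z)) 0.
  have /eqP := enorm_eq0 xz; rewrite subr_eq0 => /eqP ->.
  by rewrite !subrr normr0 mulr_ge0 ?powR_ge0//; apply: le_trans (h x x cx cx); rewrite subrr normr0 mul0r.
have e0 : 0 < enorm (x - z) by rewrite lt_neqAle eq_sym xz enorm_ge0.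
by rewrite -ler_pdivrMr ?powR_gt0//; exact: h.
Qed.

Hypothesis mu0 : 0 < mu.

Lemma hoelder_equi (M e : R) : 0 <= M -> 0 < e -> exists2 del : R, 0 < del &
  forall y x z, hoelder_bound M y -> clO x -> clO z -> `|x - z| < del -> `|y x - y z| <= e.
Proof.
move=> M0 e0; have c0 : 0 < e / (M + 1) by rewrite divr_gt0// ltr_wpDl.
have d0 : 0 < (e / (M + 1)) `^ mu^-1 by rewrite powR_gt0.
(* Inverts [M t^mu <= e], with [M + 1] in case [M] is 0; the factor [n + 1] pays for passing from
   the maximum norm to [enorm]. *)
exists ((e / (M + 1)) `^ mu^-1 / (n%:R + 1)); first by rewrite divr_gt0// ltr_wpDl.
move=> y x z hy cx cz xz; apply: (le_trans (hoelder_bound_dist hy cx cz)).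
have h1 : enorm (x - z) <= (e / (M + 1)) `^ mu^-1.
  apply: (le_trans (enorm_le _)).
  move: xz; rewrite ltr_pdivlMr ?ltr_wpDl// => /ltW; apply: le_trans.
  by rewrite mulrC ler_wpM2l// lerDl.
have h2 : enorm (x - z) `^ mu <= e / (M + 1).
  apply: (@le_trans _ _ (((e / (M + 1)) `^ mu^-1) `^ mu)).
    by apply: ge0_ler_powR; rewrite ?nnegrE ?enorm_ge0 ?(ltW mu0) ?(ltW d0).
  by rewrite -powRrM mulVf ?gt_eqF// powRr1// ltW.
apply: (le_trans (ler_wpM2l M0 h2)).
by rewrite mulrA ler_pdivrMr ?ltr_wpDl// mulrC ler_pM2l// lerDl.
Qed.

Lemma closure_bounded_compact : compact clO.
Proof.
have [M [Mr hM]] := bO.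
apply: bounded_closed_compact; last exact: closed_closure.
exists M; split => // r Mr' x cx /=; rewrite leNgt; apply/negP => rx.
have xr0 : 0 < `|x| - r by rewrite subr_gt0.
have [y [Oy xy]] := cx _ (nbhsx_ballx x _ xr0).
have := hM r Mr' y Oy; move: xy; rewrite -ball_normE /= => xy yr.
by have := ler_normD (x - y) y; rewrite subrK; lra.
Qed.

Lemma el_continuous y : el y -> {within clO, continuous y}.
Proof.
move=> ye; have hb := nH_bound ye; have M0 := nH_ge0 ye.
apply/continuousP => V oV; apply/open_subspaceP.
pose W := \bigcup_(p in [set p : 'rV[R]_n * {posnum R} | clO p.1 /\
   forall z, clO z -> ball p.1 p.2%:num z -> V (y z)]) ball p.1 p.2%:num.
exists W; first by apply: bigcup_open => p _; exact: ball_open.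
apply/seteqP; split => x [h cx]; split => //.
  by case: h => p [_ hp] px; exact: hp.
have /nbhs_ballP[e /= e0 he] : nbhs (y x) V by exact: open_nbhs_nbhs.
have e2 : 0 < e / 2 by rewrite divr_gt0.
have [del del0 hd] := hoelder_equi M0 e2.
exists (x, PosNum del0) => /=; last exact: ballxx.
split => // z cz xz; apply: he; rewrite -ball_normE /=.
have := hd y x z hb cx cz; move: xz; rewrite -ball_normE /= => xz /(_ xz) h1.
by apply: le_lt_trans h1 _; lra.
Qed.

(** The constant sequence [y] is an admissible approximation in [is_trace]. *)
Lemma continuous_trace y : H1 O y -> {within clO, continuous y} -> is_trace O y y.
Proof.
move=> hy cy.
have mcl : measurable clO.
  rewrite -[clO]setCK; apply: measurableC; apply: open_measurable_mx.
  by apply: closed_openC; exact: closed_closure.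
split.
  apply: (@measurable_funS _ _ _ _ clO) => //; first by move=> x [].
  exact: within_continuous_measurable.
exists (fun=> y); split => //.
- rewrite (_ : y \- y = fun=> 0); last by apply/funext => x; rewrite /= subrr.
  rewrite (_ : H1_norm O (fun=> 0) = 0); first exact: cvg_cst.
  have h0 := H1_0 oO; have mO := open_measurable_mx oO.
  rewrite (H1_normE oO h0).
  have z : n2 (@lebesgue_rV R n) O (fun=> 0) = 0.
    by rewrite /n2 /ip; under eq_Rintegral do rewrite mulr0; rewrite Rintegral_cst// mul0r sqrtr0.
  rewrite z expr0n add0r big1 ?sqrtr0// => i _.
  rewrite (n2_ae (g := fun=> 0)) ?z ?expr0n//.
  have := wp_lin oO bO i (-1) h0 h0.
  rewrite (_ : (fun x => 0 + -1 * 0) = fun=> 0); last by apply/funext => x; rewrite mulr0 addr0.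
  by apply: aeD1 => x _ ->; rewrite mulN1r subrr.
- rewrite (_ : y \- y = fun=> 0); last by apply/funext => x; rewrite /= subrr.
  rewrite (_ : eLp_norm _ _ _ _ = 0%E); first exact: cvg_cst.
  rewrite /eLp_norm (_ : EFin \o _ = cst 0%E) ?Lnorm0//.
  by apply/funext => x /=; rewrite patchE; case: ifP.
Qed.

Lemma within_continuous_bounded y : {within clO, continuous y} ->
  exists2 M : R, 0 <= M & forall x, O x -> `|y x| <= M.
Proof.
move=> cy; have : compact (y @` clO).
  by apply: continuous_compact => //; exact: closure_bounded_compact.
move=> /compact_bounded[M [_ hM]]; exists (`|M| + 1); first by rewrite addr_ge0.
move=> x Ox; apply: hM; first by rewrite (le_lt_trans (ler_norm M))// ltrDl.
by exists x => //; exact: subset_closure.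
Qed.

End hoelder_elements.

(** * The concrete content of the Fréchet derivatives *)

Section frechet_facts.
Context (R : realType) (n : nat) (O : set 'rV[R]_n) (mu : R).
Hypotheses (oO : open O) (bO : bounded_set O) (On0 : O !=set0).
Local Notation leb := (@lebesgue_rV R n).
Local Notation clO := (closure O).
Local Notation fT := ('rV[R]_n -> R).
Local Notation X := (L2_space O).
Local Notation Y := (H1C_space O mu).
Local Notation el := (elements (H1C_space O mu)).
Local Notation nH := (@nrm R (H1C_space O mu)).
Local Notation L2 := (L2 leb O).
Local Notation n2 := (n2 leb O).

Let mO : measurable O := open_measurable_mx oO.

(** What is used of a derivative, freed from operator norms. A function of seminorm 0 in the Hölder
    space vanishes on the closure, so linearity up to seminorm 0 becomes pointwise there. Both [G]
    and [Phi] provide such facts. *)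
Record frechet_facts (U : set fT) (F : fT -> fT) (DF : fT -> fT -> fT) : Prop := {
  ff_el : forall u v, U u -> L2 v -> el (DF u v) ;
  ff_bound : forall u, U u -> exists2 K : R, 0 <= K & forall v, L2 v -> nH (DF u v) <= K * n2 v ;
  ff_lin : forall u f g (t : R), U u -> L2 f -> L2 g -> forall x, clO x ->
    DF u (fun x => f x + t * g x) x = DF u f x + t * DF u g x ;
  ff_diff : forall u, U u -> forall e : R, 0 < e -> exists2 r : R, 0 < r &
    forall v, L2 v -> n2 v < r ->
      nH (fun x => F (fun x => u x + v x) x - F u x - DF u v x) <= e * n2 v ;
  ff_cont : forall u, U u -> forall e : R, 0 < e -> exists2 r : R, 0 < r &
    forall u', U u' -> n2 (fun x => u' x - u x) < r ->
    forall v, L2 v -> forall x, clO x -> `|DF u' v x - DF u v x| <= e * n2 v }.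

Lemma hoelder_norm_le (M : R) (y : fT) : hoelder_bound O mu M y -> fine (hoelder_norm O mu y) <= M + M.
Proof.
move=> h; have fin := hoelder_bound_fin h; have [h1 h2] := h.
have f : hoelder_norm O mu y \is a fin_num.
  rewrite ge0_fin_numE//; have [x0 Ox0] := On0; have cx0 : clO x0 by exact: subset_closure.
  apply: adde_ge0; apply: ereal_sup_ge.
    by exists `|y x0|%:E; [exists x0|rewrite lee_fin].
  exists (`|y x0 - y x0| / enorm (x0 - x0) `^ mu)%:E; first by exists x0 => //; exists x0.
  by rewrite lee_fin divr_ge0// powR_ge0.
rewrite -lee_fin fineK// EFinD.
apply: leeD; apply: ge_ereal_sup.
  by move=> _ [x cx <-]; rewrite lee_fin h1.
by move=> _ [x cx [z cz <-]]; rewrite lee_fin h2.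
Qed.

(** The squares are compared term by term through [(b + c)^2 <= 2 b^2 + 2 c^2]. The factor is
    harmless, because the estimate only serves to show that the suprema in operator norms are
    finite. *)
Lemma H1_norm_quasi (y z : fT) : H1 O y -> H1 O z ->
  H1_norm O (fun x => y x - z x) <= 2 * (H1_norm O y + H1_norm O z).
Proof.
move=> hy hz; have hd := H1B oO bO hy hz.
have q (f g : fT) : L2 f -> L2 g -> n2 (fun x => f x - g x) ^+ 2 <= 2 * n2 f ^+ 2 + 2 * n2 g ^+ 2.
  move=> f2 g2; have := n2_triB mO f2 g2; have := n2_ge0 leb O f; have := n2_ge0 leb O g.
  have := n2_ge0 leb O (fun x => f x - g x).
  set a := n2 _; set b := n2 f; set c := n2 g => a0 c0 b0 abc.
  have : a ^+ 2 <= (b + c) ^+ 2 by rewrite lerXn2r// nnegrE addr_ge0.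
  by have := sqr_ge0 (b - c); nra.
have y0 := H1_norm_ge0 O y; have z0 := H1_norm_ge0 O z.
have : H1_norm O (fun x => y x - z x) ^+ 2 <= 2 * H1_norm O y ^+ 2 + 2 * H1_norm O z ^+ 2.
  have aux (D2 Y2 Z2 a b c d' e f : R) : D2 = a + b -> Y2 = c + d' -> Z2 = e + f ->
      a <= 2 * c + 2 * e -> b <= 2 * d' + 2 * f -> D2 <= 2 * Y2 + 2 * Z2.
    by move=> -> -> ->; lra.
  apply: (aux _ _ _ _ _ _ _ _ _ (H1_norm_sqr oO hd) (H1_norm_sqr oO hy) (H1_norm_sqr oO hz)).
    by apply: q; exact: H1_L2.
  have sum_quasi (F a b : 'I_n -> R) : (forall i, F i <= 2 * a i + 2 * b i) ->
      \sum_i F i <= 2 * (\sum_i a i) + 2 * (\sum_i b i).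
    by move=> h; rewrite !mulr_sumr -big_split /=; apply: ler_sum => i _.
  apply: sum_quasi => i.
  rewrite (n2_ae (g := fun x => weak_partial O i y x - weak_partial O i z x)).
    by apply: q; exact: wp_L2.
  have := wp_lin oO bO i (-1) hy hz.
  rewrite (_ : (fun x => y x + -1 * z x) = (fun x => y x - z x)).
    by apply: aeD1 => x _ ->; rewrite mulN1r.
  by apply/funext => x; rewrite mulN1r.
move: (H1_norm_ge0 O (fun x => y x - z x)) y0 z0.
move: (H1_norm O (fun x => _)) (H1_norm O y) (H1_norm O z) => c a b c0 a0 b0 h.
rewrite -(@ler_pXn2r _ 2)// ?nnegrE//; last by rewrite mulr_ge0// addr_ge0.
have ab : 0 <= a * b by exact: mulr_ge0.
by apply: (le_trans h); nra.
Qed.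

Lemma nH_quasi (y z : fT) : el y -> el z -> nH (fun x => y x - z x) <= 4 * (nH y + nH z).
Proof.
move=> ye ze; have h1 := H1_norm_quasi (elH1 ye) (elH1 ze).
have hb := hoelder_bound_lin (-1) (nH_bound On0 ye) (nH_bound On0 ze).
have h2 : fine (hoelder_norm O mu (fun x => y x - z x)) <= (nH y + nH z) + (nH y + nH z).
  rewrite (_ : (fun x => y x - z x) = (fun x => y x + -1 * z x)); last first.
    by apply/funext => x; rewrite mulN1r.
  by move: hb; rewrite normrN1 mul1r; exact: hoelder_norm_le.
have := H1_norm_le_nH On0 ye; have := H1_norm_le_nH On0 ze.
have -> : nH (fun x => y x - z x) = H1_norm O (fun x => y x - z x) + fine (hoelder_norm O mu (fun x => y x - z x)).
  by [].
move: h1 h2; move: (H1_norm O (fun x => _)) (H1_norm O y) (H1_norm O z) (nH y) (nH z) (fine _).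
by move=> a b c d' e f; lra.
Qed.

Lemma X_elP (v : fT) : elements X v <-> L2 v. Proof. exact: Lp2P. Qed.

Lemma X_nrm (v : fT) : L2 v -> @nrm R X v = n2 v. Proof. exact: Lp_norm_n2. Qed.

Lemma bl_el (T : fT -> fT) v : @bounded_linear R X Y T -> L2 v -> el (T v).
Proof. by move=> [h _ _] /X_elP /h. Qed.

Lemma bl_bound (T : fT -> fT) : @bounded_linear R X Y T ->
  exists2 K : R, 0 <= K & forall v, L2 v -> nH (T v) <= K * n2 v.
Proof.
move=> [h _ [K hK]]; exists `|K| => // v v2.
have := hK v ((X_elP v).2 v2); rewrite X_nrm// => /le_trans; apply.
by apply: ler_wpM2r; [exact: n2_ge0|exact: ler_norm].
Qed.

Lemma bl_lin (T : fT -> fT) f g (t : R) x : @bounded_linear R X Y T -> L2 f -> L2 g -> clO x ->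
  T (fun x => f x + t * g x) x = T f x + t * T g x.
Proof.
move=> hT f2 g2 cx; have [_ h _] := hT.
have := h t g f ((X_elP _).2 g2) ((X_elP _).2 f2).
have -> : (t *: (g : X) + (f : X)) = (fun x => f x + t * g x).
  by apply/funext => z; rewrite addrC.
have -> : T (fun x => f x + t * g x) - (t *: (T g : Y) + (T f : Y)) =
    (fun x => T (fun x => f x + t * g x) x - (T f x + t * T g x)).
  by apply/funext => z; rewrite (addrC (T f z)).
move=> h0; have e : el (fun x => T (fun x => f x + t * g x) x - (T f x + t * T g x)).
  apply: elB => //; first by apply: bl_el => //; exact: L2_lin.
  by apply: el_lin => //; exact: bl_el.
have := sup_le_nH On0 e cx; rewrite h0 normr_le0 subr_eq0 => /eqP //.
Qed.

(** The operator norm is a real [sup], which dominates its elements only when the set is bounded;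
    this is what [B] is for. *)
Lemma op_nrm_ge (T : fT -> fT) (B : R) : (forall w, L2 w -> n2 w <= 1 -> nH (T w) <= B) ->
  forall w, L2 w -> n2 w <= 1 -> nH (T w) <= @nrm R (op_space X Y) T.
Proof.
move=> hB w w2 w1; apply: ub_le_sup.
  exists B => _ [v [/X_elP v2 v1] <-]; apply: hB => //; by rewrite -X_nrm.
by exists w => //; split; [exact/X_elP|rewrite X_nrm].
Qed.

(** By homogeneity. A direction of seminorm 0 cannot be normalized, but its images vanish on the
    closure. *)
Lemma sup_scale (A B : fT -> fT) (e : R) :
  @bounded_linear R X Y A -> @bounded_linear R X Y B -> 0 <= e ->
  (forall w, L2 w -> n2 w <= 1 -> forall x, clO x -> `|A w x - B w x| <= e) ->
  forall v, L2 v -> forall x, clO x -> `|A v x - B v x| <= e * n2 v.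
Proof.
move=> hA hB e0 h v v2 x cx.
have [v0|v0] := eqVneq (n2 v) 0.
  rewrite v0 mulr0.
  have z T : @bounded_linear R X Y T -> T v x = 0.
    move=> hT; have [K _ hK] := bl_bound hT.
    have := sup_le_nH On0 (bl_el hT v2) cx; have := hK v v2; rewrite v0 mulr0 => k1 k2.
    by apply/eqP; rewrite -normr_le0; exact: le_trans k2 k1.
  by rewrite !z// subrr normr0.
have vp : 0 < n2 v by rewrite lt_neqAle eq_sym v0 n2_ge0.
pose w x := (n2 v)^-1 * v x.
have w2 : L2 w by exact: L2Z.
have w1 : n2 w <= 1 by rewrite n2Z// gtr0_norm ?invr_gt0// mulVf// gt_eqF.
have vw : v = (fun x => 0 + n2 v * w x).
  by apply/funext => z; rewrite add0r /w mulrA divff// mul1r.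
have E T : @bounded_linear R X Y T -> T v x = n2 v * T w x.
  move=> hT; rewrite {1}vw (bl_lin (n2 v) hT (L2_0 leb O) w2 cx).
  have := bl_lin (-1) hT (L2_0 leb O) (L2_0 leb O) cx.
  rewrite (_ : (fun=> 0 + -1 * 0) = fun=> 0); last by apply/funext => z; rewrite mulr0 addr0.
  by move=> e'; lra.
by rewrite !E// -mulrBr normrM gtr0_norm// mulrC ler_wpM2r// ?h// ltW.
Qed.

Lemma frechet_diff (F : X -> Y) u (T : op_space X Y) : frechet_derivative F u T ->
  forall e : R, 0 < e -> exists2 r : R, 0 < r & forall v, L2 v -> n2 v < r ->
    nH (fun x => F (fun x => u x + v x) x - F u x - T v x) <= e * n2 v.
Proof.
move=> [_ h] e e0; have [r r0 hr] := h e e0; exists r => // v v2 vr.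
by have := hr v ((X_elP v).2 v2); rewrite X_nrm// => /(_ vr).
Qed.

Lemma facts_cont (DF : fT -> fT -> fT) (U : set fT) u :
  (forall w, U w -> L2 w) -> (forall w, U w -> @bounded_linear R X Y (DF w)) -> U u ->
  (forall e : R, 0 < e -> exists2 r : R, 0 < r & forall u', U u' -> n2 (fun x => u' x - u x) < r ->
    forall w, L2 w -> n2 w <= 1 -> forall x, clO x -> `|DF u' w x - DF u w x| <= e) ->
  forall e : R, 0 < e -> exists2 r : R, 0 < r & forall u', U u' -> n2 (fun x => u' x - u x) < r ->
    forall v, L2 v -> forall x, clO x -> `|DF u' v x - DF u v x| <= e * n2 v.
Proof.
move=> U2 bl Uu h e e0; have [r r0 hr] := h e e0; exists r => // u' Uu' ur.
by apply: sup_scale (bl _ Uu') (bl _ Uu) (ltW e0) _ => w w2 w1 x cx; exact: hr.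
Qed.

Lemma op_sub_bound (A B : fT -> fT) : @bounded_linear R X Y A -> @bounded_linear R X Y B ->
  exists K : R, forall w, L2 w -> n2 w <= 1 -> nH (fun x => A w x - B w x) <= K.
Proof.
move=> hA hB; have [K K0 hK] := bl_bound hA; have [K' K'0 hK'] := bl_bound hB.
exists (4 * (K + K')) => w w2 w1.
apply: (le_trans (nH_quasi (bl_el hA w2) (bl_el hB w2))); apply: ler_wpM2l => //; apply: lerD.
  by apply: (le_trans (hK w w2)); rewrite ler_piMr.
by apply: (le_trans (hK' w w2)); rewrite ler_piMr.
Qed.

Lemma C1_facts (U : set X) (F : X -> Y) (DF : X -> op_space X Y) :
  (forall w : fT, U w -> L2 w) ->
  derivative_on U F DF -> continuous_in U DF -> frechet_facts U F DF.
Proof.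
move=> U2 dF cF; have bl u : U u -> @bounded_linear R X Y (DF u) by move=> /dF[].
split=> [u v Uu v2|u Uu|u f g t Uu f2 g2 x cx|u Uu|u Uu].
- exact: bl_el (bl u Uu) v2.
- exact: bl_bound (bl u Uu).
- exact: bl_lin (bl u Uu) f2 g2 cx.
- exact: frechet_diff (dF u Uu).
apply: (facts_cont U2 bl Uu) => e e0; have [r r0 hr] := cF u Uu e e0; exists r => // u' Uu' ur w w2 w1 x cx.
have d2 : L2 (fun x => u' x - u x) by apply: L2B => //; exact: U2.
have := hr u' Uu'; rewrite -(X_nrm d2) in ur; move=> /(_ ur) lt.
have [K hK] := op_sub_bound (bl u' Uu') (bl u Uu).
apply: le_trans (ltW lt); apply: le_trans (op_nrm_ge hK w2 w1).
by apply: (sup_le_nH On0 _ cx); apply: elB => //; [exact: bl_el (bl u' Uu') w2|exact: bl_el (bl u Uu) w2].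
Qed.

(** The definition of [class_C2] gives the derivative of [DF], not directly its continuity. Near
    [u], differentiability bounds the increments of [DF] by [(|K| + 1) |u' - u|], where the 1 is the
    tolerance in the remainder of [DF] at [u]. *)
Lemma C2_facts (U : set X) (F : X -> Y) (DF : X -> op_space X Y) :
  (forall w : fT, U w -> L2 w) ->
  derivative_on U F DF -> class_C1 U DF -> frechet_facts U F DF.
Proof.
move=> U2 dF [D2 [dDF _]]; have bl u : U u -> @bounded_linear R X Y (DF u) by move=> /dF[].
split=> [u v Uu v2|u Uu|u f g t Uu f2 g2 x cx|u Uu|u Uu].
- exact: bl_el (bl u Uu) v2.
- exact: bl_bound (bl u Uu).
- exact: bl_lin (bl u Uu) f2 g2 cx.
- exact: frechet_diff (dF u Uu).
apply: (facts_cont U2 bl Uu) => e e0.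
have [[T2el _ [K hK]] hT2] := dDF u Uu.
have [r r0 hr] := hT2 1 ltr01.
have K1 : 0 < `|K| + 1 by rewrite ltr_wpDl.
exists (Num.min r (e / (`|K| + 1))); first by rewrite lt_min r0 divr_gt0.
move=> u' Uu'; rewrite lt_min => /andP[ur ue] w w2 w1 x cx.
pose v : fT := fun x => u' x - u x.
have v2 : L2 v by apply: L2B => //; exact: U2.
have elv := (X_elP v).2 v2.
have uv : (u : X) + (v : X) = (u' : X) by apply/funext => z; rewrite /= addrC subrK.
have := hr v elv; rewrite (X_nrm v2) => /(_ ur); rewrite uv => h1.
have h2 := hK v elv; rewrite (X_nrm v2) in h2.
have blT : @bounded_linear R X Y (D2 u v) by exact: T2el.
have [B2 B20 hB2] := bl_bound blT.
have hT w' : L2 w' -> n2 w' <= 1 -> nH (D2 u v w') <= B2.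
  by move=> w'2 w'1; apply: (le_trans (hB2 w' w'2)); rewrite ler_piMr.
have [K' hK'] := op_sub_bound (bl u' Uu') (bl u Uu).
have eld w' : L2 w' -> el (fun x => DF u' w' x - DF u w' x).
  by move=> w'2; apply: elB => //; [exact: bl_el (bl u' Uu') w'2|exact: bl_el (bl u Uu) w'2].
have hE w' : L2 w' -> n2 w' <= 1 ->
    nH ((fun w0 => fun x => DF u' w0 x - DF u w0 x - D2 u v w0 x) w') <= 4 * (K' + B2).
  move=> w'2 w'1; apply: (le_trans (nH_quasi (eld w' w'2) (bl_el blT w'2))).
  by apply: ler_wpM2l => //; apply: lerD; [exact: hK'|exact: hT].
have m1 := op_nrm_ge hT w2 w1; have m2 := op_nrm_ge hE w2 w1.
have s1 := sup_le_nH On0 (bl_el blT w2) cx.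
have s2 := sup_le_nH On0 (elB oO bO On0 (eld w w2) (bl_el blT w2)) cx.
have a1 : `|D2 u v w x| <= K * n2 v by exact: le_trans s1 (le_trans m1 h2).
have a2 : `|DF u' w x - DF u w x - D2 u v w x| <= 1 * n2 v by exact: le_trans s2 (le_trans m2 h1).
have a3 : (`|K| + 1) * n2 v <= e by rewrite mulrC -ler_pdivlMr// ltW.
have a4 : K * n2 v <= `|K| * n2 v by apply: ler_wpM2r; [exact: n2_ge0|exact: ler_norm].
have := ler_normD (DF u' w x - DF u w x - D2 u v w x) (D2 u v w x); rewrite subrK.
by move: a1 a2 a3 a4; rewrite mulrDl; lra.
Qed.

End frechet_facts.

(** * Measurability of superpositions *)

Section ae_limits.
Context d (T : measurableType d) (R : realType).
Context (mu : {measure set T -> \bar R}) (D : set T) (mD : measurable D).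

(** Off one null set [N] the measurable representatives converge at every point; on [N] everything
    is replaced by 0. *)
Lemma aem_lim (f_ : nat -> T -> R) (f : T -> R) : (forall m, aem mu D (f_ m)) ->
  aeD mu D (fun x => f_ m x @[m --> \oo] --> f x) -> aem mu D f.
Proof.
move=> af lf.
have [g_ hg_] := choice (fun m => let: ex_intro2 g mg fg := af m in
  ex_intro (fun g => measurable_fun D g /\ aeD mu D (fun x => f_ m x = g x)) g (conj mg fg)).
have ae1 : \forall x \ae mu, forall m, D x -> f_ m x = g_ m x.
  by apply: ae_foralln => m; have [_] := hg_ m.
have [N [mN N0 hN]] : \forall x \ae mu, D x -> (f_ m x @[m --> \oo] --> f x) /\ forall m, f_ m x = g_ m x.
  by apply: filterS2 ae1 lf => x h1 h2 Dx; split; [exact: h2|move=> m; exact: h1].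
have good x : D x -> ~ N x -> (f_ m x @[m --> \oo] --> f x) /\ forall m, f_ m x = g_ m x.
  by move=> Dx nN; apply: contrapT => h; apply: nN; apply: hN => /(_ Dx).
exists (f \_ (~` N)); last first.
  exists N; split => // x /= h; apply: contrapT => nN; apply: h => Dx.
  by rewrite patchE mem_set.
apply: (@measurable_fun_cvg _ _ _ D (fun m => g_ m \_ (~` N))) => [m|x Dx].
  have -> : g_ m \_ (~` N) = (fun x => \1_(~` N) x * g_ m x).
    by apply/funext => x; rewrite patchE indicE; case: ifPn => _; rewrite ?mul1r ?mul0r.
  apply: measurable_funM; last by have [] := hg_ m.
  by apply: measurable_indic; exact: measurableC.
have [Nx|Nx] := pselect (N x).
  have z (h : T -> R) : (h \_ (~` N)) x = 0 by rewrite patchE memNset.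
  by rewrite z; under eq_fun do rewrite z; exact: cvg_cst.
have [h1 h2] := good x Dx Nx; have e (h : T -> R) : (h \_ (~` N)) x = h x by rewrite patchE mem_set.
by rewrite e; under eq_fun do rewrite e -h2.
Qed.

(** Rounding [y] down to multiples of 1/(m+1) leaves countably many values, so the composition is
    measurable piece by piece; continuity in the second variable gives the limit. *)
Lemma aem_comp (F : T -> R -> R) (y : T -> R) : (forall t, measurable_fun D (F ^~ t)) ->
  aeD mu D (fun x => continuous (F x)) -> measurable_fun D y -> aem mu D (fun x => F x (y x)).
Proof.
move=> mF cF my.
pose q (m : nat) (t : R) : R := (Num.floor (t * m.+1%:R))%:~R / m.+1%:R.
apply: (@aem_lim (fun m x => F x (q m (y x)))) => [m|]; last first.
  apply: aeD1 cF => x Dx cx; apply: (cvg_comp (fun m => q m (y x)) (F x)); last exact: cx.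
  apply/cvgrPdist_le => e e0; have [N hN] := natSinv_small e0.
  exists N => // m /= Nm; have := hN m Nm => /ltW; apply: le_trans.
  rewrite /q; set k := m.+1%:R; have k0 : 0 < k by [].
  have fl := floor_le_tmp (y x * k); have fu := floorD1_gt (y x * k).
  have -> : y x - (Num.floor (y x * k))%:~R / k = (y x * k - (Num.floor (y x * k))%:~R) / k.
    by field; rewrite gt_eqF.
  rewrite normrM normfV (gtr0_norm k0) ler_pdivrMr// mulVf ?gt_eqF//.
  by move: fl fu; rewrite intrD ler_norml => h1 h2; apply/andP; split; lra.
apply: aem_mfun => _ B mB.
have -> : D `&` (fun x => F x (q m (y x))) @^-1` B =
    \bigcup_(k : int) ((D `&` y @^-1` [set t | Num.floor (t * m.+1%:R) = k]) `&`
       (D `&` (F ^~ (k%:~R / m.+1%:R)) @^-1` B)).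
  apply/seteqP; split => [x [Dx /= h]|x [k _ [[Dx /= hk] [_ /= h]]]].
    by exists (Num.floor (y x * m.+1%:R)).
  by split => //=; rewrite /q hk.
apply: countable_bigcupT_measurable; first exact: countableP.
move=> k; apply: measurableI; last exact: mF.
apply: my => //.
have -> : [set t : R | Num.floor (t * m.+1%:R) = k] = `[k%:~R / m.+1%:R, (k + 1)%:~R / m.+1%:R[%classic.
  apply/seteqP; split => t /=; rewrite in_itv /= ler_pdivrMr// ltr_pdivlMr//.
    by move=> <-; rewrite floor_le_tmp floorD1_gt.
  by move=> h; apply/eqP; rewrite floor_eq.
exact: measurable_itv.
Qed.

(** The derivative is the limit of the difference quotients with steps 1/(m+1). *)
Lemma aem_comp_derive1 (F : T -> R -> R) :
  (forall y : T -> R, measurable_fun D y -> aem mu D (fun x => F x (y x))) ->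
  aeD mu D (fun x => forall t : R, derivable (F x : R -> R^o) t 1) ->
  forall y : T -> R, measurable_fun D y -> aem mu D (fun x => derive1 (F x) (y x)).
Proof.
move=> hF dF y my.
apply: (@aem_lim (fun m x => m.+1%:R * (F x (y x + m.+1%:R^-1) - F x (y x)))) => [m|].
  apply: aemZ => //; apply: aemB => //; last exact: hF.
  by apply: hF; apply: measurable_funD => //; exact: measurable_cst.
apply: aeD1 dF => x Dx dx; rewrite derive1E.
have h := dx (y x); apply/cvgrPdist_le => e e0.
have /cvgrPdist_le/(_ e e0)/nbhs_ballP[del /= del0 hdel] := h.
have [N hN] := natSinv_small del0; exists N => // m /= Nm.
have m0 : (m.+1%:R^-1 : R) != 0 by [].
have bm : ball (0 : R) del m.+1%:R^-1 by rewrite -ball_normE /= sub0r normrN gtr0_norm// hN.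
have := hdel _ bm m0; rewrite /= invrK [_%:A]mulr1 (addrC _ (y x)).
by [].
Qed.

End ae_limits.

Section taylor.
Context (R : realType) (f : R -> R) (M : R).
Hypothesis df : forall t : R, derivable (f : R -> R^o) t 1.

Lemma convex_bound (s t th : R) : `|s| <= M -> `|t| <= M -> 0 <= th <= 1 -> `|s + th * (t - s)| <= M.
Proof.
move=> sM tM /andP[th0 th1].
have -> : s + th * (t - s) = (1 - th) * s + th * t by ring.
apply: (le_trans (ler_normD _ _)); rewrite !normrM (ger0_norm th0) ger0_norm ?subr_ge0//.
have : (1 - th) * `|s| <= (1 - th) * M by apply: ler_wpM2l => //; rewrite subr_ge0.
have : th * `|t| <= th * M by apply: ler_wpM2l.
by lra.
Qed.

Lemma lipschitz_of_derive1 (C s t : R) : (forall x, `|x| <= M -> `|derive1 f x| <= C) ->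
  `|s| <= M -> `|t| <= M -> `|f t - f s| <= C * `|t - s|.
Proof.
move=> hC sM tM; have [th th01 ->] := mean_value s t df.
by rewrite normrM ler_wpM2r// hC// convex_bound.
Qed.

Lemma taylor1 (C s t : R) : 
  (forall x y, `|x| <= M -> `|y| <= M -> `|derive1 f x - derive1 f y| <= C * `|x - y|) -> 0 <= C ->
  `|s| <= M -> `|t| <= M -> `|f t - f s - derive1 f s * (t - s)| <= C * `|t - s| ^+ 2.
Proof.
move=> hC C0 sM tM; have [th th01 ->] := mean_value s t df.
rewrite -mulrBl normrM expr2 mulrA ler_wpM2r//.
apply: (le_trans (hC _ _ (convex_bound sM tM th01) sM)); apply: ler_wpM2l => //.
rewrite (addrC s) addrK normrM; have /andP[th0 th1] := th01.
by rewrite (ger0_norm th0) ler_piMl.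
Qed.

(** Meant for [f] equal to [dy a x] or [dy L x]: their derivatives have a modulus of continuity but
    no Lipschitz bound, so the remainder is small relative to the increment instead of quadratic. *)
Lemma taylor1_modulus (e rho s t : R) :
  (forall x y, `|x| <= M -> `|y| <= M -> `|x - y| <= rho -> `|derive1 f x - derive1 f y| <= e) ->
  `|s| <= M -> `|t| <= M -> `|t - s| <= rho -> `|f t - f s - derive1 f s * (t - s)| <= e * `|t - s|.
Proof.
move=> hC sM tM ts; have [th th01 ->] := mean_value s t df.
rewrite -mulrBl normrM ler_wpM2r//; apply: hC => //; first exact: convex_bound.
rewrite (addrC s) addrK normrM; have /andP[th0 th1] := th01.
by rewrite (ger0_norm th0); apply: le_trans ts; rewrite ler_piMl.
Qed.

End taylor.

Section superposition.
Context (R : realType) (n : nat) (O : set 'rV[R]_n) (mO : measurable O).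
Local Notation leb := (@lebesgue_rV R n).
Local Notation fT := ('rV[R]_n -> R).
Context (F : 'rV[R]_n -> R -> R) (hF : caratheodory_C2 O F).

Lemma superposition_aem (y : fT) : measurable_fun O y -> aem leb O (fun x => F x (y x)).
Proof.
have [mF h] := hF; apply: aem_comp => //.
apply: aeD1 h => x _ [d1 _ _] t; apply/differentiable_continuous/derivable1_diffP; exact: d1.
Qed.

Lemma superposition_dy_aem (y : fT) : measurable_fun O y -> aem leb O (fun x => dy F x (y x)).
Proof.
apply: aem_comp_derive1 => //; first exact: superposition_aem.
have [_ h] := hF; apply: aeD1 h => x _ [d1 _ _]; exact: d1.
Qed.

Lemma superposition_dyy_aem (y : fT) : measurable_fun O y -> aem leb O (fun x => dyy F x (y x)).
Proof.
apply: (aem_comp_derive1 (F := dy F)) => //; first exact: superposition_dy_aem.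
have [_ h] := hF; apply: aeD1 h => x _ [_ d2 _]; exact: d2.
Qed.

Lemma dy_lipschitz (M C : R) :
  aeD leb O (fun x => forall t, `|t| <= M -> `|dyy F x t| <= C) ->
  aeD leb O (fun x => forall s t, `|s| <= M -> `|t| <= M -> `|dy F x t - dy F x s| <= C * `|t - s|).
Proof.
have [_ h] := hF; apply: aeD2 h => x _ [_ d2 _] hC s t sM tM.
exact: (lipschitz_of_derive1 (M := M)).
Qed.

Lemma taylor_F (M C : R) : 0 <= C ->
  aeD leb O (fun x => forall t, `|t| <= M -> `|dyy F x t| <= C) ->
  aeD leb O (fun x => forall s t, `|s| <= M -> `|t| <= M ->
    `|F x t - F x s - dy F x s * (t - s)| <= C * `|t - s| ^+ 2).
Proof.
move=> C0 hC; have := dy_lipschitz hC; have [_ h] := hF; apply: aeD2 h => x _ [d1 _ _] hl s t sM tM.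
by apply: (taylor1 (M := M)) => // s' t' s'M t'M; exact: hl.
Qed.

Lemma taylor_dy (M e rho : R) : 
  aeD leb O (fun x => forall t1 t2, `|t1| <= M -> `|t2| <= M -> `|t1 - t2| <= rho ->
    `|dyy F x t1 - dyy F x t2| <= e) ->
  aeD leb O (fun x => forall s t, `|s| <= M -> `|t| <= M -> `|t - s| <= rho ->
    `|dy F x t - dy F x s - dyy F x s * (t - s)| <= e * `|t - s|).
Proof.
have [_ h] := hF; apply: aeD2 h => x _ [_ d2 _] he s t sM tM ts.
exact: (taylor1_modulus d2 he).
Qed.

End superposition.

(** * Linearized equations *)

Section weak_equations.
Context (R : realType) (n : nat) (O : set 'rV[R]_n) (mu : R).
Hypotheses (oO : open O) (bO : bounded_set O) (On0 : O !=set0) (mu0 : 0 < mu).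
Local Notation leb := (@lebesgue_rV R n).
Local Notation clO := (closure O).
Local Notation fT := ('rV[R]_n -> R).
Local Notation el := (elements (H1C_space O mu)).
Local Notation L2 := (L2 leb O).
Local Notation n2 := (n2 leb O).
Local Notation ip := (ip leb O).
Local Notation I := (Rintegral leb O).
Local Notation aeO := (aeD leb O).
Local Notation aeiO := (aei leb O).

Let mO : measurable O := open_measurable_mx oO.
Let Ofin : (leb O < +oo)%E := lebesgue_bounded_fin mO bO.

Context (B : 'rV[R]_n -> 'M[R]_n) (MB : R) (MB0 : 0 <= MB).
Hypothesis mB : forall i j, measurable_fun O (fun x => B x i j).
Hypothesis bB : forall i j, aeO (fun x => `|B x i j| <= MB).

Let real_aux (x1 x2 a b h e : R) : x1 <= a * h -> x2 <= b * h -> 0 <= h ->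
  (a + b + 1) * h <= e -> x1 + x2 <= e.
Proof. by rewrite !mulrDl mul1r; lra. Qed.

Let pt_aux (f d c b u ub lam : R) : f = - ((c + u) * d) -> b <= c -> lam <= b + ub ->
  f * d <= - (lam * d ^+ 2 + (u - ub) * d ^+ 2).
Proof.
move=> -> bc lb; rewrite -mulrDl mulNr -mulrA -expr2 lerN2 ler_wpM2r ?sqr_ge0//.
by lra.
Qed.

Let energy_aux (p1 p2 p3 p4 p5 p6 q lam lam' : R) : p6 <= q ->
  lam * p2 <= lam' * p2 -> lam' * p2 <= p3 -> p3 <= - (lam * p5 + p4) -> `|p4| <= p6 ->
  - p4 <= `|p4| -> p1 = p5 + p2 -> lam * p1 <= q.
Proof. by move=> h1 h2 h3 h4 h5 h6 ->; rewrite mulrDr; lra. Qed.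

Let Aform_subN y1 y2 w1 w2 : w1 = w2 ->
  Aform O B (fun x => y1 x - y2 x) w1 = Aform O B (fun x => y1 x + -1 * y2 x) w2.
Proof.
have -> : (fun x => y1 x - y2 x) = (fun x => y1 x + -1 * y2 x).
  by apply/funext => x; rewrite mulN1r.
by move=> ->.
Qed.

Let Aform_subNr y1 y2 w1 w2 : w1 = w2 ->
  Aform O B w1 (fun x => y1 x - y2 x) = Aform O B w2 (fun x => y1 x + -1 * y2 x).
Proof.
have -> : (fun x => y1 x - y2 x) = (fun x => y1 x + -1 * y2 x).
  by apply/funext => x; rewrite mulN1r.
by move=> ->.
Qed.

Lemma aeiM_bounded f (w : fT) (M : R) : aeiO f -> measurable_fun O w -> aeO (fun x => `|w x| <= M) ->
  aeiO (fun x => f x * w x).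
Proof.
move=> fi mw wM; have af := aei_aem fi.
apply: (aei_dom mO _ (aeiZ mO `|M| (aei_norm fi))).
  by apply: aemM => //; exact: aem_mfun.
apply: aeD1 wM => x _ h; rewrite normrM mulrC ler_wpM2r//.
exact: le_trans h (ler_norm M).
Qed.

Lemma weak_test f h y (w : fT) : weak_solution O B f h y -> H1 O w -> {within clO, continuous w} ->
  Aform O B y w = I (fun x => f x * w x) + \int[@hausdorff R n n.-1]_(x in boundary O) (h x * w x).
Proof. by move=> [_ hs] hw cw; apply: hs => //; exact: continuous_trace. Qed.

(* Difference quotients are tested with functions that are continuous up to the
   boundary, which are their own traces; the trace is then reached by density. *)
Lemma linearize f0 h y0 (z k k' kap : fT) :
  weak_solution O B f0 h y0 -> aeiO f0 -> H1 O z -> L2 k' -> L2 kap ->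
  aeO (fun x => k x = k' x) ->
  (forall e : R, 0 < e -> exists s ys fs, [/\ 0 < s, weak_solution O B fs h ys, aeiO fs,
     H1_norm O (fun x => ys x - y0 x - s * z x) <= e * s &
     aeO (fun x => `|fs x - f0 x - s * k' x| <= e * s * kap x)]) ->
  weak_solution O B k (cst 0) z.
Proof.
move=> hs0 if0 hz k'2 kap2 kk app.
have core (w : fT) : H1 O w -> {within clO, continuous w} -> Aform O B z w = ip k' w.
  move=> hw cw; have [M M0 hM] := within_continuous_bounded bO cw.
  have mw : measurable_fun O w by have [] := H1_L2 oO hw.
  have wM : aeO (fun x => `|w x| <= M) by exact: aeD_all.
  have w2 := H1_L2 oO hw.
  (* Collects what [w] sees of the two errors: the continuity of the form for the solutions, and the
     weight [kap] for the right-hand sides. *)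
  pose C := n%:R ^+ 2 * MB * H1_norm O w + I (fun x => kap x * `|w x|).
  have kw : aeiO (fun x => kap x * `|w x|).
    have := aei_norm (L2M mO kap2 w2).
    have [mk _] := kap2; move=> ikw; apply: (aei_dom mO _ ikw).
      by apply: aemM; [exact: aem_mfun|apply: aem_norm; exact: aem_mfun].
    by apply: aeD_all => x _; rewrite !normrM normr_id.
  suff h1 (e : R) : 0 < e -> `|Aform O B z w - ip k' w| <= e * C.
    have [C0|C0] := leP C 0.
      apply/eqP; rewrite -subr_eq0 -normr_le0; apply: le_trans (h1 1 ltr01) _.
      by rewrite mul1r.
    apply/eqP; rewrite -subr_eq0 -normr_le0; apply/ler_addgt0Pl => e e0; rewrite addr0.
    have := h1 (e / C); rewrite divfK ?gt_eqF//; apply; exact: divr_gt0.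
  move=> e0; have [s [ys [fs [s0 hss ifs hd hf]]]] := app e e0.
  have [hys _] := hss; have [hy0 _] := hs0.
  (* Both solutions have the boundary datum [h], so the boundary integrals cancel in the
     difference. *)
  have t1 := weak_test hss hw cw; have t0 := weak_test hs0 hw cw.
  have hb := H1B oO bO hys hy0.
  have hd1 := H1_lin oO bO (- s) hb hz.
  have dE : (fun x => ys x - y0 x - s * z x) = (fun x => (ys x - y0 x) + - s * z x).
    by apply/funext => x; rewrite mulNr.
  have Ab : Aform O B (fun x => ys x - y0 x) w = Aform O B ys w - Aform O B y0 w.
    have := Aform_linl oO bO MB0 mB bB (-1) hys hy0 hw; rewrite mulN1r => <-.
    by apply: Aform_subN.
  have Ad : Aform O B (fun x => ys x - y0 x - s * z x) w =
      I (fun x => fs x * w x) - I (fun x => f0 x * w x) - s * Aform O B z w.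
    by rewrite dE (Aform_linl oO bO MB0 mB bB (- s) hb hz hw) Ab t1 t0; ring.
  have i1 := aeiM_bounded ifs mw wM; have i0 := aeiM_bounded if0 mw wM.
  have ik := L2M mO k'2 w2.
  have Ef : I (fun x => (fs x - f0 x - s * k' x) * w x) =
      I (fun x => fs x * w x) - I (fun x => f0 x * w x) - s * ip k' w.
    rewrite /ip -RintZ// -RintB// -RintB//; last 2 first.
    - exact: aeiB.
    - exact: aeiZ.
    by apply: Rint_ae; apply: aeD_all => x _; ring.
  have iE : aeiO (fun x => (fs x - f0 x - s * k' x) * w x).
    have := aeiB mO (aeiB mO i1 i0) (aeiZ mO s ik); apply: aei_ae.
    by apply: aeD_all => x _; ring.
  have bE : `|I (fun x => (fs x - f0 x - s * k' x) * w x)| <= e * s * I (fun x => kap x * `|w x|).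
    apply: (le_trans (Rint_norm mO iE)); rewrite -RintZ//; apply: Rint_le => //.
    - exact: aei_norm.
    - exact: aeiZ.
    - by apply: aeD1 hf => x _ hfx; rewrite normrM mulrA ler_wpM2r.
  rewrite -dE in hd1.
  have bA := Aform_bound oO MB0 mB bB hd1 hw.
  have bA' : `|Aform O B (fun x => ys x - y0 x - s * z x) w| <= e * s * (n%:R ^+ 2 * MB * H1_norm O w).
    apply: (le_trans bA); move: hd.
    move: (H1_norm O w) (H1_norm_ge0 O w) => W W0; move: (H1_norm O (fun x => _)) => X XE.
    have c0 : 0 <= n%:R ^+ 2 * MB :> R by rewrite mulr_ge0// sqr_ge0.
    have -> : e * s * (n%:R ^+ 2 * MB * W) = (n%:R ^+ 2 * MB) * (e * s) * W by ring.
    by rewrite ler_wpM2r// ler_wpM2l.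
  move: bE bA'; rewrite Ef Ad.
  set a := I _ - I _; set al := Aform O B z w; set be := ip k' w => b1 b2.
  have sab : s * `|al - be| <= s * (e * C).
    rewrite -{1}(gtr0_norm s0) -normrM.
    have -> : s * (al - be) = (a - s * be) - (a - s * al) by ring.
    apply: (le_trans (ler_normB _ _)); apply: (le_trans (lerD b1 b2)).
    by rewrite /C le_eqVlt; apply/orP; left; apply/eqP; ring.
  by rewrite ler_pM2l in sab.
split=> // v t hv [_ [w [hw cw hcv _]]].
have v2 := H1_L2 oO hv.
have -> : I (fun x => k x * v x) = ip k' v by apply: Rint_ae; apply: aeD1 kk => x _ ->.
have -> : \int[@hausdorff R n n.-1]_(x in boundary O) (cst 0 x * t x) = 0.
  by rewrite /Rintegral integral0_eq// => x _; rewrite /= mul0r.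
rewrite addr0; apply/eqP; rewrite -subr_eq0 -normr_le0; apply/ler_addgt0Pl => e e0; rewrite addr0.
(* A constant of continuity, in the [H^1] norm of the test function, for the functional that
   vanishes on the approximating functions; the 1 keeps it positive. *)
pose C := n%:R ^+ 2 * MB * H1_norm O z + n2 k' + 1.
have C0 : 0 < C.
  by rewrite /C ltr_wpDl// addr_ge0 ?n2_ge0// mulr_ge0 ?H1_norm_ge0// mulr_ge0// sqr_ge0.
have /cvgrPdist_le/(_ _ (divr_gt0 e0 C0)) [N _ hN] := hcv.
have := hN N (leqnn N); rewrite /= sub0r normrN ger0_norm ?H1_norm_ge0//.
set wN := w N; have hwN := hw N; have cwN := cw N => small.
have wN2 := H1_L2 oO hwN.
have hdd := H1B oO bO hwN hv.
have E1 : Aform O B z (fun x => wN x - v x) = Aform O B z wN - Aform O B z v.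
  have := Aform_linr oO bO MB0 mB bB (-1) hz hwN hv; rewrite mulN1r => <-.
  by apply: Aform_subNr.
have E2 : ip k' (fun x => wN x - v x) = ip k' wN - ip k' v.
  by rewrite ipC ipBl// !(ipC _ _ k').
have b1 := Aform_bound oO MB0 mB bB hz hdd.
have b2 := ip_cauchy_schwarz mO k'2 (L2B mO wN2 v2).
have b3 := n2_le_H1 oO hdd.
have b4 : n2 k' * n2 (fun x => wN x - v x) <= n2 k' * H1_norm O (fun x => wN x - v x).
  by apply: ler_wpM2l => //; exact: n2_ge0.
have b5 : C * H1_norm O (fun x => wN x - v x) <= e by rewrite mulrC -ler_pdivlMr.
have H0 := H1_norm_ge0 O (fun x => wN x - v x).
rewrite -[X in X - _]/(Aform O B z v) -normrN.
have -> : - (Aform O B z v - ip k' v) = Aform O B z (fun x => wN x - v x) - ip k' (fun x => wN x - v x).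
  by rewrite E1 E2 (core wN hwN cwN); ring.
apply: (le_trans (ler_normB _ _)).
exact: (real_aux b1 (le_trans b2 b4) H0 b5).
Qed.

(** The energy estimate behind the radii of [calA]. Testing with the difference [d] gives, in the
    [H^1] norm, [Lam |d|^2] at most the absolute pairing of [u - ubar] with [d^2]; the embedding
    into [L^4] bounds this by [eps C4^2 |d|^2], and [eps C4^2 < Lam] leaves only [d = 0]. *)
Lemma coercive_unique (LamA Lam a0 eps C4 : R) (f1 f2 h : fT) (z1 z2 c u ubar : fT) (Cc : R) :
  el z1 -> el z2 -> weak_solution O B f1 h z1 -> weak_solution O B f2 h z2 ->
  aeiO f1 -> aeiO f2 ->
  aeO (fun x => f1 x - f2 x = - ((c x + u x) * (z1 x - z2 x))) ->
  aem leb O c -> aeO (fun x => `|c x| <= Cc) -> aeO (fun x => a0 <= c x) ->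
  L2 u -> L2 ubar -> aeO (fun x => Lam <= a0 + ubar x) -> 0 < Lam <= LamA ->
  n2 (fun x => u x - ubar x) <= eps -> eps * C4 ^+ 2 < Lam ->
  aeO (fun x => forall xi : 'rV[R]_n, LamA * enorm xi ^+ 2 <= \sum_i \sum_j B x i j * xi 0 i * xi 0 j) ->
  embedding_L4 O C4 ->
  aeO (fun x => z1 x = z2 x).
Proof.
move=> e1 e2 s1 s2 i1 i2 f12 ac cC ca u2 ub2 Lub /andP[Lam0 LamLe] ue eC ell emb.
pose dd x := z1 x - z2 x.
have de : el dd by exact: elB.
have hd := elH1 de; have d2 := H1_L2 oO hd.
have cd := el_continuous On0 mu0 de.
have [M M0 hM] := within_continuous_bounded bO cd.
have dM : aeO (fun x => `|dd x| <= M) by exact: aeD_all.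
have md : measurable_fun O dd by case: d2.
have t1 := weak_test s1 hd cd; have t2 := weak_test s2 hd cd.
have A12 : Aform O B dd dd = Aform O B z1 dd - Aform O B z2 dd.
  have := Aform_linl oO bO MB0 mB bB (-1) (elH1 e1) (elH1 e2) hd; rewrite mulN1r => <-.
  by apply: Aform_subN.
have j1 := aeiM_bounded i1 md dM; have j2 := aeiM_bounded i2 md dM.
have r2 : L2 (fun x => u x - ubar x) by exact: L2B.
have [CH0 dd2 ndd] := L4_sqr md (emb _ hd).
have ir := L2M mO r2 dd2.
have iub : aeiO (fun x => Lam * dd x ^+ 2) by apply: aeiZ => //; case: d2.
have E : Aform O B dd dd = I (fun x => f1 x * dd x - f2 x * dd x).
  by rewrite A12 t1 t2 RintB//; ring.
have le1 : I (fun x => f1 x * dd x - f2 x * dd x) <=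
    - (I (fun x => Lam * dd x ^+ 2) + ip (fun x => u x - ubar x) (fun x => dd x ^+ 2)).
  rewrite /ip -RintD// -RintN//; last exact: aeiD.
  apply: Rint_le => //; [exact: aeiB|by apply: aeiN => //; exact: aeiD|].
  have := aeD3 (fun x _ a b c => conj a (conj b c)) f12 ca Lub.
  apply: aeD1 => x _ [h1 [h2 h3]].
  by rewrite -mulrBl; exact: (pt_aux h1 h2 h3).
have iA : aeiO (fun x => \sum_i \sum_j B x i j * weak_partial O i dd x * weak_partial O j dd x).
  apply: aei_sum => // i; apply: aei_sum => // j; apply: (L2M mO); last exact: wp_L2.
  by apply: (mulB_L2 oO MB0 mB bB); exact: wp_L2.
have co := Aform_coercive oO hd iA ell.
have hn := H1_norm_sqr oO hd.
have In : I (fun x => Lam * dd x ^+ 2) = Lam * n2 dd ^+ 2 by rewrite RintZ ?n2_sqr//; case: d2.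
have cs := ip_cauchy_schwarz mO r2 dd2.
have csn := ler_norm (- ip (fun x => u x - ubar x) (fun x => dd x ^+ 2)); rewrite normrN in csn.
have S0 : 0 <= \sum_i n2 (weak_partial O i dd) ^+ 2 by apply: sumr_ge0 => i _; exact: sqr_ge0.
have key : Lam * H1_norm O dd ^+ 2 <= eps * (C4 ^+ 2 * H1_norm O dd ^+ 2).
  have k1 : n2 (fun x => u x - ubar x) * n2 (fun x => dd x ^+ 2) <= eps * (C4 * H1_norm O dd) ^+ 2.
    by apply: ler_pM => //; exact: n2_ge0.
  rewrite exprMn in k1.
  have k2 : Lam * (\sum_i n2 (weak_partial O i dd) ^+ 2) <= LamA * (\sum_i n2 (weak_partial O i dd) ^+ 2).
    by apply: ler_wpM2r.
  rewrite -E In in le1.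
  exact: (energy_aux k1 k2 co le1 cs csn hn).
have H0 : H1_norm O dd = 0.
  apply/eqP; apply: contraTT (isT) => nz.
  have p : 0 < H1_norm O dd ^+ 2 by rewrite lt_neqAle eq_sym sqrf_eq0 nz sqr_ge0.
  by move: key; rewrite mulrA ler_pM2r// leNgt eC.
have n0 : n2 dd = 0.
  by apply/eqP; rewrite eq_le n2_ge0 andbT -H0; exact: n2_le_H1.
by apply: aeD1 (n2_eq0 mO d2 n0) => x _ /eqP; rewrite subr_eq0 => /eqP.
Qed.

End weak_equations.

(** * Difference quotients along a line of controls *)

Section directional.
Context (R : realType) (n : nat) (O : set 'rV[R]_n) (mu : R).
Hypotheses (oO : open O) (bO : bounded_set O) (On0 : O !=set0).
Local Notation leb := (@lebesgue_rV R n).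
Local Notation clO := (closure O).
Local Notation fT := ('rV[R]_n -> R).
Local Notation el := (elements (H1C_space O mu)).
Local Notation L2 := (L2 leb O).
Local Notation n2 := (n2 leb O).

Let mO : measurable O := open_measurable_mx oO.

Lemma H1_norm_eq y (y' : fT) : (forall x, O x -> y x = y' x) -> H1 O y -> H1_norm O y = H1_norm O y'.
Proof.
move=> yy hy; have hy' := H1_eq oO yy hy.
rewrite (H1_normE oO hy) (H1_normE oO hy').
have -> : n2 y = n2 y' by apply: n2_ae; exact: aeD_all.
have aux (c s s' : R) : s = s' -> Num.sqrt (c + s) = Num.sqrt (c + s') by move=> ->.
apply: aux; have wpE i : n2 (weak_partial O i y) = n2 (weak_partial O i y').
  by apply: n2_ae; exact: wp_eq.
have sumE (F G : 'I_n -> R) : (forall i, F i = G i) -> \sum_i F i ^+ 2 = \sum_i G i ^+ 2.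
  by move=> h; apply: eq_bigr => i _; rewrite h.
exact: (sumE _ _ wpE).
Qed.

Lemma elD y (z : fT) : el y -> el z -> el (fun x => y x + z x).
Proof.
by move=> hy hz; have := el_lin oO bO On0 1 hy hz; apply: el_eq => x; rewrite mul1r.
Qed.

Variables (U : set fT) (F : fT -> fT) (DF : fT -> fT -> fT).
Hypothesis ff : frechet_facts O mu U F DF.

Lemma ff_zero u x : U u -> clO x -> DF u (fun=> 0) x = 0.
Proof.
move=> Uu cx; have h0 : L2 (fun=> 0) by exact: L2_0.
have := ff_lin ff 1 Uu h0 h0 cx.
rewrite (_ : (fun _ : 'rV[R]_n => 0 + 1 * 0) = (fun=> 0 : R)); last first.
  by apply/funext => z; rewrite mulr0 addr0.
by move=> /eqP; rewrite mul1r -subr_eq0 opprD addrA subrr sub0r oppr_eq0 => /eqP.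
Qed.

Lemma ff_scale u v (t : R) x : U u -> L2 v -> clO x -> DF u (fun z => t * v z) x = t * DF u v x.
Proof.
move=> Uu v2 cx; have h0 : L2 (fun=> 0) by exact: L2_0.
have := ff_lin ff t Uu h0 v2 cx; rewrite ff_zero// add0r => <-.
by congr (DF u _ x); apply/funext => z; rewrite add0r.
Qed.

Hypothesis Uopen : forall u, U u -> exists2 r : R, 0 < r &
  forall v, L2 v -> n2 v < r -> U (fun x => u x + v x).
Hypothesis elF : forall u, U u -> el (F u).

(** The remainder along [u + s v] is needed in two norms: the [H^1] norm for the solutions
    themselves, and uniformly for the nonlinear terms. *)
Lemma ff_directional u v (e : R) : U u -> L2 v -> 0 < e -> exists2 s0 : R, 0 < s0 &
  forall s : R, 0 < s -> s <= s0 -> let u' := fun x => u x + s * v x in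
    [/\ U u', H1_norm O (fun x => F u' x - F u x - s * DF u v x) <= e * s &
        forall x, clO x -> `|F u' x - F u x - s * DF u v x| <= e * s].
Proof.
move=> Uu v2 e0; have N0 := n2_ge0 leb O v.
have N1 : 0 < n2 v + 1 by rewrite ltr_wpDl.
have [r1 r10 hr1] := Uopen Uu; have [r2 r20 hr2] := ff_diff ff Uu (divr_gt0 e0 N1).
exists (Num.min r1 r2 / 2 / (n2 v + 1)); first by rewrite !divr_gt0// lt_min r10.
move=> s s0; rewrite ler_pdivlMr// => ss u'.
have sN : n2 (fun x => s * v x) < Num.min r1 r2.
  rewrite n2Z// gtr0_norm//; apply: (@le_lt_trans _ _ (s * (n2 v + 1))).
    by rewrite ler_pM2l// lerDl.
  apply: (le_lt_trans ss); rewrite ltr_pdivrMr// mulr_natr mulr2n ltrDl.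
  by rewrite lt_min r10.
move: sN; rewrite lt_min => /andP[sN1 sN2].
have sv2 := L2Z mO s v2.
have Uu' : U u' by exact: hr1.
have := hr2 _ sv2 sN2; rewrite -/u'.
rewrite n2Z// gtr0_norm// => hn.
have bound : e / (n2 v + 1) * (s * n2 v) <= e * s.
  have -> : e / (n2 v + 1) * (s * n2 v) = e * s * (n2 v / (n2 v + 1)) by ring.
  by rewrite ler_piMr ?mulr_ge0 ?(ltW s0) ?(ltW e0)// ler_pdivrMr// mul1r lerDl.
(* [DF u] at [s v] is [s] times [DF u v] only on the closure; agreement there is enough for the
   [H^1] norm by [H1_norm_eq]. *)
set D := (fun x => F u' x - F u x - DF u (fun x => s * v x) x) in hn.
have Del : el D by apply: elB => //; [apply: elB => //; exact: elF|exact: (ff_el ff)].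
have DE x : clO x -> D x = F u' x - F u x - s * DF u v x by move=> cx; rewrite /D ff_scale.
split=> // [|x cx].
  rewrite -(@H1_norm_eq D) => [||]; last exact: elH1 Del.
    by apply: le_trans bound; apply: le_trans hn; exact: H1_norm_le_nH.
  by move=> x Ox; apply: DE; exact: subset_closure.
by rewrite -DE//; apply: le_trans bound; apply: le_trans hn; exact: sup_le_nH.
Qed.

End directional.

Section remainders.
Context (R : realType).

Lemma increment_bound (y y0 z s e N : R) : 0 <= s -> e <= 1 -> `|z| <= N ->
  `|y - y0 - s * z| <= e * s -> `|y - y0| <= s * (N + 1).
Proof.
move=> s0 e1 zN h.
have -> : y - y0 = (y - y0 - s * z) + s * z by ring.
apply: (le_trans (ler_normD _ _)); rewrite [`|s * z|]normrM (ger0_norm s0) mulrDr mulr1 addrC.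
apply: lerD; first exact: ler_wpM2l.
by apply: (le_trans h); rewrite -[leRHS]mul1r ler_wpM2r.
Qed.

(** The term [s v (y - y0)] is of order [s^2] and is absorbed through [s <= e]; the same device
    handles the quadratic remainder in [taylor_remainder]. *)
Lemma product_remainder (u v y y0 z s e N : R) : 0 <= s -> s <= e -> e <= 1 -> `|z| <= N ->
  `|y - y0 - s * z| <= e * s ->
  `|(u + s * v) * y - u * y0 - s * (u * z + v * y0)| <= e * s * (`|u| + (N + 1) * `|v|).
Proof.
move=> s0 se e1 zN h; have hb := increment_bound s0 e1 zN h.
have N0 : 0 <= N by exact: le_trans zN.
have -> : (u + s * v) * y - u * y0 - s * (u * z + v * y0) =
  u * (y - y0 - s * z) + s * v * (y - y0) by ring.
apply: (le_trans (ler_normD _ _)); rewrite !normrM (ger0_norm s0) mulrDr; apply: lerD.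
  by rewrite mulrC ler_wpM2r.
apply: (@le_trans _ _ (s * `|v| * (s * (N + 1)))); first by rewrite ler_wpM2l// mulr_ge0.
have -> : s * `|v| * (s * (N + 1)) = s * (s * ((N + 1) * `|v|)) by ring.
have -> : e * s * ((N + 1) * `|v|) = e * (s * ((N + 1) * `|v|)) by ring.
by apply: ler_wpM2r => //; rewrite !mulr_ge0// addr_ge0.
Qed.

Lemma taylor_remainder (f f0 c y y0 z s e N C : R) : 0 <= s -> s <= e -> e <= 1 -> 0 <= C ->
  `|z| <= N -> `|y - y0 - s * z| <= e * s -> `|c| <= C ->
  `|f - f0 - c * (y - y0)| <= C * `|y - y0| ^+ 2 ->
  `|f - f0 - s * (c * z)| <= e * s * (C * (N + 1) ^+ 2 + C).
Proof.
move=> s0 se e1 C0 zN h cC hf; have hb := increment_bound s0 e1 zN h.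
have -> : f - f0 - s * (c * z) = (f - f0 - c * (y - y0)) + c * (y - y0 - s * z) by ring.
apply: (le_trans (ler_normD _ _)); rewrite [leRHS]mulrDr; apply: lerD.
  apply: (le_trans hf).
  apply: (@le_trans _ _ (C * (s * (N + 1)) ^+ 2)).
    by rewrite ler_wpM2l// lerXn2r ?nnegrE//; exact: le_trans hb.
  have -> : C * (s * (N + 1)) ^+ 2 = s * (s * (C * (N + 1) ^+ 2)) by ring.
  rewrite mulrA; apply: ler_wpM2r; first by rewrite mulr_ge0// sqr_ge0.
  exact: ler_wpM2r.
by rewrite normrM mulrC; apply: ler_pM.
Qed.

Lemma modulus_remainder (f f0 c y y0 z s e N C : R) : 0 <= s -> e <= 1 -> 0 <= C ->
  `|z| <= N -> `|y - y0 - s * z| <= e * s -> `|c| <= C ->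
  `|f - f0 - c * (y - y0)| <= e * `|y - y0| ->
  `|f - f0 - s * (c * z)| <= e * s * (N + 1 + C).
Proof.
move=> s0 e1 C0 zN h cC hf; have hb := increment_bound s0 e1 zN h.
(* The bound on the remainder forces [e] to be nonnegative unless [s] is 0. *)
have e0 : 0 <= e \/ s = 0.
  have [s1|s1] := leP s 0; first by right; apply/eqP; rewrite eq_le s1.
  by left; rewrite -(pmulr_lge0 _ s1); exact: le_trans h.
have -> : f - f0 - s * (c * z) = (f - f0 - c * (y - y0)) + c * (y - y0 - s * z) by ring.
apply: (le_trans (ler_normD _ _)); rewrite [leRHS]mulrDr; apply: lerD.
  apply: (le_trans hf); case: e0 => [e0|e0].
    by rewrite -mulrA ler_wpM2l.
  rewrite e0 mulr0 mul0r in hb *; move: hb; rewrite normr_le0 => /eqP ->.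
  by rewrite normr0 mulr0.
by rewrite normrM mulrC; apply: ler_pM.
Qed.

End remainders.

Section ae_L2.
Context d (T : measurableType d) (R : realType).
Context (mu : {measure set T -> \bar R}) (D : set T).
Hypotheses (mD : measurable D) (Dfin : (mu D < +oo)%E).
Local Notation L2 := (L2 mu D).
Local Notation aeD := (aeD mu D).
Local Notation aem := (aem mu D).
Local Notation aei := (aei mu D).
Implicit Types f g c : T -> R.

(** The right-hand sides of the linearized equations contain factors such as [dy a x (y x)], which
    have a measurable representative but need not be measurable. *)
Definition aeL2 f := exists2 f', L2 f' & aeD (fun x => f x = f' x).

Lemma aeL2_L2 f : L2 f -> aeL2 f.
Proof. by move=> f2; exists f => //; exact: aeD_all. Qed.

Lemma L2_norm f : L2 f -> L2 (fun x => `|f x|).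
Proof.
move=> f2; apply: (L2_dom mD _ f2); first by case: f2 => mf _; exact: measurableT_comp.
by apply: aeD_all => x _; rewrite normr_id.
Qed.

Lemma aeL2D f g : aeL2 f -> aeL2 g -> aeL2 (fun x => f x + g x).
Proof.
move=> [f' f2 ff] [g' g2 gg]; exists (fun x => f' x + g' x); first exact: L2D.
by apply: aeD2 ff gg => x _ -> ->.
Qed.

Lemma aeL2N f : aeL2 f -> aeL2 (fun x => - f x).
Proof.
move=> [f' f2 ff]; exists (fun x => -1 * f' x); first exact: L2Z.
by apply: aeD1 ff => x _ ->; rewrite mulN1r.
Qed.

Lemma aeL2B f g : aeL2 f -> aeL2 g -> aeL2 (fun x => f x - g x).
Proof. by move=> hf /aeL2N; exact: aeL2D. Qed.

Lemma aeL2M c f (C : R) : aem c -> aeD (fun x => `|c x| <= C) -> aeL2 f -> aeL2 (fun x => c x * f x).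
Proof.
move=> [c' mc cc] cC [f' f2 ff]; exists (fun x => c' x * f' x); last first.
  by apply: aeD2 cc ff => x _ -> ->.
apply: (L2_dom mD _ (L2Z mD `|C| f2)); first by apply: measurable_funM => //; case: f2.
apply: aeD2 cc cC => x _ -> h; rewrite !normrM normr_id ler_wpM2r//.
exact: le_trans h (ler_norm C).
Qed.

Lemma aeL2_aei f : aeL2 f -> aei f.
Proof.
move=> [f' f2 ff]; have := L2M mD f2 (L2_cst mD Dfin 1); apply: aei_ae.
by apply: aeD1 ff => x _ ->; rewrite mulr1.
Qed.

End ae_L2.

(** * Integrability of the data of the equations *)

Section linearized_equations.
Context (R : realType) (n : nat) (O : set 'rV[R]_n) (mu : R).
Hypotheses (oO : open O) (bO : bounded_set O) (On0 : O !=set0).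
Local Notation leb := (@lebesgue_rV R n).
Local Notation el := (elements (H1C_space O mu)).
Local Notation nH := (@nrm R (H1C_space O mu)).
Local Notation L2 := (L2 leb O).
Local Notation n2 := (n2 leb O).
Local Notation aeO := (aeD leb O).
Local Notation aemO := (aem leb O).
Local Notation aeiO := (aei leb O).
Local Notation aeL2O := (aeL2 leb O).
Implicit Types u v w y z phi eta f : 'rV[R]_n -> R.

Let mO : measurable O := open_measurable_mx oO.
Let Ofin : (leb O < +oo)%E := lebesgue_bounded_fin mO bO.

Lemma el_measurable y : el y -> measurable_fun O y.
Proof. by move=> /elH1 /(H1_L2 oO)[]. Qed.

Lemma el_bound y : el y -> aeO (fun x => `|y x| <= nH y).
Proof.
by move=> hy; apply: aeD_all => x Ox; apply: sup_le_nH => //; exact: subset_closure.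
Qed.

Lemma el_aeL2M f y : aeL2O f -> el y -> aeL2O (fun x => f x * y x).
Proof.
move=> hf hy; have := aeL2M mO (aem_mfun leb (el_measurable hy)) (el_bound hy) hf.
by move=> [k k2 hk]; exists k => //; apply: aeD1 hk => x _ <-; rewrite mulrC.
Qed.

Lemma el_L2 y : el y -> L2 y.
Proof. by move=> /elH1 /(H1_L2 oO). Qed.

Context (a L : 'rV[R]_n -> R -> R) (p : \bar R) (a0 : R).
Hypotheses (p1 : (1%:E <= p)%E) (ha : nonlinearity O p a0 a) (hL : cost_integrand O p L).

Lemma nonlinearity_bounds (M : R) : 0 < M -> exists2 C : R, 0 <= C &
  aeO (fun x => forall t, `|t| <= M -> `|dy a x t| <= C /\ `|dyy a x t| <= C).
Proof.
have [_ _ _ h _] := ha; move=> /h[C hC]; exists `|C| => //.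
apply: aeD1 hC => x _ hC t /hC h'; have := ler_norm C.
by have := normr_ge0 (dy a x t); have := normr_ge0 (dyy a x t); split; lra.
Qed.

Lemma cost_bounds (M : R) : 0 < M -> exists2 C : R, 0 <= C &
  aeO (fun x => forall t, `|t| <= M -> `|dyy L x t| <= C).
Proof.
have [_ _ _ h _] := hL; move=> /h[C hC]; exists `|C| => //.
by apply: aeD1 hC => x _ hC t /hC h'; exact: le_trans h' (ler_norm C).
Qed.

Lemma dy_nonlinearity_bound y : el y -> exists2 C : R, 0 <= C & aeO (fun x => `|dy a x (y x)| <= C).
Proof.
move=> hy; have N0 : 0 < nH y + 1 by rewrite ltr_wpDl// nH_ge0.
have [C C0 hC] := nonlinearity_bounds N0; exists C => //.
by apply: aeD2 hC (el_bound hy) => x _ hC h; apply: (hC _ _).1; apply: le_trans h _; rewrite lerDl.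
Qed.

Lemma dyy_nonlinearity_bound y : el y -> exists2 C : R, 0 <= C & aeO (fun x => `|dyy a x (y x)| <= C).
Proof.
move=> hy; have N0 : 0 < nH y + 1 by rewrite ltr_wpDl// nH_ge0.
have [C C0 hC] := nonlinearity_bounds N0; exists C => //.
by apply: aeD2 hC (el_bound hy) => x _ hC h; apply: (hC _ _).2; apply: le_trans h _; rewrite lerDl.
Qed.

Lemma dyy_cost_bound y : el y -> exists2 C : R, 0 <= C & aeO (fun x => `|dyy L x (y x)| <= C).
Proof.
move=> hy; have N0 : 0 < nH y + 1 by rewrite ltr_wpDl// nH_ge0.
have [C C0 hC] := cost_bounds N0; exists C => //.
by apply: aeD2 hC (el_bound hy) => x _ hC h; apply: hC; apply: le_trans h _; rewrite lerDl.
Qed.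

Let caraa : caratheodory_C2 O a. Proof. by case: ha. Qed.
Let caraL : caratheodory_C2 O L. Proof. by case: hL. Qed.

Lemma dy_nonlinearity_aem y : el y -> aemO (fun x => dy a x (y x)).
Proof. by move=> /el_measurable; exact: superposition_dy_aem. Qed.

Lemma dyy_nonlinearity_aem y : el y -> aemO (fun x => dyy a x (y x)).
Proof. by move=> /el_measurable; exact: superposition_dyy_aem. Qed.

Lemma dyy_cost_aem y : el y -> aemO (fun x => dyy L x (y x)).
Proof. by move=> /el_measurable; exact: superposition_dyy_aem. Qed.

Lemma dy_cost_aei y : el y -> aeiO (fun x => dy L x (y x)).
Proof.
move=> hy; have N0 : 0 < nH y + 1 by rewrite ltr_wpDl// nH_ge0.
have [_ _ /(_ _ N0)[LM hLM hb] _ _] := hL.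
have my := el_measurable hy.
apply: (aei_dom mO _ (Lp_integrable mO Ofin p1 hLM)); first exact: superposition_dy_aem.
apply: aeD2 hb (el_bound hy) => x _ hC h; apply: hC; apply: le_trans h _; by rewrite lerDl.
Qed.

Lemma dy_nonlinearity_aeL2M y f : el y -> aeL2O f -> aeL2O (fun x => dy a x (y x) * f x).
Proof.
move=> hy hf; have [C _ hC] := dy_nonlinearity_bound hy.
exact: aeL2M (dy_nonlinearity_aem hy) hC hf.
Qed.

Lemma dyy_nonlinearity_aeL2M y f : el y -> aeL2O f -> aeL2O (fun x => dyy a x (y x) * f x).
Proof.
move=> hy hf; have [C _ hC] := dyy_nonlinearity_bound hy.
exact: aeL2M (dyy_nonlinearity_aem hy) hC hf.
Qed.

Lemma dyy_cost_aeL2M y f : el y -> aeL2O f -> aeL2O (fun x => dyy L x (y x) * f x).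
Proof.
move=> hy hf; have [C _ hC] := dyy_cost_bound hy.
exact: aeL2M (dyy_cost_aem hy) hC hf.
Qed.

Lemma nonlinearity_aei y : el y -> aeiO (fun x => a x (y x)).
Proof.
move=> hy; have N0 : 0 < nH y + 1 by rewrite ltr_wpDl// nH_ge0.
have [C C0 hC] := nonlinearity_bounds N0; have [[_ hd] hp0 _ _ _] := ha.
have i0 := aei_norm (Lp_integrable mO Ofin p1 hp0).
have iC : aeiO (fun=> C * (nH y + 1)) by apply: (aeL2_aei mO Ofin); apply: aeL2_L2; exact: L2_cst.
apply: (aei_dom mO _ (aeiD mO i0 iC)); first exact: (@superposition_aem _ _ _ mO a caraa y (el_measurable hy)).
apply: aeD3 hC (el_bound hy) hd => x _ hC' h [d1 _ _].
(* Integrability is given at 0; from there the mean value theorem adds a constant. *)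
have -> : a x (y x) = a x 0 + (a x (y x) - a x 0) by ring.
apply: (le_trans (ler_normD _ _)); rewrite lerD2l.
have yM : `|y x| <= nH y + 1 by apply: le_trans h _; rewrite lerDl.
have := @lipschitz_of_derive1 _ (a x) (nH y + 1) d1 C 0 (y x).
rewrite normr0 subr0 => bnd; apply: le_trans (bnd _ (ltW N0) yM) _; last exact: ler_wpM2l.
by move=> t /hC'[].
Qed.

Lemma state_aei u y : L2 u -> el y -> aeiO (fun x => - (a x (y x) + u x * y x)).
Proof.
move=> u2 hy; apply: aeiN => //; apply: aeiD => //; first exact: nonlinearity_aei.
by apply: (aeL2_aei mO Ofin); apply: el_aeL2M => //; exact: aeL2_L2.
Qed.

Lemma adjoint_aei u y phi : L2 u -> el y -> el phi ->
  aeiO (fun x => dy L x (y x) - dy a x (y x) * phi x - u x * phi x).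
Proof.
move=> u2 hy hphi; apply: aeiB => //; first apply: aeiB => //; first exact: dy_cost_aei.
  apply: (aeL2_aei mO Ofin); apply: dy_nonlinearity_aeL2M => //; apply: aeL2_L2; exact: el_L2.
by apply: (aeL2_aei mO Ofin); apply: el_aeL2M => //; exact: aeL2_L2.
Qed.

Lemma linearized_state_aeL2 u y v z : L2 u -> el y -> L2 v -> el z ->
  aeL2O (fun x => - (dy a x (y x) * z x + u x * z x + v x * y x)).
Proof.
move=> u2 hy v2 hz; apply: aeL2N => //; apply: aeL2D => //; last by apply: el_aeL2M => //; exact: aeL2_L2.
apply: aeL2D => //; last by apply: el_aeL2M => //; exact: aeL2_L2.
by apply: dy_nonlinearity_aeL2M => //; apply: aeL2_L2; exact: el_L2.
Qed.

Let distr_aux (l b z f : R) : (l - f * b) * z = l * z - b * (z * f).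
Proof. by ring. Qed.

Lemma linearized_adjoint_aeL2 u y phi v z eta : L2 u -> el y -> el phi -> L2 v -> el z -> el eta ->
  aeL2O (fun x => (dyy L x (y x) - phi x * dyy a x (y x)) * z x - v x * phi x
              - dy a x (y x) * eta x - u x * eta x).
Proof.
move=> u2 hy hphi v2 hz heta.
apply: aeL2B => //; last by apply: el_aeL2M => //; exact: aeL2_L2.
apply: aeL2B => //; last by apply: dy_nonlinearity_aeL2M => //; apply: aeL2_L2; exact: el_L2.
apply: aeL2B => //; last by apply: el_aeL2M => //; exact: aeL2_L2.
have := aeL2B mO (dyy_cost_aeL2M hy (aeL2_L2 (el_L2 hz)))
  (dyy_nonlinearity_aeL2M hy (el_aeL2M (aeL2_L2 (el_L2 hz)) hphi)).
by move=> [k k2 hk]; exists k => //; apply: aeD1 hk => x _ <-; exact: distr_aux.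
Qed.

End linearized_equations.

Section equation_remainders.
Context (R : realType).

Lemma pos_below4 (b c e f : R) : 0 < b -> 0 < c -> 0 < e -> 0 < f ->
  exists2 s : R, 0 < s & [/\ s <= b, s <= c, s <= e & s <= f].
Proof.
move=> b0 c0 e0 f0; exists (Num.min (Num.min b c) (Num.min e f)).
  by rewrite !lt_min b0 c0 e0 f0.
by rewrite !ge_min !lexx !orbT.
Qed.

Lemma state_remainder (as_ a0 c ys y0 z u v s e N C k : R) : 0 <= s -> s <= e -> e <= 1 -> 0 <= C ->
  `|z| <= N -> `|ys - y0 - s * z| <= e * s -> `|c| <= C ->
  `|as_ - a0 - c * (ys - y0)| <= C * `|ys - y0| ^+ 2 -> - (c * z + u * z + v * y0) = k ->
  `|- (as_ + (u + s * v) * ys) - - (a0 + u * y0) - s * k| <=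
    e * s * ((C * (N + 1) ^+ 2 + C) + (`|u| + (N + 1) * `|v|)).
Proof.
move=> s0 se e1 C0 zN h cC hf <-.
have h1 := taylor_remainder s0 se e1 C0 zN h cC hf.
have h2 := product_remainder u v s0 se e1 zN h.
have -> : - (as_ + (u + s * v) * ys) - - (a0 + u * y0) - s * - (c * z + u * z + v * y0) =
  - ((as_ - a0 - s * (c * z)) + ((u + s * v) * ys - u * y0 - s * (u * z + v * y0))) by ring.
by rewrite normrN [leRHS]mulrDr; apply: (le_trans (ler_normD _ _)); exact: lerD.
Qed.

Lemma adjoint_remainder (ls l0 dl bs b0 db ps p0 eta ys y0 z u v s e N P C k : R) :
  0 <= s -> s <= e -> e <= 1 -> 0 <= C ->
  `|z| <= N -> `|eta| <= N -> `|p0| <= P ->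
  `|ys - y0 - s * z| <= e * s -> `|ps - p0 - s * eta| <= e * s ->
  `|dl| <= C -> `|db| <= C -> `|b0| <= C -> `|bs - b0| <= C * `|ys - y0| ->
  `|ls - l0 - dl * (ys - y0)| <= e * `|ys - y0| ->
  `|bs - b0 - db * (ys - y0)| <= e * `|ys - y0| ->
  (dl - p0 * db) * z - v * p0 - b0 * eta - u * eta = k ->
  `|(ls - bs * ps - (u + s * v) * ps) - (l0 - b0 * p0 - u * p0) - s * k| <=
    e * s * (((N + 1 + C) + P * (N + 1 + C) + C + C * (N + 1) ^+ 2) + (`|u| + (N + 1) * `|v|)).
Proof.
move=> s0 se e1 C0 zN eN pP h h' dlC dbC b0C bl hl hb <-.
have h1 := modulus_remainder s0 e1 C0 zN h dlC hl.
have h2 := modulus_remainder s0 e1 C0 zN h dbC hb.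
have h3 := product_remainder u v s0 se e1 eN h'.
have h4 := increment_bound s0 e1 zN h.
have h5 := increment_bound s0 e1 eN h'.
have N0 : 0 <= N by exact: le_trans zN.
have es0 : 0 <= e * s by exact: le_trans h.
(* The increment of the product of [b] and the adjoint is split into [p0] times the one of [b], [b0]
   times the one of the adjoint, and the product of both increments, which is of order [s^2]. *)
have -> : (ls - bs * ps - (u + s * v) * ps) - (l0 - b0 * p0 - u * p0) -
  s * ((dl - p0 * db) * z - v * p0 - b0 * eta - u * eta) =
  (ls - l0 - s * (dl * z)) - p0 * (bs - b0 - s * (db * z)) - b0 * (ps - p0 - s * eta)
  - (bs - b0) * (ps - p0) - ((u + s * v) * ps - u * p0 - s * (u * eta + v * p0)) by ring.
rewrite [leRHS]mulrDr; apply: (le_trans (ler_normB _ _)); apply: lerD => //.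
rewrite [leRHS]mulrDr; apply: (le_trans (ler_normB _ _)); apply: lerD; last first.
  rewrite normrM; apply: (@le_trans _ _ ((C * (s * (N + 1))) * (s * (N + 1)))).
    by apply: ler_pM => //; apply: (le_trans bl); exact: ler_wpM2l.
  have -> : C * (s * (N + 1)) * (s * (N + 1)) = s * (s * (C * (N + 1) ^+ 2)) by ring.
  rewrite mulrA; apply: ler_wpM2r; first by rewrite mulr_ge0// sqr_ge0.
  exact: ler_wpM2r.
rewrite [leRHS]mulrDr; apply: (le_trans (ler_normB _ _)); apply: lerD; last first.
  by rewrite normrM mulrC; exact: ler_pM.
rewrite [leRHS]mulrDr; apply: (le_trans (ler_normB _ _)); apply: lerD => //.
by rewrite normrM (mulrCA _ P); exact: ler_pM.
Qed.

End equation_remainders.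

(** * The equations solved by the derivatives of [G] and [Phi] *)

Section derivative_equations.
Context (R : realType) (n : nat) (O : set 'rV[R]_n) (mu : R).
Hypotheses (oO : open O) (bO : bounded_set O) (On0 : O !=set0).
Local Notation leb := (@lebesgue_rV R n).
Local Notation fT := ('rV[R]_n -> R).
Local Notation el := (elements (H1C_space O mu)).
Local Notation nH := (@nrm R (H1C_space O mu)).
Local Notation L2 := (L2 leb O).
Local Notation n2 := (n2 leb O).
Local Notation aeO := (aeD leb O).
Implicit Types u v w y z phi eta f : 'rV[R]_n -> R.

Let mO : measurable O := open_measurable_mx oO.
Let Ofin : (leb O < +oo)%E := lebesgue_bounded_fin mO bO.

Context (A : 'rV[R]_n -> 'M[R]_n) (MB : R) (MB0 : 0 <= MB).
Hypothesis mA : forall i j, measurable_fun O (fun x => A x i j).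
Hypothesis bA : forall i j, aeO (fun x => `|A x i j| <= MB).
Context (a L : 'rV[R]_n -> R -> R) (p : \bar R) (a0 : R) (g : fT).
Hypotheses (p1 : (1%:E <= p)%E) (ha : nonlinearity O p a0 a) (hL : cost_integrand O p L).
Context (U : set fT) (G Phi : fT -> fT) (DG DPhi : fT -> fT -> fT).
Hypothesis U2 : forall u, U u -> L2 u.
Hypothesis Uopen : forall u, U u -> exists2 r : R, 0 < r &
  forall v, L2 v -> n2 v < r -> U (fun x => u x + v x).
Hypothesis elG : forall u, U u -> el (G u).
Hypothesis eqG : forall u, U u -> state_eq O A a g u (G u).
Hypothesis fG : frechet_facts O mu U G DG.

Let caraa : caratheodory_C2 O a. Proof. by case: ha. Qed.
Let caraL : caratheodory_C2 O L. Proof. by case: hL. Qed.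

Let L2_weight (K k : R) u v : L2 u -> L2 v -> L2 (fun x => K + (`|u x| + k * `|v x|)).
Proof.
by move=> u2 v2; apply: L2D => //; [exact: L2_cst|apply: L2_lin => //; exact: L2_norm].
Qed.

(** Smoothness of [G] does not tell what [DG] is. The state equation is differentiated along
    [u + s v]; the remainder of the nonlinearity is quadratic on the bounded range of the states. *)
Lemma derivative_state_eq u v : U u -> L2 v -> linearized_state_eq O A a u (G u) v (DG u v).
Proof.
move=> Uu v2; set y0 := G u; set z := DG u v.
have u2 := U2 Uu; have ey : el y0 := elG Uu; have ez : el z := ff_el fG Uu v2.
have [k' k'2 kk] := linearized_state_aeL2 oO On0 ha u2 ey v2 ez.
pose N := nH z; have N0 : 0 <= N := nH_ge0 On0 ez; have Y0 := nH_ge0 On0 ey.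
have Nz : 0 <= N + 1 by lra.
(* Bounds all states in play: for [s <= 1] they differ from [y0] by at most [N + 1]. *)
pose M := nH y0 + (N + 2); have M0 : 0 < M by rewrite /M; lra.
have [C C0 hC] := nonlinearity_bounds ha M0.
have hdyy : aeO (fun x => forall t, `|t| <= M -> `|dyy a x t| <= C).
  by apply: aeD1 hC => x _ h t tM; case: (h t tM).
have hT := taylor_F caraa C0 hdyy.
apply: (linearize oO bO MB0 mA bA (eqG Uu) (state_aei oO bO On0 p1 ha u2 ey) (elH1 ez) k'2 _ kk).
  exact: (L2_weight (C * (N + 1) ^+ 2 + C) (N + 1) u2 v2).
move=> e e0; pose e1 := Num.min e 1.
have e10 : 0 < e1 by rewrite lt_min e0 ltr01.
have e1e : e1 <= e by rewrite ge_min lexx.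
have e11 : e1 <= 1 by rewrite ge_min lexx orbT.
have [s0 s00 hs] := ff_directional oO bO On0 fG Uopen elG Uu v2 e10.
pose s := Num.min s0 e1; have spos : 0 < s by rewrite lt_min s00.
have se1 : s <= e1 by rewrite ge_min lexx orbT.
have ss0 : s <= s0 by rewrite ge_min lexx.
have [Uu' hH hP] := hs s spos ss0.
pose u' := fun x => u x + s * v x.
have ey' : el (G u') := elG Uu'.
exists s, (G u'), (fun x => - (a x (G u' x) + u' x * G u' x)); split=> //.
- exact: eqG.
- exact: (@state_aei _ _ _ _ oO bO On0 _ _ _ p1 ha u' (G u') (U2 Uu') ey').
- by apply: le_trans hH _; rewrite ler_pM2r.
have zN := el_bound On0 ez; have yM := el_bound On0 ey.
have := aeD3 (fun x _ h1 h2 h3 => conj h1 (conj h2 h3)) zN yM kk.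
apply: aeD3 hC hT => x Ox hCx hTx [zx [yx kx]].
have px := hP x (@subset_closure _ O x Ox).
have inc := increment_bound (ltW spos) e11 zx px.
have y0M : `|y0 x| <= M by apply: (le_trans yx); rewrite /M; lra.
have ysM : `|G u' x| <= M.
  have -> : G u' x = y0 x + (G u' x - y0 x) by ring.
  apply: (le_trans (ler_normD _ _)); rewrite /M; apply: lerD => //.
  apply: (le_trans inc); apply: (@le_trans _ _ (1 * (N + 1))).
    by apply: ler_wpM2r => //; exact: le_trans se1 e11.
  by lra.
have [cC _] := hCx _ y0M.
have kap0 : 0 <= (C * (N + 1) ^+ 2 + C) + (`|u x| + (N + 1) * `|v x|).
  by rewrite !addr_ge0 ?mulr_ge0 ?sqr_ge0//; lra.
apply: (@le_trans _ _ (e1 * s * ((C * (N + 1) ^+ 2 + C) + (`|u x| + (N + 1) * `|v x|)))); last first.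
  by apply: ler_wpM2r => //; rewrite ler_pM2r.
exact: (state_remainder (ltW spos) se1 e11 C0 zx px cC (hTx _ _ y0M ysM) kx).
Qed.

Hypothesis elPhi : forall u, U u -> el (Phi u).
Hypothesis eqPhi : forall u, U u -> adjoint_eq O A a L u (G u) (Phi u).
Hypothesis fPhi : frechet_facts O mu U Phi DPhi.

(** As for the state, except that [dy a] and [dy L] have no quadratic remainder: [s (N + 1)], which
    bounds the increment of the state, must also stay below the radii [ra] and [rl] of
    equicontinuity. *)
Lemma derivative_adjoint_eq u v : U u -> L2 v ->
  linearized_adjoint_eq O A a L u (G u) (Phi u) v (DG u v) (DPhi u v).
Proof.
move=> Uu v2; set y0 := G u; set z := DG u v; set p0 := Phi u; set eta := DPhi u v.
have u2 := U2 Uu; have ey : el y0 := elG Uu; have ez : el z := ff_el fG Uu v2.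
have ep : el p0 := elPhi Uu; have ee : el eta := ff_el fPhi Uu v2.
have [k' k'2 kk] := linearized_adjoint_aeL2 oO On0 ha hL u2 ey ep v2 ez ee.
have Z0 := nH_ge0 On0 ez; have E0 := nH_ge0 On0 ee.
pose N := nH z + nH eta; have N0 : 0 <= N by exact: addr_ge0.
have Y0 := nH_ge0 On0 ey; pose P := nH p0; have P0 : 0 <= P := nH_ge0 On0 ep.
pose M := nH y0 + (N + 2); have M0 : 0 < M by rewrite /M; lra.
have ZN : nH z <= N by rewrite lerDl.
have EN : nH eta <= N by rewrite lerDr.
have YM : nH y0 <= M by rewrite /M; lra.
have NM : 1 * (N + 1) <= N + 2 by lra.
have [Ca Ca0 hCa] := nonlinearity_bounds ha M0.
have [Cl Cl0 hCl] := cost_bounds hL M0.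
pose C := Ca + Cl; have C0 : 0 <= C by exact: addr_ge0.
have hdyy : aeO (fun x => forall t, `|t| <= M -> `|dyy a x t| <= Ca).
  by apply: aeD1 hCa => x _ h t tM; case: (h t tM).
have hLip := dy_lipschitz caraa hdyy.
have mAt i j : measurable_fun O (fun x => adjoint_coef A x i j).
  by have := mA j i; apply: eq_measurable_fun => x _; rewrite /adjoint_coef mxE.
have bAt i j : aeO (fun x => `|adjoint_coef A x i j| <= MB).
  by apply: aeD1 (bA j i) => x _; rewrite /adjoint_coef mxE.
pose K := (N + 1 + C) + P * (N + 1 + C) + C + C * (N + 1) ^+ 2.
have K0 : 0 <= K.
  have Q0 : 0 <= N + 1 + C by lra.
  by apply: addr_ge0; [have := mulr_ge0 P0 Q0; lra|rewrite mulr_ge0// sqr_ge0].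
apply: (linearize oO bO MB0 mAt bAt (eqPhi Uu) (adjoint_aei oO bO On0 p1 ha hL u2 ey ep) (elH1 ee) k'2 _ kk).
  exact: (L2_weight K (N + 1) u2 v2).
move=> e e0; pose e1 := Num.min e 1.
have e10 : 0 < e1 by rewrite lt_min e0 ltr01.
have e1e : e1 <= e by rewrite ge_min lexx.
have e11 : e1 <= 1 by rewrite ge_min lexx orbT.
have [_ _ _ _ /(_ _ _ e10 M0)[ra ra0 hra]] := ha.
have [_ _ _ _ /(_ _ _ e10 M0)[rl rl0 hrl]] := hL.
have hTa := taylor_dy caraa hra; have hTl := taylor_dy caraL hrl.
have [s1 s10 hs1] := ff_directional oO bO On0 fG Uopen elG Uu v2 e10.
have [s2 s20 hs2] := ff_directional oO bO On0 fPhi Uopen elPhi Uu v2 e10.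
have N1 : 0 < N + 1 by lra.
have Nz := ltW N1.
have r0 : 0 < Num.min ra rl / (N + 1) by rewrite divr_gt0// lt_min ra0.
have [s spos [ss1 ss2 se1 sr1]] := pos_below4 s10 s20 e10 r0.
have sr : s * (N + 1) <= Num.min ra rl by rewrite -ler_pdivlMr.
have [Uu' _ hP] := hs1 s spos ss1.
have [_ hH hP'] := hs2 s spos ss2.
pose u' := fun x => u x + s * v x.
have ey' : el (G u') := elG Uu'; have ep' : el (Phi u') := elPhi Uu'.
exists s, (Phi u'), (fun x => dy L x (G u' x) - dy a x (G u' x) * Phi u' x - u' x * Phi u' x).
split=> //.
- exact: eqPhi.
- exact: (@adjoint_aei _ _ _ _ oO bO On0 _ _ _ _ p1 ha hL u' (G u') (Phi u') (U2 Uu') ey' ep').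
- by apply: le_trans hH _; rewrite ler_pM2r.
have zN := el_bound On0 ez; have yM := el_bound On0 ey.
have eN := el_bound On0 ee; have pN := el_bound On0 ep.
have h1 := aeD3 (fun x _ h1 h2 h3 => conj h1 (conj h2 h3)) zN yM kk.
have h2 := aeD3 (fun x _ h1 h2 h3 => conj h1 (conj h2 h3)) eN pN h1.
have h3 := aeD3 (fun x _ h1 h2 h3 => conj h1 (conj h2 h3)) hCa hCl hLip.
have h4 := aeD3 (fun x _ h1 h2 h3 => conj h1 (conj h2 h3)) hTa hTl h3.
apply: aeD2 h2 h4 => x Ox [ex [px [zx [yx kx]]]] [hax [hlx [hCax [hClx hLx]]]].
have qx := hP x (@subset_closure _ O x Ox).
have qx' := hP' x (@subset_closure _ O x Ox).
have zx' := le_trans zx ZN.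
have ex' := le_trans ex EN.
have inc := increment_bound (ltW spos) e11 zx' qx.
have y0M := le_trans yx YM.
have ysM : `|G u' x| <= M.
  have -> : G u' x = y0 x + (G u' x - y0 x) by ring.
  apply: (le_trans (ler_normD _ _)); rewrite /M; apply: lerD => //.
  apply: (le_trans inc); apply: le_trans NM.
  by apply: ler_wpM2r => //; exact: le_trans se1 e11.
have [c1 c2] := hCax _ y0M; have c3 := hClx _ y0M.
have CaC : Ca <= C by rewrite lerDl.
have ClC : Cl <= C by rewrite lerDr.
have := le_trans inc sr; rewrite le_min => /andP[ira irl].
have kap0 : 0 <= K + (`|u x| + (N + 1) * `|v x|).
  by apply: addr_ge0 => //; apply: addr_ge0 => //; exact: mulr_ge0.
apply: (@le_trans _ _ (e1 * s * (K + (`|u x| + (N + 1) * `|v x|)))); last first.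
  by apply: ler_wpM2r => //; rewrite ler_pM2r.
apply: (adjoint_remainder (ltW spos) se1 e11 C0 zx' ex' px qx qx' (le_trans c3 ClC)
  (le_trans c2 CaC) (le_trans c1 CaC) _ (hlx _ _ y0M ysM irl) (hax _ _ y0M ysM ira) kx).
by apply: (le_trans (hLx _ _ y0M ysM)); exact: ler_wpM2r.
Qed.

End derivative_equations.

Section weak_solution_ae.
Context (R : realType) (n : nat) (O : set 'rV[R]_n).
Local Notation leb := (@lebesgue_rV R n).

Lemma weak_solution_ae B f f' h (y : 'rV[R]_n -> R) : aeD leb O (fun x => f x = f' x) ->
  weak_solution O B f h y -> weak_solution O B f' h y.
Proof.
move=> ff [hy hs]; split=> // v t hv ht; rewrite (hs v t hv ht); congr (_ + _).
by apply: Rint_ae; apply: aeD1 ff => x _ ->.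
Qed.

End weak_solution_ae.

(** * The domain [calA] and uniqueness for the linearized equations *)

Section admissible_domain.
Context (R : realType) (n : nat) (O : set 'rV[R]_n) (mu : R).
Hypotheses (oO : open O) (bO : bounded_set O) (On0 : O !=set0) (mu0 : 0 < mu).
Local Notation leb := (@lebesgue_rV R n).
Local Notation el := (elements (H1C_space O mu)).
Local Notation L2 := (L2 leb O).
Local Notation n2 := (n2 leb O).
Local Notation aeO := (aeD leb O).
Local Notation aeiO := (aei leb O).
Implicit Types u v w y z phi eta f : 'rV[R]_n -> R.

Let mO : measurable O := open_measurable_mx oO.
Let Ofin : (leb O < +oo)%E := lebesgue_bounded_fin mO bO.

Context (A : 'rV[R]_n -> 'M[R]_n) (MA LambdaA : R) (hA : elliptic O A MA LambdaA).

Lemma elliptic_bounded : exists2 MB : R, 0 <= MB &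
  [/\ forall i j, measurable_fun O (fun x => A x i j),
      forall i j, aeO (fun x => `|A x i j| <= MB),
      forall i j, measurable_fun O (fun x => adjoint_coef A x i j) &
      forall i j, aeO (fun x => `|adjoint_coef A x i j| <= MB)].
Proof.
have [_ _ hL _] := hA.
have mA i j : measurable_fun O (fun x => A x i j) by exact: Lp_measurable (hL i j).
have hM0 i : exists M : 'I_n -> R, forall j, aeO (fun x => `|A x i j| <= M j).
  by have [M hM] := choice (fun j => Lp_infty_bounded (hL i j)); exists M.
have [M hM] := choice hM0.
have le i j : M i j <= \sum_i \sum_j `|M i j|.
  rewrite (bigD1 i)//= (bigD1 j)//= -addrA; apply: (le_trans (ler_norm _)); rewrite lerDl.
  by apply: addr_ge0; apply: sumr_ge0 => k _ //; exact: sumr_ge0.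
have bA i j : aeO (fun x => `|A x i j| <= \sum_i \sum_j `|M i j|).
  by apply: aeD1 (hM i j) => x _ h; exact: le_trans h (le i j).
exists (\sum_i \sum_j `|M i j|); first by apply: sumr_ge0 => i _; exact: sumr_ge0.
split=> // i j.
  by have := mA j i; apply: eq_measurable_fun => x _; rewrite /adjoint_coef mxE.
by apply: aeD1 (bA j i) => x _; rewrite /adjoint_coef mxE.
Qed.

Lemma elliptic_coercive : aeO (fun x => forall xi : 'rV[R]_n,
  LambdaA * enorm xi ^+ 2 <= \sum_i \sum_j A x i j * xi 0 i * xi 0 j).
Proof. by have [_ _ _ h] := hA; apply: aeD1 h => x _ h xi; have /andP[] := h xi. Qed.

Lemma elliptic_adjoint_coercive : aeO (fun x => forall xi : 'rV[R]_n,
  LambdaA * enorm xi ^+ 2 <= \sum_i \sum_j adjoint_coef A x i j * xi 0 i * xi 0 j).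
Proof.
apply: aeD1 elliptic_coercive => x _ h xi; apply: le_trans (h xi) _.
rewrite exchange_big/= le_eqVlt; apply/orP; left; apply/eqP.
by apply: eq_bigr => i _; apply: eq_bigr => j _; rewrite /adjoint_coef mxE mulrAC.
Qed.

Context (a0 C4 : R) (eps : ('rV[R]_n -> R) -> R).
Hypothesis hC4 : embedding_L4 O C4.
Hypothesis heps : forall u, calA0 O a0 u -> 0 < eps u < Lambda O LambdaA a0 u / C4 ^+ 2.

Local Notation calU := (@calA R n O a0 eps).

Lemma calA_L2 u : calU u -> L2 u.
Proof. by move=> [/(Lp2P mO)]. Qed.

Lemma calA_open u : calU u -> exists2 r : R, 0 < r &
  forall v, L2 v -> n2 v < r -> calU (fun x => u x + v x).
Proof.
move=> [/(Lp2P mO) u2 [ub hub du]]; have ub2 : L2 ub by have [/(Lp2P mO)] := hub.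
have d2 := L2B mO u2 ub2.
exists (eps ub - Lp_norm leb O 2%:E (u \- ub)); first by rewrite subr_gt0.
move=> v v2 vr; split; first by apply/(Lp2P mO); exact: L2D.
exists ub => //.
have E : (fun x => u x + v x) \- ub = (fun x => (u x - ub x) + v x).
  by apply/funext => x /=; rewrite addrAC.
rewrite E Lp_norm_n2//; last exact: L2D.
rewrite Lp_norm_n2// in vr; apply: (le_lt_trans (n2_tri mO d2 v2)).
by move: vr; rewrite ltrBrDl.
Qed.

Lemma calA_admissible (alpha : R) (beta : \bar R) u : - a0 < alpha -> admissible O alpha beta u ->
  calU u.
Proof.
move=> al [up uae]; have u2 : L2 u by exact/(Lp2P mO).
have hu0 : calA0 O a0 u.
  split=> //; have al' : (alpha%:E <= ess_inf_in O u)%E.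
    by apply: ereal_sup_ubound; apply: aeD1 uae => x _ /andP[].
  apply: lt_le_trans (leeD2l a0%:E al'); rewrite -EFinD lte_fin; lra.
split=> //; exists u => //; have /andP[e0 _] := heps hu0.
rewrite Lp_norm_n2//; last exact: L2B.
apply: le_lt_trans e0; rewrite (@n2_ae _ _ _ _ _ _ (fun x => 0 * u x)) ?n2Z ?normr0 ?mul0r//.
by apply: aeD_all => x _ /=; rewrite subrr mul0r.
Qed.

Lemma calA_coercive u : calU u -> exists ub (Lam e : R), [/\ L2 ub,
  aeO (fun x => Lam <= a0 + ub x), 0 < Lam <= LambdaA, n2 (fun x => u x - ub x) <= e &
  e * C4 ^+ 2 < Lam].
Proof.
move=> [/(Lp2P mO) u2 [ub hub du]]; have ub2 : L2 ub by have [/(Lp2P mO)] := hub.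
have /andP[e0 eL] := heps hub.
(* If [C4] were 0, the quotient by its square would be 0 by convention and leave no room for the
   positive radius. *)
have C0 : 0 < C4 ^+ 2.
  rewrite lt_neqAle sqr_ge0 andbT eq_sym; apply/negP => /eqP C0; move: eL.
  by rewrite C0 invr0 mulr0 ltNge (ltW e0).
have eC : eps ub * C4 ^+ 2 < Lambda O LambdaA a0 ub by rewrite -ltr_pdivlMr.
have eC0 : 0 < eps ub * C4 ^+ 2 by exact: mulr_gt0.
(* Strictly below [Lambda]: the essential infimum is a supremum of lower bounds, and only a smaller
   number is sure to lie below one of them. *)
pose Lam := (eps ub * C4 ^+ 2 + Lambda O LambdaA a0 ub) / 2.
have L1 : eps ub * C4 ^+ 2 < Lam by rewrite /Lam; lra.
have L2' : Lam < Lambda O LambdaA a0 ub by rewrite /Lam; lra.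
have [L3 L4] : Lam < LambdaA /\ Lam < a0 + fine (ess_inf_in O ub).
  by move: L2'; rewrite /Lambda lt_min => /andP[].
have : ((Lam - a0)%:E < ess_inf_in O ub)%E.
  have [_] := hub; case: (ess_inf_in O ub) L4 => [r|_ _|]//=; last exact: ltry.
  by move=> h _; rewrite lte_fin; lra.
move=> /ereal_sup_gt[m hm mL].
exists ub, Lam, (eps ub); split=> //.
- apply: aeD1 hm => x _ hm; have := lt_le_trans mL hm; rewrite lte_fin => h; lra.
- by rewrite (lt_trans eC0 L1) ltW.
- by move: du; rewrite (Lp_norm_n2 mO (L2B mO u2 ub2)) => /ltW.
Qed.

Context (a L : 'rV[R]_n -> R -> R) (p : \bar R).
Hypotheses (ha : nonlinearity O p a0 a) (hL : cost_integrand O p L).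

Let unique (B : 'rV[R]_n -> 'M[R]_n) (MB : R) u y f1 f2 (h : 'rV[R]_n -> R) z1 z2 : 0 <= MB ->
  (forall i j, measurable_fun O (fun x => B x i j)) ->
  (forall i j, aeO (fun x => `|B x i j| <= MB)) ->
  aeO (fun x => forall xi : 'rV[R]_n,
    LambdaA * enorm xi ^+ 2 <= \sum_i \sum_j B x i j * xi 0 i * xi 0 j) ->
  calU u -> el y -> el z1 -> el z2 -> weak_solution O B f1 h z1 -> weak_solution O B f2 h z2 ->
  aeiO f1 -> aeiO f2 -> aeO (fun x => f1 x - f2 x = - ((dy a x (y x) + u x) * (z1 x - z2 x))) ->
  aeO (fun x => z1 x = z2 x).
Proof.
move=> MB0 mB bB ell hu ey e1 e2 s1 s2 i1 i2 f12.
have [ub [Lam [e [ub2 Lub Lam0 ue eC]]]] := calA_coercive hu.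
have [C C0 hC] := dy_nonlinearity_bound On0 ha ey.
have low : aeO (fun x => a0 <= dy a x (y x)) by have [_ _ h' _ _] := ha; apply: aeD1 h' => x _.
exact: (coercive_unique oO bO On0 mu0 MB0 mB bB e1 e2 s1 s2 i1 i2 f12
  (dy_nonlinearity_aem oO ha ey) hC low (calA_L2 hu) ub2 Lub Lam0 ue eC ell hC4).
Qed.

Lemma linearized_state_unique u u' y y' v v' z z' : calU u -> L2 u' -> el y -> el y' ->
  L2 v -> L2 v' -> el z -> el z' ->
  aeO (fun x => u x = u' x) -> aeO (fun x => y x = y' x) -> aeO (fun x => v x = v' x) ->
  linearized_state_eq O A a u y v z -> linearized_state_eq O A a u' y' v' z' ->
  aeO (fun x => z x = z' x).
Proof.
move=> hu u2' ey ey' v2 v2' ez ez' uu yy vv s s'.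
have [MB MB0 [mA bA _ _]] := elliptic_bounded.
have i1 := aeL2_aei mO Ofin (linearized_state_aeL2 oO On0 ha (calA_L2 hu) ey v2 ez).
have i2 := aeL2_aei mO Ofin (linearized_state_aeL2 oO On0 ha u2' ey' v2' ez').
apply: (unique MB0 mA bA elliptic_coercive hu ey ez ez' s s' i1 i2).
by apply: aeD3 uu yy vv => x _ <- <- <-; set c := dy a x _; ring.
Qed.

Lemma linearized_adjoint_unique u u' y y' phi phi' v v' z z' eta eta' :
  calU u -> L2 u' -> el y -> el y' -> el phi -> el phi' ->
  L2 v -> L2 v' -> el z -> el z' -> el eta -> el eta' ->
  aeO (fun x => u x = u' x) -> aeO (fun x => y x = y' x) -> aeO (fun x => phi x = phi' x) ->
  aeO (fun x => v x = v' x) -> aeO (fun x => z x = z' x) ->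
  linearized_adjoint_eq O A a L u y phi v z eta ->
  linearized_adjoint_eq O A a L u' y' phi' v' z' eta' ->
  aeO (fun x => eta x = eta' x).
Proof.
move=> hu u2' ey ey' ep ep' v2 v2' ez ez' ee ee' uu yy pp vv zz s s'.
have [MB MB0 [_ _ mA bA]] := elliptic_bounded.
have i1 := aeL2_aei mO Ofin (linearized_adjoint_aeL2 oO On0 ha hL (calA_L2 hu) ey ep v2 ez ee).
have i2 := aeL2_aei mO Ofin (linearized_adjoint_aeL2 oO On0 ha hL u2' ey' ep' v2' ez' ee').
apply: (unique MB0 mA bA elliptic_adjoint_coercive hu ey ee ee' s s' i1 i2).
have h1 := aeD3 (fun x _ a b c => conj a (conj b c)) uu yy pp.
apply: aeD3 h1 vv zz => x _ [<- [<- <-]] <- <-.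
by set c := dy a x _; set k := (_ - _) * z x; ring.
Qed.

End admissible_domain.

(** * Derivatives of the cost *)

Section adjoint_identities.
Context (R : realType) (n : nat) (O : set 'rV[R]_n) (mu : R).
Hypotheses (oO : open O) (bO : bounded_set O) (On0 : O !=set0) (mu0 : 0 < mu).
Local Notation leb := (@lebesgue_rV R n).
Local Notation el := (elements (H1C_space O mu)).
Local Notation L2 := (L2 leb O).
Local Notation ip := (ip leb O).
Local Notation I := (Rintegral leb O).
Local Notation aeiO := (aei leb O).
Implicit Types u v w y z phi eta f : 'rV[R]_n -> R.

Let mO : measurable O := open_measurable_mx oO.
Let Ofin : (leb O < +oo)%E := lebesgue_bounded_fin mO bO.

Context (A : 'rV[R]_n -> 'M[R]_n) (a L : 'rV[R]_n -> R -> R) (p : \bar R) (a0 : R).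
Hypotheses (p1 : (1%:E <= p)%E) (ha : nonlinearity O p a0 a) (hL : cost_integrand O p L).

Lemma el_aeiM f y : aeiO f -> el y -> aeiO (fun x => f x * y x).
Proof.
by move=> hf hy; exact: (aeiM_bounded oO hf (el_measurable oO hy) (el_bound On0 hy)).
Qed.

(* testing either equation with the solution of the other *)
Lemma weak_solution_adjoint f1 f2 z eta : el z -> el eta -> aeiO f1 -> aeiO f2 ->
  weak_solution O A f1 (cst 0) z -> weak_solution O (adjoint_coef A) f2 (cst 0) eta ->
  I (fun x => f1 x * eta x - f2 x * z x) = 0.
Proof.
move=> ez ee i1 i2 s1 s2.
have t1 := weak_test oO bO s1 (elH1 ee) (el_continuous On0 mu0 ee).
have t2 := weak_test oO bO s2 (elH1 ez) (el_continuous On0 mu0 ez).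
have z0 w : \int[@hausdorff R n n.-1]_(x in boundary O) (cst 0 x * w x) = 0.
  by rewrite /Rintegral integral0_eq// => x _; rewrite /= mul0r.
rewrite RintB//; [|exact: el_aeiM|exact: el_aeiM].
by move: t1 t2; rewrite !z0 !addr0 Aform_adjoint => <- <-; rewrite subrr.
Qed.

(** Each equation is tested with the solution of the other, and the terms in [dy a] and [u] cancel.
    This makes [nu u - y phi] the gradient of the cost. *)
Lemma gradient_identity u y phi v z : L2 u -> el y -> el phi -> L2 v -> el z ->
  adjoint_eq O A a L u y phi -> linearized_state_eq O A a u y v z ->
  I (fun x => dy L x (y x) * z x) = - I (fun x => v x * (y x * phi x)).
Proof.
move=> u2 ey ep v2 ez sp sz.
have i1 := aeL2_aei mO Ofin (linearized_state_aeL2 oO On0 ha u2 ey v2 ez).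
have i2 := @adjoint_aei _ _ _ _ oO bO On0 _ _ _ _ p1 ha hL u y phi u2 ey ep.
have h := weak_solution_adjoint ez ep i1 i2 sz sp.
have iL := el_aeiM (dy_cost_aei oO bO On0 p1 hL ey) ez.
have iv : aeiO (fun x => v x * (y x * phi x)).
  have := el_aeiM (el_aeiM (aeL2_aei mO Ofin (aeL2_L2 v2)) ey) ep; apply: aei_ae.
  by apply: aeD_all => x _; rewrite mulrA.
apply/eqP; rewrite -subr_eq0 opprK -RintD//; apply/eqP; rewrite -[RHS]oppr0 -h -RintN//; last first.
  by apply: aeiB => //; exact: el_aeiM.
apply: Rint_ae; apply: aeD_all => x _; set c := dy a x _; set l := dy L x _; ring.
Qed.

(** The right-hand side is unchanged when the two directions are exchanged together with their
    linearized states; this yields the selfadjointness of [K_u]. *)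
Lemma hessian_identity u y phi v1 v2 z1 z2 eta1 : L2 u -> el y -> el phi -> L2 v1 -> L2 v2 ->
  el z1 -> el z2 -> el eta1 ->
  linearized_state_eq O A a u y v2 z2 -> linearized_adjoint_eq O A a L u y phi v1 z1 eta1 ->
  ip (fun x => z1 x * phi x + y x * eta1 x) v2 =
  I (fun x => (v1 x * z2 x + v2 x * z1 x) * phi x -
    (dyy L x (y x) - phi x * dyy a x (y x)) * z1 x * z2 x).
Proof.
move=> u2 ey ep v12 v22 ez1 ez2 ee sz se.
have i1 := aeL2_aei mO Ofin (linearized_state_aeL2 oO On0 ha u2 ey v22 ez2).
have i2 := aeL2_aei mO Ofin (linearized_adjoint_aeL2 oO On0 ha hL u2 ey ep v12 ez1 ee).
have h := weak_solution_adjoint ez2 ee i1 i2 sz se.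
have iE : aeiO (fun x => (z1 x * phi x + y x * eta1 x) * v2 x).
  have a1 := el_aeiM (el_aeiM (aeL2_aei mO Ofin (aeL2_L2 v22)) ez1) ep.
  have a2 := el_aeiM (el_aeiM (aeL2_aei mO Ofin (aeL2_L2 v22)) ey) ee.
  by apply: aei_ae (aeiD mO a1 a2); apply: aeD_all => x _; ring.
apply/eqP; rewrite -subr_eq0; apply/eqP.
have iD := aeiB mO (el_aeiM i1 ee) (el_aeiM i2 ez2).
have iF : aeiO (fun x => (v1 x * z2 x + v2 x * z1 x) * phi x -
    (dyy L x (y x) - phi x * dyy a x (y x)) * z1 x * z2 x).
  have := aeiD mO iD iE; apply: aei_ae; apply: aeD_all => x _.
  by set c := dy a x _; set b := dyy a x _; set l := dyy L x _; ring.
rewrite /ip -RintB//; rewrite -[RHS]oppr0 -h -RintN//.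
apply: Rint_ae; apply: aeD_all => x _.
by set c := dy a x _; set b := dyy a x _; set l := dyy L x _; ring.
Qed.

End adjoint_identities.

(** * Compactness and continuity of [K_u], and the expansion of theta *)

Section hessian_kernel.
Context (R : realType) (n : nat) (O : set 'rV[R]_n) (mu : R).
Hypotheses (oO : open O) (bO : bounded_set O) (On0 : O !=set0) (mu0 : 0 < mu).
Local Notation leb := (@lebesgue_rV R n).
Local Notation clO := (closure O).
Local Notation fT := ('rV[R]_n -> R).
Local Notation el := (elements (H1C_space O mu)).
Local Notation nH := (@nrm R (H1C_space O mu)).
Local Notation L2 := (L2 leb O).
Local Notation n2 := (n2 leb O).
Local Notation ip := (ip leb O).
Implicit Types u v w y z phi eta f : 'rV[R]_n -> R.

Let mO : measurable O := open_measurable_mx oO.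
Let Ofin : (leb O < +oo)%E := lebesgue_bounded_fin mO bO.

Let small_aux (e K m : R) : 0 < K + e -> m <= e / (K + e) -> (e + K) * m <= e.
Proof. by move=> K1; rewrite ler_pdivlMr// mulrC (addrC K). Qed.

Lemma ff_near (U : set fT) F DF u (e : R) : (forall u, U u -> L2 u) -> (forall u, U u -> el (F u)) ->
  frechet_facts O mu U F DF -> U u -> 0 < e ->
  exists2 r : R, 0 < r & forall u', U u' -> n2 (fun x => u' x - u x) < r ->
  forall x, clO x -> [/\ `|F u' x - F u x| <= e,
    `|F u' x - F u x - DF u (fun x => u' x - u x) x| <= e * n2 (fun x => u' x - u x) &
    forall f, L2 f -> `|DF u' f x - DF u f x| <= e * n2 f].
Proof.
move=> U2 elF ff Uu e0; have [K K0 hK] := ff_bound ff Uu.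
have [r1 r10 hr1] := ff_diff ff Uu e0; have [r2 r20 hr2] := ff_cont ff Uu e0.
have K1 : 0 < K + e by rewrite ltr_wpDl.
have K2 : 0 < e / (K + e) by exact: divr_gt0.
have [r r0 [rr1 rr2 rr3 _]] := pos_below4 r10 r20 K2 K2.
exists r => // u' Uu' ur x cx.
have d2 : L2 (fun x => u' x - u x) by apply: L2B => //; exact: U2.
have := hr1 _ d2 (lt_le_trans ur rr1).
rewrite (_ : (fun x => u x + (u' x - u x)) = u'); last by apply/funext => z; rewrite addrC subrK.
set D := fun x => F u' x - F u x - DF u _ x => hD.
have elDF : el (DF u (fun x => u' x - u x)) by exact: (ff_el ff).
have elD : el D by apply: elB => //; apply: elB => //; exact: elF.
have h1 := le_trans (sup_le_nH On0 elD cx) hD.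
have h2 := le_trans (sup_le_nH On0 elDF cx) (hK _ d2).
split=> //; last by move=> f f2; exact: (hr2 u' Uu' (lt_le_trans ur rr2) f f2 x cx).
have -> : F u' x - F u x = D x + DF u (fun x => u' x - u x) x by rewrite /D; ring.
apply: (le_trans (ler_normD _ _)); apply: (le_trans (lerD h1 h2)); rewrite -mulrDl.
exact: small_aux K1 (le_trans (ltW ur) rr3).
Qed.

Context (U : set fT) (G Phi : fT -> fT) (DG DPhi : fT -> fT -> fT).
Hypothesis U2 : forall u, U u -> L2 u.
Hypothesis elG : forall u, U u -> el (G u).
Hypothesis elPhi : forall u, U u -> el (Phi u).
Hypothesis fG : frechet_facts O mu U G DG.
Hypothesis fPhi : frechet_facts O mu U Phi DPhi.

Definition product_derivative u v x := DG u v x * Phi u x + G u x * DPhi u v x.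
Local Notation K := product_derivative.

Let bound4 (b c e f : R) : 0 <= b -> 0 <= c -> 0 <= e -> 0 <= f ->
  exists2 B : R, 0 <= B & [/\ b <= B, c <= B, e <= B & f <= B].
Proof. by move=> *; exists (b + c + e + f); last split; lra. Qed.

Let four_bound (z p y e Z P Y E : R) : `|z| <= Z -> `|p| <= P -> `|y| <= Y -> `|e| <= E ->
  `|z * p + y * e| <= Z * P + Y * E.
Proof.
by move=> *; apply: (le_trans (ler_normD _ _)); rewrite !normrM; apply: lerD; exact: ler_pM.
Qed.

(** Along an [L^2]-bounded sequence the values of [DG u] and [DPhi u] are bounded in the Hölder
    norm, hence equicontinuous, and so are their products with the fixed functions [Phi u] and
    [G u]; [equicontinuous_cluster] applies on the compact closure. *)
Lemma product_derivative_csa u : U u -> (forall f g, L2 f -> L2 g -> ip (K u f) g = ip f (K u g)) ->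
  exists C, compact_selfadjoint leb O (K u) C.
Proof.
move=> Uu sym; have ey := elG Uu; have ep := elPhi Uu.
have [Kz Kz0 hz] := ff_bound fG Uu; have [Ke Ke0 he] := ff_bound fPhi Uu.
have Y0 := nH_ge0 On0 ey; have P0 := nH_ge0 On0 ep.
have ez v : L2 v -> el (DG u v) by exact: (ff_el fG).
have ee v : L2 v -> el (DPhi u v) by exact: (ff_el fPhi).
have bz v x : L2 v -> clO x -> `|DG u v x| <= Kz * n2 v.
  by move=> v2 cx; apply: le_trans (hz v v2); apply: sup_le_nH => //; exact: ez.
have be v x : L2 v -> clO x -> `|DPhi u v x| <= Ke * n2 v.
  by move=> v2 cx; apply: le_trans (he v v2); apply: sup_le_nH => //; exact: ee.
have by_ x : clO x -> `|G u x| <= nH (G u) by exact: sup_le_nH.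
have bp x : clO x -> `|Phi u x| <= nH (Phi u) by exact: sup_le_nH.
have bK v x : L2 v -> clO x -> `|K u v x| <= (Kz * nH (Phi u) + nH (G u) * Ke) * n2 v.
  move=> v2 cx; have := four_bound (bz v x v2 cx) (bp x cx) (by_ x cx) (be v x v2 cx).
  by move=> h; apply: (le_trans h); rewrite le_eqVlt; apply/orP; left; apply/eqP; ring.
exists (Kz * nH (Phi u) + nH (G u) * Ke); split=> //.
- by rewrite addr_ge0// mulr_ge0.
- move=> f g t f2 g2 x Ox; have cx := @subset_closure _ O x Ox.
  by rewrite /K (ff_lin fG t Uu f2 g2 cx) (ff_lin fPhi t Uu f2 g2 cx); ring.
- move=> f f2.
  have m1 := measurable_funM (el_measurable oO (ez f f2)) (el_measurable oO ep).
  have m2 := measurable_funM (el_measurable oO ey) (el_measurable oO (ee f f2)).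
  exact: measurable_funD m1 m2.
- by move=> f f2 x Ox; apply: bK => //; exact: subset_closure.
move=> v M v2 vM; have M0 : 0 <= M := le_trans (n2_ge0 _ _ _) (vM 0%N).
have KM0 : 0 <= Kz * M by exact: mulr_ge0.
have EM0 : 0 <= Ke * M by exact: mulr_ge0.
have [B B0 [KzB KeB pB yB]] := bound4 KM0 EM0 P0 Y0.
have zB m : nH (DG u (v m)) <= B.
  apply: (le_trans (hz _ (v2 m))); apply: (@le_trans _ _ (Kz * M)); first exact: ler_wpM2l.
  exact: KzB.
have eB m : nH (DPhi u (v m)) <= B.
  apply: (le_trans (he _ (v2 m))); apply: (@le_trans _ _ (Ke * M)); first exact: ler_wpM2l.
  exact: KeB.
have sup m x : clO x -> [/\ `|DG u (v m) x| <= B, `|DPhi u (v m) x| <= B, `|Phi u x| <= B & `|G u x| <= B].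
  move=> cx; split; [exact: le_trans (sup_le_nH On0 (ez _ (v2 m)) cx) (zB m)
    |exact: le_trans (sup_le_nH On0 (ee _ (v2 m)) cx) (eB m)
    |exact: le_trans (bp x cx) pB|exact: le_trans (by_ x cx) yB].
have hb y : el y -> nH y <= B -> hoelder_bound O mu B y.
  move=> hy yb; have [h1 h2] := nH_bound On0 hy.
  by split=> [x cx|x z cx cz]; apply: le_trans yb; [exact: h1|exact: h2].
have [k hk] : exists k : fT, forall e : R, 0 < e -> forall N, exists2 m, (N <= m)%N &
    forall x, clO x -> `|K u (v m) x - k x| <= e.
  apply: (@equicontinuous_cluster _ _ _ _ (B * B + B * B)).
  - exact: closure_bounded_compact.
  - by move=> m x cx; have [h1 h2 h3 h4] := sup m x cx; exact: four_bound.
  (* The increment of [K u (v m)] is a sum of four products, each an increment of one function times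
     a factor bounded by [B]. *)
  move=> e e0; have B1 : 0 < 4 * (B + 1) by rewrite mulr_gt0// ltr_wpDl.
  have [del del0 h] := hoelder_equi O mu0 B0 (divr_gt0 e0 B1).
  exists del => // m x z cx cz xz.
  have [h1 h2 h3 h4] := sup m x cx; have [k1 k2 k3 k4] := sup m z cz.
  have g1 := h _ _ _ (hb _ (ez _ (v2 m)) (zB m)) cx cz xz.
  have g2 := h _ _ _ (hb _ (ee _ (v2 m)) (eB m)) cx cz xz.
  have g3 := h _ _ _ (hb _ ep pB) cx cz xz.
  have g4 := h _ _ _ (hb _ ey yB) cx cz xz.
  have -> : K u (v m) x - K u (v m) z =
    ((DG u (v m) x - DG u (v m) z) * Phi u x + DG u (v m) z * (Phi u x - Phi u z)) +
    ((G u x - G u z) * DPhi u (v m) x + G u z * (DPhi u (v m) x - DPhi u (v m) z)).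
    by rewrite /K; ring.
  apply: (le_trans (ler_normD _ _)).
  apply: (le_trans (lerD (four_bound g1 h3 k1 g3) (four_bound g4 h2 k4 g2))).
  set q := e / _.
  have -> : q * B + B * q + (q * B + B * q) = (4 * B) * q by ring.
  have -> : e = (4 * (B + 1)) * q by rewrite /q mulrC divfK// gt_eqF.
  by rewrite ler_wpM2r ?divr_ge0 ?(ltW e0) ?(ltW B1)// ler_pM2l// lerDl.
exists k => e e0 N; have [m Nm hm] := hk e e0 N; exists m => // x Ox.
by apply: hm; exact: subset_closure.
Qed.

Let scale_small (e S : R) : 0 < e -> 0 <= S -> exists e1 : R, [/\ 0 < e1, e1 <= 1 & e1 * S <= e].
Proof.
move=> e0 S0; have S1 : 0 < S + 1 by rewrite ltr_wpDl.
exists (Num.min 1 (e / (S + 1))); split.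
- by rewrite lt_min ltr01 divr_gt0.
- by rewrite ge_min lexx.
apply: (@le_trans _ _ (e / (S + 1) * (S + 1))); last by rewrite divfK// gt_eqF.
apply: ler_pM => //; last by rewrite lerDl.
  by rewrite le_min ler01 divr_ge0// ltW.
by rewrite ge_min lexx orbT.
Qed.

Let sum_ge0 (b c e f : R) : 0 <= b -> 0 <= c -> 0 <= e -> 0 <= f -> 0 <= (b + 1) + c + (e + f).
Proof. by move=> *; lra. Qed.

Let near_norm (f' f e F : R) : `|f' - f| <= e -> e <= 1 -> `|f| <= F -> `|f'| <= F + 1.
Proof.
move=> h e1 fF; have -> : f' = f + (f' - f) by ring.
by apply: (le_trans (ler_normD _ _)); apply: lerD => //; exact: le_trans h e1.
Qed.

Lemma product_derivative_continuous u (e : R) : U u -> 0 < e -> exists2 r : R, 0 < r &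
  forall u', U u' -> n2 (fun x => u' x - u x) < r ->
  forall f, L2 f -> forall x, O x -> `|K u' f x - K u f x| <= e * n2 f.
Proof.
move=> Uu e0; have ey := elG Uu; have ep := elPhi Uu.
have [Kz Kz0 hz] := ff_bound fG Uu; have [Ke Ke0 he] := ff_bound fPhi Uu.
have Y0 := nH_ge0 On0 ey; have P0 := nH_ge0 On0 ep.
(* The constants that accompany [e1] in the four products below; the summands 1 are due to [Phi u']
   and [DPhi u'], taken at the nearby control. *)
have S0 := sum_ge0 P0 Kz0 (addr_ge0 Ke0 ler01) Y0.
have [e1 [e10 e11 eS]] := scale_small e0 S0.
have [r1 r10 h1] := ff_near U2 elG fG Uu e10; have [r2 r20 h2] := ff_near U2 elPhi fPhi Uu e10.
have [r r0 [rr1 rr2 _ _]] := pos_below4 r10 r20 r10 r20.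
exists r => // u' Uu' ur f f2 x Ox; have cx := @subset_closure _ O x Ox.
have [g1 _ /(_ _ f2) g3] := h1 u' Uu' (lt_le_trans ur rr1) x cx.
have [k1 _ /(_ _ f2) k3] := h2 u' Uu' (lt_le_trans ur rr2) x cx.
have N0 := n2_ge0 leb O f.
have p'B := near_norm k1 e11 (sup_le_nH On0 ep cx).
have yB := sup_le_nH On0 ey cx.
have zB := le_trans (sup_le_nH On0 (ff_el fG Uu f2) cx) (hz _ f2).
have eB := le_trans (sup_le_nH On0 (ff_el fPhi Uu f2) cx) (he _ f2).
have e'B : `|DPhi u' f x| <= (Ke + 1) * n2 f.
  have -> : DPhi u' f x = DPhi u f x + (DPhi u' f x - DPhi u f x) by ring.
  apply: (le_trans (ler_normD _ _)); rewrite mulrDl mul1r; apply: lerD => //.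
  by apply: (le_trans k3); rewrite ler_piMl.
have -> : K u' f x - K u f x =
  ((DG u' f x - DG u f x) * Phi u' x + DG u f x * (Phi u' x - Phi u x)) +
  ((G u' x - G u x) * DPhi u' f x + G u x * (DPhi u' f x - DPhi u f x)).
  by rewrite /K; ring.
apply: (le_trans (ler_normD _ _)).
apply: (le_trans (lerD (four_bound g3 p'B zB k1) (four_bound g1 e'B yB k3))).
apply: le_trans (ler_wpM2r N0 eS).
by rewrite le_eqVlt; apply/orP; left; apply/eqP; ring.
Qed.

Lemma product_expansion u (e : R) : U u -> 0 < e -> exists2 r : R, 0 < r &
  forall u', U u' -> n2 (fun x => u' x - u x) < r -> forall x, O x ->
  `|G u' x * Phi u' x - G u x * Phi u x - K u (fun x => u' x - u x) x| <=
    e * n2 (fun x => u' x - u x).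
Proof.
move=> Uu e0; have ey := elG Uu; have ep := elPhi Uu.
have [Kz Kz0 hz] := ff_bound fG Uu.
have Y0 := nH_ge0 On0 ey; have P0 := nH_ge0 On0 ep.
have S0 := sum_ge0 P0 Kz0 Y0 (lexx 0).
have [e1 [e10 e11 eS]] := scale_small e0 S0.
have [r1 r10 h1] := ff_near U2 elG fG Uu e10; have [r2 r20 h2] := ff_near U2 elPhi fPhi Uu e10.
have [r r0 [rr1 rr2 _ _]] := pos_below4 r10 r20 r10 r20.
exists r => // u' Uu' ur x Ox; have cx := @subset_closure _ O x Ox.
have [_ g2 _] := h1 u' Uu' (lt_le_trans ur rr1) x cx.
have [k1 k2 _] := h2 u' Uu' (lt_le_trans ur rr2) x cx.
have d2 : L2 (fun x => u' x - u x) by apply: L2B => //; exact: U2.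
have N0 := n2_ge0 leb O (fun x => u' x - u x).
have p'B := near_norm k1 e11 (sup_le_nH On0 ep cx).
have yB := sup_le_nH On0 ey cx.
have zB := le_trans (sup_le_nH On0 (ff_el fG Uu d2) cx) (hz _ d2).
(* A zero product pads the three-term splitting to the shape of [four_bound]. *)
have z0 : `|0 : R| <= 0 by rewrite normr0.
have -> : G u' x * Phi u' x - G u x * Phi u x - K u (fun x => u' x - u x) x =
  ((G u' x - G u x - DG u (fun x => u' x - u x) x) * Phi u' x +
    DG u (fun x => u' x - u x) x * (Phi u' x - Phi u x)) +
  (G u x * (Phi u' x - Phi u x - DPhi u (fun x => u' x - u x) x) + 0 * 0).
  by rewrite /K; ring.
apply: (le_trans (ler_normD _ _)).
apply: (le_trans (lerD (four_bound g2 p'B zB k1) (four_bound yB k2 z0 z0))).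
apply: le_trans (ler_wpM2r N0 eS).
by rewrite le_eqVlt; apply/orP; left; apply/eqP; ring.
Qed.

End hessian_kernel.

(** * Identification of the abstract second derivative *)

Section second_derivative.
Context (R : realType) (n : nat) (O : set 'rV[R]_n) (oO : open O) (bO : bounded_set O).
Local Notation leb := (@lebesgue_rV R n).
Local Notation fT := ('rV[R]_n -> R).
Local Notation X := (L2_space O).
Local Notation RS := (real_space R).
Local Notation L2 := (L2 leb O).
Local Notation n2 := (n2 leb O).
Local Notation ip := (ip leb O).
Local Notation aeO := (aeD leb O).
Implicit Types u v w f : 'rV[R]_n -> R.

Let mO : measurable O := open_measurable_mx oO.
Let Ofin : (leb O < +oo)%E := lebesgue_bounded_fin mO bO.
Let elX v : elements X v <-> L2 v. Proof. exact: Lp2P. Qed.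
Let nrmX v : L2 v -> @nrm R X v = n2 v. Proof. exact: Lp_norm_n2. Qed.

Let eq_of_small (b c N : R) : 0 <= N -> (forall e, 0 < e -> `|b - c| <= 2 * (e * N)) -> b = c.
Proof.
move=> N0 h; apply/eqP; rewrite -subr_eq0 -normr_le0; apply/ler_addgt0Pl => e e0; rewrite addr0.
have N1 : 0 < 2 * (N + 1) by rewrite mulr_gt0// ltr_wpDl.
apply: (le_trans (h _ (divr_gt0 e0 N1))).
have -> : 2 * (e / (2 * (N + 1)) * N) = e * (N / (N + 1)).
  by field; rewrite gt_eqF// ltr_wpDl.
by rewrite ler_piMr// ?(ltW e0)// ler_pdivrMr ?mul1r ?lerDl// ltr_wpDl.
Qed.

Let n2_zero : n2 (fun=> 0) = 0.
Proof. by have := n2Z mO 0 (L2_0 leb O); rewrite normr0 !mul0r. Qed.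

Let small_scale (r : R) v : 0 < r -> L2 v -> exists2 t : R, 0 < t & n2 (fun x => t * v x) < r.
Proof.
move=> r0 v2; have N0 := n2_ge0 leb O v; have N1 : 0 < n2 v + 1 by rewrite ltr_wpDl.
exists (r / (n2 v + 1)); first exact: divr_gt0.
rewrite n2Z// gtr0_norm ?divr_gt0// mulrAC ltr_pdivrMr// ltr_pM2l// ltrDl//.
Qed.

Lemma real_bounded_linear (T : fT -> R) : @bounded_linear R X RS T ->
  (exists2 B : R, 0 <= B & forall v, L2 v -> `|T v| <= B * n2 v) /\
  forall (t : R) v, L2 v -> T (fun x => t * v x) = t * T v.
Proof.
move=> [_ lin [B hB]].
have bT v : L2 v -> `|T v| <= `|B| * n2 v.
  move=> v2; have := hB v ((elX v).2 v2); rewrite nrmX// => /le_trans; apply.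
  by rewrite ler_wpM2r ?n2_ge0// ler_norm.
split; first by exists `|B|.
move=> t v v2; have := lin t v (fun=> 0) ((elX _).2 v2) ((elX _).2 (L2_0 _ _)).
have -> : (t *: (v : X) + (fun=> 0 : R) : X) = (fun x => t * v x).
  by apply/funext => x; apply: addr0.
have T0 : T (fun=> 0) = 0.
  have := bT _ (L2_0 leb O); rewrite n2_zero mulr0.
  by rewrite normr_le0 => /eqP.
move/eqP; rewrite normr_eq0 subr_eq0 => /eqP ->.
rewrite -[RHS]addr0 -[X in _ = _ + X]T0; exact: erefl.
Qed.

Lemma op_eval (S : fT -> R) (B : R) : (forall w, L2 w -> n2 w <= 1 -> `|S w| <= B) ->
  forall w, L2 w -> n2 w <= 1 -> `|S w| <= @nrm R (op_space X RS) S.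
Proof.
move=> hB w w2 w1; apply: ub_le_sup.
  exists B => _ [v [/elX v2 v1] <-]; apply: hB => //; by rewrite -nrmX.
by exists w => //; split; [exact/elX|rewrite nrmX].
Qed.

Lemma op_bound (S : fT -> R) (B : R) : (forall w, L2 w -> n2 w <= 1 -> `|S w| <= B) ->
  @nrm R (op_space X RS) S <= B.
Proof.
move=> hB; apply: ge_sup.
  exists `|S (fun=> 0)|; exists (fun=> 0) => //; split; first exact/elX/L2_0.
  rewrite nrmX; last exact: L2_0.
  by rewrite n2_zero.
by move=> _ [w [/elX w2 w1] <-]; apply: hB => //; rewrite -nrmX.
Qed.

Lemma op_zero (S : fT -> R) : (forall w, L2 w -> S w = 0) -> @nrm R (op_space X RS) S = 0.
Proof.
move=> S0; have S1 w : L2 w -> n2 w <= 1 -> `|S w| <= 0 by move=> w2 _; rewrite S0// normr0.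
apply/eqP; rewrite eq_le (op_bound S1)/=.
have := op_eval S1 (L2_0 leb O); rewrite n2_zero => /(_ ler01); apply: le_trans.
exact: normr_ge0.
Qed.

Let real_bl_bound1 (T : fT -> R) : @bounded_linear R X RS T ->
  exists B : R, forall w, L2 w -> n2 w <= 1 -> `|T w| <= B.
Proof.
move=> /real_bounded_linear[[B B0 hB] _]; exists B => w w2 w1; apply: (le_trans (hB w w2)).
by rewrite ler_piMr.
Qed.

(** Linearity in the first argument holds up to operators of seminorm 0, and that seminorm sees only
    the unit ball; hence the restriction on [w]. *)
Lemma op_bounded_linear (T : fT -> fT -> R) : @bounded_linear R X (op_space X RS) T ->
  (forall v, L2 v -> @bounded_linear R X RS (T v)) /\
  forall (t : R) v w, L2 v -> L2 w -> n2 w <= 1 -> T (fun x => t * v x) w = t * T v w.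
Proof.
move=> [elT lin [B hB]].
have blT v : L2 v -> @bounded_linear R X RS (T v) by move=> v2; exact/elT/elX.
split=> // t v w v2 w2 w1.
have z2 := L2_0 leb O; have tv2 := L2Z mO t v2.
have [B1 hB1] := real_bl_bound1 (blT _ v2); have [B2 hB2] := real_bl_bound1 (blT _ z2).
have [B3 hB3] := real_bl_bound1 (blT _ tv2).
have T0 : T (fun=> 0) w = 0.
  have h0 : @nrm R (op_space X RS) (T (fun=> 0)) <= 0.
    by have := hB (fun=> 0) ((elX _).2 z2); rewrite nrmX// n2_zero mulr0.
  have := le_trans (op_eval hB2 w2 w1) h0; by rewrite normr_le0 => /eqP.
have := lin t v (fun=> 0) ((elX _).2 v2) ((elX _).2 z2).
have -> : (t *: (v : X) + (fun=> 0 : R) : X) = (fun x => t * v x).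
  by apply/funext => x; apply: addr0.
pose S f := T (fun x => t * v x) f - (t * T v f + T (fun=> 0) f).
have SB f : L2 f -> n2 f <= 1 -> `|S f| <= B3 + (`|t| * B1 + B2).
  move=> f2 f1; apply: (le_trans (ler_normB _ _)); apply: lerD; first exact: hB3.
  apply: (le_trans (ler_normD _ _)); apply: lerD; last exact: hB2.
  by rewrite normrM ler_wpM2l// hB1.
have -> : T (fun x => t * v x) - (t *: (T v : op_space X RS) + (T (fun=> 0) : op_space X RS)) = S by [].
move=> S0; have := op_eval SB w2 w1; rewrite S0 normr_le0 /S T0 addr0 subr_eq0 => /eqP //.
Qed.

Context (U : set fT) (U2 : forall u, U u -> L2 u).
Hypothesis Uopen : forall u, U u -> exists2 r : R, 0 < r &
  forall v, L2 v -> n2 v < r -> U (fun x => u x + v x).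

(** [second_derivative] is a choice among all second derivatives, so its value can be computed only
    after a uniqueness result, first for derivatives of [J] and then for derivatives of those. A
    direction is shrunk by [t], and [t] cancels by homogeneity. *)
Lemma frechet_unique (J : X -> RS) u (S T : fT -> R) : 
  @frechet_derivative R X RS J u S -> @frechet_derivative R X RS J u T ->
  forall v, L2 v -> S v = T v.
Proof.
move=> [blS hS] [blT hT] v v2.
have [_ scS] := real_bounded_linear blS; have [_ scT] := real_bounded_linear blT.
apply: (eq_of_small (n2_ge0 leb O v)) => e e0.
have [r1 r10 h1] := hS e e0; have [r2 r20 h2] := hT e e0.
have r0 : 0 < Num.min r1 r2 by rewrite lt_min r10.
have [t t0] := small_scale r0 v2; rewrite lt_min => /andP[t1 t2].
have tv2 := L2Z mO t v2.
have := h1 _ ((elX _).2 tv2); rewrite nrmX// => /(_ t1) g1.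
have := h2 _ ((elX _).2 tv2); rewrite nrmX// => /(_ t2) g2.
have E : t * `|S v - T v| <= t * (2 * (e * n2 v)).
  rewrite -{1}(gtr0_norm t0) -normrM mulrBr -scS// -scT//.
  have -> : S (fun x => t * v x) - T (fun x => t * v x) =
    (J (u + (fun x => t * v x) : X) - J u - T (fun x => t * v x)) -
    (J (u + (fun x => t * v x) : X) - J u - S (fun x => t * v x)) by ring.
  apply: (le_trans (ler_normB _ _)); apply: (le_trans (lerD g2 g1)).
  by rewrite n2Z// gtr0_norm// le_eqVlt; apply/orP; left; apply/eqP; ring.
by rewrite ler_pM2l in E.
Qed.

(** The two first derivatives are known to agree only on [U], so the shrunk direction must keep
    [u + t v] in this open set. A general [w] is reached by scaling it into the unit ball. *)
Lemma frechet_op_unique (DJ DJ' : X -> op_space X RS) u (S T : fT -> fT -> R) :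
  U u -> (forall u, U u -> @bounded_linear R X RS (DJ u)) ->
  (forall u, U u -> @bounded_linear R X RS (DJ' u)) ->
  (forall u v, U u -> L2 v -> DJ u v = DJ' u v) ->
  @frechet_derivative R X (op_space X RS) DJ u S -> @frechet_derivative R X (op_space X RS) DJ' u T ->
  forall v w, L2 v -> L2 w -> S v w = T v w.
Proof.
move=> Uu bl bl' DD [blS hS] [blT hT] v w0 v2 w02.
have [blSv scS] := op_bounded_linear blS; have [blTv scT] := op_bounded_linear blT.
have unit w : L2 w -> n2 w <= 1 -> S v w = T v w.
  move=> w2 w1; apply: (eq_of_small (n2_ge0 leb O v)) => e e0.
  have [r1 r10 h1] := hS e e0; have [r2 r20 h2] := hT e e0; have [r3 r30 h3] := Uopen Uu.
  have [r r0 [rr1 rr2 rr3 _]] := pos_below4 r10 r20 r30 r30.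
  have [t t0 tr] := small_scale r0 v2.
  have tv2 := L2Z mO t v2.
  have Ut : U (fun x => u x + t * v x) by apply: h3 => //; exact: lt_le_trans tr rr3.
  have := h1 _ ((elX _).2 tv2); rewrite nrmX// => /(_ (lt_le_trans tr rr1)) g1.
  have := h2 _ ((elX _).2 tv2); rewrite nrmX// => /(_ (lt_le_trans tr rr2)) g2.
  have ev (DD' : X -> op_space X RS) (Q : fT -> fT -> R) : (forall u, U u -> @bounded_linear R X RS (DD' u)) ->
      (forall v, L2 v -> @bounded_linear R X RS (Q v)) ->
      nrm (DD' (u + (fun x => t * v x) : X) - DD' u - (Q (fun x => t * v x) : op_space X RS)) <=
        e * n2 (fun x => t * v x) ->
      `|DD' (fun x => u x + t * v x) w - DD' u w - Q (fun x => t * v x) w| <= e * n2 (fun x => t * v x).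
    move=> blD blQ; apply: le_trans.
    have [B1 hB1] := real_bl_bound1 (blD _ Ut); have [B2 hB2] := real_bl_bound1 (blD _ Uu).
    have [B3 hB3] := real_bl_bound1 (blQ _ tv2).
    pose Z f := DD' (fun x => u x + t * v x) f - DD' u f - Q (fun x => t * v x) f.
    have ZB f : L2 f -> n2 f <= 1 -> `|Z f| <= B1 + B2 + B3.
      move=> f2 f1; apply: (le_trans (ler_normB _ _)); apply: lerD; last exact: hB3.
      by apply: (le_trans (ler_normB _ _)); apply: lerD; [exact: hB1|exact: hB2].
    exact: (op_eval ZB w2 w1).
  have k1 := ev _ _ bl blSv g1; have k2 := ev _ _ bl' blTv g2.
  have E : t * `|S v w - T v w| <= t * (2 * (e * n2 v)).
    rewrite -{1}(gtr0_norm t0) -normrM mulrBr -(scS t v w v2 w2 w1) -(scT t v w v2 w2 w1).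
    rewrite -!DD// in k2.
    have -> : S (fun x => t * v x) w - T (fun x => t * v x) w =
      (DJ (fun x => u x + t * v x) w - DJ u w - T (fun x => t * v x) w) -
      (DJ (fun x => u x + t * v x) w - DJ u w - S (fun x => t * v x) w) by ring.
    apply: (le_trans (ler_normB _ _)); apply: (le_trans (lerD k2 k1)).
    by rewrite n2Z// gtr0_norm// le_eqVlt; apply/orP; left; apply/eqP; ring.
  by rewrite ler_pM2l in E.
have [_ sc1] := real_bounded_linear (blSv v v2); have [_ sc2] := real_bounded_linear (blTv v v2).
have [t t0 tw] := small_scale ltr01 w02.
have := unit _ (L2Z mO t w02) (ltW tw); rewrite sc1// sc2//.
by move/(mulfI (lt0r_neq0 t0)).
Qed.

Lemma ip_bounded_linear f : L2 f -> @bounded_linear R X RS (fun v => ip f v).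
Proof.
move=> f2; split=> // [k u v /elX u2 /elX v2|].
  have -> : (k *: (u : X) + (v : X)) = (fun x => v x + k * u x) by apply/funext => x; apply: addrC.
  apply/eqP; rewrite normr_eq0 subr_eq0; apply/eqP.
  by rewrite ip_linr// addrC.
exists (n2 f) => v /elX v2; rewrite nrmX//; exact: ip_cauchy_schwarz.
Qed.

Context (nu : R) (nu0 : 0 < nu) (theta : fT -> fT) (K : fT -> fT -> fT) (C : R) (J : X -> RS).
Hypothesis theta2 : forall u, U u -> L2 (theta u).
Hypothesis dJ : forall u, U u -> forall e : R, 0 < e -> exists2 r : R, 0 < r &
  forall v, L2 v -> n2 v < r ->
  `|J (fun x => u x + v x) - J u - ip (fun x => nu * u x - theta u x) v| <= e * n2 v.

(** The gradient is represented by [nu u - theta u], whose derivative is [opS nu (K u)]. This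
    exhibits one second derivative, and uniqueness identifies it with the chosen one. *)
Lemma second_derivativeE u v w : U u -> compact_selfadjoint leb O (K u) C ->
  (forall e : R, 0 < e -> exists2 r : R, 0 < r & forall u', U u' -> n2 (fun x => u' x - u x) < r ->
    forall x, O x -> `|theta u' x - theta u x - K u (fun x => u' x - u x) x| <=
      e * n2 (fun x => u' x - u x)) ->
  L2 v -> L2 w -> @second_derivative R X RS U J u v w = qform leb O nu (K u) v w.
Proof.
move=> Uu HK expand v2 w2.
pose m u x := nu * u x - theta u x.
have m2 u0 : U u0 -> L2 (m u0) by move=> U0; apply: L2B; [|apply: L2Z => //; exact: U2|exact: theta2].
pose DJ : X -> op_space X RS := fun u v => ip (m u) v.
have blDJ u0 : U u0 -> @bounded_linear R X RS (DJ u0) by move=> /m2; exact: ip_bounded_linear.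
have dDJ : @derivative_on R X RS U J DJ.
  move=> u0 U0; split; first exact: blDJ.
  move=> e e0; have [r r0 hr] := dJ U0 e0; exists r => // f /elX f2; rewrite nrmX// => fr.
  exact: (hr f f2 fr).
pose T : X -> op_space X RS := fun v w => ip (opS nu (K u) v) w.
have S2 f : L2 f -> L2 (opS nu (K u) f) by move=> f2; exact: (opS_L2 mO Ofin nu HK f2).
have hT : @frechet_derivative R X (op_space X RS) DJ u T.
  split.
    split=> [f /elX f2|k f g /elX f2 /elX g2|].
    - by apply: ip_bounded_linear; exact: S2.
    - apply: op_zero => h h2.
      have kf2 := L2_lin mO k g2 f2.
      have E : aeO (fun x => opS nu (K u) (fun x => g x + k * f x) x =
          opS nu (K u) g x + k * opS nu (K u) f x).
        by apply: aeD_all => x Ox; exact: (opS_lin nu HK).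
      have -> : (T (k *: (f : X) + (g : X)) - (k *: T f + T g)) h =
          ip (opS nu (K u) (fun x => g x + k * f x)) h -
          (k * ip (opS nu (K u) f) h + ip (opS nu (K u) g) h).
        rewrite /T; congr (ip (opS nu (K u) _) h - _).
        by apply/funext => x; apply: addrC.
      rewrite (ip_ae E (aeD_all leb (fun x _ => erefl (h x)))) ip_linl//; last 2 first.
        exact: S2.
        exact: S2.
      by ring.
    exists (nu + C * msqrt leb O setT) => f /elX f2; rewrite nrmX//.
    apply: op_bound => h h2 h1; rewrite /T -(qformE mO Ofin nu HK f2 h2).
    apply: (le_trans (qform_bound mO Ofin nu0 HK f2 h2)).
    rewrite ler_piMr// mulr_ge0 ?n2_ge0// addr_ge0 ?(ltW nu0)// mulr_ge0 ?msqrt_ge0//.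
    exact: csa_ge0 HK.
  move=> e e0; have M1 : 0 < msqrt leb O setT + 1 by rewrite ltr_wpDl// msqrt_ge0.
  have [r1 r10 h1] := expand _ (divr_gt0 e0 M1); have [r2 r20 h2] := Uopen Uu.
  exists (Num.min r1 r2); first by rewrite lt_min r10.
  move=> f /elX f2; rewrite nrmX// lt_min => /andP[fr1 fr2].
  have Uf := h2 f f2 fr2.
  have fE : (fun x => (u x + f x) - u x) = f by apply/funext => x; rewrite addrC addKr.
  have := h1 _ Uf; rewrite fE => /(_ fr1) hx.
  pose D x := m (fun x => u x + f x) x - m u x - opS nu (K u) f x.
  have mf2 := m2 _ Uf; have mu2 := m2 _ Uu; have Sf2 := S2 f f2.
  have D2 : L2 D by apply: L2B => //; exact: L2B.
  have nD : n2 D <= e * n2 f.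
    have ef0 : 0 <= e / (msqrt leb O setT + 1) * n2 f by rewrite mulr_ge0 ?n2_ge0// divr_ge0// ltW.
    apply: (@le_trans _ _ (e / (msqrt leb O setT + 1) * n2 f * msqrt leb O setT)).
      apply: n2_boundedT => //; apply: aeD_all => x Ox; apply: le_trans (hx x Ox).
      rewrite -normrN /D /m /opS le_eqVlt; apply/orP; left; apply/eqP; congr (`|_|); ring.
    have -> : e / (msqrt leb O setT + 1) * n2 f * msqrt leb O setT =
      e * n2 f * (msqrt leb O setT / (msqrt leb O setT + 1)) by ring.
    rewrite ler_piMr ?mulr_ge0 ?n2_ge0 ?(ltW e0)// ler_pdivrMr// mul1r lerDl//.
  apply: op_bound => h hh h1'; apply: le_trans nD.
  have -> : (DJ (u + f : X) - DJ u - T f) h = ip D h.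
    by rewrite /D (ipBl mO (L2B mO mf2 mu2) Sf2 hh) (ipBl mO mf2 mu2 hh).
  apply: (le_trans (ip_cauchy_schwarz mO D2 hh)); rewrite ler_piMr//; exact: n2_ge0.
pose P := fun T' : fT -> fT -> R => exists DF : X -> op_space X RS,
  @derivative_on R X RS U J DF /\ @frechet_derivative R X (op_space X RS) DF u T'.
have ex : exists T', P T' by exists T, DJ.
rewrite /second_derivative -[X in xget _ X]/(P : set (op_space X (op_space X RS))).
have [DJ' [dDJ' hT']] : P (xget (0 : op_space X (op_space X RS)) P) by exact: (xgetPex _ ex).
rewrite -(@frechet_op_unique DJ DJ' u T _ Uu blDJ _ _ hT hT' v w v2 w2).
- by rewrite /T -(qformE mO Ofin nu HK v2 w2).
- by move=> u0 /dDJ'[].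
by move=> u0 f U0 f2; exact: (frechet_unique (dDJ u0 U0) (dDJ' u0 U0)).
Qed.

End second_derivative.

(** * Gradient and Hessian of the functional *)

Section cost_derivatives.
Context (R : realType) (n : nat) (O : set 'rV[R]_n) (mu : R).
Hypotheses (oO : open O) (bO : bounded_set O) (On0 : O !=set0) (mu0 : 0 < mu).
Local Notation leb := (@lebesgue_rV R n).
Local Notation clO := (closure O).
Local Notation fT := ('rV[R]_n -> R).
Local Notation el := (elements (H1C_space O mu)).
Local Notation nH := (@nrm R (H1C_space O mu)).
Local Notation L2 := (L2 leb O).
Local Notation n2 := (n2 leb O).
Local Notation ip := (ip leb O).
Local Notation I := (Rintegral leb O).
Local Notation aeiO := (aei leb O).
Implicit Types u v w y z phi eta f : 'rV[R]_n -> R.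

Let mO : measurable O := open_measurable_mx oO.
Let Ofin : (leb O < +oo)%E := lebesgue_bounded_fin mO bO.

Context (A : 'rV[R]_n -> 'M[R]_n) (a L : 'rV[R]_n -> R -> R) (p : \bar R) (a0 nu : R).
Hypotheses (p1 : (1%:E <= p)%E) (ha : nonlinearity O p a0 a) (hL : cost_integrand O p L).
Hypothesis nu0 : 0 < nu.
Context (U : set fT) (G Phi : fT -> fT) (DG DPhi : fT -> fT -> fT).
Hypothesis U2 : forall u, U u -> L2 u.
Hypothesis Uopen : forall u, U u -> exists2 r : R, 0 < r &
  forall v, L2 v -> n2 v < r -> U (fun x => u x + v x).
Hypothesis elG : forall u, U u -> el (G u).
Hypothesis elPhi : forall u, U u -> el (Phi u).
Hypothesis fG : frechet_facts O mu U G DG.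
Hypothesis fPhi : frechet_facts O mu U Phi DPhi.
Hypothesis eqPhi : forall u, U u -> adjoint_eq O A a L u (G u) (Phi u).
Hypothesis eqDG : forall u v, U u -> L2 v -> linearized_state_eq O A a u (G u) v (DG u v).
Hypothesis eqDPhi : forall u v, U u -> L2 v ->
  linearized_adjoint_eq O A a L u (G u) (Phi u) v (DG u v) (DPhi u v).

Let caraL : caratheodory_C2 O L. Proof. by case: hL. Qed.

Lemma cost_aei y : el y -> aeiO (fun x => L x (y x)).
Proof.
move=> hy; have N0 : 0 < nH y + 1 by rewrite ltr_wpDl// nH_ge0.
have [[_ hd] hL0 /(_ _ N0)[LM hLM hb] _ _] := hL.
have i0 := aei_norm (Lp_integrable mO Ofin (lexx _) hL0).
have iM := Lp_integrable mO Ofin p1 hLM.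
apply: (aei_dom mO _ (aeiD mO i0 (aeiZ mO (nH y + 1) iM))).
  exact: (@superposition_aem _ _ _ mO L caraL y (el_measurable oO hy)).
apply: aeD3 hb (el_bound On0 hy) hd => x _ hC h [d1 _ _].
have -> : L x (y x) = L x 0 + (L x (y x) - L x 0) by ring.
apply: (le_trans (ler_normD _ _)); rewrite lerD2l.
have yM : `|y x| <= nH y + 1 by apply: le_trans h _; rewrite lerDl.
have := @lipschitz_of_derive1 _ (L x) (nH y + 1) d1 (LM x) 0 (y x) hC.
rewrite normr0 subr0 => bnd; apply: le_trans (bnd (ltW N0) yM) _; rewrite mulrC.
apply: ler_wpM2r => //; apply: le_trans (hC 0 _) => //; rewrite normr0; exact: ltW.
Qed.

(** Thresholds for the three errors in [cost_expansion]: the Taylor remainder of [L], the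
    linearization error of the state, and the quadratic control term. *)
Let choose_small (e b c f : R) : 0 < e -> 0 <= b -> 0 <= c -> 0 <= f ->
  exists e1 r : R, [/\ 0 < e1, e1 <= 1, 0 < r &
    forall m, 0 <= m -> m < r -> b * (m * m) + e1 * m * c + f * (m * m) <= e * m].
Proof.
move=> e0 b0 c0 f0; have c1 : 0 < 2 * (c + 1) by lra.
have b1 : 0 < 2 * (b + f + 1) by lra.
exists (Num.min 1 (e / (2 * (c + 1)))), (e / (2 * (b + f + 1))); split.
- by rewrite lt_min ltr01 divr_gt0.
- by rewrite ge_min lexx.
- exact: divr_gt0.
move=> m m0 mr; set e1 := Num.min _ _.
have h1 : e1 * (2 * (c + 1)) <= e by rewrite -ler_pdivlMr// ge_min lexx orbT.
have h2 : m * (2 * (b + f + 1)) <= e by rewrite -ler_pdivlMr// ltW.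
have e10 : 0 <= e1 by rewrite le_min ler01 divr_ge0// ltW.
have -> : b * (m * m) + e1 * m * c + f * (m * m) = (b * m + e1 * c + f * m) * m by ring.
apply: ler_wpM2r => //.
have -> : b * m + e1 * c + f * m = (2 * (m * (b + f)) + 2 * (e1 * c)) / 2 by field.
by rewrite ler_pdivrMr//; move: h1 h2; rewrite !mulrDr !mulr1; nra.
Qed.

Lemma product_L2 u : U u -> L2 (fun x => G u x * Phi u x).
Proof.
move=> Uu; have ey := elG Uu; have ep := elPhi Uu.
apply: (@L2_bounded _ _ _ _ _ mO Ofin _ (nH (G u) * nH (Phi u))).
  exact: measurable_funM (el_measurable oO ey) (el_measurable oO ep).
by apply: aeD2 (el_bound On0 ey) (el_bound On0 ep) => x _ c1 c2; rewrite normrM; exact: ler_pM.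
Qed.

Lemma cost_expansion u (e : R) : U u -> 0 < e -> exists2 r : R, 0 < r & forall v, L2 v -> n2 v < r ->
  `|cost L nu (G : L2_space O -> H1C_space O mu) (fun x => u x + v x) -
    cost L nu (G : L2_space O -> H1C_space O mu) u -
    ip (fun x => nu * u x - G u x * Phi u x) v| <= e * n2 v.
Proof.
move=> Uu e0; have ey := elG Uu; have u2 := U2 Uu; have ep := elPhi Uu.
have N0 : 0 < nH (G u) + 1 by rewrite ltr_wpDl// nH_ge0.
have [Kz Kz0 hz] := ff_bound fG Uu.
have [C C0 hC] := cost_bounds hL N0.
have hT := taylor_F caraL C0 hC.
have iL := dy_cost_aei oO bO On0 p1 hL ey.
have i1 : aeiO (fun=> 1) by apply: (aeL2_aei mO Ofin); apply: aeL2_L2; exact: L2_cst.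
pose S1 := I (fun=> 1); pose Sd := I (fun x => `|dy L x (G u x)|).
have S10 : 0 <= S1 by apply: Rint_ge0; apply: aeD_all => x _; exact: ler01.
have Sd0 : 0 <= Sd by apply: Rint_ge0; apply: aeD_all => x _; exact: normr_ge0.
have b0 : 0 <= C * (Kz + 1) ^+ 2 * S1 by apply: mulr_ge0 => //; apply: mulr_ge0 => //; exact: sqr_ge0.
have f0 : 0 <= nu / 2 by rewrite divr_ge0// ltW.
have [e1 [r3 [e10 e11 r30 small]]] := choose_small e0 b0 Sd0 f0.
have [r1 r10 h1] := ff_near oO bO On0 U2 elG fG Uu e10; have [r2 r20 h2] := Uopen Uu.
have [r r0 [rr1 rr2 rr3 _]] := pos_below4 r10 r20 r30 r30.
exists r => // v v2 vr; have Uv := h2 v v2 (lt_le_trans vr rr2).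
have ez := ff_el fG Uu v2; have ey' := elG Uv.
have vE : (fun x => (u x + v x) - u x) = v by apply/funext => x; rewrite addrC addKr.
have := h1 _ Uv; rewrite vE => /(_ (lt_le_trans vr rr1)) hx.
set u' := fun x => u x + v x in Uv ey' hx *.
set z := DG u v in ez hx.
have zb x : clO x -> `|z x| <= Kz * n2 v.
  by move=> cx; apply: le_trans (hz v v2); exact: sup_le_nH.
have m0 := n2_ge0 leb O v.
have iz : aeiO (fun x => dy L x (G u x) * z x) by exact: (el_aeiM oO On0 iL ez).
have gr := gradient_identity oO bO On0 mu0 p1 ha hL u2 ey ep v2 ez (eqPhi Uu) (eqDG Uu v2).
have cF := cost_aei ey'; have cF0 := cost_aei ey.
have uv := L2M mO u2 v2; have uu := L2M mO u2 u2; have vv := L2M mO v2 v2.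
have sq : I (fun x => u' x ^+ 2) = ip u u + 2 * ip u v + ip v v.
  have := ip_sqr mO 1 u2 v2; rewrite mulr1 expr1n mul1r => <-.
  by apply: Rint_ae; apply: aeD_all => x _; rewrite /u' mul1r expr2.
have sq0 : I (fun x => u x ^+ 2) = ip u u.
  by apply: Rint_ae; apply: aeD_all => x _; rewrite expr2.
have th2 := product_L2 Uu.
have nu2 := L2Z mO nu u2.
(* Through [gradient_identity] the first-order part of the cost integral becomes the pairing of [v]
   with the product of state and adjoint state. *)
have E : cost L nu (G : L2_space O -> H1C_space O mu) u' -
    cost L nu (G : L2_space O -> H1C_space O mu) u -
    ip (fun x => nu * u x - G u x * Phi u x) v =
    I (fun x => L x (G u' x) - L x (G u x) - dy L x (G u x) * z x) + nu / 2 * (n2 v * n2 v).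
  have tv : I (fun x => v x * (G u x * Phi u x)) = ip (fun x => G u x * Phi u x) v.
    by apply: Rint_ae; apply: aeD_all => x _; rewrite mulrC.
  rewrite /cost sq sq0 ipBl// ipZl// RintB//; last exact: aeiB.
  rewrite RintB// gr tv -[in RHS]expr2 n2_sqr.
  move: (I _) (I _) (ip _ _) (ip _ _) (ip _ _) (ip _ _) => *; by field.
rewrite E; apply: (le_trans (ler_normD _ _)).
have iD : aeiO (fun x => L x (G u' x) - L x (G u x) - dy L x (G u x) * z x).
  by apply: aeiB => //; exact: aeiB.
have bound : I (fun x => `|L x (G u' x) - L x (G u x) - dy L x (G u x) * z x|) <=
    C * (Kz + 1) ^+ 2 * S1 * (n2 v * n2 v) + e1 * n2 v * Sd.
  have -> : C * (Kz + 1) ^+ 2 * S1 * (n2 v * n2 v) = (C * ((Kz + 1) ^+ 2 * (n2 v * n2 v))) * S1 by ring.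
  have iA := aeiZ mO (C * ((Kz + 1) ^+ 2 * (n2 v * n2 v))) i1.
  have iB := aeiZ mO (e1 * n2 v) (aei_norm iL).
  rewrite -RintZ// -RintZ//; last exact: aei_norm.
  rewrite -RintD//; apply: Rint_le => //; [exact: aei_norm|exact: aeiD|].
  apply: aeD2 hT (el_bound On0 ey) => x Ox hTx yx.
  have cx := @subset_closure _ O x Ox; have [g1 g2 _] := hx x cx.
  have y0M : `|G u x| <= nH (G u) + 1 by apply: (le_trans yx); rewrite lerDl.
  have ysM : `|G u' x| <= nH (G u) + 1.
    have -> : G u' x = G u x + (G u' x - G u x) by ring.
    by apply: (le_trans (ler_normD _ _)); apply: lerD => //; exact: le_trans g1 e11.
  have dist : `|G u' x - G u x| <= (Kz + 1) * n2 v.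
    have -> : G u' x - G u x = (G u' x - G u x - z x) + z x by ring.
    apply: (le_trans (ler_normD _ _)); rewrite addrC mulrDl mul1r; apply: lerD; first exact: zb.
    by apply: (le_trans g2); rewrite ler_piMl.
  have -> : L x (G u' x) - L x (G u x) - dy L x (G u x) * z x =
     (L x (G u' x) - L x (G u x) - dy L x (G u x) * (G u' x - G u x)) +
     dy L x (G u x) * (G u' x - G u x - z x) by ring.
  apply: (le_trans (ler_normD _ _)); apply: lerD; last first.
    by rewrite normrM mulrC ler_wpM2r.
  rewrite mulr1; apply: (le_trans (hTx _ _ y0M ysM)); apply: ler_wpM2l => //.
  rewrite -expr2 -exprMn; apply: lerXn2r => //; rewrite nnegrE//.
  by rewrite mulr_ge0// addr_ge0.
rewrite (ger0_norm (mulr_ge0 f0 (mulr_ge0 m0 m0))).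
apply: le_trans (small _ m0 (lt_le_trans vr rr3)); rewrite lerD2r.
by apply: le_trans bound; exact: Rint_norm.
Qed.

Local Notation K := (product_derivative G Phi DG DPhi).

Lemma product_derivative_compact u : U u -> exists C, compact_selfadjoint leb O (K u) C.
Proof.
move=> Uu; apply: (product_derivative_csa oO bO On0 mu0 elG elPhi fG fPhi Uu) => f g f2 g2.
have ey := elG Uu; have ep := elPhi Uu; have u2 := U2 Uu.
have ezf := ff_el fG Uu f2; have ezg := ff_el fG Uu g2.
have eef := ff_el fPhi Uu f2; have eeg := ff_el fPhi Uu g2.
rewrite (ipC _ _ f).
have h1 := hessian_identity oO bO On0 mu0 ha hL u2 ey ep f2 g2 ezf ezg eef (eqDG Uu g2) (eqDPhi Uu f2).
have h2 := hessian_identity oO bO On0 mu0 ha hL u2 ey ep g2 f2 ezg ezf eeg (eqDG Uu f2) (eqDPhi Uu g2).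
rewrite /product_derivative h1 h2; apply: Rint_ae; apply: aeD_all => x _.
by set b := dyy a x _; set l := dyy L x _; ring.
Qed.

Lemma cost_hessian u v w : U u -> L2 v -> L2 w ->
  cost'' L nu (U : set (L2_space O)) (G : L2_space O -> H1C_space O mu) u v w =
  qform leb O nu (K u) v w.
Proof.
move=> Uu v2 w2; have [C HK] := product_derivative_compact Uu.
apply: (second_derivativeE oO bO U2 Uopen nu0 product_L2 _ Uu HK _ v2 w2).
  by move=> u0 U0 e e0; exact: cost_expansion.
by move=> e e0; exact: (product_expansion oO bO On0 U2 elG elPhi fG fPhi Uu e0).
Qed.

End cost_derivatives.

(** * The semismooth Newton iteration *)

Section projection.
Context (R : realType) (nu alpha : R) (beta : \bar R).
Hypotheses (nu0 : 0 < nu) (ab : (alpha%:E < beta)%E).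
Implicit Types s t : R.

Definition above t := (nu%:E * beta <= t%:E)%E.
Definition below t := t <= nu * alpha.

(* distance of t to the points where the projection changes regime *)
Definition switch_gap t : R :=
  Num.min `|t - nu * alpha| (if beta is b%:E then `|t - nu * b| else `|t - nu * alpha|).

Local Notation P t := (Defs.proj alpha beta (nu^-1 * t)).

Let cases : beta = +oo%E \/ exists2 b, beta = b%:E & alpha < b.
Proof.
by case: beta ab => [b||]//= h; [right; exists b => //; rewrite lte_fin in h|left].
Qed.

Let above_fin b t : beta = b%:E -> above t = (nu * b <= t).
Proof. by move=> h; rewrite /above h -EFinM lee_fin. Qed.

Let above_oo t : beta = +oo%E -> above t = false.
Proof. by move=> h; rewrite /above h mulry gtr0_sg// mul1e leNgt ltry. Qed.

Let P_fin b t : beta = b%:E -> P t = Num.min b (Num.max alpha (nu^-1 * t)).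
Proof. by move=> h; rewrite /Defs.proj h -EFin_max -EFin_min. Qed.

Let P_oo t : beta = +oo%E -> P t = Num.max alpha (nu^-1 * t).
Proof. by move=> h; rewrite /Defs.proj h -EFin_max min_r ?leey. Qed.

Let divnu c t : (c <= nu^-1 * t) = (nu * c <= t).
Proof. by rewrite mulrC ler_pdivlMr// mulrC. Qed.

Let divnu' c t : (nu^-1 * t <= c) = (t <= nu * c).
Proof. by rewrite mulrC ler_pdivrMr// (mulrC c). Qed.

Lemma proj_above t : above t -> P t = fine beta.
Proof.
move=> ha; have [b|[b hb lb]] := cases; first by rewrite above_oo in ha.
rewrite (P_fin _ hb) hb/=; rewrite (above_fin _ hb) -divnu in ha.
by apply/min_idPl; rewrite le_max ha orbT.
Qed.

Lemma proj_below t : below t -> P t = alpha.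
Proof.
rewrite /below -divnu' => ht; have mx : Num.max alpha (nu^-1 * t) = alpha by apply/max_idPl.
have [b|[b hb lb]] := cases; first by rewrite P_oo.
by rewrite (P_fin _ hb) mx; apply/min_idPr; exact: ltW.
Qed.

Lemma proj_between t : ~~ above t -> ~~ below t -> P t = nu^-1 * t.
Proof.
move=> ha; rewrite /below -divnu' -ltNge => ht.
have mx : Num.max alpha (nu^-1 * t) = nu^-1 * t by apply/max_idPr; exact: ltW.
have [b|[b hb lb]] := cases; first by rewrite P_oo.
rewrite (P_fin _ hb) mx; apply/min_idPr.
by move: ha; rewrite (above_fin _ hb) -divnu -ltNge => /ltW.
Qed.

(** Makes the sign conditions of [critical_cone] void on the inactive set. *)
Lemma proj_strict t : ~~ above t -> ~~ below t -> P t <> alpha /\ (P t)%:E <> beta.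
Proof.
move=> ha hb; rewrite proj_between//; split=> h.
  by move: hb; rewrite /below -divnu' h lexx.
by move: ha; rewrite /above -h -EFinM mulrA divff ?gt_eqF// mul1r lexx.
Qed.

Let max_lip (c x y : R) : `|Num.max c x - Num.max c y| <= `|x - y|.
Proof.
have := ler_norm (x - y); have := ler_norm (y - x); rewrite (distrC y) ler_norml /Num.max.
by case: ltP => hx; case: ltP => hy h1 h2; apply/andP; split; lra.
Qed.

Let min_lip (c x y : R) : `|Num.min c x - Num.min c y| <= `|x - y|.
Proof.
have := ler_norm (x - y); have := ler_norm (y - x); rewrite (distrC y) ler_norml /Num.min.
by case: ltP => hx; case: ltP => hy h1 h2; apply/andP; split; lra.
Qed.

Lemma proj_lipschitz s t : `|P s - P t| <= nu^-1 * `|s - t|.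
Proof.
have -> : nu^-1 * `|s - t| = `|nu^-1 * s - nu^-1 * t|.
  by rewrite -mulrBr normrM gtr0_norm// invr_gt0.
have [b|[b hb lb]] := cases; first by rewrite !P_oo.
by rewrite !(P_fin _ hb); apply: le_trans (min_lip _ _ _) _.
Qed.

Let side (c s t : R) : `|s - t| < `|t - c| -> (s <= c) = (t <= c) /\ (c <= s) = (c <= t).
Proof.
rewrite ltr_norml => /andP[h1 h2].
have [tc|tc] := leP t c.
  rewrite ler0_norm ?subr_le0// in h1 h2; have sc : s < c by lra.
  split; first by rewrite ltW.
  rewrite leNgt sc/=; apply/esym/negbTE; rewrite -ltNge; lra.
rewrite gtr0_norm ?subr_gt0// in h1 h2; have sc : c < s by lra.
by split; [rewrite leNgt sc|rewrite !ltW].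
Qed.

(** A displacement shorter than the distance to each threshold crosses none of them. *)
Lemma switch_stable s t : `|s - t| < switch_gap t -> above s = above t /\ below s = below t.
Proof.
rewrite /switch_gap /below lt_min => /andP[h1 h2]; split; last by have [->] := side h1.
have [b|[b hb lb]] := cases; first by rewrite !above_oo.
by rewrite !(above_fin _ hb); rewrite hb in h2; have [_ ->] := side h2.
Qed.

(* The first order in s - t = k + rho cancels unless the regime switches. *)
Lemma proj_residual s t k rho : `|s - t - k| <= rho ->
  `|P s - P t - (if above s || below s then 0 else nu^-1 * k)| <=
  nu^-1 * (rho + (if switch_gap t <= `|s - t| then `|s - t| + `|k| else 0)).
Proof.
move=> hr; have rho0 : 0 <= rho by exact: le_trans hr.
have i0 : 0 <= nu^-1 by rewrite invr_ge0 ltW.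
case: (leP (switch_gap t)) => [_|/switch_stable[ha hb]].
  apply: (le_trans (ler_normB _ _)).
  have h1 := proj_lipschitz s t.
  have h2 : `|if above s || below s then 0 else nu^-1 * k| <= nu^-1 * `|k|.
    by case: ifP => _; rewrite ?normr0 ?mulr_ge0// normrM (ger0_norm i0).
  apply: (le_trans (lerD h1 h2)); rewrite -mulrDr; apply: ler_wpM2l => //; lra.
rewrite addr0; have [a1|na] /= := boolP (above s).
  by rewrite !proj_above -?ha// subrr subr0 normr0 mulr_ge0.
have [b1|nb] := boolP (below s).
  by rewrite !proj_below -?hb// subrr subr0 normr0 mulr_ge0.
rewrite !proj_between -?ha -?hb// -!mulrBr normrM (ger0_norm i0).
exact: ler_wpM2l.
Qed.

(** The link with [Sigma_set]: at a threshold the projection sits at a bound and the multiplier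
    vanishes, which strict complementarity allows only on a null set. *)
Lemma switch_gap_eq0 t : switch_gap t = 0 ->
  [/\ P t = alpha \/ (P t)%:E = beta & nu * P t - t = 0].
Proof.
rewrite /switch_gap => h.
have [t0|[b hb tb]] : t = nu * alpha \/ exists2 b, beta = b%:E & t = nu * b.
  have [b|[b hb lb]] := cases.
    by move: h; rewrite b minxx => /eqP; rewrite normr_eq0 subr_eq0 => /eqP; left.
  rewrite hb in h; move: h; rewrite /Num.min; case: ifP => _ /eqP; rewrite normr_eq0 subr_eq0 => /eqP.
    by left.
  by right; exists b.
  have bt : below t by rewrite /below t0.
  by rewrite proj_below//; split; [left|rewrite t0 subrr].
have at_ : above t by rewrite (above_fin _ hb) tb.
by rewrite proj_above// hb; split; [right|rewrite tb subrr].
Qed.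

End projection.

(** * The error after one step *)

Section newton_estimate.
Context d (T : measurableType d) (R : realType).
Context (mu : {measure set T -> \bar R}) (D : set T) (mD : measurable D).
Hypothesis Dfin : (mu D < +oo)%E.
Local Notation L2 := (L2 mu D).
Local Notation n2 := (n2 mu D).
Local Notation aeD := (aeD mu D).
Context (nu alpha : R) (beta : \bar R) (nu0 : 0 < nu) (ab : (alpha%:E < beta)%E).
Implicit Types (th thb f h e : T -> R).
Local Notation P t := (Defs.proj alpha beta (nu^-1 * t)).
Local Notation gap := (switch_gap nu alpha beta).

Definition above_set th : set T := [set x | D x /\ (nu%:E * beta <= (th x)%:E)%E].
Definition below_set th : set T := [set x | D x /\ th x <= nu * alpha].
Definition between_set th : set T := D `\` (above_set th `|` below_set th).

Lemma measurable_above_set th : measurable_fun D th -> measurable (above_set th).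
Proof.
rewrite /above_set => mth; case: beta ab => [b||]//= h.
  have -> : [set x | D x /\ (nu%:E * b%:E <= (th x)%:E)%E] = D `&` th @^-1` `[nu * b, +oo[%classic.
    by apply/seteqP; split => x /=; rewrite in_itv/= andbT -EFinM lee_fin.
  exact: mth.
rewrite (_ : [set x | _] = set0)//; apply/seteqP; split=> // x [_].
by rewrite mulry gtr0_sg// mul1e leNgt ltry.
Qed.

Lemma measurable_below_set th : measurable_fun D th -> measurable (below_set th).
Proof.
move=> mth; have -> : below_set th = D `&` th @^-1` `]-oo, nu * alpha]%classic.
  by apply/seteqP; split => x /=; rewrite in_itv.
exact: mth.
Qed.

Lemma measurable_between_set th : measurable_fun D th -> measurable (between_set th).
Proof.
move=> mth; apply: measurableD => //; apply: measurableU.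
  exact: measurable_above_set.
exact: measurable_below_set.
Qed.

Lemma measurable_proj f : measurable_fun D f -> measurable_fun D (fun x => P (f x)).
Proof.
move=> mf; have mt : measurable_fun D (fun x => nu^-1 * f x) by exact: measurable_funM.
have [b|[b hb lb]] : beta = +oo%E \/ exists2 b, beta = b%:E & alpha < b.
  by case: beta ab => [b||]//= h'; [right; exists b => //; rewrite lte_fin in h'|left].
  have -> : (fun x => P (f x)) = (fun x => Num.max alpha (nu^-1 * f x)).
    by apply/funext => x; rewrite /Defs.proj b -EFin_max min_r ?leey.
  by apply: measurable_maxr.
have -> : (fun x => P (f x)) = (fun x => Num.min b (Num.max alpha (nu^-1 * f x))).
  by apply/funext => x; rewrite /Defs.proj hb -EFin_max -EFin_min.
by apply: measurable_minr => //; exact: measurable_maxr.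
Qed.

(** Continuity of the measure from above: the sets where the gap is at most 1/(k+1) have finite
    measure and decrease to the null set where it is 0. *)
Lemma switch_gap_small thb (eps : R) : measurable_fun D thb -> aeD (fun x => gap (thb x) <> 0) ->
  0 < eps -> exists2 tau : R, 0 < tau &
    measurable (D `&` [set x | gap (thb x) <= tau]) /\
    msqrt mu D (D `&` [set x | gap (thb x) <= tau]) <= eps.
Proof.
move=> mth nz e0.
have mg : measurable_fun D (fun x => gap (thb x)).
  have mc (c : R) : measurable_fun D (fun x => `|thb x - c|).
    by apply: measurableT_comp => //; apply: measurable_funB => //; exact: measurable_cst.
  by rewrite /switch_gap; apply: measurable_minr => //; case: beta.
have mB (t : R) : measurable (D `&` [set x | gap (thb x) <= t]).
  have -> : [set x | gap (thb x) <= t] = (fun x => gap (thb x)) @^-1` `]-oo, t]%classic.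
    by apply/seteqP; split => x /=; rewrite in_itv.
  exact: mg.
pose B (k : nat) := D `&` [set x | gap (thb x) <= k.+1%:R^-1].
have Boo : (mu (B 0%N) < +oo)%E.
  by apply: le_lt_trans Dfin; apply: le_measure; rewrite ?inE//; [exact: mB|exact: subIsetl].
have mcap : measurable (\bigcap_k B k) by apply: bigcap_measurable => [|k _]; [exists 0%N|exact: mB].
have cap0 : mu (\bigcap_k B k) = 0%E.
  have [N [mN N0 hN]] := nz.
  apply/eqP; rewrite eq_le measure_ge0 andbT -N0; apply: le_measure; rewrite ?inE//.
  move=> x hx; apply: hN => /= /(_ (hx 0%N Logic.I).1); apply.
  apply/eqP; rewrite eq_le; apply/andP; split.
    apply/ler_addgt0Pl => e /natSinv_small[k hk]; rewrite addr0.
    by apply: le_trans (hx k Logic.I).2 _; apply: ltW; exact: hk.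
  by rewrite /switch_gap le_min normr_ge0/=; case: beta.
have noninc : nonincreasing_seq B.
  move=> i j ij; apply/subsetPset => x [Dx h]; split=> //; apply: le_trans h _.
  by rewrite lef_pV2 ?posrE// ler_nat.
have := nonincreasing_cvg_mu Boo (fun k => mB _) mcap noninc; rewrite cap0 => cv.
have e2 : 0 < eps ^+ 2 by rewrite exprn_gt0.
have [k _ /(_ k (leqnn k)) hk] : \forall k \near \oo, fine (mu (B k)) < eps ^+ 2.
  exact: (cvgr_lt _ (fine_cvg cv)).
exists (k.+1%:R^-1) => //; split; first exact: mB.
rewrite /msqrt; have -> : D `&` (D `&` [set x | gap (thb x) <= k.+1%:R^-1]) = B k.
  by rewrite setIA setIid.
by rewrite -(ger0_norm (ltW e0)) -sqrtr_sqr ler_wsqrtr// ltW.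
Qed.

(** [proj_residual] supplies the right-hand side for [coercive_residual]: the linearization error
    everywhere and, on [S], outside of which no regime switches, a bound of the order of [n2 h]. The
    factor [msqrt S] is what can make the second part small. *)
Lemma newton_estimate K (C gam eps c : R) th thb h e (S : set T) :
  compact_selfadjoint mu D K C -> measurable (between_set th) ->
  0 < gam -> coercive_on mu D nu K gam (between_set th) ->
  measurable_fun D th -> measurable_fun D thb -> measurable S -> L2 h -> L2 e -> 0 <= eps -> 0 <= c ->
  (forall x, D x -> `|th x - thb x| <= c * n2 h) ->
  (forall x, D x -> `|th x - thb x - K h x| <= eps * n2 h) ->
  (forall x, D x -> gap (thb x) <= `|th x - thb x| -> S x) ->
  aeD (fun x => if x \in between_set th then
      opS nu K e x = nu * (P (th x) - P (thb x)) - K h x else e x = P (th x) - P (thb x)) ->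
  n2 e <= ((nu + C * msqrt mu D setT) / gam + 1) *
    (nu^-1 * (eps * msqrt mu D setT + (c + C) * msqrt mu D S) * n2 h).
Proof.
move=> HK mI gam0 co mth mthb mS h2 e2 eps0 c0 hc heps hS step.
have N0 := n2_ge0 mu D h; have C0 := csa_ge0 HK; have i0 : 0 <= nu^-1 by rewrite invr_ge0 ltW.
have notI x : D x -> (x \notin between_set th) = (above nu beta (th x) || below nu alpha (th x)).
  move=> Dx; apply/idP/idP.
    rewrite notin_setE => nI; apply/negPn/negP; rewrite negb_or => /andP[h1 h2'].
    by apply: nI; split=> // -[[_ h3]|[_ h3]]; [move/negP: h1; apply|move/negP: h2'; apply].
  move=> h1; rewrite notin_setE => -[_]; apply.
  by case/orP: h1 => h1; [left|right].
pose r x := P (th x) - P (thb x) - (if above nu beta (th x) || below nu alpha (th x) then 0 else nu^-1 * K h x).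
have mK := csa_meas HK h2.
have rE : aeD (fun x => r x = if x \in between_set th then P (th x) - P (thb x) - nu^-1 * K h x
    else P (th x) - P (thb x)).
  by apply: aeD_all => x Dx; rewrite /r -notI//; case: (x \in _); rewrite /= ?subr0.
have mP f : measurable_fun D f -> measurable_fun D (fun x => P (f x)) by exact: measurable_proj.
(* A measurable form of [r], with [K h] cut off by the indicator of the inactive set. *)
pose r' x := (P (th x) - P (thb x)) - (\1_(between_set th) x * (nu^-1 * K h x)).
have r'r : aeD (fun x => r x = r' x).
  apply: aeD1 rE => x _ ->; rewrite /r' indicE; case: (x \in _); by rewrite ?mul1r ?mul0r ?subr0.
have mr : measurable_fun D r'.
  apply: measurable_funB; first by apply: measurable_funB; exact: mP.
  by apply: measurable_funM; [exact: measurable_indic|exact: measurable_funM].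
pose b x := nu^-1 * (eps * n2 h) + nu^-1 * ((c + C) * n2 h) * \1_S x.
have rb : aeD (fun x => `|r x| <= b x).
  apply: aeD_all => x Dx.
  apply: (le_trans (proj_residual nu0 ab (heps x Dx))); rewrite mulrDr lerD2l -mulrA.
  apply: ler_wpM2l => //; case: ifP => [hg|_]; last by rewrite mulr_ge0// mulr_ge0// addr_ge0.
  rewrite indicE mem_set ?mulr1; last exact: hS hg.
  by rewrite mulrDl; apply: lerD; [exact: hc|exact: csa_bound HK _ h2 x Dx].
have i2 : L2 (\1_S : T -> R) by exact: L2_indic.
have c2 (k : R) : L2 (fun=> k) by exact: L2_cst.
have b2 : L2 b by apply: L2_lin.
have b0 x : 0 <= b x.
  by rewrite /b addr_ge0// !mulr_ge0// ?addr_ge0//.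
have r'2 : L2 r'.
  by apply: (L2_dom mD mr b2); apply: aeD2 rb r'r => x _ h1 <-; rewrite (ger0_norm (b0 x)).
have nr : n2 r' <= nu^-1 * (eps * msqrt mu D setT + (c + C) * msqrt mu D S) * n2 h.
  apply: (@le_trans _ _ (n2 b)).
    by apply: n2_le => //; apply: aeD2 rb r'r => x _ h1 <-; rewrite (ger0_norm (b0 x)).
  have := n2_tri mD (c2 (nu^-1 * (eps * n2 h))) (L2Z mD (nu^-1 * ((c + C) * n2 h)) i2).
  move=> h1; apply: (le_trans h1).
  have k1 : n2 (fun=> nu^-1 * (eps * n2 h)) <= nu^-1 * (eps * n2 h) * msqrt mu D setT.
    apply: n2_boundedT => //; first by rewrite !mulr_ge0.
    by apply: aeD_all => x _; rewrite ger0_norm// !mulr_ge0.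
  have k2 : n2 (fun x => nu^-1 * ((c + C) * n2 h) * \1_S x) <= nu^-1 * ((c + C) * n2 h) * msqrt mu D S.
    have p0 : 0 <= nu^-1 * ((c + C) * n2 h) by rewrite !mulr_ge0// addr_ge0.
    apply: n2_bounded => //; first exact: L2Z.
      apply: aeD_all => x _; rewrite normrM (ger0_norm p0) ler_piMr//.
      by rewrite indicE; case: (x \in S); rewrite ?normr1 ?normr0.
    by apply: aeD_all => x _ nS; rewrite indicE memNset// mulr0.
  apply: (le_trans (lerD k1 k2)); rewrite le_eqVlt; apply/orP; left; apply/eqP; ring.
apply: (@le_trans _ _ (((nu + C * msqrt mu D setT) / gam + 1) * n2 r')).
  apply: (coercive_residual mD Dfin nu0 HK mI gam0 co e2 r'2).
  have stepr := aeD3 (fun x _ a b c => conj a (conj b c)) step rE r'r.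
  apply: aeD1 stepr => x _ [h1 [h2' <-]]; rewrite h2'; move: h1; case: ifP => // _ ->.
  by field; rewrite gt_eqF.
apply: ler_wpM2l => //; rewrite addr_ge0// divr_ge0 ?(ltW gam0)// addr_ge0 ?(ltW nu0)//.
by rewrite mulr_ge0// msqrt_ge0.
Qed.

End newton_estimate.

Section quadratic_minimization.
Context d (T : measurableType d) (R : realType).
Context (mu : {measure set T -> \bar R}) (D : set T) (mD : measurable D).
Hypothesis Dfin : (mu D < +oo)%E.
Local Notation L2 := (L2 mu D).
Local Notation n2 := (n2 mu D).
Local Notation ip := (ip mu D).
Local Notation aeD := (aeD mu D).
Context (nu : R) (nu0 : 0 < nu) (K : (T -> R) -> T -> R) (C : R).
Hypothesis HK : compact_selfadjoint mu D K C.
Implicit Types f g v r : T -> R.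

Lemma csa_ae f g x : L2 f -> L2 g -> aeD (fun x => f x = g x) -> D x -> K f x = K g x.
Proof.
move=> f2 g2 fg Dx; have h2 := L2_lin mD (-1) f2 g2.
have n0 : n2 (fun x => f x + -1 * g x) = 0.
  rewrite (@n2_ae _ _ _ _ _ _ (fun x => 0 * f x)) ?n2Z ?normr0 ?mul0r//.
  by apply: aeD1 fg => z _ ->; rewrite mulN1r subrr mul0r.
have := csa_bound HK h2 Dx; rewrite n0 mulr0 normr_le0 (csa_lin HK)// mulN1r subr_eq0.
by move/eqP.
Qed.

(** Completing the square at a solution [f] of the Euler equation on [E]. *)
Lemma quadratic_minimizer (E : set T) r f v : L2 r -> L2 f -> L2 v ->
  vanishes_off E f -> vanishes_off E v -> aeD (fun x => E x -> opS nu K f x = nu * r x) ->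
  (2 * nu)^-1 * qform mu D nu K v v - ip r v =
  (2 * nu)^-1 * qform mu D nu K f f - ip r f +
    (2 * nu)^-1 * qform mu D nu K (fun x => v x - f x) (fun x => v x - f x).
Proof.
move=> r2 f2 v2 fE vE sol; pose g x := v x - f x; have g2 : L2 g by exact: L2B.
have vfg : v = (fun x => f x + 1 * g x).
  by apply/funext => x; rewrite /g mul1r addrC subrK.
have q : qform mu D nu K f g = nu * ip r g.
  rewrite (qformE mD Dfin nu HK f2 g2) -ipZl//; apply: Rint_ae.
  apply: aeD1 sol => x _ sol; have [Ex|nE] := pselect (E x); first by rewrite sol.
  by rewrite /g (fE x nE) (vE x nE) subrr !mulr0.
have := qform_sqr mD Dfin nu HK 1 f2 g2; rewrite -vfg -/g => ->.
have -> : ip r v = ip r f + ip r g by rewrite {1}vfg ip_linr// mul1r.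
by rewrite q expr1n; field; rewrite gt_eqF.
Qed.

End quadratic_minimization.

(** * The quadratic subproblem of a step *)

Section newton_steps.
Context (R : realType) (n : nat) (O : set 'rV[R]_n) (mu : R).
Hypotheses (oO : open O) (bO : bounded_set O).
Local Notation leb := (@lebesgue_rV R n).
Local Notation fT := ('rV[R]_n -> R).
Local Notation el := (elements (H1C_space O mu)).
Local Notation L2 := (L2 leb O).
Local Notation n2 := (n2 leb O).
Local Notation ip := (ip leb O).
Local Notation aeO := (aeD leb O).
Implicit Types u v w y z phi eta f : 'rV[R]_n -> R.

Let mO : measurable O := open_measurable_mx oO.
Let Ofin : (leb O < +oo)%E := lebesgue_bounded_fin mO bO.

Context (nu alpha : R) (beta : \bar R).
Hypotheses (nu0 : 0 < nu) (ab : (alpha%:E < beta)%E).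
Local Notation P t := (Defs.proj alpha beta (nu^-1 * t)).

Lemma Lp_patch (E : set 'rV[R]_n) v : E `<=` O -> Lp leb E 2%:E v <-> L2 (v \_ E).
Proof.
move=> EO; have h : (v \_ E) \_ O = v \_ E.
  apply/funext => x; rewrite !patchE; case: ifPn => // xO; case: ifPn => // xE.
  by move: xO; rewrite notin_setE => -[]; apply: EO; rewrite inE in xE.
have := @Lp2P _ _ _ mO (v \_ E); rewrite {1}/Lp /= h; exact.
Qed.

Lemma Rintegral_patch (E : set 'rV[R]_n) f : E `<=` O ->
  \int[leb]_(x in E) f x = \int[leb]_(x in O) (f \_ E) x.
Proof.
move=> EO; rewrite /Rintegral; congr fine; rewrite integral_mkcond [RHS]integral_mkcond.
apply: eq_integral => x _; rewrite !patchE; case: ifPn => xE.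
  by rewrite ifT// inE; apply: EO; rewrite inE in xE.
by case: ifP.
Qed.

Context (A : 'rV[R]_n -> 'M[R]_n) (a L : 'rV[R]_n -> R -> R).
Context (U : set fT) (G Phi : fT -> fT) (DG DPhi : fT -> fT -> fT).
Local Notation K := (product_derivative G Phi DG DPhi).
Local Notation GG := (G : L2_space O -> H1C_space O mu).
Local Notation PP := (Phi : L2_space O -> H1C_space O mu).
Local Notation theta u := (fun x => G u x * Phi u x).
Local Notation residual u := (newton_residual nu alpha beta GG PP u).
Local Notation inact u := (between_set O nu alpha beta (theta u)).
Local Notation act u := (above_set O nu beta (theta u) `|` below_set O nu alpha (theta u)).

Lemma newton_residualE u x : O x -> residual u x = P (theta u x) - u x.
Proof.
move=> Ox; rewrite /newton_residual; case: ifPn => [|na].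
  by rewrite inE => -[_ h]; rewrite (proj_above nu0 ab h) addrC.
case: ifPn => [|nb].
  by rewrite inE => -[_ h]; rewrite (proj_below nu0 ab h) addrC.
rewrite (proj_between nu0 ab); first by rewrite addrC (mulrC (G u x)).
  by apply/negP => h; move: na; rewrite notin_setE; apply; split.
by apply/negP => h; move: nb; rewrite notin_setE; apply; split.
Qed.

Lemma proj_L2 f : L2 f -> L2 (fun x => P (f x)).
Proof.
move=> f2; have mf : measurable_fun O f by case: f2.
have c2 : L2 (fun=> `|P 0|) by exact: L2_cst.
have b2 := L2_lin mO nu^-1 c2 (L2_norm mO f2).
apply: (L2_dom mO (measurable_proj nu ab mf) b2); apply: aeD_all => x _.
have i0 : 0 <= nu^-1 by rewrite invr_ge0 ltW.
rewrite [leRHS]ger0_norm ?addr_ge0 ?mulr_ge0//.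
have -> : P (f x) = P 0 + (P (f x) - P 0) by ring.
apply: (le_trans (ler_normD _ _)); rewrite lerD2l.
by have := proj_lipschitz nu0 ab (f x) 0; rewrite subr0.
Qed.

Hypothesis U2 : forall u, U u -> L2 u.
Hypothesis theta2 : forall u, U u -> L2 (theta u).
Hypothesis hess : forall u v w, U u -> L2 v -> L2 w ->
  cost'' L nu (U : set (L2_space O)) GG u v w = qform leb O nu (K u) v w.
Hypothesis DGel : forall u v, U u -> L2 v -> el (DG u v) /\ linearized_state_eq O A a u (G u) v (DG u v).
Hypothesis DPhiel : forall u v, U u -> L2 v -> el (DPhi u v) /\
  linearized_adjoint_eq O A a L u (G u) (Phi u) v (DG u v) (DPhi u v).
Hypothesis DGunique : forall u v z, U u -> L2 v -> el z -> linearized_state_eq O A a u (G u) v z ->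
  aeO (fun x => z x = DG u v x).
Hypothesis DPhiunique : forall u v z eta, U u -> L2 v -> el z -> el eta ->
  aeO (fun x => z x = DG u v x) ->
  linearized_adjoint_eq O A a L u (G u) (Phi u) v z eta -> aeO (fun x => eta x = DPhi u v x).

Context (u : fT) (Uu : U u) (C gam : R).
Hypothesis HK : compact_selfadjoint leb O (K u) C.
Hypotheses (gam0 : 0 < gam) (co : coercive_on leb O nu (K u) gam (inact u)).

Let mth : measurable_fun O (theta u). Proof. by case: (theta2 Uu). Qed.
Let mI : measurable (inact u). Proof. exact: measurable_between_set. Qed.
Let mA : measurable (act u).
Proof. exact: measurableU (measurable_above_set mO nu0 ab mth) (measurable_below_set mO nu alpha mth). Qed.
Let IO : inact u `<=` O. Proof. by move=> x []. Qed.
Let AO : act u `<=` O. Proof. by move=> x [[]|[]]. Qed.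

Let res x := P (theta u x) - u x.
Let res2 : L2 res. Proof. by apply: L2B => //; [apply: proj_L2; exact: theta2|exact: U2]. Qed.
Let wA := (residual u) \_ (act u).

Let wAE : wA = res \_ (act u).
Proof.
by apply/funext => x; rewrite /wA !patchE; case: ifPn => // /set_mem /AO; exact: newton_residualE.
Qed.

Let wA2 : L2 wA. Proof. by rewrite wAE; exact: L2_patch. Qed.

(** The datum of the linear part of [newton_functional]: [K u wA] is, up to null sets, the
    expression that the algorithm forms from [z] and [eta]. *)
Let r x := res x + nu^-1 * K u wA x.
Let r2 : L2 r. Proof. by apply: L2_lin => //; exact: (csa_L2 mO Ofin HK). Qed.

Let functionalE z eta v : aeO (fun x => z x = DG u wA x) -> aeO (fun x => eta x = DPhi u wA x) ->
  L2 (v \_ (inact u)) ->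
  newton_functional L nu alpha beta U GG PP u z eta v =
  (2 * nu)^-1 * qform leb O nu (K u) (v \_ (inact u)) (v \_ (inact u)) - ip r (v \_ (inact u)).
Proof.
move=> hz he v2; rewrite /newton_functional -[inactive _ _ _ _ _ _]/(inact u) hess//; congr (_ - _).
rewrite Rintegral_patch//; apply: Rint_ae; apply: aeD2 hz he => x Ox zx ex.
rewrite !patchE; case: ifP => _; last by rewrite mulr0.
by rewrite newton_residualE// zx ex.
Qed.

Let solution : exists f, [/\ L2 f, vanishes_off (inact u) f &
  forall x, O x -> inact u x -> opS nu (K u) f x = nu * r x].
Proof. exact: (coercive_solvable mO Ofin nu0 HK mI gam0 co (L2Z mO nu r2)). Qed.

Let solution_residual f : L2 f -> vanishes_off (inact u) f ->
  (forall x, O x -> inact u x -> opS nu (K u) f x = nu * r x) ->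
  forall x, O x -> if x \in inact u then opS nu (K u) (fun x => wA x + 1 * f x) x = nu * res x
    else wA x + 1 * f x = res x.
Proof.
move=> f2 fI sol x Ox; case: ifPn => [|nI].
  rewrite inE => Ix; rewrite (opS_lin nu HK)// sol//.
  have nA : ~ act u x by case: Ix.
  (* On the inactive set [wA] enters [opS] only through [- K u wA], which cancels the same term in
     [nu * r x]. *)
  have wAx : wA x = 0 by rewrite /wA patchE memNset.
  by rewrite /opS wAx /r; move: (K u wA x) (res x) => k s; field; rewrite gt_eqF.
rewrite fI ?mulr0 ?addr0; last by move: nI; rewrite notin_setE.
rewrite wAE patchE mem_set//; move: nI; rewrite notin_setE => nI.
by apply: contrapT => nA; apply: nI.
Qed.

(** The exact solution [f] of the Euler equation competes with the minimizer. By the completed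
    square the form at their difference is at most 0, and coercivity makes the difference null. *)
Lemma newton_step_solution u1 : newton_step A a L nu alpha beta U GG PP u u1 ->
  L2 u1 /\ aeO (fun x => if x \in inact u then opS nu (K u) (fun x => u1 x - u x) x = nu * res x
    else u1 x - u x = res x).
Proof.
move=> [z [eta [v [[ez sz] [ee se] [v2 vmin] [/(Lp2P mO) u12 u1E]]]]].
have hz := DGunique Uu wA2 ez sz.
have he := DPhiunique Uu wA2 ez ee hz se.
split=> //; have [f [f2 fI sol]] := solution.
move/(Lp_patch v IO) in v2; pose V := v \_ (inact u).
have fp : f \_ (inact u) = f by exact: vanishes_patch.
have f2' : L2 (f \_ (inact u)) by rewrite fp.
have VI : vanishes_off (inact u) V by exact: patch_off.
have := vmin f ((Lp_patch f IO).2 f2'); rewrite !functionalE// fp.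
have sol' : aeO (fun x => inact u x -> opS nu (K u) f x = nu * r x) by apply: aeD_all => x; exact: sol.
rewrite (quadratic_minimizer mO Ofin nu0 HK r2 f2 v2 fI VI sol') gerDl.
have d2 : L2 (fun x => V x - f x) by exact: L2B.
have dI : vanishes_off (inact u) (fun x => V x - f x) by move=> x nI; rewrite VI// fI// subrr.
have nu2 : 0 < (2 * nu)^-1 by rewrite invr_gt0 mulr_gt0.
rewrite pmulr_rle0// => q0; have := le_trans (co d2 dI) q0.
rewrite pmulr_rle0// => n0.
have dn0 : n2 (fun x => V x - f x) = 0 by apply/eqP; rewrite -sqrf_eq0 eq_le n0 sqr_ge0.
have Vf := n2_eq0 mO d2 dn0.
have g2 : L2 (fun x => wA x + 1 * f x) by exact: L2_lin.
have E : aeO (fun x => u1 x - u x = wA x + 1 * f x).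
  apply: aeD2 Vf u1E => x _ h ->.
  have -> : (v \_ (inactive nu alpha beta GG PP u)) x = f x.
    by apply/eqP; rewrite -subr_eq0; apply/eqP; exact: h.
  by rewrite addrC addKr mul1r.
have du2 : L2 (fun x => u1 x - u x) by apply: L2B => //; exact: U2.
apply: aeD1 (E) => x Ox h.
have Keq := csa_ae mO HK du2 g2 E Ox.
by have := solution_residual f2 fI sol Ox; rewrite /opS Keq h.
Qed.

(** [DG u wA] and [DPhi u wA] serve as [z] and [eta], and the solution of the Euler equation is
    minimal by the completed square. *)
Lemma newton_step_exists : exists u1, newton_step A a L nu alpha beta U GG PP u u1.
Proof.
have [f [f2 fI sol]] := solution.
have fp : f \_ (inact u) = f by exact: vanishes_patch.
have f2' : L2 (f \_ (inact u)) by rewrite fp.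
exists (fun x => u x + (wA x + (f \_ (inact u)) x)), (DG u wA), (DPhi u wA), f; split.
- exact: (DGel Uu wA2).
- exact: (DPhiel Uu wA2).
- split; first exact/(Lp_patch f IO).
  move=> v' /(Lp_patch _ IO) v'2.
  have hz : aeO (fun x => DG u wA x = DG u wA x) by exact: aeD_all.
  have he : aeO (fun x => DPhi u wA x = DPhi u wA x) by exact: aeD_all.
  rewrite !functionalE// fp.
  have VI : vanishes_off (inact u) (v' \_ (inact u)) by exact: patch_off.
  have sol' : aeO (fun x => inact u x -> opS nu (K u) f x = nu * r x) by apply: aeD_all => x; exact: sol.
  rewrite (quadratic_minimizer mO Ofin nu0 HK r2 f2 v'2 fI VI sol') lerDl.
  have nu2 : 0 < (2 * nu)^-1 by rewrite invr_gt0 mulr_gt0.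
  rewrite mulr_ge0 ?(ltW nu2)//.
  have d2 : L2 (fun x => (v' \_ (inact u)) x - f x) by exact: L2B.
  have dI : vanishes_off (inact u) (fun x => (v' \_ (inact u)) x - f x) by move=> x nI; rewrite VI// fI// subrr.
  by apply: le_trans (co d2 dI); rewrite mulr_ge0 ?sqr_ge0// ltW.
- split; last by apply: aeD_all.
  by apply/(Lp2P mO); apply: L2D => //; [exact: U2|exact: L2D].
Qed.

End newton_steps.

(** * Uniform coercivity and contraction near [ubar] *)

Section newton_contraction.
Context (R : realType) (n : nat) (O : set 'rV[R]_n).
Hypotheses (oO : open O) (bO : bounded_set O).
Local Notation leb := (@lebesgue_rV R n).
Local Notation fT := ('rV[R]_n -> R).
Local Notation L2 := (L2 leb O).
Local Notation n2 := (n2 leb O).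
Local Notation aeO := (aeD leb O).
Local Notation msq := (msqrt leb O).
Implicit Types u v w y z phi eta f : 'rV[R]_n -> R.

Let mO : measurable O := open_measurable_mx oO.
Let Ofin : (leb O < +oo)%E := lebesgue_bounded_fin mO bO.

Context (nu alpha : R) (beta : \bar R).
Hypotheses (nu0 : 0 < nu) (ab : (alpha%:E < beta)%E).
Local Notation P t := (Defs.proj alpha beta (nu^-1 * t)).
Local Notation gap := (switch_gap nu alpha beta).
Context (U : set fT) (theta : fT -> fT) (K : fT -> fT -> fT).
Local Notation inact u := (between_set O nu alpha beta (theta u)).

Hypothesis U2 : forall u, U u -> L2 u.
Hypothesis theta2 : forall u, U u -> L2 (theta u).
Hypothesis Kcsa : forall u, U u -> exists C, compact_selfadjoint leb O (K u) C.
Context (ub : fT) (Uub : U ub).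
Hypothesis Uopen : exists2 r : R, 0 < r & forall u, L2 u -> n2 (fun x => u x - ub x) < r -> U u.
Hypothesis Kcont : forall e : R, 0 < e -> exists2 r : R, 0 < r &
  forall u', U u' -> n2 (fun x => u' x - ub x) < r ->
  forall f, L2 f -> forall x, O x -> `|K u' f x - K ub f x| <= e * n2 f.
Hypothesis expansion : forall e : R, 0 < e -> exists2 r : R, 0 < r &
  forall u', U u' -> n2 (fun x => u' x - ub x) < r -> forall x, O x ->
  `|theta u' x - theta ub x - K ub (fun x => u' x - ub x) x| <= e * n2 (fun x => u' x - ub x).
Hypothesis nondegenerate : aeO (fun x => gap (theta ub x) <> 0).
Hypothesis positive : forall f, L2 f -> vanishes_off (inact ub) f -> n2 f != 0 ->
  0 < qform leb O nu (K ub) f f.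

Let msq0 := msqrt_ge0 leb O.

Let csa_weaken Q C C' : compact_selfadjoint leb O Q C -> 0 <= C' ->
  (forall f, L2 f -> forall x, O x -> `|Q f x| <= C' * n2 f) -> compact_selfadjoint leb O Q C'.
Proof. by case=> *; split. Qed.

Let small_factor (e c : R) : 0 < e -> 0 <= c -> exists2 s : R, 0 < s & c * s <= e.
Proof.
move=> e0 c0; have c1 : 0 < c + 1 by rewrite ltr_wpDl.
exists (e / (c + 1)); first exact: divr_gt0.
by rewrite mulrCA ler_piMr ?(ltW e0)// ler_pdivrMr// mul1r lerDl.
Qed.

Let msq_le (E F : set 'rV[R]_n) : measurable E -> measurable F -> E `<=` F -> msq E <= msq F.
Proof.
move=> mE mF EF; rewrite /msqrt ler_wsqrtr// fine_le//.
- by rewrite ge0_fin_numE ?measure_ge0//; exact: mDE_fin.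
- by rewrite ge0_fin_numE ?measure_ge0//; exact: mDE_fin.
by apply: le_measure; rewrite ?inE; [exact: measurableI|exact: measurableI|exact: setIS].
Qed.

(** One radius and one pair of constants for all nearby controls. A point inactive for [u] but not
    for [ub] has switched regime, so its gap is at most [tau]. Such points fill a small set, and
    [coercive_perturb] loses a quarter of [g] for them and a quarter for the change of [K]. *)
Lemma newton_local : exists r gam C : R, [/\ 0 < r, 0 < gam, 0 <= C &
  forall u, L2 u -> n2 (fun x => u x - ub x) < r -> [/\ U u, compact_selfadjoint leb O (K u) C,
    coercive_on leb O nu (K u) gam (inact u) &
    forall x, O x -> `|theta u x - theta ub x| <= C * n2 (fun x => u x - ub x)]].
Proof.
have [C HK] := Kcsa Uub; have C0 := csa_ge0 HK.
have mthb : measurable_fun O (theta ub) by have [] := theta2 Uub.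
have mIb : measurable (inact ub) by exact: (measurable_between_set mO nu0 ab mthb).
have [g0 g00 co0] := coercive_of_positive mO Ofin nu0 HK mIb positive.
(* [coercive_perturb] asks for a coercivity constant not above [nu]. *)
pose g := Num.min g0 nu.
have gpos : 0 < g by rewrite lt_min g00.
have co : coercive_on leb O nu (K ub) g (inact ub).
  move=> f f2 fI; apply: le_trans (co0 f f2 fI); apply: ler_wpM2r; first exact: sqr_ge0.
  by rewrite ge_min lexx.
have gnu : 0 <= g <= nu by rewrite (ltW gpos) ge_min lexx orbT.
have g4 : 0 < g / 4 by rewrite divr_gt0.
have C30 : 0 <= 3 * C by rewrite mulr_ge0.
have [s s0 hs] := small_factor g4 C30.
have [e1 e10 he1] := small_factor g4 (msq0 setT).
pose e := Num.min e1 1; have e0 : 0 < e by rewrite lt_min e10 ltr01.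
have e1' : e <= 1 by rewrite ge_min lexx orbT.
have ee1 : e <= e1 by rewrite ge_min lexx.
have [tau tau0 [mS hS]] := switch_gap_small mO Ofin mthb nondegenerate s0.
have [r1 r10 h1] := Uopen; have [r2 r20 h2] := Kcont e0; have [r3 r30 h3] := expansion ltr01.
have C1 : 0 < C + 1 by rewrite ltr_wpDl.
(* The last bound, [tau / (C + 1)], keeps [theta u] within [tau] of [theta ub]. *)
have [r r0 [rr1 rr2 rr3 rr4]] := pos_below4 r10 r20 r30 (divr_gt0 tau0 C1).
exists r, (g / 2), (C + 1); split; [by []|by rewrite divr_gt0|exact: ltW|] => u u2 ur.
have Uu := h1 u u2 (lt_le_trans ur rr1).
have Kc := h2 u Uu (lt_le_trans ur rr2); have ex := h3 u Uu (lt_le_trans ur rr3).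
have d2 : L2 (fun x => u x - ub x) by apply: L2B => //; exact: U2.
have dist x : O x -> `|theta u x - theta ub x| <= (C + 1) * n2 (fun x => u x - ub x).
  move=> Ox; have -> : theta u x - theta ub x =
    K ub (fun x => u x - ub x) x + (theta u x - theta ub x - K ub (fun x => u x - ub x) x) by ring.
  by apply: (le_trans (ler_normD _ _)); rewrite mulrDl; apply: lerD; [exact: csa_bound HK _ d2 x Ox|exact: ex].
have [Cu HKu] := Kcsa Uu.
have mthu : measurable_fun O (theta u) by have [] := theta2 Uu.
have mIu : measurable (inact u) by exact: (measurable_between_set mO nu0 ab mthu).
have HKu' : compact_selfadjoint leb O (K u) (C + 1).
  apply: (csa_weaken HKu (ltW C1)) => f f2 x Ox.
  have -> : K u f x = K ub f x + (K u f x - K ub f x) by ring.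
  apply: (le_trans (ler_normD _ _)); rewrite mulrDl; apply: lerD; first exact: csa_bound HK _ f2 x Ox.
  by apply: (le_trans (Kc f f2 x Ox)); rewrite ler_wpM2r ?n2_ge0.
split=> //.
have cop := coercive_perturb mO Ofin nu0 HK HKu' mIb mIu co gnu (ltW e0) Kc.
move=> f f2 fI; apply: le_trans (cop f f2 fI); apply: ler_wpM2r; first exact: sqr_ge0.
have sub : inact u `\` inact ub `<=` O `&` [set x | gap (theta ub x) <= tau].
  move=> x [[Ox nAu] nIb]; split=> //=.
  have small : `|theta u x - theta ub x| <= tau.
    by apply: (le_trans (dist x Ox)); rewrite mulrC -ler_pdivlMr//; exact: le_trans (ltW ur) rr4.
  apply: le_trans small; rewrite leNgt; apply/negP => /(switch_stable nu0 ab)[ea eb].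
  apply: nIb; split=> // -[[_ h]|[_ h]]; apply: nAu; [left|right]; split=> //.
    by rewrite -[X in is_true X]/(above nu beta (theta u x)) ea.
  by rewrite -[X in is_true X]/(below nu alpha (theta u x)) eb.
have mdiff : measurable (inact u `\` inact ub) by exact: measurableD.
have k1 : 3 * C * msq (inact u `\` inact ub) <= g / 4.
  apply: le_trans hs; apply: ler_wpM2l => //; apply: le_trans hS; exact: msq_le.
have k2 : e * msq setT <= g / 4 by apply: le_trans he1; rewrite mulrC; apply: ler_wpM2l.
by lra.
Qed.

Local Notation step_eq u u1 := (aeO (fun x =>
  if x \in inact u then opS nu (K u) (fun x => u1 x - u x) x = nu * (P (theta u x) - u x)
  else u1 x - u x = P (theta u x) - u x)).

Hypothesis stationary : aeO (fun x => ub x = P (theta ub x)).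

(** Since [q] is arbitrary this is the superlinear rate. Half of [q] pays for the linearization
    error, half for the set where a regime may switch. *)
Lemma newton_contraction (q : R) : 0 < q -> exists2 r : R, 0 < r &
  forall u u1, L2 u -> n2 (fun x => u x - ub x) < r -> L2 u1 -> step_eq u u1 ->
  n2 (fun x => u1 x - ub x) <= q * n2 (fun x => u x - ub x).
Proof.
move=> q0; have [r0 [gam [C [r00 gam0 C0 loc]]]] := newton_local.
pose k := ((nu + C * msq setT) / gam + 1) * nu^-1.
have k0 : 0 <= k.
  rewrite mulr_ge0 ?invr_ge0 ?(ltW nu0)// addr_ge0// divr_ge0 ?(ltW gam0)//.
  by rewrite addr_ge0 ?(ltW nu0)// mulr_ge0// msq0.
have q2 : 0 < q / 2 by rewrite divr_gt0.
have [e e0 he] := small_factor q2 (mulr_ge0 k0 (msq0 setT)).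
have [s s0 hs] := small_factor q2 (mulr_ge0 k0 (addr_ge0 C0 C0)).
have mthb : measurable_fun O (theta ub) by have [] := theta2 Uub.
have [tau tau0 [mS hS]] := switch_gap_small mO Ofin mthb nondegenerate s0.
have e20 : 0 < e / 2 by rewrite divr_gt0.
have [r1 r10 h1] := Kcont e20; have [r2 r20 h2] := expansion e20.
have C1 : 0 < C + 1 by rewrite ltr_wpDl.
have [r rpos [rr0 rr1 rr2 rr3]] := pos_below4 r00 r10 r20 (divr_gt0 tau0 C1).
exists r => // u u1 u2 ur u12 step.
have [Uu HK co dist] := loc u u2 (lt_le_trans ur rr0).
have mthu : measurable_fun O (theta u) by have [] := theta2 Uu.
have mIu : measurable (inact u) by exact: (measurable_between_set mO nu0 ab mthu).
have d2 : L2 (fun x => u x - ub x) by apply: L2B => //; exact: U2.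
have s2 : L2 (fun x => u1 x - u x) by exact: L2B.
have t2 : L2 (fun x => u1 x - ub x) by apply: L2B => //; exact: U2.
have N0 := n2_ge0 leb O (fun x => u x - ub x).
(* The expansion is made with [K ub], whereas the step works with [K u]; continuity of [K] exchanges
   them at the cost of the second [e / 2]. *)
have ex x : O x -> `|theta u x - theta ub x - K u (fun x => u x - ub x) x| <= e * n2 (fun x => u x - ub x).
  move=> Ox; have -> : theta u x - theta ub x - K u (fun x => u x - ub x) x =
    (theta u x - theta ub x - K ub (fun x => u x - ub x) x) -
    (K u (fun x => u x - ub x) x - K ub (fun x => u x - ub x) x) by ring.
  apply: (le_trans (ler_normB _ _)).
  have a1 := h2 u Uu (lt_le_trans ur rr2) x Ox.
  have a2 := h1 u Uu (lt_le_trans ur rr1) _ d2 x Ox.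
  by apply: (le_trans (lerD a1 a2)); rewrite -mulrDl -splitr.
have gS x : O x -> gap (theta ub x) <= `|theta u x - theta ub x| ->
    (O `&` [set x | gap (theta ub x) <= tau]) x.
  move=> Ox hg; split=> //=; apply: (le_trans hg); apply: (le_trans (dist x Ox)).
  apply: (@le_trans _ _ ((C + 1) * n2 (fun x => u x - ub x))); first by rewrite ler_wpM2r// lerDl.
  by rewrite mulrC -ler_pdivlMr//; exact: le_trans (ltW ur) rr3.
(* [opS] of [u - ub] is added to the step equation. The multiples of [u] cancel, stationarity turns
   [nu * ub] into the projected value, and [- K u (u - ub)] remains. *)
have step' : aeO (fun x => if x \in inact u then
    opS nu (K u) (fun x => u1 x - ub x) x =
      nu * (P (theta u x) - P (theta ub x)) - K u (fun x => u x - ub x) x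
    else u1 x - ub x = P (theta u x) - P (theta ub x)).
  have E : (fun x => u1 x - ub x) = (fun x => (u1 x - u x) + 1 * (u x - ub x)).
    by apply/funext => x; ring.
  apply: aeD2 step stationary => x Ox; case: ifP => _ h <-.
    by rewrite E (opS_lin nu HK)// h /opS; move: (K u _ x) => kk; ring.
  by move: h => /eqP; rewrite -subr_eq0 => /eqP h; apply/eqP; rewrite -subr_eq0 -h; apply/eqP; ring.
have est := newton_estimate mO Ofin nu0 ab HK mIu gam0 co mthu mthb mS d2 t2 (ltW e0) C0 dist ex gS step'.
apply: (le_trans est); rewrite !mulrA; apply: ler_wpM2r => //; rewrite -/k mulrDr.
have -> : q = q / 2 + q / 2 by rewrite -splitr.
apply: lerD; first by apply: le_trans he; rewrite mulrCA mulrC.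
rewrite mulrA; apply: le_trans hs; apply: ler_wpM2l => //; rewrite mulr_ge0//; exact: addr_ge0.
Qed.

Hypothesis theta_ae : forall u u' x, U u -> U u' -> aeO (fun x => u x = u' x) -> O x ->
  theta u x = theta u' x.
Hypothesis K_ae : forall u u' f, U u -> U u' -> aeO (fun x => u x = u' x) -> L2 f ->
  aeO (fun x => K u f x = K u' f x).

(** The difference of two corrections satisfies the error equation with zero data, so
    [coercive_residual] makes it null. *)
Lemma newton_step_unique (gam C : R) u u' u1 u1' : 0 < gam -> U u -> U u' ->
  compact_selfadjoint leb O (K u) C -> coercive_on leb O nu (K u) gam (inact u) ->
  aeO (fun x => u x = u' x) -> L2 u1 -> L2 u1' -> step_eq u u1 -> step_eq u' u1' ->
  aeO (fun x => u1 x = u1' x).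
Proof.
move=> gam0 Uu Uu' HK co uu u12 u12' s s'.
have mthu : measurable_fun O (theta u) by have [] := theta2 Uu.
have mIu : measurable (inact u) by exact: (measurable_between_set mO nu0 ab mthu).
have thE x : O x -> theta u x = theta u' x by exact: theta_ae.
have IE : inact u' = inact u.
  apply/seteqP; split=> x [Ox nA]; split=> // -[[_ h]|[_ h]]; apply: nA; [left|right|left|right];
    by split=> //; move: h; rewrite thE.
have u2 := U2 Uu; have u2' := U2 Uu'.
have d2 : L2 (fun x => u1 x - u x) by exact: L2B.
have d2' : L2 (fun x => u1' x - u' x) by exact: L2B.
have e2 : L2 (fun x => (u1 x - u x) + -1 * (u1' x - u' x)) by exact: L2_lin.
have z2 : L2 (fun=> 0) by exact: L2_0.
have res : aeO (fun x => if x \in inact u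
    then opS nu (K u) (fun x => (u1 x - u x) + -1 * (u1' x - u' x)) x = nu * 0
    else (u1 x - u x) + -1 * (u1' x - u' x) = 0).
  have := aeD3 (fun x _ a b c => conj a (conj b c)) uu s s'.
  apply: aeD2 (K_ae Uu Uu' uu d2') => x Ox Kx [ux [sx sx']].
  move: sx sx'; rewrite IE -(thE x Ox); case: ifP => _ h h'.
    rewrite (opS_lin nu HK)// h.
    have -> : opS nu (K u) (fun x => u1' x - u' x) x = opS nu (K u') (fun x => u1' x - u' x) x.
      by rewrite /opS Kx.
    by rewrite h' ux; ring.
  by rewrite h h' ux; ring.
have := coercive_residual mO Ofin nu0 HK mIu gam0 co e2 z2 res.
have -> : n2 (fun=> 0) = 0 by have := n2Z mO 0 z2; rewrite normr0 !mul0r.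
rewrite mulr0 => n0.
have e0 : n2 (fun x => (u1 x - u x) + -1 * (u1' x - u' x)) = 0.
  by apply/eqP; rewrite eq_le n0 n2_ge0.
apply: aeD2 (n2_eq0 mO e2 e0) uu => x _ h ux; move: h; rewrite ux => h.
by apply/eqP; rewrite -subr_eq0 -h; apply/eqP; ring.
Qed.

End newton_contraction.

(** * Runs of an iteration that contracts by every factor near its limit *)

Section superlinear_runs.
Context (R : realType) (T : Type) (good : T -> Prop) (dist : T -> R) (step : T -> T -> Prop) (del : R).
Hypothesis dist_ge0 : forall u, good u -> 0 <= dist u.
Hypothesis next : forall u, good u -> dist u < del -> exists u1, step u u1.
Hypothesis contract : forall q : R, 0 < q -> exists2 r : R, 0 < r &
  forall u u1, good u -> dist u < r -> dist u < del -> step u u1 -> dist u1 <= q * dist u.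
Hypothesis halve : forall u u1, good u -> dist u < del -> step u u1 ->
  good u1 /\ dist u1 <= 2^-1 * dist u.

Let half_lt (t : R) : 0 <= t -> t < del -> 2^-1 * t < del.
Proof. by move=> *; lra. Qed.

Lemma run_invariant (u : nat -> T) : good (u 0%N) -> dist (u 0%N) < del ->
  (forall j, step (u j) (u j.+1)) -> forall j, good (u j) /\ dist (u j) < del.
Proof.
move=> g0 d0 st; elim=> [//|j [gj dj]]; have [g1 h1] := halve gj dj (st j).
by split=> //; apply: le_lt_trans h1 _; apply: half_lt => //; exact: dist_ge0.
Qed.

Lemma run_exists (u0 : T) : good u0 -> dist u0 < del ->
  exists u : nat -> T, u 0%N = u0 /\ forall j, step (u j) (u j.+1).
Proof.
move=> g0 d0.
(* A total successor function is chosen; outside the ball the implication is void and [u] itself is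
   a default. *)
have hex u : exists u1, good u /\ dist u < del -> step u u1.
  have [[gu du]|nb] := pselect (good u /\ dist u < del); last by exists u.
  by have [u1 h] := next gu du; exists u1.
have [F hF] := choice hex; pose u j := iter j F u0.
have inv j : good (u j) /\ dist (u j) < del.
  elim: j => [//|j [gj dj]]; have [g1 h1] := halve gj dj (hF _ (conj gj dj)).
  by split=> //; apply: le_lt_trans h1 _; apply: half_lt => //; exact: dist_ge0.
by exists u; split=> // j; exact: hF.
Qed.

Lemma run_cvg (u : nat -> T) : good (u 0%N) -> dist (u 0%N) < del ->
  (forall j, step (u j) (u j.+1)) -> dist (u j) @[j --> \oo] --> (0 : R).
Proof.
move=> g0 d0 st; have inv := run_invariant g0 d0 st.
have bnd j : dist (u j) <= dist (u 0%N) * 2^-1 ^+ j.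
  elim: j => [|j ih]; first by rewrite expr0 mulr1.
  have [gj dj] := inv j; have [_ h] := halve gj dj (st j).
  by apply: (le_trans h); rewrite exprS mulrCA ler_pM2l.
have geo : (fun j => dist (u 0%N) * 2^-1 ^+ j) @ \oo --> (0 : R).
  rewrite -(mulr0 (dist (u 0%N))); apply: cvgMr; apply: cvg_expr.
  by rewrite ger0_norm ?invr_ge0// invf_lt1// ltr1n.
apply: (squeeze_cvgr _ (cvg_cst (0 : R)) geo); apply: nearW => j.
by have [gj _] := inv j; rewrite dist_ge0//= bnd.
Qed.

Lemma run_superlinear (u : nat -> T) : good (u 0%N) -> dist (u 0%N) < del ->
  (forall j, step (u j) (u j.+1)) ->
  (fun j => dist (u j.+1) : R^o) =o_\oo (fun j => dist (u j) : R^o).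
Proof.
move=> g0 d0 st; have inv := run_invariant g0 d0 st; have cv := run_cvg g0 d0 st.
apply/eqoP => q q0; have [r r0 hr] := contract q0.
have [N _ hN] : \forall j \near \oo, dist (u j) < r by exact: (cvgr_lt _ cv).
exists N => // j /hN jr.
have [gj dj] := inv j; have [g1 _] := inv j.+1.
by rewrite /= !ger0_norm ?dist_ge0//; exact: (hr _ _ gj jr dj (st j)).
Qed.

End superlinear_runs.

(** * Strict complementarity *)

Section sigma_set.
Context (R : realType) (n : nat) (O : set 'rV[R]_n) (mO : measurable O).
Local Notation leb := (@lebesgue_rV R n).
Implicit Types u y phi : 'rV[R]_n -> R.

(** Only for a measurable set does measure 0 give negligibility, on which almost everywhere
    statements rest. *)
Lemma measurable_Sigma_set (nu alpha : R) (beta : \bar R) u y phi :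
  measurable_fun O u -> measurable_fun O y -> measurable_fun O phi ->
  measurable (Sigma_set O nu alpha beta u y phi).
Proof.
move=> mu_ my mp.
have mr : measurable_fun O (fun x => nu * u x - y x * phi x).
  by apply: measurable_funB; [exact: measurable_funM|exact: measurable_funM].
have lev f (c : R) : measurable_fun O f -> measurable (O `&` f @^-1` [set c]).
  by move=> mf; apply: mf => //; exact: measurable_set1.
have mE : measurable (O `&` (EFin \o u) @^-1` [set beta]).
  by have /measurable_EFinP mEu := mu_; apply: mEu => //; exact: emeasurable_set1.
have -> : Sigma_set O nu alpha beta u y phi =
    ((O `&` u @^-1` [set alpha]) `|` (O `&` (EFin \o u) @^-1` [set beta])) `&`
    (O `&` (fun x => nu * u x - y x * phi x) @^-1` [set 0]).
  apply/seteqP; split=> x /=.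
    by move=> [Ox [h|h] h0]; split=> //; [left|right].
  by move=> [[[Ox h]|[Ox h]] [_ h0]]; split=> //; [left|right].
by apply: measurableI; [apply: measurableU => //; exact: lev|exact: lev].
Qed.

Lemma switch_gap_nondegenerate (nu alpha : R) (beta : \bar R) u y phi (th : 'rV[R]_n -> R) :
  0 < nu -> (alpha%:E < beta)%E ->
  measurable_fun O u -> measurable_fun O y -> measurable_fun O phi ->
  leb (Sigma_set O nu alpha beta u y phi) = 0%E ->
  aeD leb O (fun x => th x = y x * phi x) ->
  aeD leb O (fun x => u x = Defs.proj alpha beta (nu^-1 * th x)) ->
  aeD leb O (fun x => switch_gap nu alpha beta (th x) <> 0).
Proof.
move=> nu0 ab mu_ my mp S0 hth hu.
have hS : aeD leb O (fun x => ~ Sigma_set O nu alpha beta u y phi x).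
  exists (Sigma_set O nu alpha beta u y phi); split=> //; first exact: measurable_Sigma_set.
  by move=> x /= /not_implyP[_ /contrapT].
apply: aeD3 hth hu hS => x Ox tE uE nS g0; apply: nS.
have [h1 h2] := switch_gap_eq0 nu0 ab g0; rewrite -uE in h1 h2.
by split=> //; rewrite -tE.
Qed.

End sigma_set.

Theorem corollary4p6 (R : realType) (d : nat) (Omega : set 'rV[R]_d)
    (A : 'rV[R]_d -> 'M[R]_d) (MA LambdaA : R)
    (p q : \bar R) (a0 : R) (a L : 'rV[R]_d -> R -> R) (g : 'rV[R]_d -> R)
    (nu alpha : R) (beta : \bar R) (mu C4 : R)
    (eps : ('rV[R]_d -> R) -> R)
    (G Phi : L2_space Omega -> H1C_space Omega mu)
    (hd : d = 2%N \/ d = 3%N)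
    (Omega_nonempty : Omega !=set0) (Omega_open : open Omega)
    (Omega_connected : connected Omega) (Omega_bounded : bounded_set Omega)
    (Omega_lipschitz : lipschitz_boundary Omega)
    (hA : elliptic Omega A MA LambdaA)
    (hp : ((d%:R / 2)%:E < p)%E) (hq : (d.-1%:R%:E < q)%E)
    (ha0 : 0 <= a0) (ha : nonlinearity Omega p a0 a)
    (hg : Lp (@hausdorff R d d.-1) (boundary Omega) q g)
    (hL : cost_integrand Omega p L)
    (hnu : 0 < nu) (halpha : - a0 < alpha) (hbeta : (alpha%:E < beta)%E)
    (hmu : regularity_exponent Omega A p q mu)
    (hC4 : embedding_L4 Omega C4)
    (heps : forall u, calA0 Omega a0 u ->
      0 < eps u < Lambda Omega LambdaA a0 u / C4 ^+ 2)
    (hG : control_to_state A a g (calA a0 eps) G)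
    (hPhi : control_to_adjoint A a L (calA a0 eps) G Phi)
    (ubar : L2_space Omega) (ybar phibar : H1C_space Omega mu)
    (hubar : admissible Omega alpha beta ubar)
    (hybar : elements (H1C_space Omega mu) ybar)
    (hphibar : elements (H1C_space Omega mu) phibar)
    (first_order :
      first_order_conditions Omega A a L g nu alpha beta ubar ybar phibar)
    (strict_complementarity :
      @lebesgue_rV R d (Sigma_set Omega nu alpha beta ubar ybar phibar) = 0%E)
    (second_order : forall v,
      critical_cone Omega nu alpha beta ubar ybar phibar v ->
      ~ ae_in Omega (fun x => v x = 0) ->
      0 < cost'' L nu (calA a0 eps) G ubar v v) :
  exists2 delta : R, 0 < delta &
  forall u0 : L2_space Omega, elements (L2_space Omega) u0 -> nrm (u0 - ubar) < delta ->
  let is_run := newton_sequence A a L nu alpha beta (calA a0 eps) G Phi u0 in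
  [/\ exists u, is_run u,
      forall u u', is_run u -> is_run u' ->
        forall j, ae_in Omega (fun x => u j x = u' j x) &
      forall u, is_run u -> [/\
        forall j, nrm (u j - ubar) < delta,
        (nrm (u j - ubar) @[j --> \oo] --> (0 : R)) &
        (fun j => nrm (u j.+1 - ubar) : R^o) =o_\oo
          (fun j => nrm (u j - ubar) : R^o)]].
Proof.
set U := calA a0 eps in hG hPhi second_order *.
(* From [p > d / 2] and [d >= 2]. *)
have p1 : (1%:E <= p)%E.
  apply: ltW; apply: le_lt_trans hp; rewrite lee_fin.
  by case: hd => ->; lra.
have [/andP[mu0 _] _] := hmu.
have mO : measurable Omega by exact: open_measurable_mx.
have Ofin : (@lebesgue_rV R d Omega < +oo)%E by exact: lebesgue_bounded_fin.
have [MB MB0 [mA bA mAt bAt]] := elliptic_bounded Omega_open hA.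
have [hG1 [DG [dDG c1DG]]] := hG; have [hPhi1 [DPhi [dDPhi cDPhi]]] := hPhi.
have U2 (u : 'rV[R]_d -> R) : U u -> L2 (@lebesgue_rV R d) Omega u by move=> Uu; exact: calA_L2 Uu.
have Uopen (u : 'rV[R]_d -> R) : U u -> exists2 r : R, 0 < r & forall v,
    L2 (@lebesgue_rV R d) Omega v -> n2 (@lebesgue_rV R d) Omega v < r -> U (fun x => u x + v x).
  by move=> Uu; exact: (calA_open Omega_open Uu).
have elG (u : 'rV[R]_d -> R) : U u -> elements (H1C_space Omega mu) (G u) by move=> /hG1[].
have elPhi (u : 'rV[R]_d -> R) : U u -> elements (H1C_space Omega mu) (Phi u) by move=> /hPhi1[].
have eqG (u : 'rV[R]_d -> R) : U u -> state_eq Omega A a g u (G u) by move=> /hG1[].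
have eqPhi (u : 'rV[R]_d -> R) : U u -> adjoint_eq Omega A a L u (G u) (Phi u) by move=> /hPhi1[].
have fG := C2_facts Omega_open Omega_bounded Omega_nonempty U2 dDG c1DG.
have fPhi := C1_facts Omega_open Omega_bounded Omega_nonempty U2 dDPhi cDPhi.
have eqDG := derivative_state_eq Omega_open Omega_bounded Omega_nonempty MB0 mA bA p1 ha
  U2 Uopen elG eqG fG.
have eqDPhi := derivative_adjoint_eq Omega_open Omega_bounded Omega_nonempty MB0 mA bA p1 ha hL
  U2 Uopen elG fG elPhi eqPhi fPhi.
pose K := product_derivative G Phi DG DPhi.
pose theta (u : 'rV[R]_d -> R) := fun x => G u x * Phi u x.
have theta2 := product_L2 Omega_open Omega_bounded Omega_nonempty elG elPhi.
have Kcsa := product_derivative_compact Omega_open Omega_bounded Omega_nonempty mu0 ha hL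
  U2 elG elPhi fG fPhi eqDG eqDPhi.
have hess := cost_hessian Omega_open Omega_bounded Omega_nonempty mu0 p1 ha hL hnu
  U2 Uopen elG elPhi fG fPhi eqPhi eqDG eqDPhi.
have [so ao st] := first_order.
have Uub : U ubar by exact: (calA_admissible Omega_open heps halpha hubar).
have cl x : Omega x -> x \in closure Omega by move=> Ox; rewrite inE; exact: subset_closure.
have yE x : Omega x -> ybar x = G ubar x.
  by move=> /cl cx; have [_ _ h] := hG1 ubar Uub; exact: (h ybar hybar so x cx).
(* Uniqueness in the hypothesis on [Phi] concerns the adjoint equation at the state [G ubar], so the
   given equation at [ybar] is rewritten first. *)
have ao' : adjoint_eq Omega A a L ubar (G ubar) phibar.
  by apply: weak_solution_ae ao; apply: aeD_all => x Ox; rewrite yE.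
have pE x : Omega x -> phibar x = Phi ubar x.
  by move=> /cl cx; have [_ _ h] := hPhi1 ubar Uub; exact: (h phibar hphibar ao' x cx).
have thE x : Omega x -> theta ubar x = ybar x * phibar x by move=> Ox; rewrite /theta yE// pE.
have stationary : aeD (@lebesgue_rV R d) Omega
    (fun x => ubar x = Defs.proj alpha beta (nu^-1 * theta ubar x)).
  by apply: aeD1 st => x Ox; rewrite thE.
have mub : measurable_fun Omega (ubar : 'rV[R]_d -> R) by have [] := U2 _ Uub.
have my := el_measurable Omega_open hybar; have mphi := el_measurable Omega_open hphibar.
have nondegenerate := switch_gap_nondegenerate mO hnu hbeta mub my mphi strict_complementarity
  (aeD_all _ thE) stationary.
(* A function vanishing off the inactive set lies in the critical cone: on that set the projected
   value is strictly between the bounds, and [nu * ubar - ybar * phibar] is 0. *)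
have positive f : L2 (@lebesgue_rV R d) Omega f ->
    vanishes_off (between_set Omega nu alpha beta (theta ubar)) f ->
    n2 (@lebesgue_rV R d) Omega f != 0 -> 0 < qform (@lebesgue_rV R d) Omega nu (K ubar) f f.
  move=> f2 fI n0; rewrite -hess//; apply: second_order; last first.
    move=> f0; move/eqP: n0; apply.
    rewrite (@n2_ae _ _ _ _ _ _ (fun x => 0 * f x)) ?n2Z ?normr0 ?mul0r//.
    by apply: aeD1 f0 => x _ ->; rewrite mul0r.
  split; first exact/(Lp2P mO).
  apply: aeD1 stationary => x Ox ux.
  have [Ix|nIx] := pselect (between_set Omega nu alpha beta (theta ubar) x); last first.
    by rewrite (fI x nIx).
  have na : ~~ above nu beta (theta ubar x).
    by apply/negP => h; case: Ix => _; apply; left.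
  have nb : ~~ below nu alpha (theta ubar x).
    by apply/negP => h; case: Ix => _; apply; right.
  have [s1 s2] := proj_strict hnu hbeta na nb; rewrite -ux in s1 s2.
  split=> // /eqP[]; rewrite -thE// ux (proj_between hnu hbeta na nb).
  by rewrite mulrA divff ?gt_eqF// mul1r subrr.
have Uopen' : exists2 r : R, 0 < r & forall u : 'rV[R]_d -> R, L2 (@lebesgue_rV R d) Omega u ->
    n2 (@lebesgue_rV R d) Omega (fun x => u x - ubar x) < r -> U u.
  have [r r0 hr] := Uopen _ Uub; exists r => // u u2 ur.
  have := hr _ (L2B mO u2 (U2 _ Uub)) ur.
  by rewrite (_ : (fun x => _) = u)//; apply/funext => x; rewrite addrC subrK.
have Kcont e := product_derivative_continuous Omega_open Omega_bounded Omega_nonempty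
  U2 elG elPhi fG fPhi Uub (e := e).
have expansion e := product_expansion Omega_open Omega_bounded Omega_nonempty
  U2 elG elPhi fG fPhi Uub (e := e).
have loc := newton_local Omega_open Omega_bounded hnu hbeta U2 theta2 Kcsa Uub Uopen' Kcont
  expansion nondegenerate positive.
have contr := newton_contraction Omega_open Omega_bounded hnu hbeta U2 theta2 Kcsa Uub Uopen' Kcont
  expansion nondegenerate positive stationary.
have aerefl (f : 'rV[R]_d -> R) : aeD (@lebesgue_rV R d) Omega (fun x => f x = f x) by exact: aeD_all.
have elDG (u v : 'rV[R]_d -> R) : U u -> L2 (@lebesgue_rV R d) Omega v ->
    elements (H1C_space Omega mu) (DG u v) by move=> Uu v2; exact: (ff_el fG Uu v2).
have elDPhi (u v : 'rV[R]_d -> R) : U u -> L2 (@lebesgue_rV R d) Omega v ->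
    elements (H1C_space Omega mu) (DPhi u v) by move=> Uu v2; exact: (ff_el fPhi Uu v2).
have uniqz := linearized_state_unique Omega_open Omega_bounded Omega_nonempty mu0 hA hC4 heps ha.
have uniqe := linearized_adjoint_unique Omega_open Omega_bounded Omega_nonempty mu0 hA hC4 heps ha hL.
have DGunique (u v z : 'rV[R]_d -> R) : U u -> L2 (@lebesgue_rV R d) Omega v ->
    elements (H1C_space Omega mu) z -> linearized_state_eq Omega A a u (G u) v z ->
    aeD (@lebesgue_rV R d) Omega (fun x => z x = DG u v x).
  move=> Uu v2 ez sz.
  exact: (uniqz _ _ _ _ _ _ _ _ Uu (U2 _ Uu) (elG _ Uu) (elG _ Uu) v2 v2 ez (elDG _ _ Uu v2)
    (aerefl _) (aerefl _) (aerefl _) sz (eqDG _ _ Uu v2)).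
have DPhiunique (u v z eta : 'rV[R]_d -> R) : U u -> L2 (@lebesgue_rV R d) Omega v ->
    elements (H1C_space Omega mu) z -> elements (H1C_space Omega mu) eta ->
    aeD (@lebesgue_rV R d) Omega (fun x => z x = DG u v x) ->
    linearized_adjoint_eq Omega A a L u (G u) (Phi u) v z eta ->
    aeD (@lebesgue_rV R d) Omega (fun x => eta x = DPhi u v x).
  move=> Uu v2 ez ee zz se.
  exact: (uniqe _ _ _ _ _ _ _ _ _ _ _ _ Uu (U2 _ Uu) (elG _ Uu) (elG _ Uu) (elPhi _ Uu) (elPhi _ Uu)
    v2 v2 ez (elDG _ _ Uu v2) ee (elDPhi _ _ Uu v2)
    (aerefl _) (aerefl _) (aerefl _) (aerefl _) zz se (eqDPhi _ _ Uu v2)).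
(* [G] acts on functions, not on classes; that it does not distinguish representatives of a control
   follows from the uniqueness of the state. *)
have Gae (u u' : 'rV[R]_d -> R) x : U u -> U u' ->
    aeD (@lebesgue_rV R d) Omega (fun x => u x = u' x) -> Omega x -> G u x = G u' x.
  move=> Uu Uu' uu /cl cx; have [_ _ h] := hG1 u' Uu'; apply: (h (G u) (elG _ Uu)) => //.
  by apply: weak_solution_ae (eqG _ Uu); apply: aeD1 uu => z _ ->.
have Phiae (u u' : 'rV[R]_d -> R) x : U u -> U u' ->
    aeD (@lebesgue_rV R d) Omega (fun x => u x = u' x) -> Omega x -> Phi u x = Phi u' x.
  move=> Uu Uu' uu /cl cx; have [_ _ h] := hPhi1 u' Uu'; apply: (h (Phi u) (elPhi _ Uu)) => //.
  apply: weak_solution_ae (eqPhi _ Uu); apply: aeD1 (uu) => z Oz ->.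
  by rewrite (Gae u u' z Uu Uu' uu Oz).
have theta_ae (u u' : 'rV[R]_d -> R) x : U u -> U u' ->
    aeD (@lebesgue_rV R d) Omega (fun x => u x = u' x) -> Omega x -> theta u x = theta u' x.
  by move=> Uu Uu' uu Ox; rewrite /theta (Gae _ _ _ Uu Uu' uu Ox) (Phiae _ _ _ Uu Uu' uu Ox).
have K_ae (u u' f : 'rV[R]_d -> R) : U u -> U u' ->
    aeD (@lebesgue_rV R d) Omega (fun x => u x = u' x) -> L2 (@lebesgue_rV R d) Omega f ->
    aeD (@lebesgue_rV R d) Omega (fun x => K u f x = K u' f x).
  move=> Uu Uu' uu f2.
  have gg : aeD (@lebesgue_rV R d) Omega (fun x => G u x = G u' x).
    by apply: aeD_all => x Ox; exact: Gae.
  have pp : aeD (@lebesgue_rV R d) Omega (fun x => Phi u x = Phi u' x).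
    by apply: aeD_all => x Ox; exact: Phiae.
  have zz := uniqz _ _ _ _ _ _ _ _ Uu (U2 _ Uu') (elG _ Uu) (elG _ Uu') f2 f2
    (elDG _ _ Uu f2) (elDG _ _ Uu' f2) uu gg (aerefl _) (eqDG _ _ Uu f2) (eqDG _ _ Uu' f2).
  have ee := uniqe _ _ _ _ _ _ _ _ _ _ _ _ Uu (U2 _ Uu') (elG _ Uu) (elG _ Uu') (elPhi _ Uu)
    (elPhi _ Uu') f2 f2 (elDG _ _ Uu f2) (elDG _ _ Uu' f2) (elDPhi _ _ Uu f2) (elDPhi _ _ Uu' f2)
    uu gg pp (aerefl _) zz (eqDPhi _ _ Uu f2) (eqDPhi _ _ Uu' f2).
  have h := aeD3 (fun x _ a b c => conj a (conj b c)) gg pp zz.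
  by apply: aeD2 h ee => x _ [h1 [h2 h3]] h4; rewrite /K /product_derivative h1 h2 h3 h4.
have [r0 [gam [C [r00 gam0 C0 hloc]]]] := loc.
have half : 0 < (2^-1 : R) by rewrite invr_gt0.
(* The factor 1/2 confines every run to the ball and makes it converge; smaller factors serve only
   for the rate. *)
have [r1 r10 hr1] := contr _ half.
pose good (u : 'rV[R]_d -> R) := L2 (@lebesgue_rV R d) Omega u.
pose dist (u : 'rV[R]_d -> R) := n2 (@lebesgue_rV R d) Omega (fun x => u x - ubar x).
pose step (u u1 : 'rV[R]_d -> R) := newton_step A a L nu alpha beta U G Phi u u1.
pose del := Num.min r0 r1.
have del0 : 0 < del by rewrite lt_min r00.
have dr0 t : t < del -> t < r0 by rewrite lt_min => /andP[].
have dr1 t : t < del -> t < r1 by rewrite lt_min => /andP[].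
have sol (u u1 : 'rV[R]_d -> R) : good u -> dist u < del -> step u u1 -> good u1 /\
    aeD (@lebesgue_rV R d) Omega (fun x =>
      if x \in between_set Omega nu alpha beta (theta u)
      then opS nu (K u) (fun x => u1 x - u x) x =
        nu * (Defs.proj alpha beta (nu^-1 * theta u x) - u x)
      else u1 x - u x = Defs.proj alpha beta (nu^-1 * theta u x) - u x).
  move=> gu du; have [Uu HK co _] := hloc u gu (dr0 _ du).
  exact: (newton_step_solution Omega_open Omega_bounded hnu hbeta U2 theta2 hess DGunique DPhiunique
    Uu HK gam0 co).
have next (u : 'rV[R]_d -> R) : good u -> dist u < del -> exists u1, step u u1.
  move=> gu du; have [Uu HK co _] := hloc u gu (dr0 _ du).
  exact: (newton_step_exists Omega_open Omega_bounded hnu hbeta U2 theta2 hess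
    (fun u v Uu v2 => conj (elDG u v Uu v2) (eqDG u v Uu v2))
    (fun u v Uu v2 => conj (elDPhi u v Uu v2) (eqDPhi u v Uu v2)) Uu HK gam0 co).
have contract (s : R) : 0 < s -> exists2 r : R, 0 < r & forall u u1 : 'rV[R]_d -> R,
    good u -> dist u < r -> dist u < del -> step u u1 -> dist u1 <= s * dist u.
  move=> /contr[r rpos hr]; exists r => // u u1 gu ur du /(sol _ _ gu du)[g1 e1].
  exact: hr.
have halve (u u1 : 'rV[R]_d -> R) : good u -> dist u < del -> step u u1 ->
    good u1 /\ dist u1 <= 2^-1 * dist u.
  move=> gu du /(sol _ _ gu du)[g1 e1]; split=> //.
  by apply: hr1 => //; exact: dr1.
have dist_ge0 (u : 'rV[R]_d -> R) : good u -> 0 <= dist u by move=> _; exact: n2_ge0.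
have nrmE (u : 'rV[R]_d -> R) : good u -> @nrm R (L2_space Omega) ((u : L2_space Omega) - ubar) = dist u.
  by move=> gu; exact: (Lp_norm_n2 mO (L2B mO gu (U2 _ Uub))).
exists del => // u0 el0 nu0 is_run.
have g0 : good u0 by exact/(Lp2P mO).
have d0 : dist u0 < del by rewrite -nrmE.
have inv u : is_run u -> forall j, good (u j) /\ dist (u j) < del.
  move=> [h0 hst]; apply: (run_invariant dist_ge0 halve); rewrite ?h0// => j.
  by have [] := hst j.
split.
- have [u [h0 hst]] := run_exists dist_ge0 next halve g0 d0.
  exists u; split=> // j; split; last exact: hst.
  (* A run in the sense of the statement must also stay in [U], which contains the invariant
     ball. *)
  have := run_invariant dist_ge0 halve (u := u); rewrite h0 => /(_ g0 d0 hst j)[gj dj].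
  by have [] := hloc (u j) gj (dr0 _ dj).
- move=> u u' hu hu'; have iu := inv u hu; have iu' := inv u' hu'.
  have [[h0 hst] [h0' hst']] := (hu, hu'); elim=> [|j ih]; first by rewrite h0 h0'; exact: aeD_all.
  have [gj dj] := iu j; have [gj' dj'] := iu' j.
  have [Uj HK co _] := hloc _ gj (dr0 _ dj); have [Uj' _ _ _] := hloc _ gj' (dr0 _ dj').
  have [g1 e1] := sol _ _ gj dj (hst j).2; have [g1' e1'] := sol _ _ gj' dj' (hst' j).2.
  exact: (newton_step_unique Omega_open Omega_bounded hnu hbeta U2 theta2 theta_ae K_ae gam0
    Uj Uj' HK co ih g1 g1' e1 e1').
move=> u hu; have iu := inv u hu; have [h0 hst] := hu.
have nE : (fun j => @nrm R (L2_space Omega) (u j - ubar)) = (fun j => dist (u j)).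
  by apply/funext => j; have [gj _] := iu j; exact: nrmE.
have nE1 : (fun j => @nrm R (L2_space Omega) (u j.+1 - ubar)) = (fun j => dist (u j.+1)).
  by apply/funext => j; have [gj _] := iu j.+1; exact: nrmE.
have [gu0 du0] := iu 0%N.
split.
- by move=> j; have [gj dj] := iu j; rewrite nrmE.
- by rewrite nE; apply: (run_cvg dist_ge0 halve gu0 du0) => j; have [] := hst j.
rewrite nE nE1; apply: (run_superlinear dist_ge0 contract halve gu0 du0) => j.
by have [] := hst j.
Qed.
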